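(* Let $k > 0$, and let $\mathbb{D}$ be the open unit disc in $\mathbb{R}^{2} \cong \mathbb{C}$. Suppose that $D = \varphi(\mathbb{D})$ where $\varphi$ is a complex analytic function in a neighbourhood of $\overline{\mathbb{D}}$ such that $\varphi\colon \mathbb{D} \to D$ is bijective. Then $D$ is a $k$-quadrature domain, i.e. there is a distribution $\mu \in \mathscr{E}'(D)$ such that $D$ is a $k$-quadrature domain corresponding to $\mu$.
   Context: $\mathscr{E}'(D)$ denotes the distributions with compact support contained in $D$. Definition: let $k>0$. A bounded open set $D \subset \mathbb{R}^n$ (not necessarily connected) is called a $k$-quadrature domain corresponding to a distribution $\mu \in \mathscr{E}'(D)$ if $\int_D w(x)\,dx = \langle \mu, w\rangle$ for all $w \in L^1(D)$ satisfying $(\Delta+k^2)w = 0$ in $D$ (in the sense of distributions; such $w$ are smooth in $D$, so the pairing is well defined). Here $n=2$. *)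

(* Defs.v *)
From HB Require Import structures.
From mathcomp Require Import all_boot all_order all_algebra.
From mathcomp Require Import all_classical all_reals all_analysis.
From mathcomp Require Import complex.

Set Implicit Arguments.
Unset Strict Implicit.
Unset Printing Implicit Defensive.

Import Order.TTheory GRing.Theory Num.Theory.
Import numFieldNormedType.Exports.

Local Open Scope classical_set_scope.
Local Open Scope ring_scope.
Local Open Scope complex_scope.

Notation plane R := (R * R)%type.
Notation leb2 R := (@lebesgue_measure R \x @lebesgue_measure R)%E.

Section Plane.
Context {R : realType}.

Definition re (f : plane R -> R[i]) (x : plane R) : R := complex.Re (f x).
Definition im (f : plane R -> R[i]) (x : plane R) : R := complex.Im (f x).
Definition modulus (z : R[i]) : R := complex.Re `|z|.
Definition to_plane (z : R[i]) : plane R := (complex.Re z, complex.Im z).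

Definition dir (i : 'I_2) : plane R := ((i == 0)%:R, (i == 1)%:R).

(* [partials [:: i1; ...; im] f] is d_i1 (d_i2 (... (d_im f))). *)
Definition partials (s : seq 'I_2) (f : plane R -> R) : plane R -> R :=
  foldr (fun i g x => 'D_(dir i) g x) f s.

Definition real_smooth_on (O : set (plane R)) (f : plane R -> R) : Prop :=
  forall (s : seq 'I_2) (x : plane R), O x ->
    {for x, continuous (partials s f)} /\
    (forall i, derivable (partials s f) x (dir i)).

Definition smooth_on (O : set (plane R)) (f : plane R -> R[i]) : Prop :=
  real_smooth_on O (re f) /\ real_smooth_on O (im f).

Definition cpartials (s : seq 'I_2) (f : plane R -> R[i]) : plane R -> R[i] :=
  fun x => partials s (re f) x +i* partials s (im f) x.

Definition laplacian (f : plane R -> R[i]) (x : plane R) : R[i] :=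
  \sum_(i < 2) cpartials [:: i; i] f x.

Definition helmholtz (k : R) (f : plane R -> R[i]) (x : plane R) : R[i] :=
  laplacian f x + (k ^+ 2)%:C * f x.

Definition fsupport (f : plane R -> R[i]) : set (plane R) :=
  closure [set x | f x != 0].

Definition test_function (O : set (plane R)) (f : plane R -> R[i]) : Prop :=
  [/\ smooth_on setT f, compact (fsupport f) & fsupport f `<=` O].

(* The sum over multi-indices of order at most N of the sup norms of the
   corresponding derivatives *)
Definition CN_norm (N : nat) (f : plane R -> R[i]) : R :=
  \sum_(a < N.+1) \sum_(b < N.+1 | (a + b <= N)%N)
    sup (range (fun x => modulus (cpartials (nseq a 0 ++ nseq b 1) f x))).

(* Only the values of [mu] on test functions are meaningful: a distribution is
   represented by any extension of it to all functions. *)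
Definition distribution (mu : (plane R -> R[i]) -> R[i]) : Prop :=
  (forall (c : R[i]) (f g : plane R -> R[i]),
     test_function setT f -> test_function setT g ->
     mu (fun x => c * f x + g x) = c * mu f + mu g) /\
  (forall K : set (plane R), compact K ->
     exists (C : R) (N : nat), forall f, test_function K f ->
       modulus (mu f) <= C * CN_norm N f).

Definition dist_support (mu : (plane R -> R[i]) -> R[i]) : set (plane R) :=
  [set x | forall V : set (plane R), open V -> V x ->
     exists2 f, test_function V f & mu f != 0].

Definition compactly_supported_in (D : set (plane R))
    (mu : (plane R -> R[i]) -> R[i]) : Prop :=
  [/\ distribution mu, compact (dist_support mu) & dist_support mu `<=` D].

Definition cutoff (D K : set (plane R)) (chi : plane R -> R[i]) : Prop :=
  test_function D chi /\
  exists V : set (plane R), [/\ open V, K `<=` V & forall x, V x -> chi x = 1].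

(* <mu, w> = v for [w] smooth on [D] and [mu] with compact support in [D]:
   <mu, w> is mu (chi w), which does not depend on the cutoff [chi]. *)
Definition smooth_pairing (D : set (plane R))
    (mu : (plane R -> R[i]) -> R[i]) (w : plane R -> R[i]) (v : R[i]) : Prop :=
  exists2 chi, cutoff D (dist_support mu) chi & mu (fun x => chi x * w x) = v.

(* L^1(D), for functions defined on the whole plane; their values outside [D]
   are irrelevant. *)
Definition integrable_on (D : set (plane R)) (w : plane R -> R[i]) : Prop :=
  (leb2 R).-integrable D (EFin \o re w) /\ (leb2 R).-integrable D (EFin \o im w).

Definition cintegral (D : set (plane R)) (w : plane R -> R[i]) : R[i] :=
  (\int[leb2 R]_(x in D) re w x) +i* (\int[leb2 R]_(x in D) im w x).

Definition weak_helmholtz_solution (k : R) (D : set (plane R))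
    (w : plane R -> R[i]) : Prop :=
  forall psi, test_function D psi ->
    cintegral D (fun x => w x * helmholtz k psi x) = 0.

(* [w] stands for a class of functions modulo equality almost everywhere, so
   <mu, w> is computed with the smooth representative of [w] on [D], which is
   unique there. That it exists is part of the assertion (it is a consequence
   of the ellipticity of the Helmholtz operator). *)
Definition L1_pairing (D : set (plane R))
    (mu : (plane R -> R[i]) -> R[i]) (w : plane R -> R[i]) (v : R[i]) : Prop :=
  exists u, [/\ smooth_on D u, {ae leb2 R, forall x, D x -> w x = u x} &
                smooth_pairing D mu u v].

Definition quadrature_domain (k : R) (D : set (plane R))
    (mu : (plane R -> R[i]) -> R[i]) : Prop :=
  [/\ open D, bounded_set D, compactly_supported_in D mu &
      forall w, integrable_on D w -> weak_helmholtz_solution k D w ->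
        L1_pairing D mu w (cintegral D w)].

(* [R[i]^o] is [R[i]] with the topology of the norm. *)
Definition unit_disc : set R[i]^o := [set z | `|z| < 1].

Definition complex_analytic_at (phi : R[i]^o -> R[i]^o) (c : R[i]^o) : Prop :=
  exists (a : nat -> R[i]^o) (r : R[i]^o), 0 < r /\
    forall z : R[i]^o, `|z - c| < r ->
      series (fun n => a n * (z - c) ^+ n) @ \oo --> phi z.

Definition complex_analytic_on (U : set R[i]^o) (phi : R[i]^o -> R[i]^o) :
    Prop :=
  forall c, U c -> complex_analytic_at phi c.

End Plane.

(* Main.v *)
From HB Require Import structures.
Require Import Defs.
From mathcomp Require Import all_boot all_order all_algebra.
From mathcomp Require Import all_classical all_reals all_analysis.
From mathcomp Require Import complex ring lra.
From mathcomp Require Import measurable_realfun.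

Set Implicit Arguments.
Unset Strict Implicit.
Unset Printing Implicit Defensive.

Import Order.TTheory GRing.Theory Num.Theory.
Import numFieldNormedType.Exports.

Local Open Scope classical_set_scope.
Local Open Scope ring_scope.

(** Write D as the image of the unit disc under phi. The quadrature functional
is integration against a continuous density m with compact support in D. Such
an m exists as soon as there is a function v, defined near the boundary, with
(Delta + k^2) v = 1 in D and v = grad v = 0 on the boundary: if eta is a cutoff
equal to 1 near the boundary, then m = 1 - (Delta + k^2)(eta v) vanishes near
the boundary, and Green's formula gives that the integral of w m over D is the
integral of w for every solution w.

The function v is where the analyticity of phi across the circle is used. In
the coordinate z of the disc the equation for v reads
d_z d_zbar v = |phi'|^2 / 4 (1 - k^2 v). The function
sig(z) = conj (phi (1 / conj z)) is holomorphic near the circle and equals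
conj phi on it. Treating z and zbar as independent variables, the problem with
zero Cauchy data on the circle is solved by the Riemann function of the
operator, a Bessel series: v(z) is one fourth of the integral, from the mirror
image 1 / conj z to z, of
(conj phi(z) - sig(s)) G ((phi(z) - phi(s)) (conj phi(z) - sig(s))) phi'(s) ds.
Lemmas [pot_jet], [pot_q_jet] and [pot_z_jet] differentiate this formula. As phi
may have critical points on the circle, the Cauchy data vanish in the weighted
form |v| <= C d^2 |phi'|^2, |grad_z v| <= C d |phi'|^2, with d = 1 - |z|
([pot_bounds]); the integrand is controlled by |phi'(z)| because phi' has the
size of a power of the distance to the nearest critical point
([der_comparable_annulus]).

Nothing is known of w near the boundary beyond its integrability, so v is also
cut off at distance e from the circle. The first and second derivatives of this
second cutoff are of sizes 1/e and 1/e^2, which the bounds on v exactly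
compensate: the functions (Delta + k^2) of the cut potentials are bounded
uniformly in e, and Green's formula for the cut potentials ([green]) passes to
the limit by dominated convergence ([density]).

The test functions so obtained are only of class C^2, and w is only a solution
in the sense of distributions, so w is first replaced by a smooth function
([weyl]). Near a point, the truncated and regularized logarithmic solution
gives P_d with (Delta + k^2) P_d = (an approximate identity) + (a bounded term
converging to a smooth psi). Testing w against translates of P_d and averaging
over boxes shows that w is proportional to its convolution with psi; that the
factor does not depend on the box is enough, and its value (the constant of the
fundamental solution) is never computed ([box_proportional]).

Differentiation in z and zbar is handled through first-order expansions with
remainders uniform over a set of base points ([jet]); these are stable under
products, composition and integration over a parameter, and their coefficients
are automatically Lipschitz ([jet_deriv_lip]). *)

(** * Moduli, and first-order expansions with uniform remainders *)

Section Modulus.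
Context {R : realType}.
Implicit Types z w : R[i].

Lemma modulusE z : ((modulus z)%:C)%C = `|z|.
Proof. by rewrite /modulus normc_def. Qed.

Lemma modulus_ge0 z : 0 <= modulus z.
Proof. by rewrite -ler0c modulusE. Qed.

Lemma modulus0 : modulus (0 : R[i]) = 0.
Proof. by apply: complexI; rewrite modulusE normr0. Qed.

Lemma modulus1 : modulus (1 : R[i]) = 1.
Proof. by apply: complexI; rewrite modulusE normr1. Qed.

Lemma modulus_eq0 z : (modulus z == 0) = (z == 0).
Proof.
by rewrite -[in RHS]normr_eq0 -modulusE; apply/eqP/eqP => [->//|/complexI].
Qed.

Lemma modulus_gt0 z : (0 < modulus z) = (z != 0).
Proof. by rewrite lt_def modulus_eq0 modulus_ge0 andbT. Qed.

Lemma modulusM z w : modulus (z * w) = modulus z * modulus w.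
Proof. by apply: complexI; rewrite rmorphM /= !modulusE normrM. Qed.

Lemma modulusX z n : modulus (z ^+ n) = modulus z ^+ n.
Proof. by apply: complexI; rewrite rmorphXn /= !modulusE normrX. Qed.

Lemma modulusV z : modulus z^-1 = (modulus z)^-1.
Proof. by apply: complexI; rewrite fmorphV /= !modulusE normfV. Qed.

Lemma modulusD z w : modulus (z + w) <= modulus z + modulus w.
Proof. by rewrite -lecR rmorphD /= !modulusE ler_normD. Qed.

Lemma modulusN z : modulus (- z) = modulus z.
Proof. by apply: complexI; rewrite !modulusE normrN. Qed.

Lemma modulusB z w : modulus (z - w) <= modulus z + modulus w.
Proof. by rewrite -(modulusN w) modulusD. Qed.

Lemma modulusC z w : modulus (z - w) = modulus (w - z).
Proof. by rewrite -modulusN opprB. Qed.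

Lemma modulus_conj z : modulus (conjc z) = modulus z.
Proof. by apply: complexI; rewrite !modulusE normcJ. Qed.

Lemma modulus_real (a : R) : modulus (a%:C)%C = `|a|.
Proof. by rewrite /modulus normc_def /= expr0n /= addr0 sqrtr_sqr. Qed.

Lemma modulus_Re z : `|complex.Re z| <= modulus z.
Proof. by rewrite -lecR modulusE normc_ge_Re. Qed.

Lemma modulus_sqr z : modulus z ^+ 2 = complex.Re z ^+ 2 + complex.Im z ^+ 2.
Proof.
by rewrite /modulus normc_def /= sqr_sqrtr// addr_ge0 ?sqr_ge0.
Qed.

Lemma modulus_Im z : `|complex.Im z| <= modulus z.
Proof.
rewrite -(@ler_pXn2r _ 2) ?nnegrE ?modulus_ge0// modulus_sqr real_normK ?num_real//.
by rewrite lerDr sqr_ge0.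
Qed.

Lemma modulus_le z : modulus z <= `|complex.Re z| + `|complex.Im z|.
Proof.
rewrite -(@ler_pXn2r _ 2) ?nnegrE ?modulus_ge0 ?addr_ge0//.
rewrite modulus_sqr -(real_normK (num_real (complex.Re z))).
rewrite -(real_normK (num_real (complex.Im z))).
have := normr_ge0 (complex.Re z); have := normr_ge0 (complex.Im z); nra.
Qed.

Lemma modulus_nat n : modulus (n%:R : R[i]) = n%:R.
Proof. by apply: complexI; rewrite modulusE rmorph_nat normr_nat. Qed.

Lemma modulus_tri z w v : modulus (z - v) <= modulus (z - w) + modulus (w - v).
Proof. by rewrite (le_trans _ (modulusD _ _))// addrA subrK. Qed.

Lemma ler_modB z w : modulus z - modulus w <= modulus (z - w).
Proof. by rewrite lerBlDr (le_trans _ (modulusD _ _))// subrK. Qed.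

Lemma conjcM z w : conjc (z * w) = conjc z * conjc w.
Proof. exact: rmorphM. Qed.
Lemma conjcD z w : conjc (z + w) = conjc z + conjc w.
Proof. exact: rmorphD. Qed.
Lemma conjcN z : conjc (- z) = - conjc z.
Proof. exact: rmorphN. Qed.
Lemma conjcB z w : conjc (z - w) = conjc z - conjc w.
Proof. exact: rmorphB. Qed.
Lemma conjcV z : conjc (z^-1) = (conjc z)^-1.
Proof. exact: fmorphV. Qed.
Lemma conjcX z n : conjc (z ^+ n) = conjc z ^+ n.
Proof. exact: rmorphXn. Qed.

End Modulus.

Ltac nonneg := repeat first [ assumption | (apply: ltW; assumption) | exact: ler01 | exact: modulus_ge0
  | exact: normr_ge0 | exact: sqr_ge0 | exact: ler0n | apply: mulr_ge0 | apply: addr_ge0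
  | apply: exprn_ge0 | (rewrite invr_ge0) ].

Section Jets.
Context {R : realType}.
Local Notation C := R[i].

(** First-order expansions of [F t] at [p t]: [a] is the derivative in z and
[b] the derivative in conj z. The remainder is quadratic and uniform in [t],
which is what makes expansions stable under composition and under integration
over a parameter, without estimates on second derivatives. *)
Definition jet (T : Type) (S : set T) (F : T -> C -> C) (p a b : T -> C) : Prop :=
  exists M d : R, [/\ 0 <= M, 0 < d, d <= 1 & forall t, S t ->
    [/\ modulus (F t (p t)) <= M, modulus (a t) <= M, modulus (b t) <= M &
      forall h, modulus h < d ->
        modulus (F t (p t + h) - F t (p t) - a t * h - b t * conjc h)
          <= M * modulus h ^+ 2]].

Variables (T : Type) (S : set T).
Implicit Types (F G : T -> C -> C) (p a b : T -> C).

Lemma jet_ext F G p a b a' b' :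
  (exists2 d : R, 0 < d & forall t h, S t -> modulus h < d ->
      F t (p t + h) = G t (p t + h)) ->
  (forall t, S t -> a t = a' t) -> (forall t, S t -> b t = b' t) ->
  jet S F p a b -> jet S G p a' b'.
Proof.
move=> [e e0 FG] aa' bb' [M [d [M0 d0 d1 H]]].
exists M, (Num.min d e); split=> //; first by rewrite lt_min d0.
  by rewrite ge_min d1.
move=> t St; have [H1 H2 H3 H4] := H t St.
have FG0 : F t (p t) = G t (p t).
  by have := FG t 0 St; rewrite addr0 modulus0; apply.
split; rewrite -?FG0 -?aa' -?bb'//.
move=> h; rewrite lt_min => /andP[hd he]; rewrite -FG//; exact: H4.
Qed.

(** The expansion bounds the increments themselves; this is how it is used
in products and compositions. *)
Lemma jet_lip F p a b : jet S F p a b ->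
  exists M d : R, [/\ 0 <= M, 0 < d, d <= 1 & forall t, S t ->
    [/\ modulus (F t (p t)) <= M, modulus (a t) <= M, modulus (b t) <= M,
      forall h, modulus h < d ->
        modulus (F t (p t + h) - F t (p t) - a t * h - b t * conjc h)
          <= M * modulus h ^+ 2 &
      forall h, modulus h < d ->
        modulus (F t (p t + h) - F t (p t)) <= 3 * M * modulus h]].
Proof.
move=> [M [d [M0 d0 d1 H]]]; exists M, d; split=> // t St.
have [H1 H2 H3 H4] := H t St; split=> // h hd.
have -> : F t (p t + h) - F t (p t) =
  (F t (p t + h) - F t (p t) - a t * h - b t * conjc h) + (a t * h + b t * conjc h).
  by ring.
have := H4 h hd; set r := _ - _ - _ - _ => Hr.
apply: le_trans (modulusD _ _) _.
have := modulusD (a t * h) (b t * conjc h); rewrite !modulusM modulus_conj => Hab.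
have h0 := modulus_ge0 h.
have : modulus (a t) * modulus h <= M * modulus h by rewrite ler_wpM2r.
have : modulus (b t) * modulus h <= M * modulus h by rewrite ler_wpM2r.
have : M * modulus h ^+ 2 <= M * modulus h.
  rewrite ler_wpM2l// expr2 -[leRHS]mulr1 ler_wpM2l//.
  by rewrite (le_trans (ltW hd)).
lra.
Qed.

Lemma jet_id p : (exists M, forall t, S t -> modulus (p t) <= M) ->
  jet S (fun _ z => z) p (fun _ => 1) (fun _ => 0).
Proof.
move=> [M Mp]; exists (Num.max M 1), 1; split=> //.
- by rewrite le_max ler01 orbT.
- move=> t St; split.
  + by rewrite le_max Mp.
  + by rewrite modulus1 le_max lexx orbT.
  + by rewrite modulus0 le_max ler01 orbT.
  + move=> h _; rewrite (_ : _ - _ = 0); last by ring.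
    by rewrite modulus0 mulr_ge0 ?exprn_ge0 ?modulus_ge0// le_max ler01 orbT.
Qed.

Lemma jet_cst p (c : T -> C) : (exists M, forall t, S t -> modulus (c t) <= M) ->
  jet S (fun t _ => c t) p (fun _ => 0) (fun _ => 0).
Proof.
move=> [M Mp]; exists (Num.max M 0), 1; split=> //.
- by rewrite le_max lexx orbT.
- move=> t St; split.
  + by rewrite le_max Mp.
  + by rewrite modulus0 le_max lexx orbT.
  + by rewrite modulus0 le_max lexx orbT.
  + move=> h _; rewrite (_ : _ - _ = 0); last by ring.
    by rewrite modulus0 mulr_ge0 ?exprn_ge0 ?modulus_ge0// le_max lexx orbT.
Qed.

Lemma jet_conj F p a b : jet S F p a b ->
  jet S (fun t z => conjc (F t z)) p (fun t => conjc (b t)) (fun t => conjc (a t)).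
Proof.
move=> [M [d [M0 d0 d1 H]]]; exists M, d; split=> // t St.
have [H1 H2 H3 H4] := H t St; split; rewrite ?modulus_conj// => h hd.
rewrite -modulus_conj !conjcB !conjcM !conjcK.
by rewrite addrAC; exact: H4.
Qed.

Lemma jet_add F G p a b a' b' : jet S F p a b -> jet S G p a' b' ->
  jet S (fun t z => F t z + G t z) p (fun t => a t + a' t) (fun t => b t + b' t).
Proof.
move=> [M [d [M0 d0 d1 H]]] [M' [d' [M0' d0' d1' H']]].
exists (M + M'), (Num.min d d'); split; first by rewrite addr_ge0.
- by rewrite lt_min d0.
- by rewrite ge_min d1.
move=> t St; have [H1 H2 H3 H4] := H t St; have [H1' H2' H3' H4'] := H' t St.
split; [by rewrite (le_trans (modulusD _ _))// lerD
  |by rewrite (le_trans (modulusD _ _))// lerD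
  |by rewrite (le_trans (modulusD _ _))// lerD|].
move=> h; rewrite lt_min => /andP[hd hd'].
rewrite (_ : _ - _ = (F t (p t + h) - F t (p t) - a t * h - b t * conjc h) +
  (G t (p t + h) - G t (p t) - a' t * h - b' t * conjc h)); last by ring.
rewrite (le_trans (modulusD _ _))// mulrDl lerD//; [exact: H4|exact: H4'].
Qed.

Lemma jet_opp F p a b : jet S F p a b ->
  jet S (fun t z => - F t z) p (fun t => - a t) (fun t => - b t).
Proof.
move=> [M [d [M0 d0 d1 H]]]; exists M, d; split=> // t St.
have [H1 H2 H3 H4] := H t St; split; rewrite ?modulusN// => h hd.
rewrite (_ : _ - _ = - (F t (p t + h) - F t (p t) - a t * h - b t * conjc h));
  last by ring.
by rewrite modulusN; exact: H4.
Qed.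

Lemma jet_sub F G p a b a' b' : jet S F p a b -> jet S G p a' b' ->
  jet S (fun t z => F t z - G t z) p (fun t => a t - a' t) (fun t => b t - b' t).
Proof. by move=> jF jG; apply: jet_add => //; exact: jet_opp. Qed.

Lemma jet_mul F G p a b a' b' : jet S F p a b -> jet S G p a' b' ->
  jet S (fun t z => F t z * G t z) p
    (fun t => a t * G t (p t) + F t (p t) * a' t)
    (fun t => b t * G t (p t) + F t (p t) * b' t).
Proof.
move=> /jet_lip[M [d [M0 d0 d1 H]]] /jet_lip[M' [d' [M0' d0' d1' H']]].
have MM0 : 0 <= M * M' by rewrite mulr_ge0.
exists (11 * (M * M')), (Num.min d d'); split.
- by rewrite mulr_ge0.
- by rewrite lt_min d0.
- by rewrite ge_min d1.
move=> t St.
have [H1 H2 H3 H4 H5] := H t St; have [H1' H2' H3' H4' H5'] := H' t St.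
have ab2 : forall x y x' y' : C, modulus x <= M -> modulus y <= M ->
    modulus x' <= M' -> modulus y' <= M' ->
    modulus (x * x' + y * y') <= 11 * (M * M').
  move=> x y x' y' hx hy hx' hy'; rewrite (le_trans (modulusD _ _))// !modulusM.
  have : modulus x * modulus x' <= M * M' by rewrite ler_pM ?modulus_ge0.
  have : modulus y * modulus y' <= M * M' by rewrite ler_pM ?modulus_ge0.
  lra.
split; [|exact: ab2|exact: ab2|].
  have : modulus (F t (p t)) * modulus (G t (p t)) <= M * M'.
    by rewrite ler_pM ?modulus_ge0.
  rewrite modulusM; lra.
move=> h; rewrite lt_min => /andP[hd hd'].
set f := F t (p t); set g := G t (p t).
rewrite (_ : _ - _ = (F t (p t + h) - f - a t * h - b t * conjc h) * g +
  f * (G t (p t + h) - g - a' t * h - b' t * conjc h) +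
  (F t (p t + h) - f) * (G t (p t + h) - g)); last by ring.
have := H4 h hd; have := H4' h hd'; have := H5 h hd; have := H5' h hd'.
rewrite -/f -/g.
set r := F _ _ - _ - _ - _; set r' := G _ _ - _ - _ - _.
set u := F _ _ - _; set u' := G _ _ - _ => hu' hu hr' hr.
rewrite (le_trans (modulusD _ _))//.
have := modulusD (r * g) (f * r'); rewrite !modulusM.
have h0 := modulus_ge0 h.
have : modulus r * modulus g <= M * modulus h ^+ 2 * M'.
  by rewrite ler_pM ?modulus_ge0.
have : modulus f * modulus r' <= M * (M' * modulus h ^+ 2).
  by rewrite ler_pM ?modulus_ge0.
have : modulus u * modulus u' <= (3 * M * modulus h) * (3 * M' * modulus h).
  by rewrite ler_pM ?modulus_ge0.
nra.
Qed.

Lemma jet_comp f F p a b A B : jet S F p a b ->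
  jet S f (fun t => F t (p t)) A B ->
  jet S (fun t z => f t (F t z)) p
    (fun t => A t * a t + B t * conjc (b t))
    (fun t => A t * b t + B t * conjc (a t)).
Proof.
move=> /jet_lip[M [d [M0 d0 d1 H]]] [M' [d' [M0' d0' d1' H']]].
have MM0 : 0 <= M * M' by rewrite mulr_ge0.
have M3 : 0 < 3 * M + 1 by rewrite ltr_wpDl// mulr_ge0.
have MMM0 : 0 <= M * (M * M') by rewrite mulr_ge0.
exists (M' + 2 * (M * M') + 9 * (M * (M * M'))), (Num.min d (d' / (3 * M + 1))); split.
- by rewrite !addr_ge0// mulr_ge0.
- by rewrite lt_min d0 divr_gt0.
- by rewrite ge_min d1.
move=> t St.
have [H1 H2 H3 H4 H5] := H t St; have [H1' H2' H3' H4'] := H' t St.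
have ab2 : forall x y x' y' : C, modulus x <= M' -> modulus y <= M' ->
    modulus x' <= M -> modulus y' <= M ->
    modulus (x * x' + y * conjc y') <= M' + 2 * (M * M') + 9 * (M * (M * M')).
  move=> x y x' y' hx hy hx' hy'; rewrite (le_trans (modulusD _ _))// !modulusM modulus_conj.
  have : modulus x * modulus x' <= M' * M by rewrite ler_pM ?modulus_ge0.
  have : modulus y * modulus y' <= M' * M by rewrite ler_pM ?modulus_ge0.
  lra.
split; [|exact: ab2|exact: ab2|]; first by lra.
move=> h; rewrite lt_min => /andP[hd]; rewrite ltr_pdivlMr// => hd'.
have h0 := modulus_ge0 h.
have := H4 h hd; have := H5 h hd.
set u := F t (p t + h) - F t (p t) => hu hr.
have ud : modulus u < d'.
  by rewrite (le_lt_trans hu)// (le_lt_trans _ hd')//; nra.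
have := H4' u ud; rewrite [_ + u]addrC subrK.
set r := u - _ - _ in hr; set Y := f t _ - f t _ - _ - _ => hY.
have uE : u = r + a t * h + b t * conjc h by rewrite /r; ring.
rewrite (_ : _ - _ = Y + A t * r + B t * conjc r); last first.
  by rewrite /Y uE !(conjcD,conjcM,conjcK); ring.
have := modulusD (Y + A t * r) (B t * conjc r).
have := modulusD Y (A t * r).
rewrite !modulusM modulus_conj.
have : modulus (A t) * modulus r <= M' * (M * modulus h ^+ 2).
  by rewrite ler_pM ?modulus_ge0.
have : modulus (B t) * modulus r <= M' * (M * modulus h ^+ 2).
  by rewrite ler_pM ?modulus_ge0.
have : M' * modulus u ^+ 2 <= M' * (3 * M * modulus h) ^+ 2.
  by rewrite ler_wpM2l// lerXn2r ?nnegrE ?modulus_ge0// !mulr_ge0.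
have -> : M' * (3 * M * modulus h) ^+ 2 = 9 * (M * (M * M')) * modulus h ^+ 2.
  by ring.
have h20 : 0 <= modulus h ^+ 2 by rewrite sqr_ge0.
have : 0 <= M' * modulus h ^+ 2 by rewrite mulr_ge0.
lra.
Qed.

Lemma jet_inv p : (exists2 m : R, 0 < m & forall t, S t -> m <= modulus (p t)) ->
  jet S (fun _ z => z^-1) p (fun t => - (p t) ^- 2) (fun _ => 0).
Proof.
move=> [m m0 Hm].
have mi : 0 < m^-1 by rewrite invr_gt0.
exists (m^-1 + m^-1 ^+ 2 + 2 * m^-1 ^+ 3), (Num.min 1 (m / 2)); split.
- by rewrite !addr_ge0 ?mulr_ge0 ?exprn_ge0 ?(ltW mi).
- by rewrite lt_min ltr01 divr_gt0.
- by rewrite ge_min lexx.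
move=> t St; have pm := Hm t St.
have p0 : p t != 0 by rewrite -modulus_gt0 (lt_le_trans m0).
have im : (modulus (p t))^-1 <= m^-1 by rewrite lef_pV2 ?posrE// (lt_le_trans m0).
have e2 : 0 <= m^-1 ^+ 2 by rewrite exprn_ge0// ltW.
have e3 : 0 <= m^-1 ^+ 3 by rewrite exprn_ge0// ltW.
have im0 : 0 <= (modulus (p t))^-1 by rewrite invr_ge0 modulus_ge0.
split.
- by rewrite modulusV; lra.
- rewrite modulusN modulusV modulusX -exprVn.
  have : (modulus (p t))^-1 ^+ 2 <= m^-1 ^+ 2.
    by rewrite lerXn2r ?nnegrE// ltW.
  lra.
- by rewrite modulus0; lra.
- move=> h; rewrite lt_min => /andP[h1 hm].
  have qm : m / 2 <= modulus (p t + h).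
    have := ler_modB (p t) (- h); rewrite modulusN opprK; lra.
  have m20 : 0 < m / 2 by rewrite divr_gt0.
  have q0 : p t + h != 0 by rewrite -modulus_gt0 (lt_le_trans m20).
  rewrite (_ : _ - _ = h ^+ 2 * (p t ^- 2 * (p t + h)^-1)); last first.
    by field; rewrite q0 p0.
  rewrite modulusM modulusX mulrC ler_wpM2r ?exprn_ge0 ?modulus_ge0//.
  rewrite modulusM !modulusV modulusX -exprVn.
  have : (modulus (p t + h))^-1 <= 2 * m^-1.
    rewrite (_ : 2 * m^-1 = (m / 2)^-1); last by rewrite invfM invrK mulrC.
    by rewrite lef_pV2 ?posrE ?modulus_gt0.
  have : (modulus (p t))^-1 ^+ 2 <= m^-1 ^+ 2.
    by rewrite lerXn2r ?nnegrE// ltW.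
  move=> k1 k2.
  have : (modulus (p t))^-1 ^+ 2 * (modulus (p t + h))^-1 <= m^-1 ^+ 2 * (2 * m^-1).
    by rewrite ler_pM ?exprn_ge0// invr_ge0 modulus_ge0.
  have -> : m^-1 ^+ 2 * (2 * m^-1) = 2 * m^-1 ^+ 3 by ring.
  lra.
Qed.

End Jets.

(** * Complex power series *)

Section PowerSeries.
Context {R : realType}.
Local Notation C := R[i].
Implicit Types (u v a : nat -> C).

Definition csumto u (l : C) : Prop := forall e : R, 0 < e ->
  exists N : nat, forall n, (N <= n)%N -> modulus (l - \sum_(i < n) u i) < e.

Lemma csumto_unique u l m : csumto u l -> csumto u m -> l = m.
Proof.
move=> hl hm; apply/eqP; rewrite -subr_eq0 -modulus_eq0 eq_le modulus_ge0 andbT.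
apply/ler_addgt0Pr => e e0; rewrite add0r.
have e2 : 0 < e / 2 by rewrite divr_gt0.
have [N HN] := hl _ e2; have [N' HN'] := hm _ e2.
have := HN _ (leq_maxl N N'); have := HN' _ (leq_maxr N N').
set s := \sum_(i < _) _ => h1 h2.
have := modulusB (l - s) (m - s); rewrite (_ : l - s - _ = l - m); last by ring.
lra.
Qed.

Lemma csumto_lin u v l m c : csumto u l -> csumto v m ->
  csumto (fun n => u n + c * v n) (l + c * m).
Proof.
move=> hl hm e e0.
have e2 : 0 < e / 2 by rewrite divr_gt0.
have c1 : 0 < modulus c + 1 by rewrite ltr_wpDl ?modulus_ge0.
have e3 : 0 < e / 2 / (modulus c + 1) by rewrite divr_gt0.
have [N HN] := hl _ e2; have [N' HN'] := hm _ e3.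
exists (maxn N N') => n; rewrite geq_max => /andP[/HN h1 /HN' h2].
rewrite big_split /= -mulr_sumr.
move: h1 h2; set s := \sum_(i < _) _; set s' := \sum_(i < _) _ => h1 h2.
rewrite (_ : _ - _ = (l - s) + c * (m - s')); last by ring.
rewrite (le_lt_trans (modulusD _ _))// modulusM.
have : modulus c * modulus (m - s') <= (modulus c + 1) * modulus (m - s').
  by rewrite ler_wpM2r ?modulus_ge0// lerDl.
move: h2; rewrite ltr_pdivlMr// mulrC; lra.
Qed.

Lemma csumto_shift u l : csumto u l ->
  csumto (fun n => if n is m.+1 then u m else 0) l.
Proof.
move=> hl e e0; have [N HN] := hl e e0.
exists N.+1 => -[//|n] Nn; rewrite big_ord_recl /= add0r.
exact: HN.
Qed.

Lemma csumto_eq u v l : (forall n, u n = v n) -> csumto u l -> csumto v l.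
Proof. by move=> uv; rewrite (_ : u = v)//; apply/funext. Qed.

Lemma csumto_bound u l (B : R) :
  (forall n, modulus (\sum_(i < n) u i) <= B) -> csumto u l -> modulus l <= B.
Proof.
move=> hB hl; apply/ler_addgt0Pr => e e0.
have [N HN] := hl e e0; have := HN N (leqnn _); have := hB N.
set s := \sum_(i < _) _ => h1 h2.
have := modulusD (l - s) s; rewrite subrK; lra.
Qed.

Lemma geometric_sum_le (q : R) n : 0 <= q -> q < 1 ->
  \sum_(i < n) q ^+ i <= (1 - q)^-1.
Proof.
move=> q0 q1; have q1' : 0 < 1 - q by rewrite subr_gt0.
rewrite -[leRHS]mul1r ler_pdivlMr//.
have := subrX1 q n; have : 0 <= q ^+ n by rewrite exprn_ge0.
set s := \sum_(i < _) _; nra.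
Qed.

Lemma csum_geometric_bound u l (M q : R) : 0 <= q -> q < 1 -> 0 <= M ->
  (forall n, modulus (u n) <= M * q ^+ n) -> csumto u l ->
  modulus l <= M * (1 - q)^-1.
Proof.
move=> q0 q1 M0 hu; apply: csumto_bound => n.
have : modulus (\sum_(i < n) u i) <= \sum_(i < n) modulus (u i).
  elim: n => [|n IH]; first by rewrite !big_ord0 modulus0.
  by rewrite !big_ord_recr /= (le_trans (modulusD _ _))// lerD2r.
move/le_trans; apply.
rewrite (@le_trans _ _ (\sum_(i < n) M * q ^+ i))// ?ler_sum// -mulr_sumr.
by rewrite ler_wpM2l// geometric_sum_le.
Qed.

Lemma csum_exists u (M q : R) : 0 <= q -> q < 1 ->
  (forall n, modulus (u n) <= M * q ^+ n) -> exists l, csumto u l.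
Proof.
move=> q0 q1 hu.
have key (f : C -> R) : (forall z, `|f z| <= modulus z) ->
    cvgn (series (fun n => f (u n))).
  move=> hf; apply: normed_cvg.
  apply: (@series_le_cvg _ _ (fun n => M * q ^+ n)) => //.
  - by move=> n /=.
  - by move=> n; apply: (le_trans _ (hu n)); exact: modulus_ge0.
  - by move=> n; rewrite (le_trans (hf _)).
  - by apply: is_cvg_geometric_series; rewrite ger0_norm.
have /cvg_ex[/= x hx] := key (@complex.Re R) (@modulus_Re R).
have /cvg_ex[/= y hy] := key (@complex.Im R) (@modulus_Im R).
exists (x +i* y)%C => e e0.
have e2 : 0 < e / 2 by rewrite divr_gt0.
move/cvgrPdist_lt : hx => /(_ _ e2)[N _ HN].
move/cvgrPdist_lt : hy => /(_ _ e2)[N' _ HN'].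
exists (maxn N N') => n; rewrite geq_max => /andP[/HN /= h1 /HN' /= h2].
apply: le_lt_trans (modulus_le _) _.
have -> : \sum_(i < n) u i =
    (series (fun n => complex.Re (u n)) n +i* series (fun n => complex.Im (u n)) n)%C.
  rewrite /series /= !big_mkord; elim: n {h1 h2} => [|n IH]; first by rewrite !big_ord0.
  by rewrite !big_ord_recr /= IH; case: (u n) => ? ?.
by rewrite [complex.Re _]/= [complex.Im _]/=; lra.
Qed.

(** Cauchy's estimates on the disc of radius [r]. *)
Definition adm (r : R) a := exists M : R, forall n, modulus (a n) * r ^+ n <= M.

Definition cdiff a : nat -> C := fun n => n.+1%:R * a n.+1.

Lemma mulnXn_bound (q : R) n : 0 <= q -> q < 1 -> n%:R * q ^+ n <= (1 - q)^-1.
Proof.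
move=> q0 q1; apply: le_trans (geometric_sum_le n q0 q1).
rewrite -[n in n%:R]card_ord -sumr_const mulr_suml ler_sum// => i _.
rewrite mul1r ler_wiXn2l// ?(ltW q1)// ltnW//.
Qed.

Lemma adm_diff (r r' : R) a : 0 < r' -> r' < r -> adm r a -> adm r' (cdiff a).
Proof.
move=> r0 rr [M HM].
have r_gt0 : 0 < r by rewrite (lt_trans r0).
have q0 : 0 <= r' / r by rewrite divr_ge0 ?ltW.
have q1 : r' / r < 1 by rewrite ltr_pdivrMr// mul1r.
exists (M * (1 - r' / r)^-1 / r') => n.
rewrite ler_pdivlMr// -mulrA -exprSr /cdiff modulusM modulus_nat.
have -> : r' ^+ n.+1 = r ^+ n.+1 * (r' / r) ^+ n.+1.
  by rewrite -exprMn mulrC divfK// gt_eqF.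
rewrite (_ : _ * _ * (_ * _) = (modulus (a n.+1) * r ^+ n.+1) * (n.+1%:R * (r' / r) ^+ n.+1));
  last by ring.
apply: ler_pM => //.
- by rewrite mulr_ge0 ?modulus_ge0 ?exprn_ge0// (ltW r_gt0).
- by rewrite mulr_ge0 ?exprn_ge0.
- exact: mulnXn_bound.
Qed.

(** The sum of the power series, with value 0 where it diverges. *)
Definition psum a (z : C) : C := xget 0 [set l | csumto (fun n => a n * z ^+ n) l].

Lemma psum_unique a z l : csumto (fun n => a n * z ^+ n) l -> psum a z = l.
Proof.
by move=> hl; apply: (csumto_unique _ hl); rewrite /psum; apply: (xgetPex 0); exists l.
Qed.

Lemma adm_term (r rho : R) a M : 0 < r -> (forall n, modulus (a n) * r ^+ n <= M) ->
  forall n, modulus (a n) * rho ^+ n <= M * (rho / r) ^+ n \/ rho < 0.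
Proof.
move=> r0 HM n; have [rho0|] := leP 0 rho; [left|by right].
rewrite expr_div_n mulrA ler_pdivlMr ?exprn_gt0// mulrAC ler_wpM2r// exprn_ge0//.
Qed.

Lemma psumP (r : R) a z : adm r a -> modulus z < r ->
  csumto (fun n => a n * z ^+ n) (psum a z).
Proof.
move=> [M HM] zr; have r0 : 0 < r := le_lt_trans (modulus_ge0 _) zr.
rewrite /psum; apply: (xgetPex 0).
apply: (@csum_exists _ M (modulus z / r)).
- by rewrite divr_ge0 ?modulus_ge0 ?ltW.
- by rewrite ltr_pdivrMr// mul1r.
- move=> n; rewrite modulusM modulusX.
  have [//|] := adm_term (modulus z) r0 HM n.
  by rewrite ltNge modulus_ge0.
Qed.

Lemma psum_bound (r rho : R) a : adm r a -> rho < r ->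
  exists M : R, forall z, modulus z <= rho -> modulus (psum a z) <= M.
Proof.
move=> ha rr; have [M HM] := ha.
exists (M * (1 - rho / r)^-1) => z zr.
have rho0 := le_trans (modulus_ge0 z) zr.
have r0 : 0 < r by rewrite (le_lt_trans rho0).
apply: (@csum_geometric_bound (fun n => a n * z ^+ n)).
- by rewrite divr_ge0// (ltW r0).
- by rewrite ltr_pdivrMr// mul1r.
- by rewrite (le_trans _ (HM 0%N))// mulr_ge0 ?modulus_ge0.
- move=> n; rewrite modulusM modulusX.
  have [h|] := adm_term rho r0 HM n; last by rewrite ltNge rho0.
  rewrite (le_trans _ h)// ler_wpM2l ?modulus_ge0// lerXn2r ?nnegrE ?modulus_ge0//.
- exact: psumP ha (le_lt_trans zr rr).
Qed.

(** By induction on the exponent; the factor n(n-1) is that of the second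
derivative of z^n. *)
Lemma binomial_remainder (z h : C) (rho : R) n :
  modulus z <= rho -> modulus (z + h) <= rho ->
  modulus ((z + h) ^+ n.+2 - z ^+ n.+2 - n.+2%:R * z ^+ n.+1 * h)
    <= n.+2%:R * n.+1%:R * rho ^+ n * modulus h ^+ 2.
Proof.
move=> zr zhr; have rho0 := le_trans (modulus_ge0 z) zr.
elim: n => [|n IH].
  rewrite (_ : _ - _ = h ^+ 2); last by rewrite !exprS expr0; ring.
  rewrite modulusX expr0 mulr1 ler_peMl ?exprn_ge0 ?modulus_ge0//.
  by rewrite mulr1 ler1n.
rewrite (_ : _ - _ = (z + h) * ((z + h) ^+ n.+2 - z ^+ n.+2 - n.+2%:R * z ^+ n.+1 * h)
   + n.+2%:R * z ^+ n.+1 * h ^+ 2); last first.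
  by rewrite -[n.+3%:R]natr1 !exprS; ring.
rewrite (le_trans (modulusD _ _))// !modulusM !modulusX modulus_nat.
have h1 : modulus (z + h) * modulus ((z + h) ^+ n.+2 - z ^+ n.+2 - n.+2%:R * z ^+ n.+1 * h)
   <= rho * (n.+2%:R * n.+1%:R * rho ^+ n * modulus h ^+ 2).
  by rewrite ler_pM ?modulus_ge0.
have h2 : n.+2%:R * modulus z ^+ n.+1 * modulus h ^+ 2 <=
   n.+2%:R * rho ^+ n.+1 * modulus h ^+ 2.
  by rewrite ler_wpM2r ?exprn_ge0 ?modulus_ge0// ler_wpM2l// lerXn2r ?nnegrE ?modulus_ge0.
apply: (le_trans (lerD h1 h2)).
rewrite -subr_ge0 [n.+2.+1%:R](_ : _ = n.+1%:R + 2); last by rewrite -natrD addn2.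
rewrite (_ : _ - _ = n.+2%:R * rho ^+ n.+1 * modulus h ^+ 2); last by rewrite exprS; ring.
by rewrite !mulr_ge0 ?exprn_ge0 ?modulus_ge0.
Qed.

(** The second-order remainders of the monomials are summed: the factor
n(n-1) is absorbed by differentiating the series twice, at the cost of a
slightly smaller radius. *)
Lemma psum_remainder (r rho : R) a : adm r a -> 0 < rho -> rho < r ->
  exists2 M : R, 0 <= M & forall z h, modulus z <= rho -> modulus (z + h) <= rho ->
    modulus (psum a (z + h) - psum a z - psum (cdiff a) z * h) <= M * modulus h ^+ 2.
Proof.
move=> ha rho0 rr.
pose s := (rho + r) / 2; pose s' := (rho + s) / 2.
have rs : rho < s by rewrite /s; lra.
have sr : s < r by rewrite /s; lra.
have rs' : rho < s' by rewrite /s'; lra.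
have ss' : s' < s by rewrite /s'; lra.
have hd : adm s (cdiff a) by apply: adm_diff ha => //; rewrite (lt_trans rho0).
have [M HM] : adm s' (cdiff (cdiff a)) by apply: adm_diff hd => //; rewrite (lt_trans rho0).
have s'0 : 0 < s' by rewrite (lt_trans rho0).
have M0 : 0 <= M by rewrite (le_trans _ (HM 0%N))// mulr_ge0 ?modulus_ge0.
have q0 : 0 < rho / s' by rewrite divr_gt0.
have q1 : rho / s' < 1 by rewrite ltr_pdivrMr// mul1r.
set q := rho / s' in q0 q1.
have rhoq : rho = s' * q by rewrite /q mulrC divfK// gt_eqF.
exists (M / q ^+ 2 * (1 - q)^-1).
  by rewrite mulr_ge0 ?divr_ge0 ?exprn_ge0 ?(ltW q0)// invr_ge0 subr_ge0 ltW.
move=> z h zr zhr.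
have h1 := psumP ha (le_lt_trans zhr rr).
have h2 := psumP ha (le_lt_trans zr rr).
have h3 := csumto_shift (psumP hd (le_lt_trans zr rs)).
have := csumto_lin (- h) (csumto_lin (-1) h1 h2) h3.
have -> : psum a (z + h) + -1 * psum a z + - h * psum (cdiff a) z =
  psum a (z + h) - psum a z - psum (cdiff a) z * h by ring.
have hh0 := exprn_ge0 2 (modulus_ge0 h).
move/(@csum_geometric_bound _ _ (M / q ^+ 2 * modulus h ^+ 2) q (ltW q0) q1).
rewrite [M / _ / _ * _]mulrAC; apply.
  by nonneg.
case=> [|[|n]].
- rewrite (_ : _ + _ + _ = 0); last by ring.
  by rewrite modulus0 ?expr1; nonneg.
- rewrite (_ : _ + _ + _ = 0); last by rewrite /cdiff; ring.
  by rewrite modulus0 ?expr1; nonneg.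
- rewrite (_ : _ + _ + _ = a n.+2 *
    ((z + h) ^+ n.+2 - z ^+ n.+2 - n.+2%:R * z ^+ n.+1 * h)); last first.
    by rewrite /cdiff; ring.
  rewrite modulusM.
  apply: (@le_trans _ _ (modulus (a n.+2) *
     (n.+2%:R * n.+1%:R * rho ^+ n * modulus h ^+ 2))).
    by rewrite ler_wpM2l ?modulus_ge0// binomial_remainder.
  have := HM n; rewrite /cdiff !modulusM !modulus_nat => Hn.
  have -> : M / q ^+ 2 * modulus h ^+ 2 * q ^+ n.+2 = M * (q ^+ n * modulus h ^+ 2).
    by rewrite !exprS; field; rewrite gt_eqF.
  have -> : modulus (a n.+2) * (n.+2%:R * n.+1%:R * rho ^+ n * modulus h ^+ 2) =
    n.+1%:R * (n.+2%:R * modulus (a n.+2)) * s' ^+ n * (q ^+ n * modulus h ^+ 2).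
    by rewrite rhoq exprMn; ring.
  by rewrite ler_wpM2r// mulr_ge0// exprn_ge0// ltW.
Qed.

(** Complex differentiability with a quadratic remainder, as analytic
functions have it. *)
Definition hasder (f : C -> C) (z l : C) := exists M d : R, [/\ 0 <= M, 0 < d &
  forall h, modulus h < d -> modulus (f (z + h) - f z - l * h) <= M * modulus h ^+ 2].

Lemma hasder_unique f z l m : hasder f z l -> hasder f z m -> l = m.
Proof.
move=> [M [d [M0 d0 H]]] [M' [d' [M0' d0' H']]].
apply/eqP; rewrite -subr_eq0 -modulus_eq0 eq_le modulus_ge0 andbT.
apply/ler_addgt0Pr => e e0; rewrite add0r.
have MM : 0 < M + M' + 1 by rewrite ltr_wpDl// addr_ge0.
pose r := Num.min (Num.min d d') (e / (M + M' + 1)) / 2.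
have r0 : 0 < r by rewrite divr_gt0// !lt_min d0 d0' divr_gt0.
have r2 : 2 * r = Num.min (Num.min d d') (e / (M + M' + 1)) by rewrite /r mulrC divfK.
have : r < 2 * r by lra.
rewrite r2 !lt_min -andbA => /and3P[rd rd' re].
have mr : modulus (r%:C)%C = r by rewrite modulus_real gtr0_norm.
have := H (r%:C)%C; have := H' (r%:C)%C; rewrite mr => /(_ rd') h' /(_ rd) h.
have := modulusB (f (z + (r%:C)%C) - f z - m * (r%:C)%C) (f (z + (r%:C)%C) - f z - l * (r%:C)%C).
rewrite (_ : _ - _ - _ - _ = (l - m) * (r%:C)%C); last by ring.
rewrite modulusM mr; move: re; rewrite ltr_pdivlMr//; nra.
Qed.

Definition der (f : C -> C) (z : C) : C := xget 0 [set l | hasder f z l].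

Lemma derE f z l : hasder f z l -> der f z = l.
Proof. by move=> h; apply: (hasder_unique _ h); apply: (xgetPex 0); exists l. Qed.

Definition psat (f : C -> C) (c : C) a (r : R) := 0 < r /\
  forall z, modulus (z - c) < r -> csumto (fun n => a n * (z - c) ^+ n) (f z).

Lemma csumto_term_bound u l : csumto u l -> exists M : R, forall n, modulus (u n) <= M.
Proof.
move=> hl; have [N HN] := hl 1 ltr01.
exists (2 + \sum_(i < N) modulus (u i)) => n.
have [nN|Nn] := ltnP n N.
  rewrite (bigD1 (Ordinal nN)) //= addrA addrAC ler_wpDl//.
    by rewrite addr_ge0// sumr_ge0// => i _; rewrite modulus_ge0.
have := HN n Nn; have := HN n.+1 (leqW Nn); rewrite big_ord_recr /=.
set s := \sum_(i < n) _ => h1 h2.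
have := modulusB (l - s) (l - (s + u n)); rewrite (_ : _ - _ - _ = u n); last by ring.
have : 0 <= \sum_(i < N) modulus (u i) by rewrite sumr_ge0// => i _; rewrite modulus_ge0.
lra.
Qed.

Lemma psat_adm f c a r : psat f c a r -> forall r', 0 < r' -> r' < r -> adm r' a.
Proof.
move=> [r0 H] r' r'0 rr.
have : modulus (c + (r'%:C)%C - c) < r.
  by rewrite addrAC subrr add0r modulus_real gtr0_norm.
move=> /H/csumto_term_bound[M HM]; exists M => n; have := HM n.
by rewrite addrAC subrr add0r modulusM modulusX modulus_real gtr0_norm.
Qed.

Lemma psat_psum f c a r z : psat f c a r -> modulus (z - c) < r -> f z = psum a (z - c).
Proof. by move=> [r0 H] /H/psum_unique. Qed.

Lemma psat_remainder f c a r : psat f c a r -> forall rho, 0 < rho -> rho < r ->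
  exists2 M : R, 0 <= M & forall z h, modulus (z - c) <= rho -> modulus (z + h - c) <= rho ->
    modulus (f (z + h) - f z - psum (cdiff a) (z - c) * h) <= M * modulus h ^+ 2.
Proof.
move=> hf rho rho0 rr.
pose r' := (rho + r) / 2.
have rr' : rho < r' by rewrite /r'; lra.
have r'r : r' < r by rewrite /r'; lra.
have ha := psat_adm hf (lt_trans rho0 rr') r'r.
have [M M0 HM] := psum_remainder ha rho0 rr'.
exists M => // z h zr zhr.
rewrite (psat_psum hf (le_lt_trans zr rr)) (psat_psum hf (le_lt_trans zhr rr)).
by rewrite [z + h - c]addrAC; apply: HM => //; rewrite addrAC.
Qed.

Lemma psat_der f c a r : psat f c a r ->
  forall z, modulus (z - c) < r -> der f z = psum (cdiff a) (z - c).
Proof.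
move=> hf z zr; apply: derE.
pose rho := (modulus (z - c) + r) / 2.
have zr' : modulus (z - c) < rho by rewrite /rho; lra.
have rr : rho < r by rewrite /rho; lra.
have rho0 : 0 < rho := le_lt_trans (modulus_ge0 _) zr'.
have [M M0 HM] := psat_remainder hf rho0 rr.
exists M, (rho - modulus (z - c)); split=> //; first by rewrite subr_gt0.
move=> h hr; apply: HM; first exact: ltW.
rewrite [z + h - c]addrAC (le_trans (modulusD _ _))//; lra.
Qed.

Lemma psat_derps f c a r : psat f c a r -> psat (der f) c (cdiff a) r.
Proof.
move=> hf; split; first by have [] := hf.
move=> z zr; rewrite (psat_der hf zr).
pose rho := (modulus (z - c) + r) / 2.
pose r' := (rho + r) / 2.
have zr' : modulus (z - c) < rho by rewrite /rho; lra.
have rr : rho < r' by rewrite /r' /rho; lra.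
have rr' : r' < r by rewrite /r' /rho; lra.
have rho0 : 0 < rho := le_lt_trans (modulus_ge0 _) zr'.
apply: (psumP _ zr'); apply: (adm_diff rho0 rr).
by apply: (psat_adm hf _ rr'); rewrite (lt_trans rho0).
Qed.

(** The remainder of the expansion at [z] is uniform for [z] near [c]. *)
Lemma psat_jet f c a r : psat f c a r -> exists2 rho : R, 0 < rho &
  exists2 M : R, 0 <= M & forall z, modulus (z - c) < rho ->
    [/\ modulus (f z) <= M, modulus (der f z) <= M & forall h, modulus h < rho ->
      modulus (f (z + h) - f z - der f z * h) <= M * modulus h ^+ 2].
Proof.
move=> hf; have [r0 _] := hf; have hf' := psat_derps hf.
have r2 : 0 < r / 2 by rewrite divr_gt0.
have r2r : r / 2 < r by lra.
have [M M0 HM] := psat_remainder hf r2 r2r.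
pose r3 := 3 * r / 4; have r30 : 0 < r3 by rewrite /r3; lra.
have r3r : r3 < r by rewrite /r3; lra.
have r23 : r / 2 < r3 by rewrite /r3; lra.
have [M1 HM1] := psum_bound (psat_adm hf r30 r3r) r23.
have [M2 HM2] := psum_bound (psat_adm hf' r30 r3r) r23.
have M10 : 0 <= M1 by rewrite (le_trans _ (HM1 0 _)) ?modulus_ge0// modulus0 ltW.
have M20 : 0 <= M2 by rewrite (le_trans _ (HM2 0 _)) ?modulus_ge0// modulus0 ltW.
exists (r / 4); first by rewrite divr_gt0.
exists (M + M1 + M2); first by rewrite !addr_ge0.
move=> z zr; have zr2 : modulus (z - c) <= r / 2 by lra.
have zrr : modulus (z - c) < r by lra.
split.
- by rewrite (psat_psum hf zrr) (le_trans (HM1 _ zr2))//; lra.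
- by rewrite (psat_der hf zrr) (le_trans (HM2 _ zr2))//; lra.
- move=> h hr; rewrite (psat_der hf zrr).
  apply: (@le_trans _ _ (M * modulus h ^+ 2)).
    apply: HM => //; rewrite [z + h - c]addrAC (le_trans (modulusD _ _))//; lra.
  by rewrite ler_wpM2r ?exprn_ge0 ?modulus_ge0//; lra.
Qed.

End PowerSeries.

(** * Compactness in the plane and the minimum modulus principle *)

Section PlaneTopology.
Context {R : realType}.
Local Notation C := R[i].

Definition of_plane (x : plane R) : C := (x.1 +i* x.2)%C.

Lemma of_planeK : cancel of_plane (@to_plane R).
Proof. by case. Qed.
Lemma to_planeK : cancel (@to_plane R) of_plane.
Proof. by case. Qed.

Lemma of_planeB x y : of_plane (x - y) = of_plane x - of_plane y.
Proof. by case: x => x1 x2; case: y. Qed.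
Lemma of_planeD x y : of_plane (x + y) = of_plane x + of_plane y.
Proof. by case: x => x1 x2; case: y. Qed.

Lemma plane_norm (x : plane R) : `|x| = Num.max `|x.1| `|x.2|.
Proof. by []. Qed.

Lemma plane_norm_modulus x : `|x| <= modulus (of_plane x).
Proof. by rewrite plane_norm ge_max (modulus_Re (of_plane x)) (modulus_Im (of_plane x)). Qed.

Lemma modulus_plane_norm x : modulus (of_plane x) <= 2 * `|x|.
Proof.
apply: le_trans (modulus_le _) _; rewrite plane_norm mulr_natl mulr2n.
by rewrite lerD// le_max lexx ?orbT.
Qed.

Lemma nbhs_planeP (A : set (plane R)) x : nbhs x A <->
  exists2 r : R, 0 < r & forall y, modulus (of_plane y - of_plane x) < r -> A y.
Proof.
split.
  move=> /nbhs_ballP[e /= e0 H]; exists e => // y hy; apply: H.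
  rewrite -ball_normE /= distrC; apply: le_lt_trans hy.
  by rewrite -of_planeB plane_norm_modulus.
move=> [r r0 H]; apply/nbhs_ballP; exists (r / 2) => /=; first by rewrite divr_gt0.
move=> y; rewrite -ball_normE /= distrC => hy; apply: H.
rewrite -of_planeB; apply: le_lt_trans (modulus_plane_norm _) _.
by rewrite mulrC -ltr_pdivlMr.
Qed.

Lemma open_planeP (A : set (plane R)) : open A <-> forall x, A x ->
  exists2 r : R, 0 < r & forall y, modulus (of_plane y - of_plane x) < r -> A y.
Proof.
rewrite openE; split=> H x /H; rewrite /interior /=; first by move/nbhs_planeP.
by move=> h; apply/nbhs_planeP.
Qed.

Lemma nbhs_complexP (A : set C^o) (z : C) : nbhs (z : C^o) A <->
  exists2 r : R, 0 < r & forall w, modulus (w - z) < r -> A w.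
Proof.
split.
  move=> /nbhs_ballP[e /= e0 H].
  have [er eE] : 0 < complex.Re e /\ e = ((complex.Re e)%:C)%C.
    by move: e0; rewrite ltcE /= => /andP[/eqP]; case: e {H} => a b /= -> ->.
  exists (complex.Re e) => // y hy; apply: H.
  by rewrite -ball_normE /= distrC -modulusE eE ltcR.
move=> [r r0 H]; apply/nbhs_ballP; exists ((r%:C)%C) => /=; first by rewrite ltcR.
move=> y; rewrite -ball_normE /= distrC => hy; apply: H.
by rewrite -ltcR modulusE.
Qed.

Lemma modulus_cont (c : C) : continuous (fun x : plane R => modulus (of_plane x - c)).
Proof.
move=> x; apply/cvgrPdist_lt => e e0; apply/nbhs_planeP; exists e => // y hy.
apply: le_lt_trans hy.
rewrite ler_norml; apply/andP; split.
  have := ler_modB (of_plane y - c) (of_plane y - of_plane x).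
  rewrite (_ : _ - _ - (_ - _) = of_plane x - c); last by ring.
  lra.
have := ler_modB (of_plane x - c) (of_plane x - of_plane y).
rewrite (_ : _ - _ - (_ - _) = of_plane y - c); last by ring.
rewrite (modulusC (of_plane x) (of_plane y)); lra.
Qed.

Lemma compact_box (a b c d : R) : compact (`[a, b]%classic `*` `[c, d]%classic : set (plane R)).
Proof. by apply: compact_setX; exact: segment_compact. Qed.

Lemma compact_bounded_closed (A : set (plane R)) (M : R) :
  closed A -> (forall x, A x -> `|x| <= M) -> compact A.
Proof.
move=> cA bA; apply: (subclosed_compact cA (@compact_box (-M) M (-M) M)).
move=> x /bA; rewrite plane_norm ge_max => /andP[h1 h2].
by split; rewrite /= in_itv /= -ler_norml.
Qed.

Lemma compact_disc (c : C) (r : R) :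
  compact [set x : plane R | modulus (of_plane x - c) <= r].
Proof.
apply: (@compact_bounded_closed _ (r + modulus c)).
  by apply: (@closed_comp _ _ (fun x : plane R => modulus (of_plane x - c)) [set y | y <= r]);
    [move=> *; exact: modulus_cont|exact: closed_le].
move=> x /= hx; apply: le_trans (plane_norm_modulus _) _.
by have := ler_modB (of_plane x) c; lra.
Qed.

Lemma compact_circle (c : C) (r : R) :
  compact [set x : plane R | modulus (of_plane x - c) = r].
Proof.
apply: (@compact_bounded_closed _ (r + modulus c)).
  by apply: (@closed_comp _ _ (fun x : plane R => modulus (of_plane x - c)) [set y | y = r]);
    [move=> *; exact: modulus_cont|exact: closed_eq].
move=> x /= hx; apply: le_trans (plane_norm_modulus _) _.
by have := ler_modB (of_plane x) c; lra.
Qed.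

(** The form in which compactness is used: [P n z] holds, for [n] large, near
each point of [K], typically because [P] is a bound by [n] or at scale 1/n; the
rank is then uniform on [K]. *)
Lemma compact_cover (K : set (plane R)) (P : nat -> C -> Prop) : compact K ->
  (forall x, K x -> exists2 r : R, 0 < r & exists N : nat, forall n, (N <= n)%N ->
     forall z, modulus (z - of_plane x) < r -> P n z) ->
  exists N : nat, forall n, (N <= n)%N -> forall x, K x -> P n (of_plane x).
Proof.
move=> /compact_near_coveringP cK H.
have := cK nat \oo (fun n x => P n (of_plane x)) _.
have H' : forall x, K x -> \forall x' \near x & i \near \oo, P i (of_plane x').
  move=> x /H[r r0 [N HN]].
  exists ([set y | modulus (of_plane y - of_plane x) < r], [set n | (N <= n)%N]).
    split => /=; first by apply/nbhs_planeP; exists r.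
    by exists N.
  by move=> [y n] /= [h1 h2]; apply: HN.
by move=> /(_ _ H')[N _ HN]; exists N => n nN x Kx; exact: HN.
Qed.

Lemma compact_min (K : set (plane R)) (f : C -> R) : compact K -> K !=set0 ->
  (forall x, K x -> forall e : R, 0 < e -> exists2 d : R, 0 < d &
     forall y, modulus (y - of_plane x) < d -> `|f (of_plane x) - f y| < e) ->
  exists2 x, K x & forall y, K y -> f (of_plane x) <= f (of_plane y).
Proof.
move=> cK K0 cf.
have [x /set_mem Kx Hx] : exists2 x, x \in K &
    forall y, y \in K -> f (of_plane x) <= f (of_plane y).
  apply: (@compact_EVT_min _ _ (fun x => f (of_plane x))) => //.
  apply/subspace_continuousP => x Kx; apply/cvgrPdist_lt => e e0.
  have [d d0 Hd] := cf x Kx e e0.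
  rewrite /prop_near1 /within /= /nbhs /=; apply/nbhs_planeP; exists d => // y hy _.
  exact: Hd.
by exists x => // y Ky; apply: Hx; rewrite inE.
Qed.

End PlaneTopology.

Section OrderOfZero.
Context {R : realType}.
Local Notation C := R[i].
Implicit Types (a : nat -> C) (f : C -> C).

Definition cshift (m : nat) a : nat -> C := fun n => a (m + n)%N.

Lemma adm_shift (r : R) m a : 0 < r -> adm r a -> adm r (cshift m a).
Proof.
move=> r0 [M HM]; exists (M / r ^+ m) => n.
rewrite ler_pdivlMr ?exprn_gt0// (le_trans _ (HM (m + n)%N))// exprD.
by rewrite -mulrA [r ^+ n * _]mulrC.
Qed.

Lemma psum_shift1 (r : R) a z : adm r a -> modulus z < r ->
  psum a z = a 0%N + z * psum (cshift 1 a) z.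
Proof.
move=> ha zr; have r0 : 0 < r := le_lt_trans (modulus_ge0 _) zr.
apply: psum_unique.
have h := csumto_shift (psumP (adm_shift 1 r0 ha) zr).
have h0 : csumto (fun n => if n is 0%N then a 0%N else 0) (a 0%N).
  move=> e e0; exists 1%N => -[//|n] _; rewrite big_ord_recl /= big1//.
  by rewrite addr0 subrr modulus0.
apply: (csumto_eq _ (csumto_lin z h0 h)) => -[|n].
  by rewrite mulr0 addr0 expr0 mulr1.
by rewrite add0r /cshift add1n exprS; ring.
Qed.

Lemma psum_order (r : R) a m z : adm r a -> modulus z < r ->
  (forall i, (i < m)%N -> a i = 0) -> psum a z = z ^+ m * psum (cshift m a) z.
Proof.
move=> ha zr; have r0 : 0 < r := le_lt_trans (modulus_ge0 _) zr.
elim: m => [|m IH] am.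
  by rewrite expr0 mul1r; congr psum; apply/funext => n; rewrite /cshift add0n.
rewrite IH; last by move=> i im; apply: am; rewrite ltnW.
have E : cshift 1 (cshift m a) = cshift m.+1 a.
  by apply/funext => n; rewrite /cshift addnA addn1.
by rewrite (psum_shift1 (adm_shift m r0 ha) zr) E {1}/cshift addn0 am// add0r mulrA -exprSr.
Qed.

(** Splitting off the first nonzero coefficient. The last condition
makes the order positive when the function vanishes at [c]. *)
Lemma psat_order f c a (r : R) : psat f c a r -> (exists n, a n != 0) ->
  exists (m : nat) (al : C) (rho K : R), [/\ al != 0, 0 < rho, 0 <= K,
    (a 0%N = 0 -> (0 < m)%N) &
    forall h, modulus h < rho -> modulus (f (c + h) - al * h ^+ m) <= K * modulus h ^+ m.+1].
Proof.
move=> hf ex; pose m := ex_minn ex.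
have [am0 am] : a m != 0 /\ forall i, (i < m)%N -> a i = 0.
  rewrite /m; case: ex_minnP => k ak kmin; split=> // i ik.
  by apply/eqP; apply: contraTT ik => /kmin; rewrite leqNgt.
have [r0 _] := hf.
pose r1 := r / 2; have r10 : 0 < r1 by rewrite divr_gt0.
have r1r : r1 < r by rewrite /r1; lra.
have ha := psat_adm hf r10 r1r; have hs := adm_shift m r10 ha.
pose r2 := r1 / 2; have r20 : 0 < r2 by rewrite divr_gt0.
have r21 : r2 < r1 by rewrite /r2; lra.
have [M HM] := psum_bound (adm_shift 1 r10 hs) r21.
have M0 : 0 <= M by rewrite (le_trans _ (HM 0 _)) ?modulus_ge0// modulus0 ltW.
exists m, (a m), r2, M; split=> //.
  by move=> a0; case: (posnP m) am0 => // ->; rewrite a0 eqxx.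
move=> h hr; have hr1 := lt_trans hr r21.
rewrite (psat_psum hf); last first.
  by rewrite addrAC subrr add0r (lt_trans hr1).
rewrite (_ : c + h - c = h); last by ring.
rewrite (psum_order ha hr1 am) (psum_shift1 hs hr1) {1}/cshift addn0.
rewrite (_ : _ - _ = h ^+ m.+1 * psum (cshift 1 (cshift m a)) h); last first.
  by rewrite exprSr; ring.
by rewrite modulusM modulusX mulrC ler_wpM2r ?exprn_ge0 ?modulus_ge0// HM// ltW.
Qed.

Definition czero a : nat -> C := fun n => if n is 0%N then 0 else a n.

Lemma psat_czero f c a r : psat f c a r -> psat (fun z => f z - f c) c (czero a) r.
Proof.
move=> hf; have [r0 H] := hf; split=> // z /H hz.
have fc : f c = a 0%N.
  have := H c; rewrite subrr modulus0 => /(_ r0) hc; apply: (csumto_unique hc).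
  move=> e e0; exists 1%N => -[//|n] _; rewrite big_ord_recl /= big1.
    by rewrite expr0 mulr1 addr0 subrr modulus0.
  by move=> i _; rewrite expr0n /= mulr0.
have h0 : csumto (fun n => if n is 0%N then a 0%N else 0) (a 0%N).
  move=> e e0; exists 1%N => -[//|n] _; rewrite big_ord_recl /= big1//.
  by rewrite addr0 subrr modulus0.
rewrite (_ : f z - f c = f z + (-1) * a 0%N); last by rewrite fc; ring.
apply: (csumto_eq _ (csumto_lin (-1) hz h0)) => -[|n] /=.
  by rewrite expr0; ring.
by ring.
Qed.

Lemma complex_root (m : nat) (w : C) : (0 < m)%N -> exists z, z ^+ m = w.
Proof. by move=> m0; exists (m.-root w); rewrite rootCK. Qed.

(** The modulus of f - w, for f analytic and nonconstant, has no local minimum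
other than a zero: moving from [c] in the direction of a suitable root decreases
the leading term of the expansion. *)
Lemma min_modulus f c a (r : R) w : psat f c a r -> (exists2 n, (0 < n)%N & a n != 0) ->
  f c != w -> forall rho : R, 0 < rho -> exists2 h, modulus h < rho &
    modulus (f (c + h) - w) < modulus (f c - w).
Proof.
move=> hf [n n0 an] fw rho rho0.
have [|m [al [r1 [K [al0 r10 K0 m0 Hm]]]]] := psat_order (psat_czero hf).
  by exists n; rewrite /czero; case: n n0 an.
have {}m0 : (0 < m)%N by apply: m0.
have [om omE] := complex_root (- (f c - w) / al) m0.
set g := f c - w in omE *.
have g0 : g != 0 by rewrite subr_eq0.
have mg0 : 0 < modulus g by rewrite modulus_gt0.
have mo0 := modulus_ge0 om.
have Ko : 0 <= K * modulus om ^+ m.+1 by nonneg.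
(* Along h = s om, with om^m = - g / al, the leading term turns g into (1 - s^m) g;
   s is so small that the remainder K |h|^(m+1) is less than s^m |g|. *)
pose s := Num.min (Num.min 1 (Num.min r1 rho / (modulus om + 1)))
                  (modulus g / (K * modulus om ^+ m.+1 + 1)) / 2.
have s0 : 0 < s.
  by rewrite divr_gt0// !lt_min ltr01 !divr_gt0 ?lt_min ?r10// ltr_wpDl.
have s2 : s < 2 * s by lra.
move: s2; rewrite {2}/s [2 * _]mulrC divfK// !lt_min -andbA => /and3P[s1].
rewrite ltr_pdivlMr ?ltr_wpDl// lt_min => /andP[sr1 srho].
rewrite ltr_pdivlMr ?ltr_wpDl// => sg.
have ms : modulus (s%:C)%C = s by rewrite modulus_real gtr0_norm.
have som : s * modulus om <= s * (modulus om + 1) by rewrite ler_wpM2l ?ltW// ltrDl.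
have hm : modulus ((s%:C)%C * om) = s * modulus om by rewrite modulusM ms.
exists ((s%:C)%C * om); first by rewrite hm (le_lt_trans som).
have := Hm ((s%:C)%C * om); rewrite hm => /(_ (le_lt_trans som sr1)).
set y := f (c + _).
have -> : al * ((s%:C)%C * om) ^+ m = - (s%:C)%C ^+ m * g.
  by rewrite exprMn omE; field.
move=> hy.
rewrite (_ : y - w = (y - f c - - (s%:C)%C ^+ m * g) + (1 - (s%:C)%C ^+ m) * g); last first.
  by rewrite /g; ring.
apply: le_lt_trans (modulusD _ _) _; rewrite modulusM.
have -> : modulus (1 - (s%:C)%C ^+ m) = 1 - s ^+ m.
  rewrite -rmorphXn -(rmorph1 (real_complex R)) -rmorphB modulus_real ger0_norm//.
  by rewrite subr_ge0 exprn_ile1 ?(ltW s0) ?(ltW s1).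
have sm0 : 0 < s ^+ m by rewrite exprn_gt0.
have : K * (s * modulus om) ^+ m.+1 < s ^+ m * modulus g.
  have -> : K * (s * modulus om) ^+ m.+1 = s ^+ m * (s * (K * modulus om ^+ m.+1)).
    by rewrite exprMn (exprSr s); ring.
  rewrite ltr_pM2l//; lra.
lra.
Qed.

End OrderOfZero.

(** * The conformal map up to the boundary circle *)

Section ConformalMap.
Context {R : realType}.
Local Notation C := R[i].
Variable phi : C -> C.

(** Holomorphy on [S] with second-order remainders uniform on [S]. *)
Definition clin (f : C -> C) (S : set C) := exists M d : R, [/\ 0 <= M, 0 < d &
  forall z, S z -> [/\ modulus (f z) <= M, modulus (der f z) <= M & forall h, modulus h < d ->
    modulus (f (z + h) - f z - der f z * h) <= M * modulus h ^+ 2]].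

(** By compactness the radii of convergence are bounded below on the closed
disc, so that everything extends uniformly to a larger disc. *)
Lemma psat_clin_disc (f : C -> C) :
  (forall c, modulus c <= 1 -> exists a (r : R), psat f c a r) ->
  exists2 rho : R, 1 < rho & clin f [set z | modulus z <= rho].
Proof.
move=> hf.
pose P (n : nat) (c : C) := forall z, modulus (z - c) < n.+1%:R^-1 ->
  [/\ modulus (f z) <= n%:R, modulus (der f z) <= n%:R & forall h, modulus h < n.+1%:R^-1 ->
    modulus (f (z + h) - f z - der f z * h) <= n%:R * modulus h ^+ 2].
have [N /(_ N (leqnn _)) HN] : exists N : nat, forall n, (N <= n)%N ->
    forall x : plane R, modulus (of_plane x - 0) <= 1 -> P n (of_plane x).
  apply: compact_cover; first exact: compact_disc.
  move=> x /= x1; rewrite subr0 in x1.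
  have [a [r /psat_jet[rho rho0 [M M0 HM]]]] := hf _ x1.
  exists (rho / 2); first by rewrite divr_gt0.
  pose N := maxn (Num.trunc (2 / rho)).+1 (Num.trunc M).+1.
  exists N => n; rewrite geq_max => /andP[n1 n2] z zx y yz.
  have hn1 : n.+1%:R^-1 < rho / 2.
    rewrite -[rho / 2]invrK ltf_pV2 ?posrE ?invr_gt0 ?divr_gt0// invfM invrK mulrC.
    by apply: lt_le_trans (truncnS_gt _) _; rewrite ler_nat ltnW.
  have hn2 : M <= n%:R.
    by apply: le_trans (ltW (truncnS_gt _)) _; rewrite ler_nat.
  have yx : modulus (y - of_plane x) < rho.
    have := lt_trans yz hn1; have := modulus_tri y z (of_plane x); lra.
  have [h1 h2 h3] := HM y yx; split.
  - exact: le_trans hn2.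
  - exact: le_trans hn2.
  - move=> h hh; apply: (le_trans (h3 h _)); first by have := lt_trans hh hn1; lra.
    by rewrite ler_wpM2r// exprn_ge0// modulus_ge0.
rewrite /P in HN; have [e eE] : exists e : R, e = N.+1%:R^-1 by eexists.
rewrite -eE in HN; have N0 : 0 < e by rewrite eE invr_gt0.
exists (1 + e / 2); first by rewrite ltrDl divr_gt0.
exists N%:R, e; split=> // z /= zr.
have [z1|z1] := leP (modulus z) 1.
  have := HN (to_plane z); rewrite to_planeK subr0 => /(_ z1); apply.
  by rewrite subrr modulus0.
have z0 : z != 0 by rewrite -modulus_gt0; lra.
pose w := z / (modulus z)%:C%C.
have mz0 : (modulus z)%:C%C != 0 by rewrite -(rmorph0 (real_complex R)) (inj_eq (@complexI R)) modulus_eq0.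
have := HN (to_plane w); rewrite to_planeK subr0.
have w1 : modulus w = 1.
  by rewrite modulusM modulusV modulus_real ger0_norm ?modulus_ge0// divff// modulus_eq0.
rewrite w1 lexx => /(_ isT); apply.
rewrite (_ : z - w = w * (modulus z - 1)%:C%C); last first.
  by rewrite /w rmorphB rmorph1 /=; field.
rewrite modulusM w1 mul1r modulus_real ger0_norm; lra.
Qed.

Hypothesis phi_an : forall c, modulus c <= 1 -> exists a (r : R), psat phi c a r.
Hypothesis phi_inj : forall z w, modulus z < 1 -> modulus w < 1 -> phi z = phi w -> z = w.

(** A function that is constant near [c] is not injective on the part of the
unit disc close to [c]; this also covers the points of the circle. *)
Lemma phi_order c a (r : R) : modulus c <= 1 -> psat phi c a r ->
  exists2 n, (0 < n)%N & a n != 0.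
Proof.
move=> c1 hf; apply: contrapT => H.
have a0 n : (0 < n)%N -> a n = 0.
  by move=> n0; apply/eqP/negPn/negP => an; apply: H; exists n.
have [r0 _] := hf.
have cst z : modulus (z - c) < r -> phi z = phi c.
  have K y : modulus (y - c) < r -> phi y = a 0%N.
    move=> yr; rewrite (psat_psum hf yr); apply: psum_unique => e e0.
    exists 1%N => -[//|n] _; rewrite big_ord_recl /= big1.
      by rewrite expr0 mulr1 addr0 subrr modulus0.
    by move=> i _; rewrite a0// mul0r.
  by move=> zr; rewrite !K// subrr modulus0.
pose t := Num.min 1 r / 2.
have t0 : 0 < t by rewrite divr_gt0// lt_min ltr01.
have [t1 tr] : 2 * t <= 1 /\ 2 * t <= r.
  by rewrite /t mulrC divfK//; split; rewrite ge_min lexx ?orbT.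
(* Two distinct points of the open unit disc, at distance less than r from c. *)
pose p := (1 - t)%:C%C * c.
pose q := p + (t / 2)%:C%C.
have mp : modulus p <= 1 - t.
  rewrite modulusM modulus_real ger0_norm; last by lra.
  by rewrite ler_piMr//; lra.
have mt : modulus (t / 2)%:C%C = t / 2 by rewrite modulus_real gtr0_norm// divr_gt0.
have mpc : modulus (p - c) <= t.
  rewrite (_ : p - c = - (t%:C%C * c)); last by rewrite /p rmorphB rmorph1 /=; ring.
  by rewrite modulusN modulusM modulus_real gtr0_norm// ler_piMr// ltW.
have mq := modulusD p (t / 2)%:C%C; rewrite mt -/q in mq.
have mqc := modulusD (p - c) (t / 2)%:C%C.
rewrite mt (_ : p - c + _ = q - c) in mqc; last by rewrite /q; ring.
have pq : p = q.
  apply: phi_inj; [lra|lra|].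
  by rewrite !cst//; lra.
move: pq => /eqP; rewrite /q addrC -subr_eq subrr eq_sym => /eqP t20.
by have := mt; rewrite t20 modulus0; lra.
Qed.

Lemma phi_cont c : modulus c <= 1 -> forall e : R, 0 < e -> exists2 d : R, 0 < d &
  forall y, modulus (y - c) < d -> modulus (phi y - phi c) < e.
Proof.
move=> c1 e e0; have [a [r /psat_jet[rho rho0 [M M0 HM]]]] := phi_an c1.
have := HM c; rewrite subrr modulus0 => /(_ rho0)[_ H2 H3].
have MM : 0 < 2 * M + 1 by rewrite ltr_wpDl// mulr_ge0.
exists (Num.min (Num.min rho 1) (e / (2 * M + 1))).
  by rewrite !lt_min rho0 ltr01 divr_gt0.
move=> y; rewrite !lt_min -andbA => /and3P[yr y1].
rewrite ltr_pdivlMr// => ye.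
have := H3 _ yr; rewrite [c + _]addrC subrK => h.
have := modulusD (phi y - phi c - der phi c * (y - c)) (der phi c * (y - c)).
rewrite subrK modulusM => h'.
have y0 := modulus_ge0 (y - c).
have : modulus (der phi c) * modulus (y - c) <= M * modulus (y - c) by rewrite ler_wpM2r.
have : M * modulus (y - c) ^+ 2 <= M * modulus (y - c).
  by rewrite ler_wpM2l// expr2 ler_piMr// ltW.
lra.
Qed.

(** The minimum of |phi - w| over a small disc is attained inside, since by
injectivity phi - phi(c) is bounded below on its boundary; by the minimum modulus
principle it is 0. *)
Lemma phi_open c (r : R) : 0 < r -> modulus c + r < 1 -> exists2 d : R, 0 < d &
  forall w, modulus (w - phi c) < d -> exists2 z, modulus (z - c) < r & phi z = w.
Proof.
move=> r0 cr.
have in1 z : modulus (z - c) <= r -> modulus z < 1.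
  by move=> zr; have := ler_modB z c; lra.
have c1 : modulus c < 1 by lra.
have cont (w : C) z : modulus z < 1 -> forall e : R, 0 < e -> exists2 d : R, 0 < d &
     forall y, modulus (y - z) < d -> `|modulus (phi z - w) - modulus (phi y - w)| < e.
  move=> z1 e e0; have [d d0 Hd] := phi_cont (ltW z1) e0.
  exists d => // y /Hd; apply: le_lt_trans; rewrite ler_norml.
  have := modulus_tri (phi z) (phi y) w; have := modulus_tri (phi y) (phi z) w.
  rewrite (modulusC (phi z) (phi y)) => h1 h2; apply/andP; split; lra.
have [x /= xr Hx] : exists2 x : plane R, modulus (of_plane x - c) = r &
    forall y : plane R, modulus (of_plane y - c) = r ->
      modulus (phi (of_plane x) - phi c) <= modulus (phi (of_plane y) - phi c).
  apply: (@compact_min _ _ (fun z => modulus (phi z - phi c))).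
  - exact: compact_circle.
  - exists (to_plane (c + r%:C%C)); rewrite /= to_planeK addrAC subrr add0r.
    by rewrite modulus_real gtr0_norm.
  - by move=> x /= xr; apply: cont; apply: in1; rewrite xr.
set m := modulus (phi (of_plane x) - phi c) in Hx.
have m0 : 0 < m.
  rewrite modulus_gt0 subr_eq0; apply/eqP => /phi_inj xc.
  have := xr; rewrite xc ?subrr ?modulus0//; first lra.
  by apply: in1; rewrite xr.
(* If |w - phi c| < m / 2, then |phi - w| is smaller at c than on the circle. *)
exists (m / 2); first by rewrite divr_gt0.
move=> w wm.
have [y /= yr Hy] : exists2 x : plane R, modulus (of_plane x - c) <= r &
    forall y : plane R, modulus (of_plane y - c) <= r ->
      modulus (phi (of_plane x) - w) <= modulus (phi (of_plane y) - w).
  apply: (@compact_min _ _ (fun z => modulus (phi z - w))).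
  - exact: compact_disc.
  - by exists (to_plane c); rewrite /= to_planeK subrr modulus0 ltW.
  - by move=> z /= zr; apply: cont; exact: in1.
have yr' : modulus (of_plane y - c) < r.
  rewrite lt_neqAle yr andbT; apply/eqP => yE.
  have := Hy (to_plane c); rewrite to_planeK subrr modulus0 => /(_ (ltW r0)).
  have := Hx _ yE; have := modulus_tri (phi (of_plane y)) w (phi c).
  rewrite (modulusC (phi c) w); lra.
exists (of_plane y) => //; apply/eqP; apply: contrapT => /negP neq.
have y1 := in1 _ yr.
have [a [s ha]] := phi_an (ltW y1).
have an := phi_order (ltW y1) ha.
have [|h hr] := min_modulus ha an neq (rho := r - modulus (of_plane y - c)).
  by rewrite subr_gt0.
have := Hy (to_plane (of_plane y + h)); rewrite to_planeK => hy.
rewrite ltNge hy// addrAC; have := modulusD (of_plane y - c) h; lra.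
Qed.

(** The derivative may vanish at a boundary point; it is then equivalent to
a power of the distance to that point, which compares its values at points with
comparable distances. A point of the segment joining [z] to its mirror image is
at distance at most 5 |z - c| from [c]. *)
Lemma der_comparable c : modulus c = 1 -> exists2 r : R, 0 < r & exists2 B : R, 0 <= B &
  forall z y, modulus (z - c) < r -> modulus z < 1 -> modulus (y - c) <= 5 * modulus (z - c) ->
    der phi z != 0 /\ modulus (der phi y) <= B * modulus (der phi z).
Proof.
move=> c1; have c1' : modulus c <= 1 by rewrite c1.
have [a [s ha]] := phi_an c1'.
have [n n0 an] := phi_order c1' ha.
have [|m [al [rho [K [al0 rho0 K0 _ H]]]]] := psat_order (psat_derps ha).
  by exists n.-1; rewrite /cdiff prednK// mulf_neq0// pnatr_eq0 -lt0n.
have ma0 : 0 < modulus al by rewrite modulus_gt0.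
have K1 : 0 < K + 1 by rewrite ltr_wpDl.
exists (Num.min (rho / 5) (modulus al / (K + 1) / 10)).
  by rewrite lt_min !divr_gt0.
exists (4 * 5 ^+ m); first by nonneg.
move=> z y; rewrite lt_min => /andP[zr za] z1 yz.
have {}zr : 5 * modulus (z - c) < rho by rewrite mulrC -ltr_pdivlMr.
have {}za : 10 * (modulus (z - c) * (K + 1)) < modulus al.
  by rewrite mulrC -ltr_pdivlMr// -ltr_pdivlMr// mulrAC.
have zc0 : 0 < modulus (z - c) by have := ler_modB c z; rewrite modulusC c1; lra.
set t := modulus (z - c) in zr za yz zc0 *.
have key x : modulus (x - c) <= 5 * t ->
    modulus (der phi x - al * (x - c) ^+ m) <= modulus al / 2 * modulus (x - c) ^+ m.
  move=> xt; have xc0 := modulus_ge0 (x - c).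
  have := H (x - c); rewrite [c + _]addrC subrK => h; apply: le_trans (h _) _; first lra.
  rewrite exprS mulrA ler_wpM2r ?exprn_ge0// .
  have : K * modulus (x - c) <= K * (5 * t) by rewrite ler_wpM2l.
  have : K * t <= (K + 1) * t by rewrite ler_wpM2r ?ltW// ltrDl.
  lra.
have lo : modulus al / 2 * t ^+ m <= modulus (der phi z).
  have := key z; rewrite -/t => h; have {}h := h _.
  have : t <= 5 * t by lra.
  move/h; rewrite modulusC => h'.
  have := ler_modB (al * (z - c) ^+ m) (al * (z - c) ^+ m - der phi z).
  by rewrite subKr modulusM modulusX -/t; lra.
have hi : modulus (der phi y) <= 2 * modulus al * modulus (y - c) ^+ m.
  have := key y yz => h; have := modulusD (der phi y - al * (y - c) ^+ m) (al * (y - c) ^+ m).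
  rewrite subrK modulusM modulusX.
  have : 0 <= modulus al * modulus (y - c) ^+ m by nonneg.
  lra.
have tm0 : 0 < t ^+ m by rewrite exprn_gt0.
split.
  by rewrite -modulus_gt0 (lt_le_trans _ lo)// mulr_gt0// divr_gt0.
apply: (le_trans hi).
have : modulus (y - c) ^+ m <= (5 * t) ^+ m.
  by rewrite lerXn2r ?nnegrE ?modulus_ge0//; nonneg.
move/(ler_wpM2l (ltW ma0)); rewrite exprMn => h1.
have : 4 * 5 ^+ m * (modulus al / 2 * t ^+ m) <= 4 * 5 ^+ m * modulus (der phi z).
  by rewrite ler_wpM2l//; nonneg.
have -> : 4 * 5 ^+ m * (modulus al / 2 * t ^+ m) = 2 * (modulus al * (5 ^+ m * t ^+ m)) by field.
lra.
Qed.

(** By compactness of the circle the constants are uniform; the points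
t z with t |z|^2 <= 1 form the segment from [z] to its mirror image. In
particular phi' has no zero in the open disc near the circle. *)
Lemma der_comparable_annulus : exists2 r : R, 0 < r & exists2 B : R, 0 <= B &
  forall z, 1 - r < modulus z -> modulus z < 1 -> der phi z != 0 /\
    forall t : R, 1 <= t -> t * modulus z ^+ 2 <= 1 ->
      modulus (der phi (t%:C%C * z)) <= B * modulus (der phi z).
Proof.
pose P (n : nat) (c : C) := forall z, modulus (z - c) < n.+2%:R^-1 -> modulus z < 1 ->
  der phi z != 0 /\
    forall y, modulus (y - z) <= 4 * (1 - modulus z) -> modulus c = 1 ->
      modulus (der phi y) <= n%:R * modulus (der phi z).
have [N /(_ N (leqnn _)) HN] : exists N : nat, forall n, (N <= n)%N ->
    forall x : plane R, modulus (of_plane x - 0) = 1 -> P n (of_plane x).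
  apply: compact_cover; first exact: compact_circle.
  move=> x /= x1; rewrite subr0 in x1.
  have [rho rho0 [M M0 HM]] := der_comparable x1.
  exists (rho / 2); first by rewrite divr_gt0.
  pose N := maxn (Num.trunc (2 / rho)).+1 (Num.trunc M).+1.
  exists N => n; rewrite geq_max => /andP[n1 n2] c cx z zc z1.
  have hn1 : n.+2%:R^-1 < rho / 2.
    rewrite -[rho / 2]invrK ltf_pV2 ?posrE ?invr_gt0 ?divr_gt0// invfM invrK mulrC.
    by apply: lt_le_trans (truncnS_gt _) _; rewrite ler_nat ltnW// ltnW.
  have hn2 : M <= n%:R.
    by apply: le_trans (ltW (truncnS_gt _)) _; rewrite ler_nat.
  have zx : modulus (z - of_plane x) < rho.
    by have := lt_trans zc hn1; have := modulus_tri z c (of_plane x); lra.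
  have [h1 _] : der phi z != 0 /\ modulus (der phi z) <= M * modulus (der phi z).
    by apply: HM => //; have := modulus_ge0 (z - of_plane x); lra.
  split=> // y yz c1.
  have [_ h2] : der phi z != 0 /\ modulus (der phi y) <= M * modulus (der phi z).
    apply: HM => //.
    have := modulus_tri y z (of_plane x); have := ler_modB (of_plane x) z.
    by rewrite x1 (modulusC (of_plane x) z); lra.
  by rewrite (le_trans h2)// ler_wpM2r// modulus_ge0.
have N0 : 0 < N.+2%:R^-1 :> R by rewrite invr_gt0.
have N12 : N.+2%:R^-1 <= 2^-1 :> R by rewrite lef_pV2 ?posrE// ler_nat.
rewrite /P in HN; have [e eE] : exists e : R, e = N.+2%:R^-1 by eexists.
rewrite -eE in HN N0 N12.
exists e => //; exists N%:R => // z zr z1.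
have mz : 0 < modulus z by lra.
have mz0 : (modulus z)%:C%C != 0.
  by rewrite -(rmorph0 (real_complex R)) (inj_eq (@complexI R)) gt_eqF.
pose w := z / (modulus z)%:C%C.
have w1 : modulus w = 1.
  by rewrite modulusM modulusV modulus_real ger0_norm ?modulus_ge0// divff// gt_eqF.
have := HN (to_plane w); rewrite to_planeK subr0 => /(_ w1 z) [||h1 h2] //.
  rewrite (_ : z - w = w * (modulus z - 1)%:C%C); last first.
    by rewrite /w rmorphB rmorph1 /=; field.
  by rewrite modulusM w1 mul1r modulus_real ler0_norm; lra.
split=> // t t1 tz; apply: h2 => //.
rewrite (_ : _ - z = (t - 1)%:C%C * z); last by rewrite rmorphB rmorph1 /=; ring.
rewrite modulusM modulus_real ger0_norm; last by lra.
have z2 : 2^-1 < modulus z by lra.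
nra.
Qed.

End ConformalMap.

(** * Lipschitz coefficients and integrals along a segment *)

Section JetExtras.
Context {R : realType}.
Local Notation C := R[i].

Lemma clin_jet (f : C -> C) (S0 : set C) (T : Type) (S : set T) (p : T -> C) :
  clin f S0 -> (forall t, S t -> S0 (p t)) ->
  jet S (fun _ => f) p (fun t => der f (p t)) (fun _ => 0).
Proof.
move=> [M [d [M0 d0 H]]] Sp; exists M, (Num.min d 1); split=> //.
- by rewrite lt_min d0 ltr01.
- by rewrite ge_min lexx orbT.
move=> t /Sp /H[h1 h2 h3]; split=> //; first by rewrite modulus0.
by move=> h; rewrite lt_min mul0r subr0 => /andP[/h3].
Qed.

Lemma clin_sub (f : C -> C) (S0 S1 : set C) : S1 `<=` S0 -> clin f S0 -> clin f S1.
Proof. by move=> S10 [M [d [M0 d0 H]]]; exists M, d; split=> // z /S10/H. Qed.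

(** Uniform second-order remainders force the derivatives to be Lipschitz:
compare the expansions at [p t] and at [p t'] on the points p t' + h, for h of
the size of p t' - p t and in the directions 1 and i, which separate the two
coefficients. *)
Lemma jet_deriv_lip (T : Type) (S : set T) (F : C -> C) (p a b : T -> C) :
  (forall t t', S t -> S t' -> p t = p t' -> t = t') ->
  jet S (fun _ => F) p a b -> exists2 L : R, 0 <= L & forall t t', S t -> S t' ->
    [/\ modulus (F (p t') - F (p t)) <= L * modulus (p t' - p t),
        modulus (a t' - a t) <= L * modulus (p t' - p t) &
        modulus (b t' - b t) <= L * modulus (p t' - p t)].
Proof.
move=> pinj /jet_lip[M [d [M0 d0 d1 H]]].
have di : 0 <= d^-1 by rewrite invr_ge0 ltW.
exists (12 * M + 3 * M + 4 * M / d); first by nonneg.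
move=> t t' St St'; have [H1 H2 H3 H4 H5] := H t St; have [H1' H2' H3' H4' H5'] := H t' St'.
set r := modulus (p t' - p t).
have r0 : 0 <= r by rewrite modulus_ge0.
have Mr0 : 0 <= M * r by nonneg.
have Mrd0 : 0 <= 4 * M / d * r by nonneg.
have [rd|rd] := leP (d / 2) r.
  have key (x y : C) : modulus x <= M -> modulus y <= M ->
      modulus (x - y) <= (12 * M + 3 * M + 4 * M / d) * r.
    move=> hx hy; apply: (le_trans (modulusB _ _)).
    have : 4 * M / d * (d / 2) <= 4 * M / d * r by rewrite ler_wpM2l//; nonneg.
    have -> : 4 * M / d * (d / 2) = 2 * M by field; rewrite gt_eqF.
    lra.
  by split; apply: key.
have F1 : modulus (F (p t') - F (p t)) <= (12 * M + 3 * M + 4 * M / d) * r.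
  have := H5 (p t' - p t); rewrite [p t + _]addrC subrK -/r => h.
  have rd' : r < d by lra.
  by have := h rd'; lra.
suff [A1 A2] : modulus (a t' - a t) <= (12 * M + 3 * M + 4 * M / d) * r /\
    modulus (b t' - b t) <= (12 * M + 3 * M + 4 * M / d) * r by [].
have [r00|rn0] := eqVneq r 0.
    have /(pinj _ _ St' St) -> : p t' = p t by apply/eqP; rewrite -subr_eq0 -modulus_eq0 -/r r00.
    by rewrite !subrr !modulus0; split; nonneg.
  have rp : 0 < r by rewrite lt_def rn0.
  have key (w : C) : modulus w = r ->
      modulus ((a t' - a t) * w + (b t' - b t) * conjc w) <= 6 * M * r ^+ 2.
    move=> wr; have h1 := H4' w; have h2 := H4 (p t' - p t); have h3 := H4 (p t' - p t + w).
    have wd : modulus (p t' - p t + w) <= 2 * r.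
      by have := modulusD (p t' - p t) w; rewrite -/r wr; lra.
    have h1' := h1 ltac:(lra); have h2' := h2 ltac:(rewrite -/r; lra).
    have h3' := h3 ltac:(lra).
    have : M * modulus (p t' - p t + w) ^+ 2 <= M * (2 * r) ^+ 2.
      by rewrite ler_wpM2l// lerXn2r ?nnegrE ?modulus_ge0//; nonneg.
    move: h1' h2' h3'; rewrite wr -/r [p t + (p t' - p t)]addrC subrK.
    rewrite [p t + (p t' - p t + w)]addrA [p t + (p t' - p t)]addrC subrK.
    set A1 := _ - _ - _ - _; set A2 := _ - _ - _ - _; set A3 := _ - _ - _ - _ => h1' h2' h3'.
    have -> : (a t' - a t) * w + (b t' - b t) * conjc w = A3 - A1 - A2.
      by rewrite /A1 /A2 /A3 conjcD; ring.
    have := modulusB (A3 - A1) A2; have := modulusB A3 A1; lra.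
  have mr : modulus (r%:C)%C = r by rewrite modulus_real ger0_norm.
  have mir : modulus ('i%C * (r%:C)%C) = r.
    by rewrite modulusM mr /modulus normc_def /= expr0n expr1n add0r sqrtr1 mul1r.
  have k1 := key _ mr; have k2 := key _ mir.
  move: k1 k2; set X := a t' - a t; set Y := b t' - b t.
  rewrite (_ : X * _ + _ = (X + Y) * (r%:C)%C); last by rewrite conjc_real; ring.
  rewrite (_ : X * _ + _ = (X - Y) * ('i%C * (r%:C)%C)); last first.
    rewrite conjcM conjc_real (_ : conjc 'i%C = - 'i%C); first by ring.
    by apply/eqP; rewrite eq_complex /= oppr0 !eqxx.
  rewrite (modulusM (X + Y)) mr (modulusM (X - Y)) mir.
  rewrite expr2 [6 * M * _]mulrA !ler_pM2r// => k1 k2.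
  have X2 : modulus X <= 6 * M * r.
    have := modulusD (X + Y) (X - Y); rewrite (_ : _ + _ = 2 * X); last by ring.
    by rewrite modulusM modulus_nat; lra.
  have Y2 : modulus Y <= 6 * M * r.
    have := modulusB (X + Y) (X - Y); rewrite (_ : _ - _ = 2 * Y); last by ring.
    by rewrite modulusM modulus_nat; lra.
  by split; lra.
Qed.

End JetExtras.

Section SegmentIntegral.
Context {R : realType}.
Local Notation C := R[i].
Local Notation mu := (@lebesgue_measure R).
Local Notation I01 := (`[0, 1]%classic : set R).
Implicit Types f g : R -> C.

Definition lip01 f := exists2 M : R, 0 <= M & forall s t, I01 s -> I01 t ->
  modulus (f t) <= M /\ modulus (f t - f s) <= M * `|t - s|.

Lemma lip01_cst (c : C) : lip01 (fun _ => c).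
Proof.
exists (modulus c); first exact: modulus_ge0.
by move=> s t _ _; split=> //; rewrite subrr modulus0; nonneg.
Qed.

Lemma lip01_real : lip01 (fun t => (t%:C)%C).
Proof.
exists 1 => // s t _; rewrite /= in_itv /= => /andP[t0 t1].
by rewrite modulus_real ger0_norm// -rmorphB modulus_real mul1r.
Qed.

Lemma lip01D f g : lip01 f -> lip01 g -> lip01 (fun t => f t + g t).
Proof.
move=> [M M0 Hf] [N N0 Hg]; exists (M + N); first by nonneg.
move=> s t s1 t1; have [h1 h2] := Hf _ _ s1 t1; have [h3 h4] := Hg _ _ s1 t1.
split; first by have := modulusD (f t) (g t); lra.
rewrite (_ : _ - _ = (f t - f s) + (g t - g s)); last by ring.
by have := modulusD (f t - f s) (g t - g s); lra.
Qed.

Lemma lip01M f g : lip01 f -> lip01 g -> lip01 (fun t => f t * g t).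
Proof.
move=> [M M0 Hf] [N N0 Hg]; exists (2 * (M * N)); first by nonneg.
have MN : 0 <= M * N by nonneg.
move=> s t s1 t1; have [h1 h2] := Hf _ _ s1 t1; have [h3 h4] := Hg _ _ s1 t1.
have [h5 _] := Hf _ _ t1 s1.
have ts := normr_ge0 (t - s).
split.
  rewrite modulusM.
  have : modulus (f t) * modulus (g t) <= M * N by rewrite ler_pM ?modulus_ge0.
  by lra.
rewrite (_ : _ - _ = (f t - f s) * g t + f s * (g t - g s)); last by ring.
have := modulusD ((f t - f s) * g t) (f s * (g t - g s)).
rewrite !modulusM.
have : modulus (f t - f s) * modulus (g t) <= M * `|t - s| * N by rewrite ler_pM ?modulus_ge0.
have : modulus (f s) * modulus (g t - g s) <= M * (N * `|t - s|) by rewrite ler_pM ?modulus_ge0.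
by lra.
Qed.

Lemma lip01N f : lip01 f -> lip01 (fun t => - f t).
Proof.
move=> [M M0 H]; exists M => // s t s1 t1; have [h1 h2] := H _ _ s1 t1.
by rewrite modulusN -opprD modulusN.
Qed.

Lemma lip01B f g : lip01 f -> lip01 g -> lip01 (fun t => f t - g t).
Proof. by move=> ? ?; apply: lip01D => //; exact: lip01N. Qed.

Lemma jet_lip01 (F : C -> C) (a b : R -> C) :
  jet I01 (fun _ => F) (fun t => (t%:C)%C) a b ->
  [/\ lip01 (fun t => F (t%:C)%C), lip01 a & lip01 b].
Proof.
move=> jF; have [L L0 HL] := jet_deriv_lip (fun t t' _ _ => @complexI R t t') jF.
have [M [d [M0 d0 d1 H]]] := jF.
have LM : 0 <= M + L by nonneg.
have key (f : R -> C) : (forall t, I01 t -> modulus (f t) <= M) ->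
    (forall t t', I01 t -> I01 t' -> modulus (f t' - f t) <= L * modulus ((t'%:C)%C - (t%:C)%C)) ->
    lip01 f.
  move=> h1 h2; exists (M + L) => // s t s1 t1; split; first by have := h1 _ t1; lra.
  have := h2 _ _ s1 t1; rewrite -rmorphB modulus_real.
  have : 0 <= M * `|t - s| by nonneg.
  by lra.
split; apply: key.
- by move=> t /H[].
- by move=> t t' h1 h2; have [] := HL _ _ h1 h2.
- by move=> t /H[].
- by move=> t t' h1 h2; have [] := HL _ _ h1 h2.
- by move=> t /H[].
- by move=> t t' h1 h2; have [] := HL _ _ h1 h2.
Qed.

Lemma lip01_cont f (g : C -> R) : (forall z w, `|g z - g w| <= modulus (z - w)) -> lip01 f ->
  {within I01, continuous (fun t => g (f t))}.
Proof.
move=> hg [M M0 H]; apply/subspace_continuousP => x x1; apply/cvgrPdist_lt => e e0.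
have M1 : 0 < M + 1 by lra.
have ed : 0 < e / (M + 1) by rewrite divr_gt0.
near=> y.
have y1 : I01 y by near: y; exact: withinT.
apply: (le_lt_trans (hg _ _)); apply: (@le_lt_trans _ _ ((M + 1) * `|x - y|)).
  have [_ h] := H _ _ y1 x1; apply: (le_trans h).
  by rewrite ler_wpM2r// lerDl.
rewrite mulrC -ltr_pdivlMr//.
near: y; apply: cvg_within; apply/nbhs_ballP; exists (e / (M + 1)) => //.
Unshelve. all: by end_near. Qed.

Lemma lip01_integrable f (g : C -> R) : (forall z w, `|g z - g w| <= modulus (z - w)) ->
  lip01 f -> mu.-integrable I01 (EFin \o (fun t => g (f t))).
Proof.
move=> hg hf; apply: continuous_compact_integrable; first exact: segment_compact.
exact: lip01_cont.
Qed.

Lemma Re_lip (z w : C) : `|complex.Re z - complex.Re w| <= modulus (z - w).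
Proof. by rewrite (_ : _ - _ = complex.Re (z - w)) ?modulus_Re//; case: z; case: w. Qed.
Lemma Im_lip (z w : C) : `|complex.Im z - complex.Im w| <= modulus (z - w).
Proof. by rewrite (_ : _ - _ = complex.Im (z - w)) ?modulus_Im//; case: z; case: w. Qed.

Definition cint f : C :=
  ((\int[mu]_(t in I01) complex.Re (f t)) +i* (\int[mu]_(t in I01) complex.Im (f t)))%C.

Lemma mI01 : measurable I01.
Proof. exact: measurable_itv. Qed.
Hint Resolve mI01 : core.

Lemma muI01 : mu I01 = 1%E.
Proof. by rewrite lebesgue_measure_itv /= lte_fin ltr01 oppr0 adde0. Qed.

Lemma cint_ext f g : (forall t, I01 t -> f t = g t) -> cint f = cint g.
Proof.
move=> fg; rewrite /cint; congr (_ +i* _)%C; apply: eq_Rintegral => t;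
by rewrite inE => /fg ->.
Qed.

Lemma integrableZlR (c : R) (f : R -> R) : mu.-integrable I01 (EFin \o f) ->
  mu.-integrable I01 (EFin \o (fun t => c * f t)).
Proof.
move=> h; rewrite (_ : EFin \o _ = (fun x => c%:E * (EFin \o f) x)%E); last exact/funext.
exact: integrableZl.
Qed.

Lemma cintD f g : lip01 f -> lip01 g -> cint (fun t => f t + g t) = cint f + cint g.
Proof.
move=> hf hg; apply/eqP; rewrite eq_complex; apply/andP; split; apply/eqP.
  rewrite [RHS]/= -RintegralD//; try exact: (lip01_integrable Re_lip).
  by apply: eq_Rintegral => t _; case: (f t); case: (g t).
rewrite [RHS]/= -RintegralD//; try exact: (lip01_integrable Im_lip).
by apply: eq_Rintegral => t _; case: (f t); case: (g t).
Qed.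

Lemma cintZ (c : C) f : lip01 f -> cint (fun t => c * f t) = c * cint f.
Proof.
move=> hf; case: c => x y; apply/eqP; rewrite eq_complex; apply/andP; split; apply/eqP.
  rewrite [RHS]/= -!RintegralZl//; try exact: (lip01_integrable Re_lip);
    try exact: (lip01_integrable Im_lip).
  rewrite -RintegralB//.
  - by apply: eq_Rintegral => t _; case: (f t).
  - by apply: integrableZlR; exact: (lip01_integrable Re_lip hf).
  - by apply: integrableZlR; exact: (lip01_integrable Im_lip hf).
rewrite [RHS]/= -!RintegralZl//; try exact: (lip01_integrable Re_lip);
    try exact: (lip01_integrable Im_lip).
rewrite -RintegralD//.
- by apply: eq_Rintegral => t _; case: (f t).
- by apply: integrableZlR; exact: (lip01_integrable Im_lip hf).
- by apply: integrableZlR; exact: (lip01_integrable Re_lip hf).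
Qed.

Lemma cintB f g : lip01 f -> lip01 g -> cint (fun t => f t - g t) = cint f - cint g.
Proof.
move=> hf hg; rewrite -mulN1r -cintZ// -cintD//.
  by congr cint; apply/funext => t; rewrite mulN1r.
by apply: lip01M => //; exact: lip01_cst.
Qed.

(** The factor 2 comes from bounding the real and imaginary parts separately. *)
Lemma cint_bound f (M : R) : lip01 f -> (forall t, I01 t -> modulus (f t) <= M) ->
  modulus (cint f) <= 2 * M.
Proof.
move=> hf hM; apply: (le_trans (modulus_le _)).
have key (g : C -> R) : (forall z w, `|g z - g w| <= modulus (z - w)) ->
    (forall z, `|g z| <= modulus z) -> `|\int[mu]_(t in I01) g (f t)| <= M.
  move=> hg hg'; have ig := lip01_integrable hg hf.
  apply: (le_trans (le_normr_Rintegral _ ig)) => //.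
  apply: (@le_trans _ _ (\int[mu]_(t in I01) M)).
    apply: le_Rintegral => //.
    - exact: (integrable_norm ig).
    - apply: continuous_compact_integrable; first exact: segment_compact.
      by apply: continuous_subspaceT => x; exact: cvg_cst.
    - by move=> x x1; rewrite (le_trans (hg' _))// hM.
  by rewrite Rintegral_cst// [X in fine X]muI01 /= mulr1.
by rewrite mulr_natl mulr2n; apply: lerD; rewrite [X in `|X|]/=;
  [exact: key Re_lip (@modulus_Re R)|exact: key Im_lip (@modulus_Im R)].
Qed.

Lemma cint_FTC (F : C -> C) (a b : R -> C) :
  jet I01 (fun _ => F) (fun t => (t%:C)%C) a b ->
  cint (fun t => a t + b t) = F 1 - F 0.
Proof.
move=> jF; have [lF la lb] := jet_lip01 jF; have lab := lip01D la lb.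
have key (g : C -> R) : (forall z w, `|g z - g w| <= modulus (z - w)) ->
    (forall z w, g (z - w) = g z - g w) -> (forall (r : R) z, g (z * (r%:C)%C) = g z * r) ->
    \int[mu]_(t in I01) g (a t + b t) = g (F 1) - g (F 0).
  move=> hg gB gZ; rewrite /Rintegral.
  have der (x : R) : x \in `]0, 1[ -> is_derive x (1 : R) (fun t => g (F (t%:C)%C)) (g (a x + b x)).
    rewrite in_itv /= => /andP[x0 x1].
    have [M [d [M0 d0 d1 H]]] := jF.
    have xI : I01 x by rewrite /= in_itv /= !ltW.
    have [_ _ _ H4] := H x xI.
    have cv : h^-1 *: ((g \o (fun t => F (t%:C)%C)) (h *: (1 : R) + x) - g (F (x%:C)%C))
        @[h --> 0^'] --> g (a x + b x).
      apply/cvgrPdist_le => e e0.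
      have M1 : 0 < M + 1 by lra.
      have ed : 0 < e / (M + 1) by rewrite divr_gt0.
      near=> h.
      have h0 : h != 0 by near: h; exact: nbhs_dnbhs_neq.
      have hd : `|h| < d by near: h; apply: dnbhs0_lt.
      have he : `|h| <= e / (M + 1) by near: h; apply: dnbhs0_le.
      rewrite ler_pdivlMr// in he.
      have := H4 (h%:C)%C; rewrite modulus_real conjc_real => /(_ hd).
      set rem := _ - _ - _ - _ => Hr.
      have -> : g (a x + b x) - h^-1 *: ((g \o (fun t => F (t%:C)%C)) (h *: (1 : R) + x)
          - g (F (x%:C)%C)) = - (h^-1 * g rem).
        rewrite /= scaler1 [h + x]addrC rmorphD /= /GRing.scale /=.
        have -> : rem = (F (x%:C + h%:C)%C - F (x%:C)%C) - (a x + b x) * (h%:C)%C.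
          by rewrite /rem; ring.
        by rewrite !gB gZ; field.
      rewrite normrN normrM normfV.
      have gr : `|g rem| <= M * `|h| ^+ 2.
        have g0 : g 0 = 0 by rewrite -(subrr 0) gB subrr.
        by apply: le_trans Hr; have := hg rem 0; rewrite g0 !subr0.
      have hp : 0 < `|h| by rewrite normr_gt0.
      rewrite mulrC ler_pdivrMr// (le_trans gr)// expr2 mulrA ler_wpM2r// .
      have := normr_ge0 h; nra.
    by apply: DeriveDef; [apply/cvg_ex; exists (g (a x + b x))|apply/cvg_lim].
  have cF : {within I01, continuous (fun t => g (F (t%:C)%C))} by exact: lip01_cont.
  rewrite (@continuous_FTC2 _ _ (fun t => g (F (t%:C)%C)))//=.
  - exact: lip01_cont.
  - have [_ c0 c1] := (continuous_within_itvP _ ltr01).1 cF.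
    by split=> // x /der[].
  - by move=> x /der[h1 h2]; rewrite derive1E.
rewrite /cint (key (@complex.Re R)) ?(key (@complex.Im R)).
- by case: (F 1); case: (F 0).
- exact: Im_lip.
- by case=> ? ? [].
- by move=> r [x y] /=; rewrite mulr0 add0r.
- exact: Re_lip.
- by case=> ? ? [].
- by move=> r [x y] /=; rewrite mulr0 subr0.
Unshelve. all: by end_near. Qed.

Lemma lip01_comp (f : C -> C) (S0 : set C) (g : R -> C) : clin f S0 -> lip01 g ->
  (forall t, I01 t -> S0 (g t)) -> lip01 (fun t => f (g t)).
Proof.
move=> [M [d [M0 d0 H]]] [N N0 Hg] gS.
have di : 0 <= d^-1 by rewrite invr_ge0 ltW.
have NN : 0 <= (M + M * d + 2 * M / d) * N by nonneg.
exists (M + (M + M * d + 2 * M / d) * N); first by nonneg.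
move=> s t sI tI; have [h1 _ _] := H _ (gS _ tI); split; first by lra.
have [h2 h3 h4] := H _ (gS _ sI); have [_ h5] := Hg _ _ sI tI.
set u := g t - g s in h5.
have u0 := modulus_ge0 u.
apply: (@le_trans _ _ ((M + M * d + 2 * M / d) * modulus u)).
  have Mu : 0 <= M * modulus u by nonneg.
  have Mdu : 0 <= M * d * modulus u by nonneg.
  have Mu2 : 0 <= 2 * M / d * modulus u by nonneg.
  have [du|ud] := leP d (modulus u).
    have : 2 * M / d * d <= 2 * M / d * modulus u by rewrite ler_wpM2l//; nonneg.
    rewrite divfK ?gt_eqF// => h6.
    by have := modulusB (f (g t)) (f (g s)); lra.
  have := h4 u ud; rewrite /u [g s + _]addrC subrK -/u => h6.
  have := modulusD (f (g t) - f (g s) - der f (g s) * u) (der f (g s) * u).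
  rewrite subrK modulusM.
  have : modulus (der f (g s)) * modulus u <= M * modulus u by rewrite ler_wpM2r.
  have : M * modulus u ^+ 2 <= M * (d * modulus u).
    by rewrite ler_wpM2l// expr2 ler_wpM2r// ltW.
  by lra.
have ts := normr_ge0 (t - s).
have : (M + M * d + 2 * M / d) * modulus u <= (M + M * d + 2 * M / d) * (N * `|t - s|).
  by rewrite ler_wpM2l//; nonneg.
have : 0 <= M * `|t - s| by nonneg.
by rewrite mulrA; lra.
Qed.

Lemma lip01_conj f : lip01 f -> lip01 (fun t => conjc (f t)).
Proof.
move=> [M M0 H]; exists M => // s t s1 t1; have [h1 h2] := H _ _ s1 t1.
by rewrite -conjcB !modulus_conj.
Qed.

(** Differentiation under the integral sign costs nothing, since the
remainders are uniform in the variable of integration. *)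
Lemma cint_jet (T : Type) (S : set T) (F : R -> C -> C) (p : T -> C) (a b : R * T -> C) :
  (exists2 e : R, 0 < e & forall t h, S t -> modulus h < e -> lip01 (fun s => F s (p t + h))) ->
  (forall t, S t -> lip01 (fun s => a (s, t))) -> (forall t, S t -> lip01 (fun s => b (s, t))) ->
  jet [set u : R * T | I01 u.1 /\ S u.2] (fun u => F u.1) (fun u => p u.2) a b ->
  jet S (fun t z => cint (fun s => F s z)) p
    (fun t => cint (fun s => a (s, t))) (fun t => cint (fun s => b (s, t))).
Proof.
move=> [e e0 lF] la lb [M [d [M0 d0 d1 H]]]; exists (2 * M), (Num.min d e); split=> //.
- by nonneg.
- by rewrite lt_min d0.
- by rewrite ge_min d1.
move=> t St; have lF0 : lip01 (fun s => F s (p t)).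
  by rewrite -[p t]addr0; apply: lF => //; rewrite modulus0.
split.
- by apply: cint_bound => // s sI; have [] := H (s, t) (conj sI St).
- by apply: cint_bound => //; [exact: la|move=> s sI; have [] := H (s, t) (conj sI St)].
- by apply: cint_bound => //; [exact: lb|move=> s sI; have [] := H (s, t) (conj sI St)].
- move=> h; rewrite lt_min => /andP[hd he]; rewrite [_ * h]mulrC [_ * conjc h]mulrC.
  have la' := la t St; have lb' := lb t St; have lFh := lF t h St he.
  have l1 : lip01 (fun s => h * a (s, t)) by apply: lip01M => //; exact: lip01_cst.
  have l2 : lip01 (fun s => conjc h * b (s, t)) by apply: lip01M => //; exact: lip01_cst.
  rewrite -(cintZ _ la') -(cintZ _ lb') -cintB// -cintB; [|exact: lip01B|by []].
  rewrite -cintB; [|by do 2 apply: lip01B => //|by []].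
  rewrite -mulrA; apply: cint_bound; first by do 3 apply: lip01B => //.
  move=> s sI; have [_ _ _] := H (s, t) (conj sI St).
  by rewrite /= [h * _]mulrC [conjc h * _]mulrC; apply.
Qed.

End SegmentIntegral.

(** * Two Bessel series *)

Section EntireSeries.
Context {R : realType}.
Local Notation C := R[i].
Implicit Types a : nat -> C.

Definition entire a := forall r : R, 0 < r -> adm r a.

Lemma entire_diff a : entire a -> entire (cdiff a).
Proof. by move=> ha r r0; apply: (@adm_diff _ (r + 1)) => //; [lra|apply: ha; lra]. Qed.

Lemma entire_clin a (B : R) : entire a -> clin (psum a) [set z | modulus z <= B].
Proof.
move=> ha.
pose rho := Num.max B 0 + 1.
have rho0 : 0 < rho by rewrite /rho ltr_wpDl// le_max lexx orbT.
have Br : B + 1 <= rho by rewrite lerD2r le_max lexx.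
have rr : rho < rho + 1 by lra.
have hr := ha (rho + 1) (addr_gt0 rho0 ltr01).
have hd := entire_diff ha (addr_gt0 rho0 ltr01).
have [M M0 HM] := psum_remainder hr rho0 rr.
have [M1 HM1] := psum_bound hr rr.
have [M2 HM2] := psum_bound hd rr.
have M10 : 0 <= M1 by rewrite (le_trans _ (HM1 0 _)) ?modulus_ge0// modulus0 ltW.
have M20 : 0 <= M2 by rewrite (le_trans _ (HM2 0 _)) ?modulus_ge0// modulus0 ltW.
have hder z h : modulus z <= B -> modulus h < 1 ->
    modulus (psum a (z + h) - psum a z - psum (cdiff a) z * h) <= M * modulus h ^+ 2.
  by move=> zB h1; apply: HM; [|have := modulusD z h]; lra.
exists (M + M1 + M2), 1; split=> //; first by nonneg.
move=> z /= zB; have derz : der (psum a) z = psum (cdiff a) z.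
  by apply: derE; exists M, 1; split=> // h h1; exact: hder.
split.
- by have := HM1 z ltac:(lra); lra.
- by rewrite derz; have := HM2 z ltac:(lra); lra.
- move=> h h1; rewrite derz; apply: (le_trans (hder _ _ zB h1)).
  by rewrite ler_wpM2r ?exprn_ge0 ?modulus_ge0//; lra.
Qed.

Lemma entire_hasder a z : entire a -> hasder (psum a) z (der (psum a) z).
Proof.
move=> ha; have [M [d [M0 d0 H]]] := entire_clin (modulus z) ha.
by have [_ _ h] := H z (lexx _); exists M, d.
Qed.

Lemma entire_der a z : entire a -> der (psum a) z = psum (cdiff a) z.
Proof.
move=> ha; apply: derE.
pose rho := modulus z + 1.
have rho0 : 0 < rho by rewrite /rho ltr_wpDl ?modulus_ge0.
have rr : rho < rho + 1 by lra.
have [M M0 HM] := psum_remainder (ha (rho + 1) (addr_gt0 rho0 ltr01)) rho0 rr.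
exists M, 1; split=> // h h1; apply: HM; rewrite /rho; first lra.
by have := modulusD z h; lra.
Qed.

Lemma entire_psumP a z : entire a -> csumto (fun n => a n * z ^+ n) (psum a z).
Proof.
move=> ha; apply: (@psumP _ (modulus z + 1)); last by rewrite ltrDl.
by apply: ha; rewrite ltr_wpDl ?modulus_ge0.
Qed.

Lemma psum_at0 a : entire a -> psum a 0 = a 0%N.
Proof.
move=> ha; rewrite (psum_shift1 (ha 1 ltr01)) ?modulus0//.
by rewrite mul0r addr0.
Qed.

(** The coefficients of a Bessel function E of order zero in the variable
s = |x|^2: for c = -k^2/4, E ((w - w0) (conj w - conj w0)), as a function of the
independent variables w and conj w, is the Riemann function of Delta + k^2. *)
Definition ecoef (c : R) : nat -> C := fun n => ((c ^+ n / (n`!)%:R ^+ 2)%:C)%C.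
(** The coefficients of the function G with (s G)' = E, which also
satisfies E' = c G. *)
Definition gcoef (c : R) : nat -> C := fun n => ((c ^+ n / (n`!%:R * (n.+1)`!%:R))%:C)%C.

Lemma exp_term_bounded (x : R) : 0 <= x ->
  exists2 M : R, 0 <= M & forall n, x ^+ n / n`!%:R <= M.
Proof.
move=> x0.
have cv := cvg_series_cvg_0 (is_cvg_series_exp_coeff x).
have [M [Mr HM]] := cvg_seq_bounded (cvgP _ cv).
exists (`|M| + 1); first by rewrite addr_ge0.
move=> n; have := HM (`|M| + 1); rewrite (_ : M < _); last first.
  by rewrite (le_lt_trans (ler_norm _))// ltrDl.
move=> /(_ isT n I) /=; rewrite /exp_coeff /= => h.
by rewrite (le_trans (ler_norm _)).
Qed.

Lemma entire_exp_bound a (K x : R) : 0 <= x -> 0 <= K ->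
  (forall n, modulus (a n) <= K * (x ^+ n / n`!%:R)) -> entire a.
Proof.
move=> x0 K0 h r r0; have [M M0 HM] := exp_term_bounded (mulr_ge0 x0 (ltW r0)).
exists (K * M) => n; apply: (@le_trans _ _ (K * (x ^+ n / n`!%:R) * r ^+ n)).
  by rewrite ler_wpM2r ?exprn_ge0// ltW.
rewrite (_ : _ * _ = K * ((x * r) ^+ n / n`!%:R)); last by rewrite exprMn; ring.
by rewrite ler_wpM2l.
Qed.

Lemma fact_gt0R n : 0 < n`!%:R :> R.
Proof. by rewrite ltr0n fact_gt0. Qed.

Lemma inv_fact_le1 n : n`!%:R^-1 <= 1 :> R.
Proof. by rewrite invf_le1 ?fact_gt0R// ler1n fact_gt0. Qed.

Lemma entire_ecoef c : entire (ecoef c).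
Proof.
apply: (@entire_exp_bound _ 1 `|c|) => // n.
rewrite /ecoef modulus_real normrM normrX mul1r ler_wpM2l ?exprn_ge0//.
rewrite ger0_norm ?invr_ge0 ?exprn_ge0// expr2 invfM ler_piMr ?invr_ge0//.
exact: inv_fact_le1.
Qed.

Lemma entire_gcoef c : entire (gcoef c).
Proof.
apply: (@entire_exp_bound _ 1 `|c|) => // n.
rewrite /gcoef modulus_real normrM normrX mul1r ler_wpM2l ?exprn_ge0//.
rewrite ger0_norm ?invr_ge0 ?mulr_ge0// invfM ler_piMr ?invr_ge0//.
exact: inv_fact_le1.
Qed.

Lemma psumZ (c : C) a z : entire a -> psum (fun n => c * a n) z = c * psum a z.
Proof.
move=> ha; apply: psum_unique.
have h0 : csumto (fun _ => 0 : C) 0.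
  by move=> e e0; exists 0%N => n _; rewrite big1// subrr modulus0.
have := csumto_lin c h0 (entire_psumP z ha); rewrite add0r.
by apply: csumto_eq => n; ring.
Qed.

Variable c : R.
Let E := psum (ecoef c).
Let G := psum (gcoef c).

Lemma E0 : E 0 = 1.
Proof. by rewrite /E psum_at0; [rewrite /ecoef expr0 fact0 expr1n divr1|exact: entire_ecoef]. Qed.

Lemma derE_G z : der E z = (c%:C)%C * G z.
Proof.
have dE : cdiff (ecoef c) = (fun n => (c%:C)%C * gcoef c n).
  apply/funext => n; rewrite /cdiff /ecoef /gcoef -(rmorph_nat (real_complex R)).
  rewrite -!rmorphM; congr (_%:C)%C.
  rewrite factS natrM exprS; field.
  by rewrite !gt_eqF ?fact_gt0R//= nat1r pnatr_eq0.
by rewrite /E entire_der ?dE ?psumZ//; [exact: entire_gcoef|exact: entire_ecoef].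
Qed.

Lemma E_G z : E z = G z + z * der G z.
Proof.
have hG := entire_gcoef c; have hE := entire_ecoef c.
rewrite /G entire_der//; apply: psum_unique.
have h := csumto_shift (entire_psumP z (entire_diff hG)).
apply: (csumto_eq _ (csumto_lin z (entire_psumP z hG) h)) => -[|n].
  by rewrite mulr0 addr0 /ecoef /gcoef fact0 (_ : 1`! = 1%N)// expr2.
have -> : ecoef c n.+1 = n.+2%:R * gcoef c n.+1.
  rewrite /ecoef /gcoef -(rmorph_nat (real_complex R)) -rmorphM; congr (_%:C)%C.
  rewrite (factS n.+1) natrM; field.
  by rewrite gt_eqF ?fact_gt0R//= (_ : _ + _ = n.+2%:R) ?pnatr_eq0// -[n.+2]addn2 natrD addrC.
by rewrite /cdiff exprS -[n.+2%:R]natr1; ring.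
Qed.

End EntireSeries.

(** * The reflection in the circle and the kernels *)

Section Kernels.
Context {R : realType}.
Local Notation C := R[i].
Local Notation I01 := (`[0, 1]%classic : set R).
Variables (phi : C -> C) (rho : R).
Hypothesis rho1 : 1 < rho.
Let disc := [set z : C | modulus z <= rho].
Hypothesis phi0 : clin phi disc.
Hypothesis phi1 : clin (der phi) disc.
Hypothesis phi2 : clin (der (der phi)) disc.

Definition annulus (r : R) := [set z : C | r^-1 <= modulus z /\ modulus z <= r].

(** The holomorphic function that coincides with conj phi on the circle, that
is, the Schwarz function of the boundary read in the disc. *)
Definition sig (z : C) : C := conjc (phi (conjc z)^-1).
Definition dsig (z : C) : C := conjc (der phi (conjc z)^-1) * - z ^- 2.

Lemma rho_gt0 : 0 < rho.
Proof. by rewrite (lt_trans ltr01). Qed.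

Lemma rhoV : 0 < rho^-1.
Proof. by rewrite invr_gt0 rho_gt0. Qed.

Lemma annulus_disc z : annulus rho z -> disc z.
Proof. by case. Qed.

Lemma annulus_refl z : annulus rho z -> annulus rho (conjc z)^-1.
Proof.
move=> [h1 h2]; have z0 : 0 < modulus z by rewrite (lt_le_trans rhoV).
rewrite /annulus /= modulusV modulus_conj; split.
  by rewrite lef_pV2 ?posrE ?rho_gt0.
by rewrite -[leRHS]invrK lef_pV2 ?posrE ?rhoV.
Qed.

Lemma annulus_refl_disc z : annulus rho z -> disc (conjc z)^-1.
Proof. by move/annulus_refl/annulus_disc. Qed.

Section JetPieces.
Variables (T : Type) (S : set T) (p : T -> C).

Lemma jet_phi F a b : jet S F p a b -> (forall t, S t -> annulus rho (F t (p t))) ->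
  jet S (fun t z => phi (F t z)) p (fun t => der phi (F t (p t)) * a t)
                                   (fun t => der phi (F t (p t)) * b t).
Proof.
move=> jF FA.
have := jet_comp jF (clin_jet phi0 (p := fun t => F t (p t)) (fun t St => annulus_disc (FA t St))).
apply: jet_ext; first by exists 1.
  by move=> t _; rewrite mul0r addr0.
by move=> t _; rewrite mul0r addr0.
Qed.

Lemma jet_dphi F a b : jet S F p a b -> (forall t, S t -> annulus rho (F t (p t))) ->
  jet S (fun t z => der phi (F t z)) p (fun t => der (der phi) (F t (p t)) * a t)
                                   (fun t => der (der phi) (F t (p t)) * b t).
Proof.
move=> jF FA.
have := jet_comp jF (clin_jet phi1 (p := fun t => F t (p t)) (fun t St => annulus_disc (FA t St))).
apply: jet_ext; first by exists 1.
  by move=> t _; rewrite mul0r addr0.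
by move=> t _; rewrite mul0r addr0.
Qed.

Lemma jet_invF F a b (m : R) : 0 < m -> jet S F p a b ->
  (forall t, S t -> m <= modulus (F t (p t))) ->
  jet S (fun t z => (F t z)^-1) p (fun t => - (F t (p t)) ^- 2 * a t)
                                   (fun t => - (F t (p t)) ^- 2 * b t).
Proof.
move=> m0 jF FA.
have := jet_comp jF (jet_inv (p := fun t => F t (p t)) (ex_intro2 _ _ m m0 FA)).
apply: jet_ext; first by exists 1.
  by move=> t _; rewrite mul0r addr0.
by move=> t _; rewrite mul0r addr0.
Qed.

Lemma jet_sig F a b : jet S F p a b -> (forall t, S t -> annulus rho (F t (p t))) ->
  jet S (fun t z => sig (F t z)) p (fun t => dsig (F t (p t)) * a t)
                                   (fun t => dsig (F t (p t)) * b t).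
Proof.
move=> jF FA.
have j1 := jet_invF rhoV (jet_conj jF) (fun t St =>
  eq_ind _ (fun x => is_true (rho^-1 <= x)) (FA t St).1 _ (esym (modulus_conj _))).
have := jet_conj (jet_phi j1 (fun t St => annulus_refl (FA t St))).
apply: jet_ext; first by exists 1.
  by move=> t _; rewrite /dsig !conjcM conjcN conjcV conjcX !conjcK; ring.
by move=> t _; rewrite /dsig !conjcM conjcN conjcV conjcX !conjcK; ring.
Qed.

End JetPieces.

(** [K a b zeta] is holomorphic in each variable, in the only sense that is
needed: expansions may be substituted for its arguments, and its values along a
Lipschitz path can be integrated. *)
Definition kernel_jet (K Ka Kb Kz : C -> C -> C -> C) : Prop :=
  (forall (T : Type) (S : set T) (p : T -> C) (al be ze : T -> C -> C)
     (a1 b1 a2 b2 a3 b3 : T -> C),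
    jet S al p a1 b1 -> jet S be p a2 b2 -> jet S ze p a3 b3 ->
    (forall t, S t -> annulus rho (ze t (p t))) ->
    jet S (fun t z => K (al t z) (be t z) (ze t z)) p
      (fun t => Ka (al t (p t)) (be t (p t)) (ze t (p t)) * a1 t +
                Kb (al t (p t)) (be t (p t)) (ze t (p t)) * a2 t +
                Kz (al t (p t)) (be t (p t)) (ze t (p t)) * a3 t)
      (fun t => Ka (al t (p t)) (be t (p t)) (ze t (p t)) * b1 t +
                Kb (al t (p t)) (be t (p t)) (ze t (p t)) * b2 t +
                Kz (al t (p t)) (be t (p t)) (ze t (p t)) * b3 t)) /\
  (forall a b (ze : R -> C), lip01 ze -> (forall t, I01 t -> annulus rho (ze t)) ->
    [/\ lip01 (fun t => K a b (ze t)), lip01 (fun t => Ka a b (ze t)),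
        lip01 (fun t => Kb a b (ze t)) & lip01 (fun t => Kz a b (ze t))]).

(** A function of the product of the two differences, as the Riemann function
is, with the factor phi' of the change of variable. *)
Definition kH (H : C -> C) a b z := H ((a - phi z) * (b - sig z)) * der phi z.
Definition kHa (H : C -> C) a b z := der H ((a - phi z) * (b - sig z)) * (b - sig z) * der phi z.
Definition kHb (H : C -> C) a b z := der H ((a - phi z) * (b - sig z)) * (a - phi z) * der phi z.
Definition kHz (H : C -> C) a b z :=
  - der H ((a - phi z) * (b - sig z)) * (der phi z * (b - sig z) + (a - phi z) * dsig z) * der phi z
  + H ((a - phi z) * (b - sig z)) * der (der phi) z.

Lemma lip_phi (ze : R -> C) : lip01 ze -> (forall t, I01 t -> annulus rho (ze t)) ->
  [/\ lip01 (fun t => phi (ze t)), lip01 (fun t => der phi (ze t)),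
      lip01 (fun t => der (der phi) (ze t)), lip01 (fun t => sig (ze t)) &
      lip01 (fun t => dsig (ze t))].
Proof.
move=> lz zA.
have inv_clin : clin (fun z : C => z^-1) (annulus rho).
  have [|M [d [M0 d0 d1 H]]] := @jet_inv R C (annulus rho) id.
    by exists rho^-1; [exact: rhoV|move=> t []].
  exists M, d; split=> // z zA'; have [h1 h2 h3 h4] := H z zA'.
  have dE : der (fun z : C => z^-1) z = - z ^- 2.
    by apply: derE; exists M, d; split=> // h /h4; rewrite mul0r subr0.
  by rewrite dE; split=> // h /h4; rewrite mul0r subr0.
have zA2 t : I01 t -> annulus rho (conjc (ze t)).
  by move=> /zA; rewrite /annulus /= modulus_conj.
have l1 : lip01 (fun t => (conjc (ze t))^-1).
  by apply: (lip01_comp inv_clin) => //; exact: lip01_conj.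
have A1 t : I01 t -> disc (conjc (ze t))^-1 by move/zA/annulus_refl_disc.
have A0 t : I01 t -> disc (ze t) by move/zA/annulus_disc.
split.
- exact: (lip01_comp phi0).
- exact: (lip01_comp phi1).
- exact: (lip01_comp phi2).
- by apply: lip01_conj; apply: (lip01_comp phi0).
- have l2 : lip01 (fun t => (ze t)^-1) by apply: (lip01_comp inv_clin).
  rewrite (_ : (fun t => _) = (fun t => conjc (der phi (conjc (ze t))^-1) *
     - ((ze t)^-1 * (ze t)^-1))); last by apply/funext => t; rewrite /dsig -expr2 exprVn.
  apply: lip01M; first by apply: lip01_conj; apply: (lip01_comp phi1).
  by apply: lip01N; exact: lip01M.
Qed.

Lemma lip_bounded (f : R -> C) : lip01 f -> exists M : R, forall t, I01 t -> modulus (f t) <= M.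
Proof. by move=> [M M0 H]; exists M => t tI; have [] := H t t tI tI. Qed.

Lemma kH_jet H : (forall B : R, clin H [set z | modulus z <= B]) ->
  (forall B : R, clin (der H) [set z | modulus z <= B]) ->
  kernel_jet (kH H) (kHa H) (kHb H) (kHz H).
Proof.
move=> H0 H1; split.
  move=> T S p al be ze a1 b1 a2 b2 a3 b3 j1 j2 j3 A.
  have jp := jet_phi j3 A; have js := jet_sig j3 A; have jd := jet_dphi j3 A.
  have jD := jet_mul (jet_sub j1 jp) (jet_sub j2 js).
  have [M [d [M0 d0 d1 HM]]] := jD.
  have jH := jet_comp jD (clin_jet (H0 M) (p := fun t => (al t (p t) - phi (ze t (p t))) *
     (be t (p t) - sig (ze t (p t)))) (fun t St => let: And4 x _ _ _ := HM t St in x)).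
  have := jet_mul jH jd; apply: jet_ext; first by exists 1.
    by move=> t _; rewrite /kHa /kHb /kHz /=; ring.
  by move=> t _; rewrite /kHa /kHb /kHz /=; ring.
move=> a b ze lz zA; have [l1 l2 l3 l4 l5] := lip_phi lz zA.
have lD : lip01 (fun t => a - phi (ze t)) by apply: lip01B => //; exact: lip01_cst.
have lB : lip01 (fun t => b - sig (ze t)) by apply: lip01B => //; exact: lip01_cst.
have ls := lip01M lD lB; have [M HM] := lip_bounded ls.
have lH : lip01 (fun t => H ((a - phi (ze t)) * (b - sig (ze t)))).
  by apply: (lip01_comp (H0 M) ls).
have ldH : lip01 (fun t => der H ((a - phi (ze t)) * (b - sig (ze t)))).
  by apply: (lip01_comp (H1 M) ls).
rewrite /kH /kHa /kHb /kHz; split.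
- exact: lip01M.
- by apply: lip01M => //; exact: lip01M.
- by apply: lip01M => //; exact: lip01M.
- apply: lip01D; last exact: lip01M.
  apply: lip01M => //; apply: lip01M; first exact: lip01N.
  by apply: lip01D; exact: lip01M.
Qed.

Lemma kernel_mulB K Ka Kb Kz : kernel_jet K Ka Kb Kz ->
  kernel_jet (fun a b z => (b - sig z) * K a b z) (fun a b z => (b - sig z) * Ka a b z)
    (fun a b z => K a b z + (b - sig z) * Kb a b z)
    (fun a b z => - dsig z * K a b z + (b - sig z) * Kz a b z).
Proof.
move=> [HJ HL]; split.
  move=> T S p al be ze a1 b1 a2 b2 a3 b3 j1 j2 j3 A.
  have jK := HJ _ _ _ _ _ _ _ _ _ _ _ _ j1 j2 j3 A.
  have := jet_mul (jet_sub j2 (jet_sig j3 A)) jK; apply: jet_ext; first by exists 1.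
    by move=> t _ /=; ring.
  by move=> t _ /=; ring.
move=> a b ze lz zA; have [l1 l2 l3 l4 l5] := lip_phi lz zA.
have [k1 k2 k3 k4] := HL a b ze lz zA.
have lB : lip01 (fun t => b - sig (ze t)) by apply: lip01B => //; exact: lip01_cst.
split.
- exact: lip01M.
- exact: lip01M.
- by apply: lip01D => //; exact: lip01M.
- by apply: lip01D; apply: lip01M => //; exact: lip01N.
Qed.

(** From the mirror image of [z] in the circle, at t = 0, to [z]. *)
Definition seg (t z : C) : C := (1 - t) * (conjc z)^-1 + t * z.

Lemma segE (t : R) z : z != 0 -> I01 t ->
  exists2 u : R, seg (t%:C)%C z = (u%:C)%C * z & u * modulus z = (1 - t) / modulus z + t * modulus z.
Proof.
move=> z0 _; exists ((1 - t) / modulus z ^+ 2 + t).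
  have mz : ((modulus z ^+ 2)%:C)%C = z * conjc z.
    by rewrite rmorphXn /= modulusE sqr_normc.
  rewrite rmorphD rmorphM fmorphV /= mz rmorphB rmorph1 /seg.
  have c0 : conjc z != 0 by rewrite conjc_eq0.
  by field; rewrite z0 c0.
by field; rewrite gt_eqF ?modulus_gt0.
Qed.

Lemma seg_annulus (t : R) z : I01 t -> annulus rho z -> annulus rho (seg (t%:C)%C z).
Proof.
move=> tI zA; have [h1 h2] := zA; have z0 : 0 < modulus z by rewrite (lt_le_trans rhoV).
have zn0 : z != 0 by rewrite -modulus_gt0.
have [u -> uE] := segE zn0 tI.
have [h3 h4] := annulus_refl zA; move: h3 h4; rewrite modulusV modulus_conj => h3 h4.
move: tI; rewrite /= in_itv /= => /andP[t0 t1].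
have up : 0 <= u * modulus z.
  by rewrite uE addr_ge0// mulr_ge0 ?subr_ge0// ?invr_ge0// ltW.
have u0 : 0 <= u by rewrite -(pmulr_lge0 _ z0).
rewrite /annulus /= modulusM modulus_real ger0_norm// uE.
have t1' : 0 <= 1 - t by rewrite subr_ge0.
split.
  have := ler_wpM2l t1' h3; have := ler_wpM2l t0 h1; lra.
have := ler_wpM2l t1' h4; have := ler_wpM2l t0 h2; lra.
Qed.

Lemma seg_jet_t z :
  jet I01 (fun _ t => seg t z) (fun t => (t%:C)%C) (fun _ => z - (conjc z)^-1) (fun _ => 0).
Proof.
have jid : jet I01 (fun _ z => z) (fun t : R => (t%:C)%C) (fun _ => 1) (fun _ => 0).
  apply: jet_id; exists 1 => t; rewrite /= in_itv /= => /andP[t0 t1].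
  by rewrite modulus_real ger0_norm.
have jc (c : C) : jet I01 (fun _ _ => c) (fun t : R => (t%:C)%C) (fun _ => 0) (fun _ => 0).
  by apply: (jet_cst _ (c := fun _ => c)); exists (modulus c).
have := jet_add (jet_mul (jet_sub (jc 1) jid) (jc (conjc z)^-1)) (jet_mul jid (jc z)).
apply: jet_ext; first by exists 1.
  by move=> t _ /=; ring.
by move=> t _ /=; ring.
Qed.

End Kernels.

(** * Integrals from the mirror image of a point to the point *)

Section SegmentPotential.
Context {R : realType}.
Local Notation C := R[i].
Local Notation I01 := (`[0, 1]%classic : set R).
Variables (phi : C -> C) (rho : R).
Hypothesis rho1 : 1 < rho.
Let disc := [set z : C | modulus z <= rho].
Hypothesis phi0 : clin phi disc.
Hypothesis phi1 : clin (der phi) disc.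
Hypothesis phi2 : clin (der (der phi)) disc.

Definition pathval (K : C -> C -> C -> C) (z : C) (t : R) : C :=
  K (phi z) (conjc (phi z)) (seg (t%:C)%C z).

(** The integral of [K (phi z) (conj (phi z))] over the path [seg]. *)
Definition segint (K : C -> C -> C -> C) (z : C) : C :=
  (z - (conjc z)^-1) * cint (pathval K z).

Lemma annulus_sub (r : R) z : 1 < r -> r <= rho -> annulus r z -> annulus rho z.
Proof.
move=> r1 rr [h1 h2]; split; last exact: le_trans rr.
by rewrite (le_trans _ h1)// lef_pV2 ?posrE//; rewrite (lt_trans ltr01)// (lt_le_trans r1).
Qed.

Lemma pathval_lip K Ka Kb Kz z : kernel_jet rho K Ka Kb Kz -> annulus rho z ->
  [/\ lip01 (pathval K z), lip01 (pathval Ka z), lip01 (pathval Kb z) & lip01 (pathval Kz z)].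
Proof.
move=> [_ HL] zA; have [lz _ _] := jet_lip01 (seg_jet_t z).
by apply: HL => // t tI; apply: seg_annulus.
Qed.

(** The fundamental theorem of calculus for K, and for t K: the second
identity absorbs the derivative of the path with respect to its endpoints. *)
Lemma pathval_FTC K Ka Kb Kz z : kernel_jet rho K Ka Kb Kz -> annulus rho z ->
  let d := z - (conjc z)^-1 in
  d * cint (pathval Kz z) = K (phi z) (conjc (phi z)) z - K (phi z) (conjc (phi z)) (conjc z)^-1
  /\ cint (pathval K z) + d * cint (fun t => (t%:C)%C * pathval Kz z t) =
     K (phi z) (conjc (phi z)) z.
Proof.
move=> KJ zA d; have [l1 l2 l3 l4] := pathval_lip KJ zA.
have [HJ _] := KJ.
have jz := seg_jet_t z.
have jc (c : C) : jet I01 (fun _ _ => c) (fun t : R => (t%:C)%C) (fun _ => 0) (fun _ => 0).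
  by apply: (jet_cst _ (c := fun _ => c)); exists (modulus c).
have jK := HJ _ _ _ _ _ _ _ _ _ _ _ _ (jc (phi z)) (jc (conjc (phi z))) jz
  (fun t tI => seg_annulus rho1 tI zA).
have jid : jet I01 (fun _ z => z) (fun t : R => (t%:C)%C) (fun _ => 1) (fun _ => 0).
  apply: jet_id; exists 1 => t; rewrite /= in_itv /= => /andP[t0 t1].
  by rewrite modulus_real ger0_norm.
have seg0 : seg 0 z = (conjc z)^-1 by rewrite /seg; ring.
have seg1 : seg 1 z = z by rewrite /seg; ring.
split.
  rewrite -cintZ//.
  have := cint_FTC jK; rewrite seg0 seg1 => <-.
  by apply: cint_ext => t _; rewrite /pathval /d; ring.
have ltK : lip01 (fun t => (t%:C)%C * pathval Kz z t) by apply: lip01M => //; exact: lip01_real.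
rewrite -cintZ// -cintD//; last by apply: lip01M => //; exact: lip01_cst.
have := cint_FTC (jet_mul jid jK); rewrite seg1 mul1r mul0r subr0 => <-.
by apply: cint_ext => t _; rewrite /pathval /d; ring.
Qed.

Lemma annulus_near (r : R) : 1 < r -> r < rho -> exists2 e : R, 0 < e &
  forall z h, annulus r z -> modulus h < e -> annulus rho (z + h).
Proof.
move=> r1 rr; have r0 : 0 < r by rewrite (lt_trans ltr01).
have rV : rho^-1 < r^-1 by rewrite ltf_pV2 ?posrE// (lt_trans r0).
exists (Num.min (rho - r) (r^-1 - rho^-1)); first by rewrite lt_min !subr_gt0 rr.
move=> z h [h1 h2]; rewrite lt_min => /andP[hh1 hh2]; split.
  by have := ler_modB z (- h); rewrite modulusN opprK; lra.
by have := modulusD z h; lra.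
Qed.

(** Each endpoint contributes the value of the kernel there, and the
parameters a = phi z, b = conj (phi z) contribute the derivatives of the
integrand. *)
Lemma segint_jet K Ka Kb Kz (r : R) : kernel_jet rho K Ka Kb Kz -> 1 < r -> r < rho ->
  jet (annulus r) (fun _ => segint K) id
    (fun z => K (phi z) (conjc (phi z)) z +
              (z - (conjc z)^-1) * (der phi z * cint (pathval Ka z)))
    (fun z => (conjc z) ^- 2 * K (phi z) (conjc (phi z)) (conjc z)^-1 +
              (z - (conjc z)^-1) * (conjc (der phi z) * cint (pathval Kb z))).
Proof.
move=> KJ r1 rr; have [HJ _] := KJ.
have Arr z : annulus r z -> annulus rho z by apply: annulus_sub => //; exact: ltW.
have rV : 0 < r^-1 by rewrite invr_gt0 (lt_trans ltr01).
pose SS := [set u : R * C | I01 u.1 /\ annulus r u.2].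
have jid (T : Type) (S : set T) (p : T -> C) : (forall t, S t -> annulus r (p t)) ->
    jet S (fun _ z => z) p (fun _ => 1) (fun _ => 0).
  by move=> pA; apply: jet_id; exists r => t /pA[].
have jinv (T : Type) (S : set T) (p : T -> C) : (forall t, S t -> annulus r (p t)) ->
    jet S (fun _ z => (conjc z)^-1) p (fun _ => 0) (fun t => - (conjc (p t)) ^- 2).
  move=> pA; have := jet_invF rV (jet_conj (jid _ _ _ pA)).
  have hm t : S t -> r^-1 <= modulus (conjc (p t)) by move=> /pA[]; rewrite modulus_conj.
  move=> /(_ hm); apply: jet_ext; first by exists 1.
    by move=> t _; rewrite conjc0 mulr0.
  by move=> t _; rewrite conjc1 mulr1.
have SA (u : R * C) : SS u -> annulus r u.2 by case.
have jid2 := jid _ SS snd SA; have jinv2 := jinv _ SS snd SA.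
have jphi : jet SS (fun _ z => phi z) snd (fun u => der phi u.2) (fun _ => 0).
  have := jet_phi phi0 jid2 (fun u Su => Arr _ (SA u Su)); apply: jet_ext; first by exists 1.
    by move=> u _; rewrite mulr1.
  by move=> u _; rewrite mulr0.
have jt : jet SS (fun u _ => (u.1%:C)%C) snd (fun _ => 0) (fun _ => 0).
  apply: jet_cst; exists 1 => -[t z] /= [tI _]; move: tI.
  by rewrite /= in_itv /= => /andP[t0 t1]; rewrite modulus_real ger0_norm.
have j1 : jet SS (fun _ _ => 1) (@snd R C) (fun _ => 0) (fun _ => 0).
  by apply: (jet_cst _ (c := fun _ => 1)); exists (modulus (1 : C)).
have jseg := jet_add (jet_mul (jet_sub j1 jt) jinv2) (jet_mul jt jid2).
have jK := HJ _ _ _ _ _ _ _ _ _ _ _ _ jphi (jet_conj jphi) jseg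
  (fun u Su => seg_annulus rho1 Su.1 (Arr _ Su.2)).
pose a (u : R * C) := der phi u.2 * pathval Ka u.2 u.1 + (u.1%:C)%C * pathval Kz u.2 u.1.
pose b (u : R * C) := conjc (der phi u.2) * pathval Kb u.2 u.1 -
   (conjc u.2) ^- 2 * (pathval Kz u.2 u.1 - (u.1%:C)%C * pathval Kz u.2 u.1).
have {}jK : jet SS (fun u z => pathval K z u.1) snd a b.
  move: jK; apply: jet_ext; first by exists 1.
    by move=> u _; rewrite conjc0 /a /pathval /seg /=; ring.
  by move=> u _; rewrite /b /pathval /seg /=; ring.
have lipA z : annulus rho z -> [/\ lip01 (pathval K z), lip01 (pathval Ka z), lip01 (pathval Kb z),
    lip01 (pathval Kz z) & lip01 (fun t => (t%:C)%C * pathval Kz z t)].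
  move=> zA; have [l1 l2 l3 l4] := pathval_lip KJ zA.
  by split=> //; apply: lip01M => //; exact: lip01_real.
have lc (c : C) f : lip01 f -> lip01 (fun t : R => c * f t).
  by move=> lf; apply: lip01M => //; exact: lip01_cst.
have [e e0 He] := annulus_near r1 rr.
have jI : jet (annulus r) (fun _ z => cint (pathval K z)) id
    (fun z => cint (fun t => a (t, z))) (fun z => cint (fun t => b (t, z))).
  apply: (cint_jet (F := fun t z => pathval K z t) (p := id)).
  - exists e => // z h zA he; by have [] := lipA _ (He _ _ zA he).
  - move=> z /Arr/lipA[l1 l2 l3 l4 l5]; rewrite /a /=; apply: lip01D => //.
    exact: lc.
  - move=> z /Arr/lipA[l1 l2 l3 l4 l5]; rewrite /b /=; apply: lip01B.
      exact: lc.
    by apply: lc; exact: lip01B.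
  - exact: jK.
have := jet_mul (jet_sub (jid C (annulus r) id (fun z h => h))
                         (jinv C (annulus r) id (fun z h => h))) jI.
apply: jet_ext; first by exists 1.
  move=> z /Arr zA; have [l1 l2 l3 l4 l5] := lipA _ zA.
  have [f1 f2] := pathval_FTC KJ zA.
  rewrite /a /= cintD ?cintZ//; last exact: lc.
  by rewrite -f2 /=; ring.
move=> z /Arr zA; have [l1 l2 l3 l4 l5] := lipA _ zA.
have [f1 f2] := pathval_FTC KJ zA.
rewrite /b /= cintB ?cintZ ?cintB//; [|exact: lip01B|exact: lc|by apply: lc; exact: lip01B].
have -> : K (phi z) (conjc (phi z)) (conjc z)^-1 =
  cint (pathval K z) + (z - (conjc z)^-1) * cint (fun t => (t%:C)%C * pathval Kz z t)
  - (z - (conjc z)^-1) * cint (pathval Kz z) by rewrite f1 f2; ring.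
by ring.
Qed.

End SegmentPotential.

(** * The potential with vanishing Cauchy data *)

Section Potential.
Context {R : realType}.
Local Notation C := R[i].
Local Notation I01 := (`[0, 1]%classic : set R).
Variables (phi : C -> C) (rho k : R).
Hypothesis rho1 : 1 < rho.
Let disc := [set z : C | modulus z <= rho].
Hypothesis phi0 : clin phi disc.
Hypothesis phi1 : clin (der phi) disc.
Hypothesis phi2 : clin (der (der phi)) disc.
Let c : R := - (k ^+ 2 / 4).
Let E := psum (ecoef c).
Let G := psum (gcoef c).
Let K1 a b z := (b - sig phi z) * kH phi G a b z.
Let K1a a b z := (b - sig phi z) * kHa phi G a b z.
Let K2 := kH phi E.
Let K2b := kHb phi E.

(** The Riemann representation of the solution of
d_z d_zbar v = |phi'|^2 / 4 (1 - k^2 v) with zero Cauchy data on the circle. *)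
Definition pot (z : C) : C := 4^-1 * segint phi K1 z.
(** [pot_z] and [pot_q] are the derivatives of [pot] in z and conj z. *)
Definition pot_z (z : C) : C := 4^-1 * (K1 (phi z) (conjc (phi z)) z +
  (z - (conjc z)^-1) * (der phi z * cint (pathval phi K1a z))).
Definition pot_q (z : C) : C := 4^-1 * (conjc (der phi z) * segint phi K2 z).

Lemma K1_jet : kernel_jet rho K1 K1a K2
  (fun a b z => - dsig phi z * kH phi G a b z + (b - sig phi z) * kHz phi G a b z).
Proof.
have -> : K2 = (fun a b z => kH phi G a b z + (b - sig phi z) * kHb phi G a b z).
  apply/funext => a; apply/funext => b; apply/funext => z.
  by rewrite /K2 /kH /kHb /E E_G -/G; ring.
apply: kernel_mulB => //; apply: kH_jet => // B.
- by apply: entire_clin; exact: entire_gcoef.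
- rewrite (_ : der G = psum (cdiff (gcoef c))).
    by apply: entire_clin; apply: entire_diff; exact: entire_gcoef.
  by apply/funext => z; rewrite entire_der//; exact: entire_gcoef.
Qed.

Lemma derE_GE : der E = (fun z => (c%:C)%C * G z).
Proof. by apply/funext => z; exact: derE_G. Qed.

Lemma K2_jet : kernel_jet rho K2 (fun a b z => (c%:C)%C * K1 a b z) K2b (kHz phi E).
Proof.
have -> : (fun a b z => (c%:C)%C * K1 a b z) = kHa phi E.
  apply/funext => a; apply/funext => b; apply/funext => z.
  by rewrite /K1 /kH /kHa derE_GE; ring.
apply: kH_jet => // B.
- by apply: entire_clin; exact: entire_ecoef.
- rewrite (_ : der E = psum (cdiff (ecoef c))).
    by apply: entire_clin; apply: entire_diff; exact: entire_ecoef.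
  by apply/funext => z; rewrite entire_der//; exact: entire_ecoef.
Qed.

(** The kernel vanishes at the mirror image, so that this endpoint does not
contribute to the derivative in conj z. *)
Lemma K1_refl z : K1 (phi z) (conjc (phi z)) (conjc z)^-1 = 0.
Proof. by rewrite /K1 /sig conjcV conjcK invrK subrr mul0r. Qed.

Lemma K2_diag z : K2 (phi z) (conjc (phi z)) z = der phi z.
Proof. by rewrite /K2 /kH subrr mul0r /E E0 mul1r. Qed.

Lemma pot_jet (r : R) : 1 < r -> r < rho -> jet (annulus r) (fun _ => pot) id pot_z pot_q.
Proof.
move=> r1 rr; have := segint_jet rho1 phi0 K1_jet r1 rr => j.
have j4 : jet (annulus r) (fun _ _ => 4^-1) id (fun _ => 0 : C) (fun _ => 0).
  by apply: (jet_cst _ (c := fun _ => 4^-1)); exists (modulus (4^-1 : C)).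
have := jet_mul j4 j; apply: jet_ext; first by exists 1.
  by move=> z _; rewrite /pot_z /=; ring.
by move=> z _; rewrite K1_refl /pot_q /segint /=; ring.
Qed.

Lemma annulus_jet_dphi (r : R) : 1 < r -> r < rho ->
  jet (annulus r) (fun _ => der phi) id (der (der phi)) (fun _ => 0).
Proof.
move=> r1 rr; have Arr z : annulus r z -> annulus rho z by apply: annulus_sub => //; exact: ltW.
exact: (clin_jet phi1 (p := id) (fun z zA => annulus_disc (Arr z zA))).
Qed.

Definition pot_qq (z : C) : C := 4^-1 * (conjc (der (der phi) z) * segint phi K2 z +
  conjc (der phi z) * ((conjc z) ^- 2 * K2 (phi z) (conjc (phi z)) (conjc z)^-1 +
    (z - (conjc z)^-1) * (conjc (der phi z) * cint (pathval phi K2b z)))).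

(** The derivative in z of [pot_q] is the differential equation; it comes
from E' = c G and from the value E(0) = 1 at the endpoint. *)
Lemma pot_q_jet (r : R) : 1 < r -> r < rho -> jet (annulus r) (fun _ => pot_q) id
  (fun z => 4^-1 * (conjc (der phi z) * der phi z * (1 - ((k ^+ 2)%:C)%C * pot z))) pot_qq.
Proof.
move=> r1 rr; have := segint_jet rho1 phi0 K2_jet r1 rr => j.
have Arr z : annulus r z -> annulus rho z by apply: annulus_sub => //; exact: ltW.
have j4 : jet (annulus r) (fun _ _ => 4^-1) id (fun _ => 0 : C) (fun _ => 0).
  by apply: (jet_cst _ (c := fun _ => 4^-1)); exists (modulus (4^-1 : C)).
have := jet_mul j4 (jet_mul (jet_conj (annulus_jet_dphi r1 rr)) j).
apply: jet_ext; first by exists 1.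
  move=> z /Arr zA; rewrite K2_diag conjc0 /=.
  have [l1 _ _ _] := pathval_lip phi rho1 K1_jet zA.
  rewrite (_ : cint (pathval phi (fun a b z => (c%:C)%C * K1 a b z) z) =
    (c%:C)%C * cint (pathval phi K1 z)); last by rewrite -cintZ.
  have -> : (k ^+ 2)%:C%C = - 4 * (c%:C)%C.
    rewrite -(rmorph_nat (real_complex R) 4) -rmorphN -rmorphM; congr (_%:C)%C.
    by rewrite /c; field.
  by rewrite /pot /segint; move: (conjc z)^-1 => w; field.
by move=> z zA; rewrite /pot_qq /=; ring.
Qed.

(** The segment from [z] to its mirror image has length O(1 - |z|), and on
it |phi'| is at most B |phi'(z)|. *)
Lemma radial_increment (z : C) (B u : R) : 2^-1 < modulus z -> modulus z < 1 -> rho^-1 <= modulus z ->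
  0 <= B ->
  (forall t : R, 1 <= t -> t * modulus z ^+ 2 <= 1 ->
      modulus (der phi (t%:C%C * z)) <= B * modulus (der phi z)) ->
  1 <= u -> u * modulus z ^+ 2 <= 1 ->
  modulus (phi ((u%:C)%C * z) - phi z) <= 8 * B * (1 - modulus z) * modulus (der phi z).
Proof.
move=> z2 z1 zr B0 HB u1 uz.
have mz0 : 0 < modulus z by lra.
pose path (s : C) := z + s * (((u - 1)%:C)%C * z).
have uu s : I01 s -> path (s%:C)%C = ((1 + s * (u - 1))%:C)%C * z.
  move=> _; have -> : ((1 + s * (u - 1))%:C)%C = 1 + (s%:C)%C * ((u - 1)%:C)%C.
    by rewrite rmorphD rmorphM rmorph1.
  by rewrite /path; ring.
have s_ok (s : R) : I01 s -> 1 <= 1 + s * (u - 1) /\ (1 + s * (u - 1)) * modulus z ^+ 2 <= 1.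
  rewrite /= in_itv /= => /andP[s0 s1].
  have su : s * (u - 1) <= u - 1 by rewrite ler_piMl// subr_ge0.
  have su0 : 0 <= s * (u - 1) by rewrite mulr_ge0// subr_ge0.
  split; first by lra.
  by apply: le_trans uz; rewrite ler_wpM2r ?exprn_ge0 ?modulus_ge0//; lra.
have jid : jet I01 (fun _ z => z) (fun t : R => (t%:C)%C) (fun _ => 1) (fun _ => 0).
  apply: jet_id; exists 1 => t; rewrite /= in_itv /= => /andP[t0 t1].
  by rewrite modulus_real ger0_norm.
have jc (w : C) : jet I01 (fun _ _ => w) (fun t : R => (t%:C)%C) (fun _ => 0) (fun _ => 0).
  by apply: (jet_cst _ (c := fun _ => w)); exists (modulus w).
have jpath := jet_add (jc z) (jet_mul jid (jc (((u - 1)%:C)%C * z))).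
have pathA (s : R) : I01 s -> annulus rho (path (s%:C)%C).
  move=> sI; rewrite uu//; have [h1 h2] := s_ok s sI.
  set w := 1 + _ in h1 h2 *.
  have wz : modulus ((w%:C)%C * z) = w * modulus z by rewrite modulusM modulus_real ger0_norm//; lra.
  rewrite /annulus /= wz.
  have h3 : w * modulus z <= (modulus z)^-1.
    by rewrite -[leRHS]mul1r ler_pdivlMr// -mulrA -expr2.
  split; first by rewrite (le_trans zr)// ler_peMl// ltW.
  rewrite (le_trans h3)// -[leRHS]invrK lef_pV2 ?posrE// invr_gt0.
  exact: rho_gt0.
have := cint_FTC (jet_phi phi0 jpath pathA).
have -> : z + 1 * (((u - 1)%:C)%C * z) = (u%:C)%C * z by rewrite rmorphB rmorph1; ring.
rewrite mul0r addr0 => <-.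
have [l1 _ _] := jet_lip01 jpath.
have [_ l2 _ _ _] := lip_phi rho1 phi0 phi1 phi2 l1 pathA.
rewrite (_ : 8 * B * (1 - modulus z) * modulus (der phi z) =
  2 * (B * modulus (der phi z) * (4 * (1 - modulus z)))); last by ring.
have uz4 : (u - 1) * modulus z <= 4 * (1 - modulus z).
  have : u * modulus z <= (modulus z)^-1.
    by rewrite -[leRHS]mul1r ler_pdivlMr// -mulrA -expr2.
  have : (modulus z)^-1 <= modulus z + 4 * (1 - modulus z).
    by rewrite -[leLHS]mul1r ler_pdivrMr//; nra.
  lra.
apply: cint_bound.
  rewrite (_ : (fun t => _) = (fun t : R => ((u - 1)%:C)%C * z * der phi (path (t%:C)%C))).
    by apply: lip01M => //; exact: lip01_cst.
  by apply/funext => t; rewrite /path; ring.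
move=> s sI /=; have [h1 h2] := s_ok s sI.
have pu : z + (s%:C)%C * (((u - 1)%:C)%C * z) = ((1 + s * (u - 1))%:C)%C * z by exact: (uu s sI).
rewrite pu (_ : der phi _ * _ + _ = der phi (((1 + s * (u - 1))%:C)%C * z) *
   (((u - 1)%:C)%C * z)); last by ring.
rewrite modulusM ler_pM ?modulus_ge0//; first exact: HB.
by rewrite modulusM modulus_real ger0_norm// subr_ge0.
Qed.

Lemma seg_scale (t : R) z : 0 < modulus z -> modulus z < 1 -> I01 t -> exists u : R,
  [/\ seg (t%:C)%C z = (u%:C)%C * z, 1 <= u & u * modulus z ^+ 2 <= 1].
Proof.
move=> z0 z1 tI; have zn0 : z != 0 by rewrite -modulus_gt0.
have [u uE uz] := segE zn0 tI; exists u; split=> //.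
  have : modulus z * 1 <= modulus z * u.
    rewrite mulr1 [leRHS]mulrC uz; move: tI; rewrite /= in_itv /= => /andP[t0 t1].
    have : modulus z <= (modulus z)^-1 by rewrite -[leRHS]mul1r ler_pdivlMr//; nra.
    have t1' : 0 <= 1 - t by lra.
    move/(ler_wpM2l t1'); lra.
  by rewrite ler_pM2l.
rewrite expr2 mulrA uz mulrDl divfK ?gt_eqF//.
move: tI; rewrite /= in_itv /= => /andP[t0 t1].
have : t * modulus z * modulus z <= t by rewrite -mulrA ler_piMr//; nra.
lra.
Qed.

(** The length of the path is O(1 - |z|), the factor conj phi - sig is
O((1 - |z|) |phi'(z)|) on it by [radial_increment], and each factor phi' on the
path is O(|phi'(z)|). Hence second order vanishing of the potential and first
order vanishing of its derivatives, both with the weight |phi'|^2. *)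
Lemma pot_bounds (B : R) : 0 <= B -> exists2 M : R, 0 <= M & forall z,
  2^-1 < modulus z -> modulus z < 1 -> rho^-1 <= modulus z ->
  (forall t : R, 1 <= t -> t * modulus z ^+ 2 <= 1 ->
      modulus (der phi (t%:C%C * z)) <= B * modulus (der phi z)) ->
  [/\ modulus (pot z) <= M * (1 - modulus z) ^+ 2 * modulus (der phi z) ^+ 2,
      modulus (pot_z z) <= M * (1 - modulus z) * modulus (der phi z) ^+ 2 &
      modulus (pot_q z) <= M * (1 - modulus z) * modulus (der phi z) ^+ 2].
Proof.
move=> B0.
have [M0 [d0 [M00 _ HM0]]] := phi0.
pose Q : R := 2 * M0 * (2 * M0).
have [ME [dE [ME0 _ HME]]] := entire_clin Q (entire_ecoef c).
have [MG [dG [MG0 _ HMG]]] := entire_clin Q (entire_gcoef c).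
pose A := 8 * B.
have A0 : 0 <= A by rewrite /A; nonneg.
exists (2 * (A * MG * B) + 4^-1 * A * MG + 2 * (A ^+ 2 * MG * B * M0 ^+ 2) + 2 * (ME * B)).
  by nonneg.
move=> z z2 z1 zr HB.
have z0 : 0 < modulus z by lra.
have zn0 : z != 0 by rewrite -modulus_gt0.
set d := 1 - modulus z; set f := modulus (der phi z).
have dp : 0 < d by rewrite /d subr_gt0.
have d1 : d <= 1 by rewrite /d; lra.
have f0 : 0 <= f by exact: modulus_ge0.
have zd : modulus z <= rho by rewrite ltW// (lt_trans z1).
have zA : annulus rho z by [].
have fM : f <= M0 by have [_ h _] := HM0 z zd.
have del : modulus (z - (conjc z)^-1) <= 4 * d.
  have -> : z - (conjc z)^-1 = ((1 - (modulus z ^+ 2)^-1)%:C)%C * z.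
    have mz : ((modulus z ^+ 2)%:C)%C = z * conjc z by rewrite rmorphXn /= modulusE sqr_normc.
    rewrite rmorphB rmorph1 fmorphV /= mz.
    have c0 : conjc z != 0 by rewrite conjc_eq0.
    by field; rewrite zn0 c0.
  rewrite modulusM modulus_real ler0_norm; last first.
    by rewrite subr_le0 invf_ge1 ?exprn_gt0// exprn_ile1 ?(ltW z0)// ltW.
  have -> : - (1 - (modulus z ^+ 2)^-1) * modulus z = (modulus z)^-1 - modulus z.
    by field; rewrite gt_eqF.
  have : (modulus z)^-1 <= modulus z + 4 * d.
    by rewrite -[leLHS]mul1r ler_pdivrMr// /d; nra.
  lra.
have path t : I01 t -> [/\ modulus (conjc (phi z) - sig phi (seg (t%:C)%C z)) <= A * d * f,
    modulus (der phi (seg (t%:C)%C z)) <= B * f &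
    modulus ((phi z - phi (seg (t%:C)%C z)) * (conjc (phi z) - sig phi (seg (t%:C)%C z))) <= Q].
  move=> tI; have [u [uE u1 uz]] := seg_scale z0 z1 tI.
  have sA := seg_annulus rho1 tI zA.
  have u0 : 0 < u by lra.
  have rE : (conjc (seg (t%:C)%C z))^-1 = (((u * modulus z ^+ 2)^-1)%:C)%C * z.
    have mz : ((modulus z ^+ 2)%:C)%C = z * conjc z by rewrite rmorphXn /= modulusE sqr_normc.
    rewrite uE conjcM conjc_real fmorphV /= rmorphM /= mz.
    have un0 : (u%:C)%C != 0 by rewrite -(rmorph0 (real_complex R)) (inj_eq (@complexI R)) gt_eqF.
    have c0 : conjc z != 0 by rewrite conjc_eq0.
    by field; rewrite un0 zn0 c0.
  have uz0 : 0 < u * modulus z ^+ 2 by rewrite mulr_gt0 ?exprn_gt0.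
  have h1 : 1 <= (u * modulus z ^+ 2)^-1 by rewrite invf_ge1.
  have h2 : (u * modulus z ^+ 2)^-1 * modulus z ^+ 2 <= 1.
    by rewrite mulrC ler_pdivrMr// mul1r ler_peMl ?exprn_ge0// ltW.
  split.
  - rewrite /sig -conjcB modulus_conj rE modulusC /A /d /f.
    exact: radial_increment.
  - by rewrite uE; exact: HB.
  - rewrite modulusM /Q ler_pM ?modulus_ge0//.
      have [h3 _ _] := HM0 z zd; have [h4 _ _] := HM0 _ (annulus_disc sA).
      by have := modulusB (phi z) (phi (seg (t%:C)%C z)); lra.
    rewrite /sig -conjcB modulus_conj.
    have [h3 _ _] := HM0 z zd; have [h4 _ _] := HM0 _ (annulus_refl_disc rho1 sA).
    by have := modulusB (phi z) (phi (conjc (seg (t%:C)%C z))^-1); lra.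
have [l1 l2 _ _] := pathval_lip phi rho1 K1_jet zA.
have [l3 _ _ _] := pathval_lip phi rho1 K2_jet zA.
have Adf0 : 0 <= A * d * f by nonneg.
have Bf0 : 0 <= B * f by nonneg.
have q1 : modulus (cint (pathval phi K1 z)) <= 2 * (A * d * f * (MG * (B * f))).
  apply: cint_bound => // t tI; have [h1 h2 h3] := path t tI.
  rewrite /pathval /K1 /kH !modulusM ler_pM ?modulus_ge0//; first by nonneg.
  by rewrite ler_pM ?modulus_ge0//; have [] := HMG _ h3.
have q2 : modulus (cint (pathval phi K1a z)) <= 2 * (A * d * f * (MG * (A * d * f) * (B * f))).
  apply: cint_bound => // t tI; have [h1 h2 h3] := path t tI.
  rewrite /pathval /K1a /kHa !modulusM ler_pM ?modulus_ge0//; first by nonneg.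
  rewrite ler_pM ?modulus_ge0//; first by nonneg.
  by rewrite ler_pM ?modulus_ge0//; have [] := HMG _ h3.
have q3 : modulus (cint (pathval phi K2 z)) <= 2 * (ME * (B * f)).
  apply: cint_bound => // t tI; have [h1 h2 h3] := path t tI.
  by rewrite /pathval /K2 /kH !modulusM ler_pM ?modulus_ge0//; have [] := HME _ h3.
have q4 : modulus (K1 (phi z) (conjc (phi z)) z) <= A * d * f * (MG * f).
  have t1 : I01 1 by rewrite /= in_itv /= ler01 lexx.
  have s1 : seg ((1%:C)%C) z = z by rewrite /seg rmorph1; ring.
  have [] := path 1 t1; rewrite s1 => h1 h2 h3.
  rewrite /K1 /kH !modulusM ler_pM ?modulus_ge0//; first by nonneg.
  by rewrite ler_pM ?modulus_ge0//; have [] := HMG _ h3.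
have m4 : modulus (4^-1 : C) = 4^-1 by rewrite modulusV modulus_nat.
have dd := mulr_ge0 (ltW dp) (ltW dp).
split.
- rewrite /pot /segint !modulusM m4.
  have : modulus (z - (conjc z)^-1) * modulus (cint (pathval phi K1 z)) <=
     4 * d * (2 * (A * d * f * (MG * (B * f)))) by rewrite ler_pM ?modulus_ge0.
  have e1 : 0 <= 4^-1 * A * MG * d ^+ 2 * f ^+ 2 by nonneg.
  have e2 : 0 <= (A ^+ 2 * MG * B * M0 ^+ 2) * d ^+ 2 * f ^+ 2 by nonneg.
  have e3 : 0 <= (ME * B) * d ^+ 2 * f ^+ 2 by nonneg.
  by lra.
- rewrite /pot_z modulusM m4.
  have := modulusD (K1 (phi z) (conjc (phi z)) z)
    ((z - (conjc z)^-1) * (der phi z * cint (pathval phi K1a z))).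
  rewrite (modulusM (z - _)) (modulusM (der phi z)) -/f.
  have : modulus (z - (conjc z)^-1) * (f * modulus (cint (pathval phi K1a z))) <=
     4 * d * (f * (2 * (A * d * f * (MG * (A * d * f) * (B * f))))).
    by rewrite ler_pM ?modulus_ge0 ?mulr_ge0// ?ler_wpM2l// modulus_ge0.
  have e1 : 0 <= A * MG * B * d * f ^+ 2 by nonneg.
  have e3 : 0 <= (ME * B) * d * f ^+ 2 by nonneg.
  have : A ^+ 2 * MG * B * d * f ^+ 2 * (d ^+ 2 * f ^+ 2) <= A ^+ 2 * MG * B * d * f ^+ 2 * (1 * M0 ^+ 2).
    rewrite ler_wpM2l//; first by nonneg.
    by rewrite ler_pM ?exprn_ge0 ?exprn_ile1 ?(ltW dp)// lerXn2r ?nnegrE.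
  by lra.
- rewrite /pot_q modulusM m4 modulusM modulus_conj -/f /segint modulusM.
  have : f * (modulus (z - (conjc z)^-1) * modulus (cint (pathval phi K2 z))) <=
     f * (4 * d * (2 * (ME * (B * f)))) by rewrite ler_wpM2l// ler_pM ?modulus_ge0.
  have e1 : 0 <= A * MG * B * d * f ^+ 2 by nonneg.
  have e2 : 0 <= (A ^+ 2 * MG * B * M0 ^+ 2) * d * f ^+ 2 by nonneg.
  have e3 : 0 <= 4^-1 * A * MG * d * f ^+ 2 by nonneg.
  by lra.
Qed.

End Potential.

(** * The mixed second derivatives of the potential *)

Section PotentialSecond.
Context {R : realType}.
Local Notation C := R[i].

(** Bessel's equation for G, on coefficients. *)
Lemma gcoef_bessel (c : R) z :
  2 * psum (cdiff (gcoef c)) z + z * psum (cdiff (cdiff (gcoef c))) z = (c%:C)%C * psum (gcoef c) z.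
Proof.
have hG := entire_gcoef c; have hd := entire_diff hG.
rewrite -(psumZ (c%:C)%C z hG); symmetry; apply: psum_unique.
have h2 : csumto (fun n => 2 * cdiff (gcoef c) n * z ^+ n) (2 * psum (cdiff (gcoef c)) z).
  have h0 : csumto (fun _ => 0 : C) 0.
    by move=> e e0; exists 0%N => n _; rewrite big1// subrr modulus0.
  rewrite -[2 * psum _ _]add0r; apply: csumto_eq (csumto_lin 2 h0 (entire_psumP z hd)) => n.
  by ring.
have h1 := csumto_shift (entire_psumP z (entire_diff hd)).
apply: csumto_eq (csumto_lin z h2 h1) => n.
have rc n' : n'.+1%:R * n'.+2%:R * gcoef c n'.+1 = (c%:C)%C * gcoef c n'.
  rewrite /gcoef -!(rmorph_nat (real_complex R)) -[(c%:C)%C]/(real_complex R c).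
  rewrite -[((_ / _)%:C)%C]/(real_complex R _) -[((_ / _)%:C)%C in RHS]/(real_complex R _).
  rewrite -!rmorphM; congr (_%:C)%C.
  rewrite /= (factS n'.+1) (factS n') !natrM (exprS c); field.
  rewrite gt_eqF ?fact_gt0R//= [1 + _]nat1r [2 + _](_ : _ = n'.+2%:R) ?pnatr_eq0//.
  by rewrite -[n'.+2]add2n natrD.
rewrite -rc /cdiff; case: n => [|n]; first by rewrite !mulr0 addr0; ring.
by rewrite exprS -[n.+3%:R]natr1 -[n.+2%:R]natr1; ring.
Qed.

Variables (phi : C -> C) (rho k : R).
Hypothesis rho1 : 1 < rho.
Let disc := [set z : C | modulus z <= rho].
Hypothesis phi0 : clin phi disc.
Hypothesis phi1 : clin (der phi) disc.
Hypothesis phi2 : clin (der (der phi)) disc.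
Let c : R := - (k ^+ 2 / 4).
Let G := psum (gcoef c).
Let K1 a b z := (b - sig phi z) * kH phi G a b z.
Let K1a a b z := (b - sig phi z) * kHa phi G a b z.

Let G1E : der G = psum (cdiff (gcoef c)).
Proof. by apply/funext => z; rewrite entire_der//; exact: entire_gcoef. Qed.
Let G2E : der (der G) = psum (cdiff (cdiff (gcoef c))).
Proof. by rewrite G1E; apply/funext => z; rewrite entire_der//; exact/entire_diff/entire_gcoef. Qed.

Lemma K1a_jet : exists Kaa Kaz, kernel_jet rho K1a Kaa (fun a b z => (c%:C)%C * K1 a b z) Kaz.
Proof.
have hj : kernel_jet rho (kH phi (der G)) (kHa phi (der G)) (kHb phi (der G)) (kHz phi (der G)).
  apply: kH_jet => // B.
    by rewrite G1E; apply: entire_clin; apply: entire_diff; exact: entire_gcoef.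
  rewrite G2E; apply: entire_clin; apply: entire_diff; apply: entire_diff.
  exact: entire_gcoef.
have := kernel_mulB rho1 phi0 phi1 phi2 (kernel_mulB rho1 phi0 phi1 phi2 hj).
set K := (X in kernel_jet rho X); set Kb := (X in kernel_jet rho _ _ X).
have -> : K = K1a.
  by apply/funext => a; apply/funext => b; apply/funext => z; rewrite /K /K1a /kH /kHa; ring.
have -> : Kb = (fun a b z => (c%:C)%C * K1 a b z).
  apply/funext => a; apply/funext => b; apply/funext => z.
  have h := gcoef_bessel c ((a - phi z) * (b - sig phi z)).
  rewrite /Kb /K1 /kH /kHb G2E G1E /G.
  rewrite (_ : (c%:C)%C * _ = (b - sig phi z) * der phi z * ((c%:C)%C * psum (gcoef c) ((a - phi z) * (b - sig phi z)))); last by ring.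
  by rewrite -h; ring.
by move=> h; eexists; eexists; exact: h.
Qed.

(** The derivative in conj z of [pot_z] is the same mixed derivative as in
[pot_q_jet]: this is where Bessel's equation for G enters. The pure derivative
d_z^2 v only matters through its existence. *)
Lemma pot_z_jet (r : R) : 1 < r -> r < rho -> exists pzz : C -> C,
  jet (annulus r) (fun _ => pot_z phi k) id pzz
  (fun z => 4^-1 * (conjc (der phi z) * der phi z * (1 - ((k ^+ 2)%:C)%C * pot phi k z))).
Proof.
move=> r1 rr; have [Kaa [Kaz hK]] := K1a_jet.
have := segint_jet rho1 phi0 hK r1 rr => j.
have Arr z : annulus r z -> annulus rho z by apply: annulus_sub => //; exact: ltW.
have j4 : jet (annulus r) (fun _ _ => 4^-1) id (fun _ => 0 : C) (fun _ => 0).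
  by apply: (jet_cst _ (c := fun _ => 4^-1)); exists (modulus (4^-1 : C)).
have jid : jet (annulus r) (fun _ z => z) id (fun _ => 1 : C) (fun _ => 0).
  by apply: jet_id; exists r => z [].
have jd := annulus_jet_dphi rho1 phi1 r1 rr.
have js := jet_sig rho1 phi0 jid Arr.
have jp := jet_phi phi0 jid (fun z zA => Arr z zA).
eexists; have := jet_mul j4 (jet_add (jet_mul (jet_sub (jet_conj jp) js) jd) (jet_mul jd j)).
apply: jet_ext; first exists 1 => //.
- move=> z h _ _; rewrite /pot_z /K1 /kH /segint subrr mul0r (_ : psum (gcoef c) 0 = 1); last first.
    rewrite psum_at0; last exact: entire_gcoef.
    by rewrite /gcoef expr0 fact0 (_ : 1`! = 1%N)// mulr1 divr1.
  by rewrite /K1a /kHa; ring.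
- by move=> z _; reflexivity.
move=> z zA /=.
have [l1 _ _ _] := pathval_lip phi rho1 (K1_jet k rho1 phi0 phi1 phi2) (Arr z zA).
rewrite (_ : cint (pathval phi (fun a b z => (c%:C)%C * K1 a b z) z) =
  (c%:C)%C * cint (pathval phi K1 z)); last by rewrite -cintZ.
have -> : K1a (phi z) (conjc (phi z)) (conjc z)^-1 = 0.
  by rewrite /K1a /sig conjcV conjcK invrK subrr mul0r.
have -> : (k ^+ 2)%:C%C = - 4 * (c%:C)%C.
  rewrite -(rmorph_nat (real_complex R) 4) -rmorphN -rmorphM; congr (_%:C)%C.
  by rewrite /c; field.
rewrite /pot /segint; move: (conjc z)^-1 => w.
set J := cint (pathval phi K1 z); set J' := (X in 1 - _ * (4^-1 * ((z - w) * X))).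
have -> : J' = J by [].
by rewrite mulr1 !mulr0; field.
Qed.

End PotentialSecond.

(** * Smooth functions of one variable *)

Section SmoothOneVariable.
Context {R : realType}.
Implicit Types (J : set R) (h : R -> R).

(** Derivatives are carried as explicit functions, so that nothing is said of
the derivation operator outside [J]. *)
Fixpoint Dn (n : nat) J h : Prop :=
  if n is m.+1 then exists2 g, (forall t, J t -> is_derive t (1 : R) h (g t)) & Dn m J g else True.

Definition smooth1 J h := forall n, Dn n J h.

Lemma Dn_le n J h : Dn n.+1 J h -> Dn n J h.
Proof. by elim: n h => // n IH h [g dg /IH Dg]; exists g. Qed.

Lemma Dn_sub n J J' h : J' `<=` J -> Dn n J h -> Dn n J' h.
Proof.
move=> JJ; elim: n h => // n IH h [g dg Dg]; exists g; last exact: IH.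
by move=> t /JJ; exact: dg.
Qed.

Lemma DnD n J f g : Dn n J f -> Dn n J g -> Dn n J (fun t => f t + g t).
Proof.
elim: n f g => // n IH f g [f' df Df] [g' dg Dg].
exists (fun t => f' t + g' t); last exact: IH.
by move=> t Jt; apply: is_deriveD; [exact: df|exact: dg].
Qed.

Lemma DnM n J f g : Dn n J f -> Dn n J g -> Dn n J (fun t => f t * g t).
Proof.
elim: n f g => // n IH f g [f' df Df] [g' dg Dg].
have Df' := Dn_le (ex_intro2 _ _ f' df Df : Dn n.+1 J f).
have Dg' := Dn_le (ex_intro2 _ _ g' dg Dg : Dn n.+1 J g).
exists (fun t => f t * g' t + g t * f' t); last by apply: DnD; exact: IH.
by move=> t Jt; apply: is_deriveM; [exact: df|exact: dg].
Qed.

Lemma Dn_cst n J c : Dn n J (fun _ => c).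
Proof. by elim: n c => // n IH c; exists (fun _ => 0) => // t _; exact: is_derive_cst. Qed.

Lemma Dn_id n J : Dn n J id.
Proof.
case: n => // n; exists (fun _ => 1); last exact: Dn_cst.
by move=> t _; exact: is_derive_id.
Qed.

Lemma Dn_comp n J J' f g : (forall t, J t -> J' (f t)) -> Dn n J' g -> Dn n J f ->
  Dn n J (fun t => g (f t)).
Proof.
move=> JJ; elim: n f g JJ => // n IH f g JJ [g' dg Dg] [f' df Df].
have Df' := Dn_le (ex_intro2 _ _ f' df Df : Dn n.+1 J f).
exists (fun t => g' (f t) * f' t); last by apply: DnM => //; exact: IH.
by move=> t Jt; exact: (is_derive1_comp (dg _ (JJ _ Jt)) (df t Jt)).
Qed.

Lemma smooth1_cst J c : smooth1 J (fun _ => c).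
Proof. by move=> n; exact: Dn_cst. Qed.
Lemma smooth1_id J : smooth1 J id.
Proof. by move=> n; exact: Dn_id. Qed.
Lemma smooth1D J f g : smooth1 J f -> smooth1 J g -> smooth1 J (fun t => f t + g t).
Proof. by move=> hf hg n; exact: DnD. Qed.
Lemma smooth1M J f g : smooth1 J f -> smooth1 J g -> smooth1 J (fun t => f t * g t).
Proof. by move=> hf hg n; exact: DnM. Qed.
Lemma smooth1N J f : smooth1 J f -> smooth1 J (fun t => - f t).
Proof.
move=> hf; rewrite (_ : (fun t => _) = (fun t => -1 * f t)).
  by apply: smooth1M => //; exact: smooth1_cst.
by apply/funext => t; rewrite mulN1r.
Qed.
Lemma smooth1_comp J J' f g : (forall t, J t -> J' (f t)) -> smooth1 J' g -> smooth1 J f ->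
  smooth1 J (fun t => g (f t)).
Proof. by move=> JJ hg hf n; exact: (Dn_comp JJ (hg n) (hf n)). Qed.
Lemma smooth1_sub J J' h : J' `<=` J -> smooth1 J h -> smooth1 J' h.
Proof. by move=> JJ hh n; exact: (Dn_sub JJ (hh n)). Qed.

Lemma smooth1_inv : smooth1 [set t : R | 0 < t] (fun t => t^-1).
Proof.
move=> n; elim: n => // n IH; exists (fun t => -1 * (t^-1 * t^-1)); last first.
  by apply: DnM; [exact: Dn_cst|exact: DnM].
move=> t /= t0; apply: is_derive_eq.
  by apply: is_deriveV; rewrite gt_eqF.
by rewrite /GRing.scale /= mulr1 expr2 invfM mulN1r.
Qed.

Lemma smooth1_ln : smooth1 [set t : R | 0 < t] (@ln R).
Proof.
case=> // n; exists (fun t => t^-1); last exact: smooth1_inv.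
by move=> t /= t0; exact: is_derive1_ln.
Qed.

(** The functions t^-m exp(-1/t), extended by 0, are stable under derivation. *)
Definition flat (m : nat) (t : R) : R := if 0 < t then t^-1 ^+ m * expR (- t^-1) else 0.

Lemma flat_bound m t : `|flat m t| <= (m.+2)`!%:R * t ^+ 2.
Proof.
rewrite /flat; case: ifPn => [t0|_]; last by rewrite normr0 mulr_ge0 ?sqr_ge0.
have ti : 0 <= t^-1 by rewrite invr_ge0 ltW.
rewrite ger0_norm; last by rewrite mulr_ge0 ?exprn_ge0 ?expR_ge0.
rewrite expRN ler_pdivrMr ?expR_gt0//.
have := expR_ge1Dxn m.+1 ti => h.
have f0 : 0 < (m.+2)`!%:R :> R by rewrite ltr0n fact_gt0.
have : t^-1 ^+ m.+2 / (m.+2)`!%:R <= expR t^-1 by lra.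
rewrite ler_pdivrMr// => h2.
have -> : t^-1 ^+ m = t^-1 ^+ m.+2 * t ^+ 2.
  rewrite -[in RHS](addn2 m) exprD -mulrA -exprMn mulVf ?gt_eqF//.
  by rewrite expr1n mulr1.
have := ler_wpM2r (sqr_ge0 t) h2; lra.
Qed.

Lemma flat_derive m (t : R) : is_derive t (1 : R) (flat m) (- m%:R * flat m.+1 t + flat m.+2 t).
Proof.
have [t0|t0|t0] := ltgtP t 0.
- rewrite /flat ltNge (ltW t0) /= mulr0 addr0.
  have dc : is_derive t (1 : R) (fun _ : R => 0 : R) (0 : R) by exact: is_derive_cst.
  apply: (near_eq_is_derive _ dc).
  near=> s; have : s < 0 by near: s; exact: lt_nbhsl.
  by rewrite /= => s0; rewrite ltNge (ltW s0).
- rewrite [flat m.+1 t]/flat [flat m.+2 t]/flat t0.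
  have tn : t != 0 by rewrite gt_eqF.
  have dinv : is_derive t (1 : R) (fun s : R => s^-1) (- t^-1 ^+ 2).
    apply: is_derive_eq; first exact: is_deriveV.
    by rewrite /GRing.scale /= mulr1 -exprVn.
  have dexp : is_derive t (1 : R) (fun s : R => expR (- s^-1)) (expR (- t^-1) * t^-1 ^+ 2).
    have d1 : is_derive t (1 : R) (fun s : R => - s^-1) (- - t^-1 ^+ 2) := is_deriveN dinv.
    have h := @is_derive1_comp _ expR (fun s : R => - s^-1) t _ _ (is_derive_expR _) d1; rewrite opprK in h.
    exact: h.
  have dpow : is_derive t (1 : R) (fun s : R => s^-1 ^+ m) (m%:R * t^-1 ^+ m.-1 * - t^-1 ^+ 2).
    have [d1 d2] := is_deriveX m dinv.
    rewrite exprfctE in d1 d2; by split.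
  have dd : is_derive t (1 : R) (fun s : R => s^-1 ^+ m * expR (- s^-1))
      (t^-1 ^+ m *: (expR (- t^-1) * t^-1 ^+ 2) +
       expR (- t^-1) *: (m%:R * t^-1 ^+ m.-1 * - t^-1 ^+ 2)) := is_deriveM dpow dexp.
  have /(is_derive_eq dd) de : t^-1 ^+ m *: (expR (- t^-1) * t^-1 ^+ 2) +
       expR (- t^-1) *: (m%:R * t^-1 ^+ m.-1 * - t^-1 ^+ 2) =
       - m%:R * (t^-1 ^+ m.+1 * expR (- t^-1)) + t^-1 ^+ m.+2 * expR (- t^-1).
    rewrite /GRing.scale /=; case: m {dpow dd} => [|m']; first by rewrite !expr0 expr2; ring.
    by rewrite /= !exprS; ring.
  apply: near_eq_is_derive de.
  near=> s; have s0 : 0 < s by near: s; exact: lt_nbhsr.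
  by rewrite /flat s0.
- rewrite t0 /flat ltxx mulr0 addr0.
  have cv : h^-1 *: ((flat m \o shift 0) (h *: (1 : R)) - flat m 0) @[h --> 0^'] --> (0 : R).
    apply/cvgrPdist_le => e e0.
    have f0 : 0 < (m.+2)`!%:R :> R by rewrite ltr0n fact_gt0.
    have ef : 0 < e / (m.+2)`!%:R by rewrite divr_gt0.
    near=> h.
    have h0 : h != 0 by near: h; exact: nbhs_dnbhs_neq.
    have he : `|h| <= e / (m.+2)`!%:R by near: h; apply: dnbhs0_le.
    rewrite sub0r normrN /= scaler1 addr0 {2}/flat ltxx subr0 /GRing.scale /= normrM normfV.
    rewrite ler_pdivlMr// in he.
    have hp : 0 < `|h| by rewrite normr_gt0.
    rewrite mulrC ler_pdivrMr//; apply: le_trans (flat_bound m h) _.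
    rewrite -[h ^+ 2]real_normK ?num_real//.
    by have := ler_wpM2r (ltW hp) he; rewrite expr2; lra.
  by apply: DeriveDef; [apply/cvg_ex; exists 0|apply/cvg_lim].
Unshelve. all: by end_near. Qed.

Lemma smooth1_flat m : smooth1 setT (flat m).
Proof.
move=> n; elim: n m => // n IH m; exists (fun t => - m%:R * flat m.+1 t + flat m.+2 t).
  by move=> t _; exact: flat_derive.
by apply: DnD => //; apply: DnM => //; exact: Dn_cst.
Qed.

Lemma flat0_gt0 t : 0 < t -> 0 < flat 0 t.
Proof. by move=> t0; rewrite /flat t0 expr0 mul1r expR_gt0. Qed.
Lemma flat0_ge0 t : 0 <= flat 0 t.
Proof. by rewrite /flat; case: ifP => // t0; rewrite expr0 mul1r expR_ge0. Qed.
Lemma flat0_eq0 t : t <= 0 -> flat 0 t = 0.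
Proof. by rewrite /flat ltNge => ->. Qed.

(** Equal to 1 for s <= a and to 0 for s >= b. *)
Definition sstep (a b s : R) : R := flat 0 (b - s) / (flat 0 (b - s) + flat 0 (s - a)).

Lemma sstep_den (a b s : R) : a < b -> 0 < flat 0 (b - s) + flat 0 (s - a).
Proof.
move=> ab; have [sb|bs] := ltP s b.
  by rewrite ltr_pwDl ?flat0_ge0// flat0_gt0// subr_gt0.
by rewrite ltr_wpDl ?flat0_ge0// flat0_gt0// subr_gt0 (lt_le_trans ab).
Qed.

Lemma sstep1 (a b s : R) : a < b -> s <= a -> sstep a b s = 1.
Proof.
move=> ab sa; have := sstep_den s ab; rewrite /sstep [flat 0 (s - a)]flat0_eq0 ?subr_le0//.
by rewrite addr0 => h; rewrite divff// gt_eqF.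
Qed.

Lemma sstep0 (a b s : R) : b <= s -> sstep a b s = 0.
Proof. by move=> bs; rewrite /sstep flat0_eq0 ?mul0r// subr_le0. Qed.

Lemma sstep_ge0 (a b s : R) : a < b -> 0 <= sstep a b s.
Proof. by move=> ab; rewrite divr_ge0 ?flat0_ge0// ltW// sstep_den. Qed.

Lemma sstep_le1 (a b s : R) : a < b -> sstep a b s <= 1.
Proof. by move=> ab; rewrite ler_pdivrMr ?sstep_den// mul1r lerDl flat0_ge0. Qed.

Lemma smooth1_sstep (a b : R) : a < b -> smooth1 setT (sstep a b).
Proof.
move=> ab.
have s1 : smooth1 setT (fun s => flat 0 (b - s)).
  apply: (@smooth1_comp _ setT) => //; first exact: smooth1_flat.
  by apply: smooth1D; [exact: smooth1_cst|apply: smooth1N; exact: smooth1_id].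
have s2 : smooth1 setT (fun s => flat 0 (s - a)).
  apply: (@smooth1_comp _ setT) => //; first exact: smooth1_flat.
  by apply: smooth1D; [exact: smooth1_id|exact: smooth1_cst].
apply: smooth1M => //; apply: (@smooth1_comp _ [set t | 0 < t]).
- by move=> t _; exact: sstep_den.
- exact: smooth1_inv.
- exact: smooth1D.
Qed.

End SmoothOneVariable.

(** * Differential calculus in the plane *)

Section PlaneCalculus.
Context {R : realType}.
Implicit Types (O : set (plane R)) (f g : plane R -> R) (x : plane R).
Local Notation mu2 := (leb2 R).

(** As for [Dn], the partial derivatives are carried as explicit functions;
[Cn_real_smooth] relates them to the iterated partial derivatives. *)
Fixpoint Cn (n : nat) O f : Prop :=
  (forall x, O x -> {for x, continuous f}) /\
  (if n is m.+1 then forall i : 'I_2, exists2 g,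
     (forall x, O x -> is_derive x (dir i) f (g x)) & Cn m O g else True).

Lemma Cn_cont n O f : Cn n O f -> forall x, O x -> {for x, continuous f}.
Proof. by case: n => [|n] []. Qed.

Lemma Cn_le n O f : Cn n.+1 O f -> Cn n O f.
Proof.
elim: n f => [|n IH] f [cf H]; split=> // i.
by have [g dg Cg] := H i; exists g => //; exact: IH.
Qed.

Lemma Cn_leq m n O f : (m <= n)%N -> Cn n O f -> Cn m O f.
Proof. by move=> /subnK <-; elim: (n - m)%N => // k IH /Cn_le. Qed.

Lemma Cn_sub n O O' f : O' `<=` O -> Cn n O f -> Cn n O' f.
Proof.
move=> OO; elim: n f => [|n IH] f [cf H]; split=> //; try by move=> x /OO; exact: cf.
move=> i; have [g dg Cg] := H i; exists g; last exact: IH.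
by move=> x /OO; exact: dg.
Qed.

Lemma Cn_partials O f (s : seq 'I_2) n : open O -> Cn (n + size s) O f ->
  exists2 g, Cn n O g & forall x, O x -> partials s f x = g x.
Proof.
move=> oO; elim: s n => [|i s IH] n /=; first by rewrite addn0 => Cf; exists f.
rewrite addnS -addSn => /IH[g Cg fg]; have [_ /(_ i)[g' dg Cg']] := Cg.
exists g' => // x Ox; have [_ <-] := dg x Ox.
apply: near_eq_derive; near=> y; apply: fg; near: y; exact: open_nbhs_nbhs.
Unshelve. all: by end_near. Qed.

Lemma Cn_real_smooth O f : open O -> (forall n, Cn n O f) -> real_smooth_on O f.
Proof.
move=> oO Cf s x Ox; have [g Cg fg] := @Cn_partials O f s 1 oO (Cf _).
have nfg : \near x, g x = partials s f x.
  by near=> y; apply/esym/fg; near: y; exact: open_nbhs_nbhs.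
split.
  have cg : g @ x --> partials s f x by rewrite fg//; exact: Cn_cont Cg _ Ox.
  exact: cvg_trans (near_eq_cvg nfg) cg.
move=> i; have [_ /(_ i)[g' dg _]] := Cg; have [d1 _] := dg x Ox.
exact: near_eq_derivable d1.
Unshelve. all: by end_near. Qed.

Lemma CnD n O f g : Cn n O f -> Cn n O g -> Cn n O (fun x => f x + g x).
Proof.
elim: n f g => [|n IH] f g [cf Hf] [cg Hg]; split=> //;
  try by move=> x Ox; apply: continuousD; [exact: cf|exact: cg].
move=> i; have [f' df Cf] := Hf i; have [g' dg Cg] := Hg i.
exists (fun x => f' x + g' x); last exact: IH.
by move=> x Ox; apply: is_deriveD; [exact: df|exact: dg].
Qed.

Lemma CnM n O f g : Cn n O f -> Cn n O g -> Cn n O (fun x => f x * g x).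
Proof.
elim: n f g => [|n IH] f g.
  move=> [cf Hf] [cg Hg]; split=> // x Ox.
  by apply: continuousM; [exact: cf|exact: cg].
move=> Cf Cg; have Cf' := Cn_le Cf; have Cg' := Cn_le Cg.
have [cf Hf] := Cf; have [cg Hg] := Cg; split.
  by move=> x Ox; apply: continuousM; [exact: cf|exact: cg].
move=> i; have [f' df Df] := Hf i; have [g' dg Dg] := Hg i.
exists (fun x => f x * g' x + g x * f' x); last by apply: CnD; exact: IH.
by move=> x Ox; apply: is_deriveM; [exact: df|exact: dg].
Qed.

Lemma Cn_cst n O c : Cn n O (fun _ => c).
Proof.
elim: n c => [|n IH] c; split=> //; try by move=> x _; exact: cst_continuous.
by move=> i; exists (fun _ => 0) => // x _; exact: is_derive_cst.
Qed.

Lemma is_derive_line (l : plane R -> R) x (v : plane R) :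
  (forall (h : R) y z, l (h *: y + z) = h * l y + l z) -> is_derive x v l (l v).
Proof.
move=> lin.
have cv : h^-1 *: ((l \o shift x) (h *: v) - l x) @[h --> (0 : R)^'] --> l v.
  apply/cvgrPdist_le => e e0; near=> h.
  have h0 : h != 0 by near: h; exact: nbhs_dnbhs_neq.
  rewrite /= lin addrK /GRing.scale /= mulrA mulVf// mul1r subrr normr0.
  exact: ltW.
by apply: DeriveDef; [apply/cvg_ex; exists (l v)|apply/cvg_lim].
Unshelve. all: by end_near. Qed.

Lemma plane_fst_continuous : continuous (fst : plane R -> R).
Proof.
move=> x; apply/cvgrPdist_lt => e e0; apply/nbhs_planeP; exists e => // y.
rewrite -of_planeB => h; rewrite distrC; apply: le_lt_trans h.
exact: (modulus_Re (of_plane (y - x))).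
Qed.

Lemma plane_snd_continuous : continuous (snd : plane R -> R).
Proof.
move=> x; apply/cvgrPdist_lt => e e0; apply/nbhs_planeP; exists e => // y.
rewrite -of_planeB => h; rewrite distrC; apply: le_lt_trans h.
exact: (modulus_Im (of_plane (y - x))).
Qed.

Lemma Cn_fst n O : Cn n O (fst : plane R -> R).
Proof.
case: n => [|n]; split; [by move=> x _; exact: plane_fst_continuous|by []|by move=> x _; exact: plane_fst_continuous|].
move=> i; exists (fun _ => (dir i : plane R).1); last exact: Cn_cst.
by move=> x _; apply: is_derive_line => h [y1 y2] [z1 z2].
Qed.

Lemma Cn_snd n O : Cn n O (snd : plane R -> R).
Proof.
case: n => [|n]; split; [by move=> x _; exact: plane_snd_continuous|by []|by move=> x _; exact: plane_snd_continuous|].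
move=> i; exists (fun _ => (dir i : plane R).2); last exact: Cn_cst.
by move=> x _; apply: is_derive_line => h [y1 y2] [z1 z2].
Qed.

Lemma is_derive_along f x (v : plane R) d :
  is_derive x v f d <-> is_derive (0 : R) (1 : R) (fun t : R => f (t *: v + x)) d.
Proof.
have E : (fun h : R => h^-1 *: ((f \o shift x) (h *: v) - f x)) =
  (fun h : R => h^-1 *: (((fun t : R => f (t *: v + x)) \o shift 0) (h *: (1 : R)) -
      (fun t : R => f (t *: v + x)) 0)).
  by apply/funext => h; rewrite /= addr0 scale0r add0r [h *: 1]mulr1.
by split=> -[d1 d2]; split; move: d1 d2; rewrite /derivable /derive E.
Qed.

Lemma is_derive_shift_line f x (v : plane R) (t : R) d :
  is_derive (t *: v + x) v f d -> is_derive t (1 : R) (fun t : R => f (t *: v + x)) d.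
Proof.
move=> /is_derive_along H.
have E : (fun h : R => h^-1 *: (((fun t : R => f (t *: v + x)) \o shift t) (h *: (1 : R)) -
      (fun t : R => f (t *: v + x)) t)) =
  (fun h : R => h^-1 *: (((fun s : R => f (s *: v + (t *: v + x))) \o shift 0) (h *: (1 : R)) -
      (fun s : R => f (s *: v + (t *: v + x))) 0)).
  by apply/funext => h; rewrite /= addr0 scale0r add0r scalerDl addrA.
by case: H => d1 d2; split; move: d1 d2; rewrite /derivable /derive E.
Qed.

Lemma is_derive_comp1 (h : R -> R) f x (v : plane R) d e :
  is_derive x v f d -> is_derive (f x) (1 : R) h e -> is_derive x v (fun y => h (f y)) (e * d).
Proof.
move=> /is_derive_along df dh; apply/is_derive_along.
pose F := fun t : R => f (t *: v + x).
have F0 : F 0 = f x by rewrite /F scale0r add0r.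
by rewrite -F0 in dh; exact: (is_derive1_comp dh df).
Qed.

Lemma Cn_comp1 n O J (h : R -> R) f : (forall x, O x -> J (f x)) -> Dn n.+1 J h -> Cn n O f ->
  Cn n O (fun x => h (f x)).
Proof.
have ch J' (h' : R -> R) m : Dn m.+1 J' h' -> forall t, J' t -> {for t, continuous h'}.
  by move=> [g dg _] t /dg[d _]; exact/differentiable_continuous/derivable1_diffP.
elim: n h f => [|n IH] h f OJ Dh Cf.
  split=> // x Ox; apply: (continuous_comp (f := f) (g := h)).
    exact: Cn_cont Cf _ Ox.
  exact: ch Dh _ (OJ _ Ox).
split.
  move=> x Ox; apply: (continuous_comp (f := f) (g := h)).
    exact: Cn_cont Cf _ Ox.
  exact: ch Dh _ (OJ _ Ox).
have Cf' := Cn_le Cf.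
have [h' dh Dh'] := Dh; have [_ Hf] := Cf => i; have [f' df Df] := Hf i.
exists (fun x => h' (f x) * f' x); last by apply: CnM => //; exact: IH.
by move=> x Ox; apply: is_derive_comp1; [exact: df|apply: dh; exact: OJ].
Qed.

Lemma Cn_smooth1 n O J (h : R -> R) f : (forall x, O x -> J (f x)) -> smooth1 J h -> Cn n O f ->
  Cn n O (fun x => h (f x)).
Proof. by move=> OJ hh; apply: (Cn_comp1 OJ). Qed.

Lemma cont_line f g (v : plane R) : (forall x, is_derive x v f (g x)) ->
  forall x (a b : R), {within `[a, b], continuous (fun t : R => f (t *: v + x))}.
Proof.
move=> df x a b; apply: continuous_subspaceT => t.
have [d _] := is_derive_shift_line (df (t *: v + x)).
exact/differentiable_continuous/derivable1_diffP.
Qed.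

(** The mean value theorem in a coordinate direction, which dominates the
difference quotients in [conv_derive]. *)
Lemma MVT_line f g (v : plane R) : (forall x, is_derive x v f (g x)) ->
  forall x (h : R), exists2 c : R, `|c| <= `|h| & f (h *: v + x) - f x = h * g (c *: v + x).
Proof.
move=> df x h; pose F := fun t : R => f (t *: v + x).
have dF t : is_derive t (1 : R) F (g (t *: v + x)) by exact: is_derive_shift_line.
have F0 : F 0 = f x by rewrite /F scale0r add0r.
have [h0|h0] := leP 0 h.
  have [c] := @MVT_segment R F (fun t => g (t *: v + x)) 0 h h0 (fun t _ => dF t)
    (@cont_line f g v df x 0 h).
  rewrite in_itv /= => /andP[c0 ch] E; exists c; first by rewrite !ger0_norm// (le_trans c0).
  by move: E; rewrite F0 /F subr0 mulrC.
have [c] := @MVT_segment R F (fun t => g (t *: v + x)) h 0 (ltW h0) (fun t _ => dF t)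
    (@cont_line f g v df x h 0).
rewrite in_itv /= => /andP[hc c0] E; exists c.
  by rewrite !ler0_norm// ?lerN2// ltW.
by rewrite -/(F h) -F0 -opprB E sub0r mulrN opprK mulrC.
Qed.

Lemma bounded_supp f (M : R) : continuous f -> (forall x, M < `|x| -> f x = 0) ->
  exists2 B : R, 0 <= B & forall x, `|f x| <= B.
Proof.
move=> cf f0.
have [[x0]|] := pselect (exists x0 : plane R, `|x0| <= M); last first.
  move=> H; exists 0 => // x; rewrite f0 ?normr0// ltNge; apply/negP => xM.
  by apply: H; exists x.
move=> x0M; pose K := [set x : plane R | `|x| <= M].
have cK : compact K.
  apply: (@compact_bounded_closed _ _ M) => //.
  by apply: (@closed_comp _ _ (fun x : plane R => `|x|) [set y | y <= M]);
    [move=> *; exact: norm_continuous|exact: closed_le].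
have [x /set_mem Kx Hx] : exists2 x, x \in K & forall y, y \in K -> `|f y| <= `|f x|.
  apply: (@compact_EVT_max _ _ (fun x => `|f x|)) => //; first by exists x0.
  apply: continuous_subspaceT => x; apply: continuous_comp; first exact: cf.
  exact: norm_continuous.
exists `|f x| => // y; have [yM|My] := leP `|y| M; last by rewrite f0 ?normr0.
by apply: Hx; rewrite inE.
Qed.

Definition bx (a b c d : R) : set (plane R) := `]a, b]%classic `*` `]c, d]%classic.

(** Boxes with rational centre and radius: a countable base of the topology,
used for measurability and for gluing statements that hold almost everywhere. *)
Definition rbx (u : rat * rat * nat) : set (plane R) :=
  bx (ratr u.1.1 - u.2.+1%:R^-1) (ratr u.1.1 + u.2.+1%:R^-1)
     (ratr u.1.2 - u.2.+1%:R^-1) (ratr u.1.2 + u.2.+1%:R^-1).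

Lemma rbx_near x (e : R) : 0 < e -> exists2 u, rbx u x &
  forall y, rbx u y -> modulus (of_plane y - of_plane x) < e.
Proof.
move=> e0; pose n := Num.trunc (4 / e).
have ne : n.+1%:R^-1 < e / 4.
  rewrite -[e / 4]invrK ltf_pV2 ?posrE ?invr_gt0 ?divr_gt0// invfM invrK mulrC.
  exact: truncnS_gt.
have np : 0 < n.+1%:R^-1 :> R by rewrite invr_gt0.
have [q1] : exists q : rat, ratr q \in `](x.1 - n.+1%:R^-1), (x.1 + n.+1%:R^-1)[.
  by apply: rat_in_itvoo; rewrite ltrBlDr -addrA ltrDl addr_gt0.
have [q2] : exists q : rat, ratr q \in `](x.2 - n.+1%:R^-1), (x.2 + n.+1%:R^-1)[.
  by apply: rat_in_itvoo; rewrite ltrBlDr -addrA ltrDl addr_gt0.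
rewrite !in_itv /= -!lter_distl => h2 h1; exists (q1, q2, n).
  have := h1; rewrite distrC ltr_distl => /andP[a1 a2].
  have := h2; rewrite distrC ltr_distl => /andP[b1 b2].
  by split; rewrite /= in_itv /=; [rewrite a1 (ltW a2)|rewrite b1 (ltW b2)].
move=> y [] /=; rewrite !in_itv /= => /andP[y1 y1'] /andP[y2 y2'].
rewrite -of_planeB; apply: le_lt_trans (modulus_le _) _ => /=.
have k1 := ler_distD (ratr q1) y.1 x.1; have k2 := ler_distD (ratr q2) y.2 x.2.
have z1 : `|y.1 - ratr q1| <= n.+1%:R^-1 by rewrite ler_distl ltW.
have z2 : `|y.2 - ratr q2| <= n.+1%:R^-1 by rewrite ler_distl ltW.
have : `|y.1 - x.1| < e / 2.
  by have := le_lt_trans z1 ne; have := lt_trans h1 ne; move: k1; lra.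
have : `|y.2 - x.2| < e / 2.
  by have := le_lt_trans z2 ne; have := lt_trans h2 ne; move: k2; lra.
lra.
Qed.

Lemma open_measurable_plane O : open O -> measurable O.
Proof.
move=> oO.
pose F (n : nat) : set (plane R) := if unpickle n is Some u then
  (if pselect (rbx u `<=` O) then rbx u else set0) else set0.
have -> : O = \bigcup_n F n.
  apply/seteqP; split=> [x Ox|x [n _]]; last first.
    by rewrite /F; case: (unpickle n) => // u; case: pselect => // h /h.
  have [e e0 He] := (open_planeP O).1 oO x Ox.
  have [u ux uO] := rbx_near x e0.
  have FE : F (pickle u) = rbx u.
    by rewrite /F pickleK; case: pselect => // -[]; move=> y /uO/He.
  by refine (ex_intro2 _ _ (pickle u) I _); rewrite FE.
apply: bigcupT_measurable => n; rewrite /F; case: (unpickle n) => [u|//].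
case: pselect => h; first by apply: measurableX; exact: measurable_itv.
exact: measurable0.
Qed.

Lemma continuous_measurable_plane f : continuous f -> measurable_fun setT f.
Proof.
move=> cf; apply: (measurability _ (RGenOpens.measurableE R)).
move=> _ [_ [a [b ->]] <-]; rewrite setTI; apply: open_measurable_plane.
by apply: open_comp.
Qed.

End PlaneCalculus.

(** * Integrals over the plane and convolution *)

Section PlaneIntegral.
Context {R : realType}.
Implicit Types (f g w ka : plane R -> R).
Local Notation mu2 := (leb2 R).

Definition itg f := mu2.-integrable setT (EFin \o f).
Definition pint f : R := \int[mu2]_(x in setT) f x.

Lemma itg_measurable f : itg f -> measurable_fun setT f.
Proof. by move=> /integrableP[mf _]; exact/measurable_EFinP. Qed.

Lemma itgD f g : itg f -> itg g -> itg (fun x => f x + g x).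
Proof.
move=> hf hg; rewrite /itg (_ : EFin \o _ = (fun x => (f x)%:E + (g x)%:E)%E); last exact/funext.
exact: integrableD.
Qed.

Lemma itgZ c f : itg f -> itg (fun x => c * f x).
Proof.
move=> hf; rewrite /itg (_ : EFin \o _ = (fun x => c%:E * (EFin \o f) x)%E); last exact/funext.
exact: integrableZl.
Qed.

Lemma itgB f g : itg f -> itg g -> itg (fun x => f x - g x).
Proof.
move=> hf hg; rewrite (_ : (fun x => _) = (fun x => f x + -1 * g x)).
  by apply: itgD => //; exact: itgZ.
by apply/funext => x; rewrite mulN1r.
Qed.

Lemma itg_abs f : itg f -> itg (fun x => `|f x|).
Proof. by move=> hf; exact: (integrable_norm hf). Qed.

Lemma itg_le f g : measurable_fun setT f -> itg g -> (forall x, `|f x| <= g x) -> itg f.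
Proof.
move=> mf hg fg; apply: (le_integrable _ _ _ hg) => //; first exact/measurable_EFinP.
by move=> x _ /=; rewrite lee_fin (le_trans (fg x))// ler_norm.
Qed.

Lemma itg_mul w ka (B : R) : itg w -> measurable_fun setT ka -> (forall x, `|ka x| <= B) ->
  itg (fun x => w x * ka x).
Proof.
move=> hw mk kB; apply: (@itg_le _ (fun x => B * `|w x|)).
- by apply: measurable_funM => //; exact: itg_measurable.
- by apply: itgZ; exact: itg_abs.
- by move=> x; rewrite normrM mulrC ler_wpM2r.
Qed.

Lemma pintD f g : itg f -> itg g -> pint (fun x => f x + g x) = pint f + pint g.
Proof. by move=> hf hg; exact: RintegralD. Qed.

Lemma pintZ c f : itg f -> pint (fun x => c * f x) = c * pint f.
Proof. by move=> hf; exact: RintegralZl. Qed.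

Lemma pintB f g : itg f -> itg g -> pint (fun x => f x - g x) = pint f - pint g.
Proof. by move=> hf hg; exact: RintegralB. Qed.

Lemma pint_ext f g : (forall x, f x = g x) -> pint f = pint g.
Proof. by move=> fg; congr pint; exact/funext. Qed.

Lemma pint_le f g : itg f -> itg g -> (forall x, f x <= g x) -> pint f <= pint g.
Proof. by move=> hf hg fg; apply: le_Rintegral => // x _; exact: fg. Qed.

Lemma pint_abs_le f : itg f -> `|pint f| <= pint (fun x => `|f x|).
Proof. by move=> hf; exact: le_normr_Rintegral. Qed.

Lemma pint_mul_le w ka (B : R) : itg w -> measurable_fun setT ka -> (forall x, `|ka x| <= B) ->
  `|pint (fun x => w x * ka x)| <= B * pint (fun x => `|w x|).
Proof.
move=> hw mk kB; have h := itg_mul hw mk kB.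
apply: (le_trans (pint_abs_le h)); rewrite -pintZ; last exact: itg_abs.
apply: pint_le; [exact: itg_abs|by apply: itgZ; exact: itg_abs|].
by move=> x; rewrite normrM mulrC ler_wpM2r.
Qed.

Lemma pint_ge0 f : (forall x, 0 <= f x) -> 0 <= pint f.
Proof. by move=> f0; exact: Rintegral_ge0. Qed.

Lemma pint_dominated (f_ : nat -> plane R -> R) f g :
  (forall n, measurable_fun setT (f_ n)) -> measurable_fun setT f -> itg g ->
  (forall n x, `|f_ n x| <= g x) -> {ae mu2, forall x, f_ ^~ x @ \oo --> f x} ->
  pint (f_ n) @[n --> \oo] --> pint f.
Proof.
move=> mf_ mf hg fg cf.
have [||||i1 _ i2] := @dominated_convergence _ _ _ mu2 setT measurableT
    (fun n => EFin \o f_ n) (EFin \o f) (EFin \o g) _ _ _ hg _.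
- by move=> n; have /measurable_EFinP := mf_ n.
- by have /measurable_EFinP := mf.
- case: cf => N [mN N0 sub]; exists N; split=> // x /= H; apply: sub => /= cx; apply: H => _.
  by apply/cvg_EFin => //; exact: nearW.
- by apply: aeW => x n _ /=; rewrite lee_fin.
move: i2; rewrite /pint /Rintegral.
by rewrite -(fineK (integrable_fin_num measurableT i1)) => /fine_cvg.
Qed.

Definition conv w ka x : R := pint (fun y : plane R => w y * ka (x - y)).

Lemma shift_continuous ka x : continuous ka -> continuous (fun y : plane R => ka (x - y)).
Proof.
move=> ck y; apply: (continuous_comp (f := fun y : plane R => x - y) (g := ka)); last exact: ck.
by apply: continuousB; [exact: cst_continuous|move=> ?].
Qed.

Lemma shift_measurable ka x : continuous ka -> measurable_fun setT (fun y : plane R => ka (x - y)).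
Proof. by move=> ck; apply: continuous_measurable_plane; exact: shift_continuous. Qed.

Lemma dir_decomp (z : plane R) : z = z.1 *: dir 0 + z.2 *: dir 1.
Proof.
case: z => a b; congr pair => /=; rewrite /GRing.scale /=.
  by rewrite mulr1 mulr0 addr0.
by rewrite mulr0 mulr1 add0r.
Qed.

Lemma derive_supp ka g (v : plane R) (M : R) : (forall z, is_derive z v ka (g z)) ->
  (forall z, M < `|z| -> ka z = 0) -> forall z, M < `|z| -> g z = 0.
Proof.
move=> dg k0 z Mz; have [_ <-] := dg z.
rewrite (@near_eq_derive _ _ _ ka (fun _ => 0) z v) ?derive_cst//.
near=> y; apply: k0; near: y.
have : open [set y : plane R | M < `|y|].
  by apply: (@open_comp _ _ (fun x : plane R => `|x|) [set y | M < y]);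
    [move=> *; exact: norm_continuous|exact: open_gt].
by move=> o; apply: open_nbhs_nbhs.
Unshelve. all: by end_near. Qed.

Lemma Cn_continuous n ka : Cn n setT ka -> continuous ka.
Proof. by move=> h z; exact: Cn_cont h z I. Qed.

Lemma conv_continuous w ka (M : R) : itg w -> Cn 1 setT ka ->
  (forall z, M < `|z| -> ka z = 0) -> continuous (conv w ka).
Proof.
move=> hw [ck dk] k0.
pose W := pint (fun x => `|w x|).
have W0 : 0 <= W by apply: pint_ge0.
have [g0 d0 C0] := dk 0; have [g1 d1 C1] := dk 1.
have [B0 B00 HB0] := bounded_supp (@Cn_continuous 0 _ C0) (derive_supp (fun z => d0 z I) k0).
have [B1 B10 HB1] := bounded_supp (@Cn_continuous 0 _ C1) (derive_supp (fun z => d1 z I) k0).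
have [B B_0 HB] := bounded_supp (fun z => ck z I) k0.
have lip (y z : plane R) : `|ka (z + y) - ka y| <= (B0 + B1) * `|z|.
  have [c0 _ E0] := MVT_line (fun z => d0 z I) (z.2 *: dir 1 + y) z.1.
  have [c1 _ E1] := MVT_line (fun z => d1 z I) y z.2.
  have E : z + y = z.1 *: dir 0 + (z.2 *: dir 1 + y) :> plane R.
    by rewrite addrA; congr (_ + y); exact: dir_decomp.
  have -> : ka (z + y) - ka y = (ka (z.1 *: dir 0 + (z.2 *: dir 1 + y)) - ka (z.2 *: dir 1 + y))
      + (ka (z.2 *: dir 1 + y) - ka y).
    by rewrite E; ring.
  rewrite E0 E1 (le_trans (ler_normD _ _))// !normrM.
  have z1 : `|z.1| <= `|z| by rewrite plane_norm le_max lexx.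
  have z2 : `|z.2| <= `|z| by rewrite plane_norm le_max lexx orbT.
  have h1 : `|z.1| * `|g0 (c0 *: dir 0 + (z.2 *: dir 1 + y))| <= `|z| * B0 by rewrite ler_pM.
  have h2 : `|z.2| * `|g1 (c1 *: dir 1 + y)| <= `|z| * B1 by rewrite ler_pM.
  by apply: (le_trans (lerD h1 h2)); rewrite -mulrDr mulrC.
move=> x; apply/cvgrPdist_le => e e0.
have K1 : 0 < (B0 + B1) * W + 1 by rewrite ltr_wpDl// mulr_ge0// addr_ge0.
apply/nbhs_planeP; exists (e / ((B0 + B1) * W + 1)); first by rewrite divr_gt0.
move=> x'; rewrite -of_planeB => hx'.
have mk z : measurable_fun setT (fun y : plane R => ka (z - y)).
  by apply: shift_measurable => u; exact: ck.
rewrite distrC /conv -pintB; try by apply: (itg_mul hw (mk _)) => y; exact: HB.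
rewrite (@pint_ext _ (fun y => w y * (ka (x' - y) - ka (x - y)))); last by move=> y; ring.
apply: (le_trans (@pint_mul_le _ _ ((B0 + B1) * `|x' - x|) hw _ _)).
- by apply: measurable_funB.
- move=> y; have -> : x' - y = (x' - x) + (x - y) by rewrite addrA subrK.
  exact: lip.
- have h1 := le_lt_trans (plane_norm_modulus (x' - x)) hx'.
  rewrite ltr_pdivlMr// in h1; rewrite -/W.
  have := normr_ge0 (x' - x); move: h1; set q := `|x' - x|; nra.
Qed.

(** The difference quotients of [ka] are bounded by those of the mean value
theorem and converge to [g]; dominated convergence applies. *)
Lemma conv_derive w ka g i (M : R) : itg w -> Cn 2 setT ka ->
  (forall z, M < `|z| -> ka z = 0) -> (forall z, is_derive z (dir i) ka (g z)) ->
  Cn 1 setT g -> forall x, is_derive x (dir i) (conv w ka) (conv w g x).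
Proof.
move=> hw Ck k0 dg Cg x.
pose W := pint (fun x => `|w x|).
have W0 : 0 <= W by apply: pint_ge0.
have g0 := derive_supp dg k0.
have [g' dgg Cg'] := Cg.2 i.
have cg := Cn_continuous Cg; have ck := Cn_continuous Ck.
have [B B0 HB] := bounded_supp (@Cn_continuous 0 _ Cg') (derive_supp (fun z => dgg z I) g0).
have [B1 B10 HB1] := bounded_supp ck k0.
have [B2 B20 HB2] := bounded_supp cg g0.
have mk z : measurable_fun setT (fun y : plane R => ka (z - y)) by exact: shift_measurable.
have mg z : measurable_fun setT (fun y : plane R => g (z - y)) by exact: shift_measurable.
have cv : h^-1 *: ((conv w ka \o shift x) (h *: dir i) - conv w ka x)
    @[h --> (0 : R)^'] --> conv w g x.
  apply/cvgrPdist_le => e e0.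
  have K1 : 0 < B * W + 1 by rewrite ltr_wpDl// mulr_ge0.
  have eK : 0 < e / (B * W + 1) by rewrite divr_gt0.
  near=> h.
  have h0 : h != 0 by near: h; exact: nbhs_dnbhs_neq.
  have he : `|h| <= e / (B * W + 1) by near: h; apply: dnbhs0_le.
  have hp : 0 < `|h| by rewrite normr_gt0.
  rewrite ler_pdivlMr// in he.
  have ik z : itg (fun y => w y * ka (z - y)) by apply: (itg_mul hw (mk z)) => y; exact: HB1.
  have ig : itg (fun y => w y * g (x - y)) by apply: (itg_mul hw (mg x)) => y; exact: HB2.
  rewrite /= /GRing.scale /= distrC /conv -pintB// -pintZ; last exact: itgB.
  rewrite -pintB//; last by apply: itgZ; exact: itgB.
  rewrite (@pint_ext _ (fun y => w y *
     (h^-1 * (ka (h *: dir i + x - y) - ka (x - y)) - g (x - y)))); last by move=> y; ring.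
  apply: (le_trans (@pint_mul_le _ _ (B * `|h|) hw _ _)).
  - apply: measurable_funB => //; apply: measurable_funM => //.
    by apply: measurable_funB.
  - move=> y; rewrite -addrA.
    have [c ch ->] := MVT_line dg (x - y) h.
    have [c' cc ->]: exists2 c' : R, `|c'| <= `|c| &
        h^-1 * (h * g (c *: dir i + (x - y))) - g (x - y) = c * g' (c' *: dir i + (x - y)).
      have [c' cc E] := MVT_line (fun z => dgg z I) (x - y) c.
      by exists c' => //; rewrite mulrA mulVf// mul1r.
    by rewrite normrM mulrC ler_pM.
  - by rewrite -/W; move: he hp; set q := `|h|; nra.
by apply: DeriveDef; [apply/cvg_ex; exists (conv w g x)|apply/cvg_lim].
Unshelve. all: by end_near. Qed.

Lemma conv_Cn w : itg w -> forall n ka (M : R), Cn n.+2 setT ka ->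
  (forall z, M < `|z| -> ka z = 0) -> Cn n setT (conv w ka).
Proof.
move=> hw; elim=> [|n IH] ka M Ck k0.
  by split=> // x _; apply: (conv_continuous (M := M)) => //; exact: Cn_le.
split; first by move=> x _; apply: (conv_continuous (M := M)) => //; apply: (Cn_leq _ Ck).
move=> i; have [ck dk] := Ck; have [g dg Cg] := dk i.
have g0 := derive_supp (fun z => dg z I) k0.
exists (conv w g); last exact: IH Cg g0.
move=> x _; apply: (conv_derive (M := M)) => //.
- exact: (@Cn_leq _ 2 n.+3 _ _ _ Ck).
- by move=> z; exact: dg.
- exact: (@Cn_leq _ 1 n.+2 _ _ _ Cg).
Qed.

End PlaneIntegral.

(** * Radial solutions of the Helmholtz equation *)

Section RadialSolutions.
Context {R : realType}.
Local Notation C := R[i].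
Implicit Types a : nat -> C.

Definition rser a (t : R) : R := complex.Re (psum a (t%:C)%C).

Lemma Re_realM (t : R) (z : C) : complex.Re ((t%:C)%C * z) = t * complex.Re z.
Proof. by case: z => x y; rewrite /= mul0r subr0. Qed.

Lemma rser_derive a t : entire a -> is_derive t (1 : R) (rser a) (rser (cdiff a) t).
Proof.
move=> ha; have := entire_hasder (t%:C)%C ha; rewrite entire_der//.
set l := psum _ _ => -[M [d [M0 d0 H]]].
have cv : h^-1 *: ((rser a \o shift t) (h *: (1 : R)) - rser a t)
    @[h --> (0 : R)^'] --> rser (cdiff a) t.
  apply/cvgrPdist_le => e e0.
  have eM : 0 < e / (M + 1) by rewrite divr_gt0// ltr_wpDl.
  near=> h.
  have h0 : h != 0 by near: h; exact: nbhs_dnbhs_neq.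
  have hd : `|h| < d by near: h; apply: dnbhs0_lt.
  have he : `|h| <= e / (M + 1) by near: h; apply: dnbhs0_le.
  have hp : 0 < `|h| by rewrite normr_gt0.
  have := H (h%:C)%C; rewrite modulus_real => /(_ hd) k.
  have := le_trans (modulus_Re _) k; rewrite /= scaler1 /GRing.scale /= distrC.
  have -> : complex.Re (psum a ((t%:C)%C + (h%:C)%C) - psum a (t%:C)%C - l * (h%:C)%C) =
     rser a (h + t) - rser a t - h * rser (cdiff a) t.
    rewrite !raddfB /= -[(h%:C)%C]/(real_complex R h) -[(t%:C)%C]/(real_complex R t) -rmorphD [t + h]addrC.
    by rewrite [l * _]mulrC Re_realM.
  move=> k2; rewrite -[X in `|X|](mulKf h0) normrM normfV.
  rewrite mulrBr mulVKf// mulrC ler_pdivrMr//; apply: (le_trans k2).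
  rewrite ler_pdivlMr ?ltr_wpDl// in he.
  by rewrite expr2 mulrA ler_wpM2r//; move: he hp; set q := `|h|; nra.
by apply: DeriveDef; [apply/cvg_ex; exists (rser (cdiff a) t)|apply/cvg_lim].
Unshelve. all: by end_near. Qed.

Lemma smooth1_rser a : entire a -> smooth1 setT (rser a).
Proof.
move=> ha n; elim: n a ha => // n IH a ha; exists (rser (cdiff a)).
  by move=> t _; exact: rser_derive.
by apply: IH; exact: entire_diff.
Qed.

(** Bessel's equation in the variable s = |x|^2, on coefficients. *)
Lemma rser_bessel a e t : entire a -> (forall n, n.+1%:R ^+ 2 * a n.+1 = e n) ->
  t * rser (cdiff (cdiff a)) t + rser (cdiff a) t = rser e t.
Proof.
move=> ha ae; rewrite /rser -Re_realM -raddfD /=; congr complex.Re; apply/esym.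
apply: psum_unique.
have h1 := csumto_shift (entire_psumP (t%:C)%C (entire_diff (entire_diff ha))).
have h2 := entire_psumP (t%:C)%C (entire_diff ha).
rewrite addrC; apply: csumto_eq (csumto_lin (t%:C)%C h2 h1) => -[|n].
  by rewrite mulr0 addr0 -ae /cdiff expr1n.
by rewrite -ae /cdiff exprS -[n.+2%:R]natr1; ring.
Qed.

Lemma entire_lin a e (c : C) : entire a -> entire e -> entire (fun n => a n + c * e n).
Proof.
move=> ha he r r0; have [M HM] := ha r r0; have [N HN] := he r r0.
exists (M + modulus c * N) => n.
have rn : 0 <= r ^+ n by rewrite exprn_ge0// ltW.
apply: (le_trans (ler_wpM2r rn (modulusD _ _))); rewrite modulusM mulrDl.
by apply: lerD; [exact: HM|rewrite -mulrA ler_wpM2l ?modulus_ge0//; exact: HN].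
Qed.

Lemma rser_lin a e (c t : R) : entire a -> entire e ->
  rser (fun n => a n + (c%:C)%C * e n) t = rser a t + c * rser e t.
Proof.
move=> ha he; rewrite /rser -Re_realM -raddfD /=; congr complex.Re.
apply: psum_unique.
apply: csumto_eq (csumto_lin (c%:C)%C (entire_psumP (t%:C)%C ha) (entire_psumP (t%:C)%C he)).
by move=> n; ring.
Qed.

Lemma ecoef_rec (c : R) n : n.+1%:R ^+ 2 * ecoef c n.+1 = (c%:C)%C * ecoef c n.
Proof.
rewrite /ecoef -(rmorph_nat (real_complex R)) -[(c%:C)%C]/(real_complex R c).
rewrite -[((_ / _)%:C)%C]/(real_complex R _) -[((_ / _)%:C)%C in RHS]/(real_complex R _).
rewrite -rmorphXn -!rmorphM; congr (_%:C)%C.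
rewrite factS natrM (exprS c); field.
by rewrite !gt_eqF ?fact_gt0R//= nat1r pnatr_eq0.
Qed.

(** The coefficients, with harmonic numbers, of the series that completes
ln s E(s) into a second solution of Bessel's equation. *)
Definition hcoef (c : R) (n : nat) : C :=
  (((- 2 * \sum_(i < n) i.+1%:R^-1) * (c ^+ n / n`!%:R ^+ 2))%:C)%C.

Lemma entire_hcoef (c : R) : entire (hcoef c).
Proof.
apply: (@entire_exp_bound _ _ 2 `|c|) => // n.
rewrite /hcoef modulus_real 3!normrM normrX normrN normfV.
rewrite (@ger0_norm _ 2)// -mulrA ler_wpM2l//.
have f0 := @fact_gt0R R n.
have -> : \sum_(i < n) i.+1%:R^-1 = \sum_(i < n) (i.+1%:R^-1 : R) by [].
have s0 : 0 <= \sum_(i < n) (i.+1%:R^-1 : R) by apply: sumr_ge0 => i _; rewrite invr_ge0.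
have sn : \sum_(i < n) (i.+1%:R^-1 : R) <= n`!%:R.
  apply: (@le_trans _ _ n%:R); last first.
    by rewrite ler_nat; case: n {f0 s0} => // n; rewrite factS leq_pmulr// fact_gt0.
  rewrite -[n in n%:R]card_ord -sumr_const; apply: ler_sum => i _.
  by rewrite invf_le1 ?ltr0n// ler1n.
rewrite (ger0_norm s0) (ger0_norm (exprn_ge0 _ (ltW f0))).
rewrite expr2 invfM mulrCA ler_wpM2l ?exprn_ge0//.
rewrite mulrA -[leRHS]mul1r ler_wpM2r ?invr_ge0//.
by rewrite ler_pdivrMr// mul1r.
Qed.

Lemma hcoef_rec (c : R) n : n.+1%:R ^+ 2 * hcoef c n.+1 =
  (c%:C)%C * hcoef c n + ((- 2)%:C)%C * cdiff (ecoef c) n.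
Proof.
rewrite /hcoef /cdiff /ecoef -(rmorph_nat (real_complex R)).
have rc (x : R) : (x%:C)%C = real_complex R x by [].
rewrite !rc -rmorphXn -!rmorphM -rmorphD; congr (_%:C)%C.
rewrite big_ord_recr /= factS natrM (exprS c); set s := \sum_(_ < _) _.
by field; rewrite !gt_eqF ?fact_gt0R//= nat1r pnatr_eq0.
Qed.

Variable k : R.
Let c := - (k ^+ 2) / 4.
(** The radial solutions of the Helmholtz equation are spanned by [bes0 s] and
[ln s * bes0 s + neu0 s], where s = |x|^2; [neu0] is the series of [hcoef]. *)
Definition bes0 := rser (ecoef c).
Definition bes1 := rser (cdiff (ecoef c)).
Definition bes2 := rser (cdiff (cdiff (ecoef c))).
Definition neu0 := rser (hcoef c).
Definition neu1 := rser (cdiff (hcoef c)).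
Definition neu2 := rser (cdiff (cdiff (hcoef c))).

Lemma bes0_derive t : is_derive t (1 : R) bes0 (bes1 t).
Proof. by apply: rser_derive; exact: entire_ecoef. Qed.
Lemma bes1_derive t : is_derive t (1 : R) bes1 (bes2 t).
Proof. by apply: rser_derive; exact/entire_diff/entire_ecoef. Qed.
Lemma neu0_derive t : is_derive t (1 : R) neu0 (neu1 t).
Proof. by apply: rser_derive; exact: entire_hcoef. Qed.
Lemma neu1_derive t : is_derive t (1 : R) neu1 (neu2 t).
Proof. by apply: rser_derive; exact/entire_diff/entire_hcoef. Qed.

Lemma smooth1_bes : [/\ smooth1 setT bes0, smooth1 setT bes1, smooth1 setT neu0 & smooth1 setT neu1].
Proof.
split; apply: smooth1_rser; [exact: entire_ecoef| |exact: entire_hcoef|].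
  exact/entire_diff/entire_ecoef.
exact/entire_diff/entire_hcoef.
Qed.

Lemma bes_eq t : 4 * (t * bes2 t + bes1 t) + k ^+ 2 * bes0 t = 0.
Proof.
rewrite /bes2 /bes1 (@rser_bessel _ (fun n => (c%:C)%C * ecoef c n)); last 2 first.
- exact: entire_ecoef.
- exact: ecoef_rec.
rewrite /rser psumZ; last exact: entire_ecoef.
by rewrite Re_realM /bes0 /rser /c; lra.
Qed.

Lemma neu_eq t : 4 * (t * neu2 t + neu1 t) + k ^+ 2 * neu0 t = - 8 * bes1 t.
Proof.
have he := entire_ecoef c; have hh := entire_hcoef c.
rewrite /neu2 /neu1 (@rser_bessel _
  (fun n => (c%:C)%C * hcoef c n + ((- 2)%:C)%C * cdiff (ecoef c) n)); last 2 first.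
- exact: hh.
- exact: hcoef_rec.
have hc : entire (fun n => (c%:C)%C * hcoef c n).
  have h0 : entire (fun=> 0 : C) by move=> r r0; exists 0 => n; rewrite modulus0 mul0r.
  rewrite (_ : (fun n => _) = (fun n => 0 + (c%:C)%C * hcoef c n)); first exact: entire_lin.
  by apply/funext => n; rewrite add0r.
rewrite rser_lin//; last exact: entire_diff.
rewrite {1}/rser psumZ//.
by rewrite Re_realM /neu0 /bes1 /rser /c; lra.
Qed.

Lemma bes0_at0 : bes0 0 = 1.
Proof. by rewrite /bes0 /rser E0. Qed.

End RadialSolutions.

Section RadialLaplacian.
Context {R : realType}.

Definition sqd (x : plane R) (y : plane R) : R := (x.1 - y.1) ^+ 2 + (x.2 - y.2) ^+ 2.
Definition sq (x : plane R) : R := x.1 ^+ 2 + x.2 ^+ 2.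

Lemma sq_ge0 x : 0 <= sq x. Proof. by rewrite addr_ge0 ?sqr_ge0. Qed.
Lemma sqdE x y : sqd x y = sq (x - y). Proof. by []. Qed.
Lemma sq_sym (x : plane R) : sq (- x) = sq x. Proof. by rewrite /sq /= !sqrrN. Qed.

Lemma Cn_sqd n O x : Cn n O (sqd x).
Proof.
have h (f : plane R -> R) c : Cn n O f -> Cn n O (fun y => (c - f y) ^+ 2).
  move=> hf; have hB : Cn n O (fun y => c + -1 * f y).
    by apply: CnD; [exact: Cn_cst|apply: CnM => //; exact: Cn_cst].
  rewrite (_ : (fun y => _) = (fun y => (c + -1 * f y) * (c + -1 * f y))); first exact: CnM.
  by apply/funext => y; rewrite mulN1r expr2.
by apply: CnD; apply: h; [exact: Cn_fst|exact: Cn_snd].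
Qed.

Lemma Cn_sq n O : Cn n O sq.
Proof.
have := Cn_sqd n O 0; rewrite (_ : sqd 0 = sq)//; apply/funext => y.
by rewrite /sqd /sq !sub0r !sqrrN.
Qed.

Definition crd (i : 'I_2) (x : plane R) : R := (dir i : plane R).1 * x.1 + (dir i : plane R).2 * x.2.

Lemma dir0E : dir 0 = (1, 0) :> plane R. Proof. by []. Qed.
Lemma dir1E : dir 1 = (0, 1) :> plane R. Proof. by []. Qed.

Lemma quadratic_derive0 (p q r : R) :
  is_derive (0 : R) (1 : R) (fun t : R => p + q * t + r * (t * t)) q.
Proof.
have did : is_derive (0 : R) (1 : R) (fun t : R => t) (1 : R) := is_derive_id (0 : R) (1 : R).
have dl := is_deriveM (is_derive_cst q (0 : R) (1 : R)) did.
have dq := is_deriveM (is_derive_cst r (0 : R) (1 : R)) (is_deriveM did did).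
apply: is_derive_eq (is_deriveD (is_deriveD (is_derive_cst p (0 : R) (1 : R)) dl) dq) _.
by rewrite /GRing.scale /= !mulr0 !mul0r !addr0 add0r mulr1 mulr0 addr0.
Qed.

Lemma crd_derive i x (y : plane R) : is_derive y (dir i) (fun y : plane R => crd i (x - y)) (- 1).
Proof.
apply/is_derive_along.
rewrite (_ : (fun t => _) = (fun t => crd i (x - y) + -1 * t + 0 * (t * t))).
  exact: quadratic_derive0.
apply/funext => t; have [->|->] : i = 0 \/ i = 1.
- by case: i => -[|[|//]] h; [left|right]; apply/val_inj.
- by case: x y => [x1 x2] [y1 y2]; rewrite /crd dir0E /GRing.scale /= [t%:A]mulr1; ring.
- by case: x y => [x1 x2] [y1 y2]; rewrite /crd dir1E /GRing.scale /= [t%:A]mulr1; ring.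
Qed.

Lemma sqd_derive i x (y : plane R) : is_derive y (dir i) (sqd x) (- 2 * crd i (x - y)).
Proof.
apply/is_derive_along.
rewrite (_ : (fun t => _) = (fun t : R => sqd x y + (- 2 * crd i (x - y)) * t + 1 * (t * t))).
  exact: quadratic_derive0.
apply/funext => t; have [->|->] : i = 0 \/ i = 1.
- by case: i => -[|[|//]] h; [left|right]; apply/val_inj.
- by case: x y => [x1 x2] [y1 y2]; rewrite /sqd /crd dir0E /GRing.scale /= [t%:A]mulr1; ring.
- by case: x y => [x1 x2] [y1 y2]; rewrite /sqd /crd dir1E /GRing.scale /= [t%:A]mulr1; ring.
Qed.

Definition lapk (k : R) (f : plane R -> R) (x : plane R) : R :=
  (partials [:: 0; 0] f x + partials [:: 1; 1] f x) + k ^+ 2 * f x.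

Lemma partials2 f g h (O : set (plane R)) i x : open O ->
  (forall y, O y -> is_derive y (dir i) f (g y)) -> O x -> is_derive x (dir i) g h ->
  partials [:: i; i] f x = h.
Proof.
move=> oO df Ox [_ <-]; rewrite /partials /=.
apply: near_eq_derive; near=> y.
by have [|_ <-] := df y; first by near: y; exact: open_nbhs_nbhs.
Unshelve. all: by end_near. Qed.

(** In the variable s = |x - y|^2 the Laplacian of h(s) is 4 (s h'' + h'). *)
Lemma lapk_radial k (x : plane R) (h h1 h2 : R -> R) y :
  (forall y, is_derive (sqd x y) (1 : R) h (h1 (sqd x y))) ->
  (forall y, is_derive (sqd x y) (1 : R) h1 (h2 (sqd x y))) ->
  lapk k (fun y => h (sqd x y)) y =
    4 * (sqd x y * h2 (sqd x y) + h1 (sqd x y)) + k ^+ 2 * h (sqd x y).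
Proof.
move=> dh dh1.
have E i : partials [:: i; i] (fun y => h (sqd x y)) y =
    h2 (sqd x y) * (4 * crd i (x - y) ^+ 2) + 2 * h1 (sqd x y).
  apply: (@partials2 _ (fun y => h1 (sqd x y) * (- 2 * crd i (x - y))) _ setT).
  - exact: openT.
  - by move=> z _; exact: (is_derive_comp1 (sqd_derive i x z) (dh z)).
  - by [].
  - have d1 := is_derive_comp1 (sqd_derive i x y) (dh1 y).
    have d2 := is_deriveM (is_derive_cst (- 2 : R) y (dir i)) (crd_derive i x y).
    apply: is_derive_eq (is_deriveM d1 d2) _.
    change (h1 (sqd x y) * (- 2 * -1 + crd i (x - y) * 0) +
      (- 2 * crd i (x - y)) * (h2 (sqd x y) * (- 2 * crd i (x - y))) =
      h2 (sqd x y) * (4 * crd i (x - y) ^+ 2) + 2 * h1 (sqd x y)).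
    by ring.
rewrite /lapk !E /crd dir0E dir1E /sqd /=; ring.
Qed.

End RadialLaplacian.

(** * The regularized logarithmic kernel *)

Section SmoothAux.
Context {R : realType}.

Lemma smooth1_der (h : R -> R) : smooth1 setT h ->
  exists2 g, (forall t, is_derive t (1 : R) h (g t)) & smooth1 setT g.
Proof.
move=> sh; exists (fun t => 'D_1 h t).
  by move=> t; have [g dg _] := sh 1%N; have := dg t I; case=> d1 _; split.
move=> n; have [g dg Dg] := sh n.+1.
by rewrite (_ : (fun t => _) = g)//; apply/funext => t; have [] := dg t I.
Qed.

Lemma smooth1_cont (h : R -> R) : smooth1 setT h -> continuous h.
Proof.
move=> sh t; have [g dg _] := sh 1%N; have [d _] := dg t I.
exact/differentiable_continuous/derivable1_diffP.
Qed.

Lemma cont_bounded_segment (h : R -> R) (a b : R) : continuous h ->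
  exists2 B : R, 0 <= B & forall t, a <= t -> t <= b -> `|h t| <= B.
Proof.
move=> ch; have [ab|ba] := leP a b; last first.
  by exists 0 => // t h1 h2; move: (le_lt_trans (le_trans h1 h2) ba); rewrite ltxx.
have [c _ Hc] : exists2 c, c \in `[a, b] & forall t, t \in `[a, b] -> `|h t| <= `|h c|.
  apply: (@EVT_max _ (fun t => `|h t|)) => //.
  apply: continuous_subspaceT => t; apply: continuous_comp; first exact: ch.
  exact: norm_continuous.
by exists `|h c| => // t h1 h2; apply: Hc; rewrite in_itv /= h1.
Qed.

Lemma derive_cst_near (h g : R -> R) (t c : R) : is_derive t (1 : R) h (g t) ->
  (\forall s \near t, h s = c) -> g t = 0.
Proof.
move=> [_ <-] hc; rewrite (@near_eq_derive _ _ _ h (fun _ => c) t 1)//.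
exact: derive_cst.
Qed.

Lemma quarter_lt (a : R) : 0 < a -> a / 4 < a / 2.
Proof. lra. Qed.

Lemma quarter_pos (a s : R) : 0 < a -> - (a / 4) < s -> 0 < s + a.
Proof. lra. Qed.

Lemma quarter_gt (a s : R) : 0 < a -> a / 4 < s -> 0 < s.
Proof. lra. Qed.

Lemma half_le (a s : R) : 0 < a -> a <= s -> a / 2 <= s.
Proof. lra. Qed.

End SmoothAux.

Section LogKernel.
Context {R : realType}.
Variables (k a b : R).
Hypotheses (a0 : 0 < a) (ab : a < b).
Local Notation A := (bes0 k).
Local Notation A1 := (bes1 k).
Local Notation A2 := (bes2 k).
Local Notation B := (neu0 k).
Local Notation B1 := (neu1 k).
Local Notation B2 := (neu2 k).
Local Notation chi := (sstep a b).
Variables (chi1 chi2 : R -> R).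
Hypotheses (dchi : forall t, is_derive t (1 : R) chi (chi1 t))
  (dchi1 : forall t, is_derive t (1 : R) chi1 (chi2 t))
  (schi1 : smooth1 setT chi1) (schi2 : smooth1 setT chi2).

(** The truncated logarithmic solution in the variable s = |x - y|^2;
[d > 0] removes the singularity. *)
Definition klog (d s : R) : R := chi s * (A s * ln (s + d) + B s).
(** The part of (Delta + k^2) [klog] that concentrates at 0 as d tends to 0. *)
Definition kmain (d s : R) : R := 4 * chi s * A s * (d * ((s + d)^-1 * (s + d)^-1)).
Definition kg1 (s : R) : R := 4 * ((s * chi2 s + chi1 s) * A s + 2 * (s * chi1 s * A1 s)).
Definition kg2 (s : R) : R := 4 * ((s * chi2 s + chi1 s) * B s + 2 * (s * chi1 s * B1 s)).
Definition kg3 (s : R) : R := 8 * (s * chi1 s * A s).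
(** The remaining part: terms with derivatives of the truncation, which
vanish for s < a, and a term that is bounded and tends to 0 for s > 0. *)
Definition krest (d s : R) : R :=
  - 8 * (chi s * A1 s) * (d * (s + d)^-1) + (kg1 s * ln (s + d) + kg2 s + kg3 s * (s + d)^-1).

Let sA : smooth1 setT A. Proof. by have [] := smooth1_bes k. Qed.
Let sA1 : smooth1 setT A1. Proof. by have [] := smooth1_bes k. Qed.
Let sB : smooth1 setT B. Proof. by have [] := smooth1_bes k. Qed.
Let sB1 : smooth1 setT B1. Proof. by have [] := smooth1_bes k. Qed.
Let schi : smooth1 setT chi. Proof. exact: smooth1_sstep. Qed.

Let chi1_lt s : s < a -> chi1 s = 0.
Proof.
move=> sa; apply: (derive_cst_near (c := 1) (dchi s)); near=> t.
by apply: sstep1 => //; apply: ltW; near: t; exact: lt_nbhsl.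
Unshelve. all: by end_near. Qed.
Let chi1_gt s : b < s -> chi1 s = 0.
Proof.
move=> sa; apply: (derive_cst_near (c := 0) (dchi s)); near=> t.
by apply: sstep0 => //; apply: ltW; near: t; exact: lt_nbhsr.
Unshelve. all: by end_near. Qed.
Let chi2_lt s : s < a -> chi2 s = 0.
Proof.
move=> sa; apply: (derive_cst_near (c := 0) (dchi1 s)); near=> t.
by apply: chi1_lt; near: t; exact: lt_nbhsl.
Unshelve. all: by end_near. Qed.
Let chi2_gt s : b < s -> chi2 s = 0.
Proof.
move=> sa; apply: (derive_cst_near (c := 0) (dchi1 s)); near=> t.
by apply: chi1_gt; near: t; exact: lt_nbhsr.
Unshelve. all: by end_near. Qed.

Let kg_lt s : s < a -> [/\ kg1 s = 0, kg2 s = 0 & kg3 s = 0].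
Proof. by move=> sa; rewrite /kg1 /kg2 /kg3 chi1_lt// chi2_lt//; split; ring. Qed.
Let kg_gt s : b < s -> [/\ kg1 s = 0, kg2 s = 0 & kg3 s = 0].
Proof. by move=> sa; rewrite /kg1 /kg2 /kg3 chi1_gt// chi2_gt//; split; ring. Qed.

Lemma smooth1_kg : [/\ smooth1 setT kg1, smooth1 setT kg2 & smooth1 setT kg3].
Proof.
have sid : smooth1 setT (@id R) := smooth1_id _.
have sc c : smooth1 setT (fun _ : R => c) := smooth1_cst _ c.
have h : smooth1 setT (fun s => s * chi2 s + chi1 s) by apply: smooth1D => //; exact: smooth1M.
have h1 : smooth1 setT (fun s => s * chi1 s) by exact: smooth1M.
split.
- apply: smooth1M => //; apply: smooth1D; first exact: smooth1M.
  by apply: smooth1M => //; exact: smooth1M.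
- apply: smooth1M => //; apply: smooth1D; first exact: smooth1M.
  by apply: smooth1M => //; exact: smooth1M.
- by apply: smooth1M => //; exact: smooth1M.
Qed.

Lemma klog_gt d s : b < s -> klog d s = 0.
Proof. by move=> bs; rewrite /klog sstep0 ?mul0r// ltW. Qed.
Lemma kmain_gt d s : b < s -> kmain d s = 0.
Proof. by move=> bs; rewrite /kmain sstep0 ?mulr0 ?mul0r// ltW. Qed.
Lemma krest_gt d s : b < s -> krest d s = 0.
Proof.
move=> bs; have [e1 e2 e3] := kg_gt bs.
by rewrite /krest e1 e2 e3 sstep0 ?(ltW bs)//; ring.
Qed.

Let J (d : R) : set R := [set s | 0 < s + d].
Let sJ d (h : R -> R) : smooth1 setT h -> smooth1 (J d) h.
Proof. exact: smooth1_sub. Qed.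
Let sshift d : smooth1 (J d) (fun s => s + d).
Proof. by apply: smooth1D; [exact: smooth1_id|exact: smooth1_cst]. Qed.
Let slog d : smooth1 (J d) (fun s => ln (s + d)).
Proof. by apply: (@smooth1_comp _ _ [set t : R | 0 < t]) => //; exact: smooth1_ln. Qed.
Let sinv d : smooth1 (J d) (fun s => (s + d)^-1).
Proof. by apply: (@smooth1_comp _ _ [set t : R | 0 < t]) => //; exact: smooth1_inv. Qed.

Lemma smooth1_kernels d :
  [/\ smooth1 (J d) (klog d), smooth1 (J d) (kmain d) & smooth1 (J d) (krest d)].
Proof.
have [g1 g2 g3] := smooth1_kg.
have sc c : smooth1 (J d) (fun _ : R => c) := smooth1_cst _ c.
split.
- apply: smooth1M; first exact: sJ.
  by apply: smooth1D; [apply: smooth1M|]; try exact: sJ; exact: slog.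
- apply: smooth1M.
    by apply: smooth1M; [apply: smooth1M => //|]; exact: sJ.
  by apply: smooth1M => //; apply: smooth1M; exact: sinv.
- apply: smooth1D.
    apply: smooth1M; first by apply: smooth1M => //; apply: smooth1M; exact: sJ.
    by apply: smooth1M => //; exact: sinv.
  apply: smooth1D; last by apply: smooth1M; [exact: sJ|exact: sinv].
  by apply: smooth1D; [apply: smooth1M; [exact: sJ|exact: slog]|exact: sJ].
Qed.

Lemma klog_lapk d (x y : plane R) : 0 < d ->
  lapk k (fun y => klog d (sqd x y)) y = kmain d (sqd x y) + krest d (sqd x y).
Proof.
move=> d0.
have sp (z : plane R) : 0 < sqd x z + d by rewrite ltr_wpDl// addr_ge0 ?sqr_ge0.
pose F s := A s * ln (s + d) + B s.
pose F1 s := (A s * (s + d)^-1 + ln (s + d) * A1 s) + B1 s.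
pose F2 s := (A s * - ((s + d)^-1 * (s + d)^-1) + (s + d)^-1 * A1 s) +
  (ln (s + d) * A2 s + A1 s * (s + d)^-1) + B2 s.
have dsh (s : R) : is_derive s (1 : R) (fun s => s + d) (1 : R).
  apply: is_derive_eq (is_deriveD (is_derive_id s (1 : R)) (is_derive_cst d s (1 : R))) _.
  by rewrite addr0.
have dln (s : R) : 0 < s + d -> is_derive s (1 : R) (fun s => ln (s + d)) ((s + d)^-1).
  move=> h; have := @is_derive1_comp _ (@ln R) (fun s : R => s + d) s _ _ (is_derive1_ln h) (dsh s).
  by rewrite mulr1.
have dinv (s : R) : 0 < s + d ->
    is_derive s (1 : R) (fun s => (s + d)^-1) (- ((s + d)^-1 * (s + d)^-1)).
  move=> h; have [g dg _] := @smooth1_inv R 1.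
  apply: is_derive_eq (@is_deriveV _ _ _ _ _ _ (dsh s)) _; first by rewrite gt_eqF.
  by rewrite /GRing.scale /= mulr1 -exprVn expr2.
have dF (s : R) : 0 < s + d -> is_derive s (1 : R) F (F1 s).
  move=> h; exact: (is_deriveD (is_deriveM (bes0_derive k s) (dln s h)) (neu0_derive k s)).
have dF1 (s : R) : 0 < s + d -> is_derive s (1 : R) F1 (F2 s).
  move=> h; exact: (is_deriveD (is_deriveD (is_deriveM (bes0_derive k s) (dinv s h))
    (is_deriveM (dln s h) (bes1_derive k s))) (neu1_derive k s)).
have D1 z : is_derive (sqd x z) (1 : R) (klog d)
    (chi (sqd x z) * F1 (sqd x z) + F (sqd x z) * chi1 (sqd x z)).
  exact: (is_deriveM (dchi _) (dF _ (sp z))).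
have D2 z : is_derive (sqd x z) (1 : R) (fun s => chi s * F1 s + F s * chi1 s)
    ((chi (sqd x z) * F2 (sqd x z) + F1 (sqd x z) * chi1 (sqd x z)) +
     (F (sqd x z) * chi2 (sqd x z) + chi1 (sqd x z) * F1 (sqd x z))).
  exact: (is_deriveD (is_deriveM (dchi _) (dF1 _ (sp z)))
    (is_deriveM (dF _ (sp z)) (dchi1 _))).
rewrite (@lapk_radial _ k x (klog d) (fun s => chi s * F1 s + F s * chi1 s)
  (fun s => (chi s * F2 s + F1 s * chi1 s) + (F s * chi2 s + chi1 s * F1 s)) y D1 D2).
have := sp y; set s := sqd x y => sd.
have e1 := bes_eq k s; have e2 := neu_eq k s.
have e3 : (s + d) * (s + d)^-1 = 1 by rewrite divff// gt_eqF.
rewrite /klog /kmain /krest /kg1 /kg2 /kg3 -/(F s).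
rewrite /F /F1 /F2.
set i := (s + d)^-1; set l := ln (s + d).
rewrite -/i in e3.
apply/eqP; rewrite -subr_eq0; apply/eqP.
transitivity (l * chi s * (4 * (s * A2 s + A1 s) + k ^+ 2 * A s)
  + chi s * (4 * (s * B2 s + B1 s) + k ^+ 2 * B s - - 8 * A1 s)
  + (8 * A1 s * chi s - 4 * A s * chi s * i) * ((s + d) * i - 1)); first by ring.
by rewrite e1 e2 e3; ring.
Qed.

Let th := sstep (a / 4) (a / 2).
(** The pointwise limit of [krest] as d tends to 0. The argument of the
logarithm is shifted near 0, where its coefficient vanishes, to make the formula
smooth across s = 0. *)
Definition klim (s : R) : R :=
  kg1 s * ln (s + a * th s) + kg2 s + kg3 s * (s + a * th s)^-1.

Let sth s : - (a / 4) < s -> 0 < s + a * th s.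
Proof.
move=> s0; have ab4 := quarter_lt a0.
have [sa|sa] := leP s (a / 4); first by rewrite /th sstep1// mulr1 (quarter_pos a0).
by apply: ltr_wpDr (quarter_gt a0 sa); rewrite mulr_ge0 ?sstep_ge0 ?(ltW a0).
Qed.

Lemma klim_gt s : b < s -> klim s = 0.
Proof.
by move=> bs; have [e1 e2 e3] := kg_gt bs; rewrite /klim e1 e2 e3; ring.
Qed.

Lemma smooth1_klim : smooth1 [set s | - (a / 4) < s] klim.
Proof.
have [g1 g2 g3] := smooth1_kg.
have sJ' (h : R -> R) : smooth1 setT h -> smooth1 [set s | - (a / 4) < s] h.
  exact: smooth1_sub.
have sL : smooth1 [set s | - (a / 4) < s] (fun s => s + a * th s).
  apply: sJ'; apply: smooth1D; first exact: smooth1_id.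
  by apply: smooth1M; [exact: smooth1_cst|apply: smooth1_sstep; exact: quarter_lt].
apply: smooth1D; last first.
  apply: smooth1M; first exact: sJ'.
  apply: (@smooth1_comp _ _ [set t : R | 0 < t] _ (fun t => t^-1)) => //.
  exact: smooth1_inv.
apply: smooth1D; last exact: sJ'.
apply: smooth1M; first exact: sJ'.
apply: (@smooth1_comp _ _ [set t : R | 0 < t] _ (@ln R)) => //.
exact: smooth1_ln.
Qed.

Lemma klimE s : 0 <= s -> klim s = kg1 s * ln s + kg2 s + kg3 s * s^-1.
Proof.
move=> s0; have [sa|sa] := ltP s a.
  by have [e1 e2 e3] := kg_lt sa; rewrite /klim e1 e2 e3; ring.
by rewrite /klim /th sstep0 ?mulr0 ?addr0 ?(half_le a0).
Qed.

Lemma krest_cvg (d : nat -> R) s : 0 < s -> (forall n, 0 < d n) -> d @ \oo --> (0 : R) ->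
  krest (d n) s @[n --> \oo] --> klim s.
Proof.
move=> s0 dp d0; rewrite klimE ?ltW//.
have sd : s + d n @[n --> \oo] --> s.
  by rewrite -[X in _ --> X]addr0; apply: cvgD => //; exact: cvg_cst.
have si : (s + d n)^-1 @[n --> \oo] --> s^-1 by apply: cvgV => //; rewrite gt_eqF.
have sl : ln (s + d n) @[n --> \oo] --> ln s.
  by apply: continuous_cvg sd; exact: continuous_ln.
have h1 : - 8 * (chi s * A1 s) * (d n * (s + d n)^-1) @[n --> \oo] -->
    - 8 * (chi s * A1 s) * (0 * s^-1).
  by apply: cvgM; [exact: cvg_cst|exact: cvgM].
have h2 : kg1 s * ln (s + d n) + kg2 s + kg3 s * (s + d n)^-1 @[n --> \oo] -->
    kg1 s * ln s + kg2 s + kg3 s * s^-1.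
  apply: cvgD; last by apply: cvgM => //; exact: cvg_cst.
  by apply: cvgD; [apply: cvgM => //|]; exact: cvg_cst.
have := cvgD h1 h2; rewrite mul0r mulr0 add0r; exact.
Qed.

Lemma krest_bounded : exists2 M : R, 0 <= M & forall d s, 0 < d -> d <= 1 -> 0 <= s ->
  `|krest d s| <= M.
Proof.
have [sg1 sg2 sg3] := smooth1_kg.
have [M1 M10 H1] := cont_bounded_segment 0 b (smooth1_cont sA1).
have [G1 G10 HG1] := cont_bounded_segment 0 b (smooth1_cont sg1).
have [G2 G20 HG2] := cont_bounded_segment 0 b (smooth1_cont sg2).
have [G3 G30 HG3] := cont_bounded_segment 0 b (smooth1_cont sg3).
pose L := `|ln a| + `|ln (b + 1)|.
have L0 : 0 <= L by rewrite addr_ge0.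
have ai : 0 <= a^-1 by rewrite invr_ge0 ltW.
exists (8 * M1 + (G1 * L + G2 + G3 * a^-1)) => [|d s d0 d1 s0]; first by nonneg.
have [bs|sb] := ltP b s; first by rewrite krest_gt// normr0; nonneg.
have sd : 0 < s + d by rewrite ltr_wpDl.
apply: (le_trans (ler_normD _ _)); apply: lerD.
  have si0 : 0 <= (s + d)^-1 by rewrite invr_ge0 ltW.
  rewrite (normrM _ (d * _)) (normrM (- 8)) (normrM (chi s)) (normrM d) normrN.
  rewrite (ger0_norm (ler0n R 8)) (ger0_norm (ltW d0)) (ger0_norm si0).
  have c1 : `|chi s| <= 1 by rewrite ger0_norm ?sstep_ge0 ?sstep_le1.
  have c2 : d * (s + d)^-1 <= 1 by rewrite ler_pdivrMr// mul1r lerDr.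
  have c3 : 0 <= d * (s + d)^-1 by rewrite divr_ge0// ltW.
  have c4 := H1 s s0 sb.
  have c5 : `|chi s| * `|A1 s| <= 1 * M1 by apply: ler_pM.
  have c6 : 8 * (`|chi s| * `|A1 s|) * (d * (s + d)^-1) <= 8 * (1 * M1) * 1.
    by apply: ler_pM => //; rewrite ?mulr_ge0// ler_wpM2l.
  by move: c6; rewrite mul1r mulr1.
have [sa|sa] := ltP s a.
  by have [e1 e2 e3] := kg_lt sa; rewrite e1 e2 e3 !mul0r !addr0 normr0; nonneg.
have l1 : `|ln (s + d)| <= L.
  have h1 : ln a <= ln (s + d) by rewrite ler_ln ?posrE//; lra.
  have h2 : ln (s + d) <= ln (b + 1) by rewrite ler_ln ?posrE//; lra.
  rewrite ler_norml /L; apply/andP; split.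
    by have := ler_norm (- ln a); have := normr_ge0 (ln (b + 1)); rewrite normrN; lra.
  by have := ler_norm (ln (b + 1)); have := normr_ge0 (ln a); lra.
have i1 : `|(s + d)^-1| <= a^-1.
  have si0 : 0 <= (s + d)^-1 by rewrite invr_ge0; exact: ltW.
  rewrite (ger0_norm si0) lef_pV2 ?posrE// (le_trans sa)// lerDl.
  exact: ltW.
apply: (le_trans (ler_normD _ _)); apply: lerD.
  apply: (le_trans (ler_normD _ _)); apply: lerD; last exact: HG2.
  by rewrite normrM; apply: ler_pM => //; exact: HG1.
by rewrite normrM; apply: ler_pM => //; exact: HG3.
Qed.

Hypothesis Ab : forall s, 0 <= s -> s <= b -> 2^-1 <= A s <= 2.

Lemma kmain_ge0 d s : 0 < d -> 0 <= s -> 0 <= kmain d s.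
Proof.
move=> d0 s0; have [bs|sb] := ltP b s; first by rewrite kmain_gt.
have /andP[A0 _] := Ab s0 sb.
have A0' : 0 <= A s by apply: le_trans A0; rewrite invr_ge0.
have d0' := ltW d0; have sd : 0 <= s + d by rewrite addr_ge0.
have c0 : 0 <= chi s by rewrite sstep_ge0.
rewrite /kmain; move: (chi s) c0 => c c0; by rewrite !mulr_ge0 ?invr_ge0.
Qed.

Lemma kmain_le d s r : 0 < d -> 0 < r -> r <= s -> kmain d s <= 8 * d * r ^- 2.
Proof.
move=> d0 r0 rs; have s0 : 0 <= s by rewrite (le_trans _ rs)// ltW.
have h0 : 0 <= 8 * d * r ^- 2 by rewrite !mulr_ge0 ?invr_ge0 ?exprn_ge0// ltW.
have [bs|sb] := ltP b s; first by rewrite kmain_gt.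
have /andP[A0 A2'] := Ab s0 sb.
have A0' : 0 <= A s by apply: le_trans A0; rewrite invr_ge0.
have i0 : 0 <= (s + d)^-1 by rewrite invr_ge0 addr_ge0// ltW.
have i1 : (s + d)^-1 <= r^-1 by rewrite lef_pV2 ?posrE//; lra.
have c0 : 0 <= chi s by rewrite sstep_ge0.
have c1 : chi s <= 1 by rewrite sstep_le1.
have i2 : (s + d)^-1 * (s + d)^-1 <= r^-1 * r^-1 by apply: ler_pM.
rewrite -exprVn expr2 /kmain.
have -> : 8 * d * (r^-1 * r^-1) = (4 * 1 * 2) * (d * (r^-1 * r^-1)) by ring.
move: (chi s) c0 c1 => c c0 c1.
have c4 : 4 * c <= 4 * 1 by rewrite ler_wpM2l.
have h1 : 4 * c * A s <= 4 * 1 * 2 by apply: ler_pM => //; rewrite mulr_ge0.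
have h2 : d * ((s + d)^-1 * (s + d)^-1) <= d * (r^-1 * r^-1) by rewrite ler_wpM2l// ltW.
apply: ler_pM => //; first by rewrite !mulr_ge0.
by rewrite !mulr_ge0// ltW.
Qed.

(** On s <= 2 d, a set of area of order d, the kernel is of order 1/d:
its mass does not tend to 0. *)
Lemma kmain_lower d s : 0 < d -> 0 <= s -> s <= a -> s <= 2 * d -> 2 / 9 * d^-1 <= kmain d s.
Proof.
move=> d0 s0 sa sd; have /andP[A0 _] := Ab s0 (le_trans sa (ltW ab)).
rewrite /kmain sstep1// mulr1.
(* The kernel is 4 A s d / (s + d)^2, with A s >= 1/2 and s + d <= 3 d. *)
have i1 : (3 * d)^-1 <= (s + d)^-1 by rewrite lef_pV2 ?posrE ?mulr_gt0//; lra.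
have i0 : 0 <= (3 * d)^-1 by rewrite invr_ge0 mulr_ge0// ltW.
have i2 : (3 * d)^-1 * (3 * d)^-1 <= (s + d)^-1 * (s + d)^-1 by apply: ler_pM.
have -> : 2 / 9 * d^-1 = (4 * 2^-1) * (d * ((3 * d)^-1 * (3 * d)^-1)).
  by field; rewrite gt_eqF.
have h1 : 4 * 2^-1 <= 4 * A s by rewrite ler_wpM2l.
have h2 : d * ((3 * d)^-1 * (3 * d)^-1) <= d * ((s + d)^-1 * (s + d)^-1).
  by rewrite ler_wpM2l// ltW.
apply: ler_pM => //.
by rewrite !mulr_ge0// ltW.
Qed.

End LogKernel.

(** * Boxes determine integrable functions *)

Section PlaneMeasure.
Context {R : realType}.
Local Notation mu2 := (leb2 R).
Implicit Types (f w q ka : plane R -> R).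

Lemma measurable_bx (a b c d : R) : measurable (bx a b c d).
Proof. by apply: measurableX; exact: measurable_itv. Qed.

Lemma bx_measure (a b c d : R) : a <= b -> c <= d -> mu2 (bx a b c d) = ((b - a) * (d - c))%:E.
Proof.
move=> ab cd; rewrite /bx product_measure1E; try exact: measurable_itv.
rewrite (_ : (_ * _)%E = (lebesgue_measure `]a, b]%classic * lebesgue_measure `]c, d]%classic)%E)//.
rewrite !lebesgue_measure_itv /= !lte_fin.
have h (x y : R) : x <= y -> (if (x < y)%R then y%:E + (- x)%:E else 0%R)%E = (y - x)%:E.
  by rewrite le_eqVlt => /predU1P[->|->//]; rewrite ltxx subrr.
by rewrite !h.
Qed.

Lemma bx_fin (a b c d : R) : (mu2 (bx a b c d) < +oo)%E.
Proof.
rewrite /bx product_measure1E; try exact: measurable_itv.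
rewrite (_ : (_ * _)%E = (lebesgue_measure `]a, b]%classic * lebesgue_measure `]c, d]%classic)%E)//.
rewrite !lebesgue_measure_itv /=.
by case: ifP => _; case: ifP => _; rewrite ?mule0 ?mul0e ?ltry// -!EFinB -EFinM ltry.
Qed.

Lemma itg_bx (a b c d : R) : itg (\1_(bx a b c d) : plane R -> R).
Proof.
apply/integrableP; split.
  by apply/measurable_EFinP; apply: measurable_indic; exact: measurable_bx.
under eq_integral do rewrite /= ger0_norm//.
rewrite integral_indic ?setIT//; first exact: bx_fin.
exact: measurable_bx.
Qed.

Lemma pint_bx (a b c d : R) : a <= b -> c <= d -> pint (\1_(bx a b c d)) = (b - a) * (d - c).
Proof.
move=> ab cd; rewrite /pint /Rintegral integral_indic ?setIT//; last exact: measurable_bx.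
by have h := bx_measure ab cd; rewrite [X in fine X]h.
Qed.

(** Sets on which an indefinite integral vanishes form a Dynkin system; this
is applied to one coordinate at a time. *)
Lemma null_dynkin d (T : measurableType d) (G : set (set T)) (g : plane R -> T)
    (E : set (plane R)) f :
  @measurable _ T = <<s G >> -> setI_closed G -> measurable_fun setT g -> measurable E -> itg f ->
  (\int[mu2]_(x in E) (f x)%:E = 0)%E ->
  (forall A, G A -> \int[mu2]_(x in E `&` g @^-1` A) (f x)%:E = 0)%E ->
  forall A, measurable A -> (\int[mu2]_(x in E `&` g @^-1` A) (f x)%:E = 0)%E.
Proof.
move=> TG GI mg mE hf E0 G0 A mA.
have mp B : measurable B -> measurable (E `&` g @^-1` B).
  by move=> mB; apply: measurableI => //; rewrite -[g @^-1` B]setTI; exact: mg.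
apply: (@dynkin_induction _ T G (fun A => \int[mu2]_(x in E `&` g @^-1` A) (f x)%:E = 0)%E) => //.
- by rewrite preimage_setT setIT.
- move=> B mB B0.
  have EB : E = (E `&` g @^-1` B) `|` (E `&` g @^-1` (~` B)).
    by rewrite -setIUr preimage_setC setUv setIT.
  have := E0; rewrite {1}EB integral_setU.
  + by rewrite B0 add0e.
  + exact: mp.
  + by apply: mp; exact: measurableC.
  + apply: measurable_funTS; apply: (measurable_int mu2 hf).
  + apply/disj_setPLR => x [_ /= h1] [_ /=]; exact.
- move=> F mF tF F0; rewrite preimage_bigcup setI_bigcupr integral_bigcup.
  + by rewrite eseries0// => k _ _; exact: F0.
  + apply/trivIsetP => i j _ _ ij; rewrite setIACA setIid -preimage_setI.
    by move/trivIsetP : tF => ->//; rewrite preimage_set0 setI0.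
  + by move=> k; apply: mp.
  + apply: (integrableS measurableT _ _ hf) => //.
    by apply: bigcupT_measurable => k; apply: mp.
- by rewrite -TG.
Qed.

(** Vanishing integrals over boxes extend to measurable sets in the first
coordinate, then in the second; the rectangles so obtained are stable under
intersection and generate the product sigma-algebra, so that the integral over
every measurable part of the box vanishes. *)
Lemma box_null_ae a b c d f : itg f ->
  (forall a' b' c' d', bx a' b' c' d' `<=` bx a b c d ->
     \int[mu2]_(x in bx a' b' c' d') (f x)%:E = 0)%E ->
  {ae mu2, forall x, bx a b c d x -> f x = 0}.
Proof.
move=> hf H.
pose Q := bx a b c d.
have mQ : measurable Q by exact: measurable_bx.
have mfst : measurable_fun setT (fst : plane R -> R) by exact: measurable_fst.
have msnd : measurable_fun setT (snd : plane R -> R) by exact: measurable_snd.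
have H0 (I J : set R) : ocitv I -> ocitv J ->
    (\int[mu2]_(x in (Q `&` snd @^-1` J) `&` fst @^-1` I) (f x)%:E = 0)%E.
  move=> hI hJ.
  have -> : (Q `&` snd @^-1` J) `&` fst @^-1` I = (`]a, b]%classic `&` I) `*` (`]c, d]%classic `&` J).
    by apply/seteqP; split=> [x [[[h1 h2] h3] h4]|x [[h1 h4] [h2 h3]]].
  have [[a' b'] _ /= e1] := ocitvI (is_ocitv a b) hI.
  have [[c' d'] _ /= e2] := ocitvI (is_ocitv c d) hJ.
  rewrite -e1 -e2; apply: H => x [/=]; rewrite -/(`]a', b']%classic x.1) -/(`]c', d']%classic x.2).
  by rewrite e1 e2 => -[h1 _] [h2 _].
have mR : @measurable _ R = <<s (@ocitv R) >> by [].
have H1 (A : set R) J : measurable A -> ocitv J ->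
    (\int[mu2]_(x in (Q `&` snd @^-1` J) `&` fst @^-1` A) (f x)%:E = 0)%E.
  move=> mA hJ; apply: (null_dynkin mR (@ocitvI R) mfst) => //.
  - apply: measurableI => //; rewrite -[snd @^-1` J]setTI; apply: msnd => //.
    by rewrite mR; exact: sub_sigma_algebra.
  - rewrite -(_ : (Q `&` snd @^-1` J) `&` fst @^-1` `]a, b]%classic = Q `&` snd @^-1` J).
      by apply: H0 => //; exact: is_ocitv.
    by apply/seteqP; split=> [x []//|x [[h1 h2] h3]].
  - by move=> I hI; exact: H0.
have H2 (A B : set R) : measurable A -> measurable B ->
    (\int[mu2]_(x in (Q `&` fst @^-1` A) `&` snd @^-1` B) (f x)%:E = 0)%E.
  move=> mA mB; apply: (null_dynkin mR (@ocitvI R) msnd) => //.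
  - by apply: measurableI => //; rewrite -[fst @^-1` A]setTI; exact: mfst.
  - rewrite -(_ : (Q `&` snd @^-1` `]c, d]%classic) `&` fst @^-1` A = Q `&` fst @^-1` A).
      by apply: H1 => //; exact: is_ocitv.
    by apply/seteqP; split=> [x [[h1 h2] h3]|x [[h1 h2] h3]].
  - by move=> J hJ; rewrite setIAC; exact: H1.
have H3 (E : set (plane R)) : measurable E -> (\int[mu2]_(x in Q `&` id @^-1` E) (f x)%:E = 0)%E.
  move=> mE; apply: (null_dynkin (G := [set A `*` B | A in measurable & B in measurable])) => //.
  - by rewrite measurable_prod_measurableType.
  - move=> _ _ [A mA [B mB <-]] [A' mA' [B' mB' <-]].
    exists (A `&` A'); first exact: measurableI.
    by exists (B `&` B'); [exact: measurableI|rewrite setXI].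
  - by apply: H.
  - move=> _ [A mA [B mB <-]].
    rewrite (_ : Q `&` _ = (Q `&` fst @^-1` A) `&` snd @^-1` B); first exact: H2.
    by apply/seteqP; split=> [x [h1 [h2 h3]]|x [[h1 h2] h3]].
have hfQ : mu2.-integrable Q (EFin \o f) by apply: (integrableS measurableT).
have := @integral_ae_eq _ _ _ mu2 Q mQ (fun=> 0%E) (EFin \o f) hfQ (measurable_cst _).
have H4 E : E `<=` Q -> measurable E ->
    (\int[mu2]_(x in E) (EFin \o f) x = \int[mu2]_(x in E) 0)%E.
  move=> EQ mE; rewrite integral0 -(H3 E mE); congr (integral _ _ _).
  by rewrite (setIidr _).
move=> /(_ H4); apply: filterS => x h /h /= []; exact.
Qed.

End PlaneMeasure.

(** * Null lines, translations and Fubini *)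

Section PlaneFubini.
Context {R : realType}.
Local Notation mu2 := (leb2 R).
Local Notation leb := (@lebesgue_measure R).
Implicit Types (f w q ka : plane R -> R).

Lemma ae_fst_neq (a : R) : {ae mu2, forall y : plane R, y.1 != a}.
Proof.
exists ([set a] `*` setT); split.
- by apply: measurableX.
- rewrite product_measure1E//.
  rewrite (_ : (_ * _)%E = (leb [set a] * leb setT)%E)// lebesgue_measure_set1 mul0e//.
- by move=> y /= /negP; rewrite negbK => /eqP.
Qed.

Lemma ae_snd_neq (a : R) : {ae mu2, forall y : plane R, y.2 != a}.
Proof.
exists (setT `*` [set a]); split.
- by apply: measurableX.
- rewrite product_measure1E//.
  rewrite (_ : (_ * _)%E = (leb setT * leb [set a])%E)// lebesgue_measure_set1 mule0//.
- by move=> y /= /negP; rewrite negbK => /eqP.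
Qed.

Global Instance ae_plane_filter : Filter (almost_everywhere mu2).
Proof. exact: (@ae_filter_ringOfSetsType). Qed.

Global Instance ae_plane_nbhs_filter : Filter (nbhs (almost_everywhere mu2)).
Proof. exact: (@ae_filter_ringOfSetsType). Qed.

Lemma ae_and (P Q : plane R -> Prop) : {ae mu2, forall y, P y} -> {ae mu2, forall y, Q y} ->
  {ae mu2, forall y, P y /\ Q y}.
Proof. move=> hP hQ; exact: (filterI hP hQ). Qed.

Lemma leb_shift (h : R -> R) (c : R) : continuous h -> (forall t, 0 <= h t) ->
  (\int[leb]_x (h (x - c))%:E = \int[leb]_x (h x)%:E)%E.
Proof.
move=> ch h0.
have dF (x : R) : is_derive x (1 : R) (fun x : R => x - c) (1 : R).
  apply: is_derive_eq (is_deriveB (is_derive_id x (1 : R)) (is_derive_cst c x (1 : R))) _.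
  by rewrite subr0.
have FE : derive1 (fun x : R => x - c) = (fun=> 1).
  by apply/funext => x; rewrite derive1E; have [_ ->] := dF x.
rewrite (@increasing_ge0_integration_by_substitutionT _ (fun x : R => x - c) h)//.
- by apply: eq_integral => x _; rewrite FE /= mulr1.
- by move=> x y xy; rewrite ltrD2r.
- by rewrite FE => x; exact: cst_continuous.
- by rewrite FE; exact: is_cvg_cst.
- by rewrite FE; exact: is_cvg_cst.
- apply/cvgrNyPle => A; near=> x; rewrite lerBlDr; near: x.
  by apply: nbhs_ninfty_le; exact: num_real.
- apply/cvgryPge => A; near=> x; rewrite lerBrDr; near: x.
  by apply: nbhs_pinfty_ge; exact: num_real.
Unshelve. all: by end_near. Qed.

Lemma pint_shift f (y : plane R) : continuous f -> (forall x, 0 <= f x) ->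
  pint (fun x : plane R => f (x - y)) = pint f.
Proof.
move=> cf f0.
have cs : continuous (fun x : plane R => f (x - y)).
  move=> x; apply: (continuous_comp (f := fun x : plane R => x - y) (g := f)); last exact: cf.
  by apply: continuousB; [move=> ?|exact: cst_continuous].
have ms := continuous_measurable_plane cs; have mf := continuous_measurable_plane cf.
have ct (g : R -> plane R) : (forall s t, modulus (of_plane (g s) - of_plane (g t)) <= `|s - t|) ->
    continuous (fun t => f (g t)).
  move=> lip t; apply: (continuous_comp (f := g) (g := f)); last exact: cf.
  move=> V /nbhs_planeP[e e0 He].
  apply/nbhs_ballP; exists e => // s; rewrite -ball_normE /= distrC => st.
  by apply: He; apply: le_lt_trans (lip _ _) st.
have c2 (u : R) : continuous (fun t : R => f (u, t)).
  apply: ct => s t; rewrite -of_planeB; apply: (le_trans (modulus_le _)).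
  by rewrite /= subrr normr0 add0r.
have c1 (u : R) : continuous (fun t : R => f (t, u)).
  apply: ct => s t; rewrite -of_planeB; apply: (le_trans (modulus_le _)).
  by rewrite /= subrr normr0 addr0.
have mh : measurable_fun setT (fun x : plane R => (f (x.1 - y.1, x.2))%:E).
  apply/measurable_EFinP.
  apply: (@measurableT_comp _ _ _ _ _ _ f) => //.
  apply/measurable_fun_pairP; split; last exact: measurable_snd.
  by apply: measurable_funB => //; exact: measurable_fst.
rewrite /pint /Rintegral; congr fine.
transitivity (\int[leb]_x1 \int[leb]_x2 (f (x1 - y.1, x2 - y.2))%:E)%E.
  apply: (@fubini_tonelli1 _ _ _ _ R leb leb (fun x : plane R => (f (x - y))%:E)).
    by have /measurable_EFinP := ms.
  by move=> x; rewrite lee_fin.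
transitivity (\int[leb]_x1 \int[leb]_x2 (f (x1 - y.1, x2))%:E)%E.
  apply: eq_integral => x1 _.
  by rewrite (leb_shift _ (c2 (x1 - y.1)))// => t.
transitivity (\int[leb]_x2 \int[leb]_x1 (f (x1 - y.1, x2))%:E)%E.
  apply: (@fubini_tonelli _ _ _ _ R leb leb (fun x : plane R => (f (x.1 - y.1, x.2))%:E)) => //.
  by move=> x; rewrite lee_fin.
transitivity (\int[leb]_x2 \int[leb]_x1 (f (x1, x2))%:E)%E.
  apply: eq_integral => x2 _.
  by rewrite (leb_shift _ (c1 x2)).
apply/esym; apply: (@fubini_tonelli2 _ _ _ _ R leb leb (fun x : plane R => (f x)%:E)).
  by have /measurable_EFinP := mf.
by move=> x; rewrite lee_fin.
Qed.

Lemma plane_sigma_finite : sigma_finite [set: plane R] mu2.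
Proof.
exists (fun n => bx (- n%:R) n%:R (- n%:R) n%:R).
  apply/seteqP; split=> // x _; pose n := (Num.trunc `|x|).+1.
  have xn : `|x| < n%:R by exact: truncnS_gt.
  exists n => //; move: xn; rewrite plane_norm gt_max !ltr_norml => /andP[/andP[a b] /andP[c d]].
  by split; rewrite /= in_itv /= ?a ?c ltW.
by move=> n; split; [exact: measurable_bx|exact: bx_fin].
Qed.

(** A fresh name on which the sigma-finite structure can be declared. *)
Definition plane_leb := mu2.
HB.instance Definition _ := Measure.copy plane_leb mu2.
HB.instance Definition _ := Measure_isSigmaFinite.Build _ _ _ plane_leb plane_sigma_finite.

Lemma pint_fin f : itg f -> (\int[mu2]_x (f x)%:E = (pint f)%:E)%E.
Proof.
move=> hf; rewrite /pint /Rintegral fineK//; exact: (integrable_fin_num measurableT hf).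
Qed.

Lemma pint_def f : pint f = fine (\int[mu2]_x (f x)%:E)%E.
Proof. by []. Qed.

(** Convolution is moved from [w] to [q]; absolute convergence holds because
the kernel is bounded and both functions are integrable. *)
Lemma conv_fubini q w ka (B : R) : itg q -> itg w -> continuous ka -> (forall z, `|ka z| <= B) ->
  pint (fun x => q x * conv w ka x) = pint (fun y : plane R => w y * pint (fun x : plane R => q x * ka (x - y))).
Proof.
move=> hq hw ck kB.
have B0 : 0 <= B by rewrite (le_trans _ (kB 0)).
have mk := continuous_measurable_plane ck.
have ms x : measurable_fun setT (fun y : plane R => ka (x - y)) := shift_measurable x ck.
have ms' y : measurable_fun setT (fun x : plane R => ka (x - y)).
  apply: continuous_measurable_plane => x.
  apply: (continuous_comp (f := fun x : plane R => x - y) (g := ka)); last exact: ck.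
  by apply: continuousB; [move=> ?|exact: cst_continuous].
pose F (z : plane R * plane R) : \bar R := (q z.1 * (w z.2 * ka (z.1 - z.2)))%:E.
have i1 x : itg (fun y : plane R => w y * ka (x - y)) by apply: (itg_mul hw (ms x)) => y.
have i1' x : itg (fun y : plane R => q x * (w y * ka (x - y))) by exact: itgZ.
have i2 y : itg (fun x : plane R => q x * ka (x - y)) by apply: (itg_mul hq (ms' y)) => x.
have mF : measurable_fun setT F.
  apply/measurable_EFinP; apply: measurable_funM.
    apply: (@measurableT_comp _ _ _ _ _ _ q); last exact: measurable_fst.
    exact: itg_measurable hq.
  apply: measurable_funM.
    apply: (@measurableT_comp _ _ _ _ _ _ w); last exact: measurable_snd.
    exact: itg_measurable hw.
  apply: (@measurableT_comp _ _ _ _ _ _ ka) => //.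
  apply/measurable_fun_pairP; split; apply: measurable_funB.
  - by apply: measurableT_comp; [exact: measurable_fst|exact: measurable_fst].
  - by apply: measurableT_comp; [exact: measurable_fst|exact: measurable_snd].
  - by apply: measurableT_comp; [exact: measurable_snd|exact: measurable_fst].
  - by apply: measurableT_comp; [exact: measurable_snd|exact: measurable_snd].
pose W := pint (fun y => `|w y|).
have WE x : (\int[mu2]_y (`|F (x, y)|)%E <= (B * W * `|q x|)%:E)%E.
  have iabs := itg_abs (i1' x).
  have -> : (\int[mu2]_y (`|F (x, y)|)%E = (pint (fun y : plane R => `|q x * (w y * ka (x - y))|))%:E)%E.
    by rewrite -(pint_fin iabs).
  have i3 := itgZ (B * `|q x|) (itg_abs hw).
  rewrite lee_fin (_ : B * W * `|q x| = pint (fun y => B * `|q x| * `|w y|)).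
    apply: pint_le => // y; rewrite !normrM mulrA.
    have -> : B * `|q x| * `|w y| = `|q x| * `|w y| * B by ring.
    by rewrite ler_wpM2l// mulr_ge0.
  rewrite pintZ; last exact: itg_abs.
  by rewrite /W mulrAC.
case: (@integrable12ltyP _ _ _ _ R plane_leb plane_leb F mF) => _ H.
have mF1 := @measurable_fun_fubini_tonelli_F _ _ _ _ R plane_leb (abse \o F).
have /H iF : (\int[mu2]_x \int[mu2]_y `|F (x, y)| < +oo)%E.
  have iq := itgZ (B * W) (itg_abs hq).
  apply: (@le_lt_trans _ _ (\int[mu2]_x (B * W * `|q x|)%:E)%E); last first.
    have := integrable_fin_num measurableT iq.
    by rewrite fin_numE ltey => /andP[].
  apply: ge0_le_integral => //.
  - by move=> x _; exact: integral_ge0.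
  - by apply: mF1; [exact: measurableT_comp|move=> z; exact: abse_ge0].
  - by have /measurable_EFinP := itg_measurable iq.
have FE := Fubini iF.
have L x : (\int[mu2]_y F (x, y) = (q x * conv w ka x)%:E)%E.
  by rewrite /conv -(pintZ _ (i1 x)) -(pint_fin (i1' x)).
have RR y : (\int[mu2]_x F (x, y) = (w y * pint (fun x : plane R => q x * ka (x - y)))%:E)%E.
  rewrite -(pintZ _ (i2 y)) -(pint_fin (itgZ (w y) (i2 y))).
  by apply: eq_integral => x _; rewrite /F /=; congr (_%:E); ring.
have E : (\int[mu2]_x (q x * conv w ka x)%:E =
    \int[mu2]_y (w y * pint (fun x : plane R => q x * ka (x - y)))%:E)%E.
  transitivity (\int[mu2]_x \int[mu2]_y F (x, y))%E; first by apply: eq_integral => x _; rewrite L.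
  by apply: (etrans FE); apply: eq_integral => y _; exact: RR.
exact: (f_equal fine E).
Qed.

End PlaneFubini.

(** * Approximate identities tested on boxes *)

Section ApproximateIdentity.
Context {R : realType}.
Local Notation mu2 := (leb2 R).
Implicit Types (f w ka : plane R -> R).

Lemma side_locally_const (a t s : R) : `|s - t| < `|t - a| -> ((a < s) = (a < t)) /\ ((s <= a) = (t <= a)).
Proof.
rewrite ltr_distl => /andP[h1 h2]; have [at_|ta|ta] := ltgtP a t.
- rewrite gtr0_norm ?subr_gt0// in h1 h2.
  have sa : a < s by lra.
  by rewrite sa leNgt sa.
- rewrite ltr0_norm ?subr_lt0// in h1 h2.
  have sa : s < a by lra.
  by rewrite (ltW sa) ltNge (ltW sa).
- by move: h1 h2; rewrite ta subrr normr0; lra.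
Qed.

(** Off the four lines that bound it, hence almost everywhere, the
indicator of a box is locally constant: this is what makes approximate
identities converge on it pointwise. *)
Lemma bx_locally_const (a b c d : R) (y : plane R) :
  y.1 != a -> y.1 != b -> y.2 != c -> y.2 != d ->
  exists2 rho : R, 0 < rho & forall x : plane R, `|x - y| < rho ->
    \1_(bx a b c d) x = \1_(bx a b c d) y :> R.
Proof.
move=> ya yb yc yd.
exists (Num.min (Num.min `|y.1 - a| `|y.1 - b|) (Num.min `|y.2 - c| `|y.2 - d|)).
  by rewrite !lt_min !normr_gt0 !subr_eq0 ya yb yc yd.
move=> x; rewrite plane_norm gt_max !lt_min /= => /andP[/andP[/andP[h1 h2] _] /andP[_ /andP[h3 h4]]].
rewrite !indicE; congr (_%:R); congr nat_of_bool.
have [e1 _] := side_locally_const h1; have [_ e2] := side_locally_const h2.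
have [e3 _] := side_locally_const h3; have [_ e4] := side_locally_const h4.
apply/idP/idP; rewrite !inE /bx /= !in_itv /=; rewrite e1 e2 e3 e4; exact.
Qed.

Lemma itg_supp f (M : R) : continuous f -> (forall z, M < `|z| -> f z = 0) -> itg f.
Proof.
move=> cf f0; have [B B0 HB] := bounded_supp cf f0.
pose K := Num.max M 0 + 1.
apply: (@itg_le _ _ (fun x => B * \1_(bx (- K) K (- K) K) x)).
- exact: continuous_measurable_plane.
- by apply: itgZ; exact: itg_bx.
move=> x; have [Mx|xM] := ltP M `|x|.
  by rewrite f0// normr0 mulr_ge0.
rewrite indicE mem_set ?mulr1//.
have M1 : M <= Num.max M 0 by rewrite le_max lexx.
have : `|x| < K by rewrite (le_lt_trans xM)// /K; move: M1; set u := Num.max M 0; lra.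
rewrite plane_norm gt_max !ltr_norml => /andP[/andP[h1 h2] /andP[h3 h4]].
by split; rewrite /= in_itv /= ?h1 ?h3 ltW.
Qed.

Variables (w : plane R -> R) (m r : nat -> plane R -> R) (psi : plane R -> R).
Variables (M B c0 : R) (O : set (plane R)).
Hypotheses (hw : itg w) (Cm : forall n, Cn 1 setT (m n)) (Cr : forall n, Cn 1 setT (r n))
  (Cpsi : Cn 1 setT psi)
  (m_supp : forall n z, M < `|z| -> m n z = 0)
  (r_supp : forall n z, M < `|z| -> r n z = 0)
  (psi_supp : forall z, M < `|z| -> psi z = 0)
  (m_ge0 : forall n z, 0 <= m n z) (m_even : forall n z, m n (- z) = m n z)
  (c0_gt0 : 0 < c0) (m_mass : forall n, c0 <= pint (m n))
  (m_conc : forall rho : R, 0 < rho -> exists2 e : nat -> R, e @ \oo --> (0 : R) &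
     forall n z, rho <= `|z| -> m n z <= e n)
  (r_bound : forall n z, `|r n z| <= B)
  (r_cvg : forall z, z != 0 -> r n z @[n --> \oo] --> psi z)
  (eqO : forall n x, O x -> conv w (m n) x + conv w (r n) x = 0).

Let cm n : continuous (m n). Proof. exact: Cn_continuous (Cm n). Qed.
Let cr n : continuous (r n). Proof. exact: Cn_continuous (Cr n). Qed.
Let cpsi : continuous psi. Proof. exact: Cn_continuous Cpsi. Qed.
Let im n : itg (m n). Proof. exact: (itg_supp (@cm n) (@m_supp n)). Qed.

Let C n := pint (m n).
Let C_gt0 n : 0 < C n. Proof. exact: lt_le_trans (m_mass n). Qed.

Let shift_even n (x y : plane R) : m n (x - y) = m n (y - x).
Proof. by rewrite -m_even opprB. Qed.

Let itg_shift n (y : plane R) : itg (fun x : plane R => m n (y - x)).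
Proof.
apply: (@itg_supp _ (M + `|y|)); first exact: shift_continuous.
move=> z hz; apply: m_supp.
have := ler_normB (y : plane R) (y - z); rewrite opprB addrC subrK; lra.
Qed.

Let pint_even n (y : plane R) : pint (fun x : plane R => m n (y - x)) = C n.
Proof.
transitivity (pint (fun x : plane R => m n (x - y))); last exact: (pint_shift y (@cm n) (m_ge0 n)).
by apply: pint_ext => x; rewrite shift_even.
Qed.

Section Box.
Variables a b c d : R.
Let Q := bx a b c d.
Let q : plane R -> R := \1_Q.
Let iq : itg q. Proof. exact: itg_bx. Qed.
Let q01 x : 0 <= q x <= 1. Proof. by rewrite /q indicE; case: (_ \in _); rewrite /= ?ler01 lexx. Qed.
Let mq : measurable_fun setT q. Proof. exact: itg_measurable. Qed.

Let J n y := conv q (m n) y.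
Let mshift n (y : plane R) : measurable_fun setT (fun x : plane R => m n (y - x)).
Proof. exact: shift_measurable. Qed.
Let iqm n (y : plane R) : itg (fun x : plane R => q x * m n (y - x)).
Proof.
apply: (@itg_le _ _ _ _ (itg_shift n y)); first exact: measurable_funM.
move=> x; have /andP[q0 q1] := q01 x.
by rewrite ger0_norm ?mulr_ge0// ler_piMl.
Qed.

Let J_ge0 n y : 0 <= J n y.
Proof. by apply: pint_ge0 => x; rewrite mulr_ge0//; have /andP[] := q01 x. Qed.
Let J_le n y : J n y <= C n.
Proof.
rewrite -(pint_even n y); apply: pint_le => // x.
by have /andP[q0 q1] := q01 x; rewrite ler_piMl.
Qed.

Let J_cvg (y : plane R) : y.1 != a -> y.1 != b -> y.2 != c -> y.2 != d ->
  J n y / C n @[n --> \oo] --> q y.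
Proof.
move=> ya yb yc yd; have [rho rho0 Hrho] := bx_locally_const ya yb yc yd.
have [e e0 He] := m_conc rho0.
pose K := `|M| + 1.
pose S := bx (y.1 - K) (y.1 + K) (y.2 - K) (y.2 + K).
have K0 : 0 < K by rewrite ltr_wpDl.
have SA : pint (\1_S : plane R -> R) = (2 * K) * (2 * K).
  by rewrite pint_bx; [ring|lra|lra].
have key n : `|J n y - q y * C n| <= e n * ((2 * K) * (2 * K)).
  rewrite -(pint_even n y) -pintZ// -pintB//; last exact: itgZ.
  have iS : itg (fun x => e n * \1_S x) by apply: itgZ; exact: itg_bx.
  rewrite -SA -pintZ; last exact: itg_bx.
  have iB : itg (fun x : plane R => q x * m n (y - x) - q y * m n (y - x)).
    by apply: itgB => //; exact: itgZ.
  apply: (le_trans (pint_abs_le iB)); apply: pint_le => //; first exact: itg_abs.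
  move=> x; rewrite -mulrBl normrM (ger0_norm (m_ge0 n _)).
  have e_ge0 : 0 <= e n.
    have := le_trans (m_ge0 n (rho, 0)) (He n (rho, 0) _); apply.
    by rewrite plane_norm /= normr0 le_max gtr0_norm// lexx.
  have [h|h] := ltP `|x - y| rho.
    by rewrite (Hrho x h : q x = q y) subrr normr0 mul0r mulr_ge0// indicE.
  have h' : rho <= `|y - x| by rewrite -normrN opprB.
  have q1 : `|q x - q y| <= 1.
    have /andP[u1 u2] := q01 x; have /andP[v1 v2] := q01 y.
    by rewrite ler_norml; lra.
  have [Mz|zM] := ltP M `|y - x|.
    by rewrite m_supp// mulr0 mulr_ge0// indicE.
  have -> : \1_S x = 1 :> R.
    rewrite indicE mem_set//.
    have : `|x - y| < K by rewrite -normrN opprB (le_lt_trans zM)// ltr_pwDr// ler_norm.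
    rewrite plane_norm gt_max !ltr_distl /= => /andP[/andP[h1 h2] /andP[h3 h4]].
    by split; rewrite /= in_itv /= ?h1 ?h3 ltW.
  rewrite mulr1 -[leRHS]mul1r; apply: ler_pM => //; exact: He.
have key2 n : `|J n y / C n - q y| <= e n * ((2 * K) * (2 * K) / c0).
  have -> : J n y / C n - q y = (J n y - q y * C n) / C n.
    by rewrite mulrBl mulfK// gt_eqF.
  have X0 : 0 <= e n * ((2 * K) * (2 * K)) := le_trans (normr_ge0 _) (key n).
  rewrite normrM (mulrA (e n)); apply: ler_pM => //.
  rewrite gtr0_norm ?invr_gt0// lef_pV2 ?posrE//; exact: m_mass.
have e1 : e n * ((2 * K) * (2 * K) / c0) @[n --> \oo] --> (0 : R).
  by rewrite -[X in _ --> X](mul0r ((2 * K) * (2 * K) / c0)); apply: cvgM => //; exact: cvg_cst.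
apply/cvgrPdist_le => eps eps0; near=> n; rewrite distrC; apply: (le_trans (key2 n)).
apply: le_trans (ler_norm _) _; rewrite -[X in `|X|]subr0; near: n.
by move/cvgrPdist_le : e1 => /(_ _ eps0); under eq_near do rewrite sub0r normrN -[X in `|X|]subr0.
Unshelve. all: by end_near. Qed.

Let J_cont n : continuous (J n).
Proof. exact: (conv_continuous iq (Cm n) (@m_supp n)). Qed.

Let i_cvg : pint (fun y => w y * (J n y / C n)) @[n --> \oo] --> pint (fun y => w y * q y).
Proof.
apply: (@pint_dominated _ _ _ (fun y => `|w y|)).
- move=> n; apply: measurable_funM; first exact: itg_measurable.
  apply: measurable_funM => //.
  by apply: continuous_measurable_plane; exact: J_cont.
- by apply: measurable_funM => //; exact: itg_measurable.
- exact: itg_abs.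
- move=> n y; rewrite normrM ler_piMr// ger0_norm ?divr_ge0 ?(ltW (C_gt0 n))//.
  by rewrite ler_pdivrMr// mul1r.
- have := ae_and (ae_and (ae_fst_neq a) (ae_fst_neq b)) (ae_and (ae_snd_neq c) (ae_snd_neq d)).
  apply: filterS => y [[ya yb] [yc yd]].
  by apply: cvgM; [exact: cvg_cst|exact: J_cvg].
Qed.

Let main_fubini n : pint (fun x => q x * conv w (m n) x) = C n * pint (fun y => w y * (J n y / C n)).
Proof.
have [Bm Bm0 HBm] := bounded_supp (@cm n) (@m_supp n).
rewrite (conv_fubini iq hw (@cm n) HBm) -pintZ.
  apply: pint_ext => y; rewrite mulrCA [C n * _]mulrC divfK ?gt_eqF//; congr (_ * _).
  by apply: pint_ext => x; rewrite shift_even.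
apply: (itg_mul (B := 1) hw).
  apply: measurable_funM => //.
  by apply: continuous_measurable_plane; exact: J_cont.
move=> y; rewrite ger0_norm ?divr_ge0 ?(ltW (C_gt0 n))//.
by rewrite ler_pdivrMr// mul1r.
Qed.

Let r_conv_cvg (x : plane R) : conv w (r n) x @[n --> \oo] --> conv w psi x.
Proof.
apply: (@pint_dominated _ _ _ (fun y => B * `|w y|)).
- move=> n; apply: measurable_funM; first exact: itg_measurable.
  by apply: shift_measurable; exact: cr.
- apply: measurable_funM; first exact: itg_measurable.
  exact: shift_measurable.
- by apply: itgZ; exact: itg_abs.
- by move=> n y; rewrite normrM mulrC ler_wpM2r.
- have := ae_fst_neq x.1; apply: filterS => y yx.
  apply: cvgM; first exact: cvg_cst.
  apply: r_cvg; apply: contraNneq yx => /(congr1 fst) /= /eqP.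
  by rewrite subr_eq0 eq_sym.
Qed.

Let rest_cvg : pint (fun x => q x * conv w (r n) x) @[n --> \oo] -->
  pint (fun x => q x * conv w psi x).
Proof.
pose W := pint (fun y => `|w y|).
apply: (@pint_dominated _ _ _ (fun x => (B * W) * q x)).
- move=> n; apply: measurable_funM => //; apply: continuous_measurable_plane.
  exact: (conv_continuous hw (Cr n) (@r_supp n)).
- apply: measurable_funM => //; apply: continuous_measurable_plane.
  exact: (conv_continuous hw Cpsi psi_supp).
- exact: itgZ.
- move=> n x; have /andP[q0 _] := q01 x; rewrite normrM mulrC (ger0_norm q0) ler_wpM2r//.
  apply: pint_mul_le => //; apply: shift_measurable; exact: cr.
- by apply: aeW => x; apply: cvgM; [exact: cvg_cst|exact: r_conv_cvg].
Qed.

Hypothesis QO : Q `<=` O.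

(** Integrate conv w m_n + conv w r_n = 0 over the box. By Fubini the first
term is the integral of w against the indicator mollified by m_n, which after
division by the mass C_n of m_n converges to the integral of w; the second
converges to the integral of conv w psi. *)
Lemma box_relation : exists2 s : nat -> R, s @ \oo --> pint (fun x => q x * conv w psi x) &
  (- (C n)^-1 * s n) @[n --> \oo] --> pint (fun x => q x * w x).
Proof.
exists (fun n => pint (fun x => q x * conv w (r n) x)); first exact: rest_cvg.
have -> : (fun n => - (C n)^-1 * pint (fun x => q x * conv w (r n) x)) =
    (fun n => pint (fun y => w y * (J n y / C n))).
  apply/funext => n.
  have h : pint (fun x => q x * conv w (r n) x) = - pint (fun x => q x * conv w (m n) x).
    have imn : itg (fun x => q x * conv w (m n) x).
      have [Bm Bm0 HBm] := bounded_supp (@cm n) (@m_supp n).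
      apply: (itg_mul (B := Bm * pint (fun y => `|w y|)) iq).
        by apply: continuous_measurable_plane; exact: (conv_continuous hw (Cm n) (@m_supp n)).
      by move=> x; apply: pint_mul_le => //; apply: shift_measurable; exact: cm.
    rewrite -mulN1r -pintZ//; apply: pint_ext => x.
    rewrite /q indicE; have [xQ|xQ] := boolP (x \in Q); last by rewrite !mul0r mulr0.
    by have := eqO n (QO (set_mem xQ)); rewrite !mul1r; lra.
  by rewrite h main_fubini mulrN mulNr opprK mulKf// gt_eqF.
rewrite (_ : (fun x => q x * w x) = (fun x => w x * q x)); first exact: i_cvg.
by apply/funext => x; rewrite mulrC.
Qed.

End Box.

(** If the integral of conv w psi is nonzero on some box, then -1/C_n
converges, to a limit that is the same for all boxes. Otherwise both sides vanish
on every box, as C_n is bounded below. The masses C_n need not be computed. *)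
Lemma box_proportional : exists la : R, forall a b c d, bx a b c d `<=` O ->
  pint (fun x => \1_(bx a b c d) x * w x) = la * pint (fun x => \1_(bx a b c d) x * conv w psi x).
Proof.
have [[[[[a b] c] d] [QO j0]]|H] := pselect (exists u : R * R * R * R,
    bx u.1.1.1 u.1.1.2 u.1.2 u.2 `<=` O /\
    pint (fun x => \1_(bx u.1.1.1 u.1.1.2 u.1.2 u.2) x * conv w psi x) != 0).
  have [s sj si] := box_relation QO.
  set j := pint _ in j0 sj; set i := pint _ in si.
  have Ci : - (C n)^-1 @[n --> \oo] --> i / j.
    have sn0 : \forall n \near \oo, s n != 0 by apply: cvgr_neq0 sj _.
    have E : \forall n \near \oo, - (C n)^-1 * s n * (s n)^-1 = - (C n)^-1.
      by near=> n; rewrite mulfK//; near: n.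
    have h : - (C n)^-1 * s n * (s n)^-1 @[n --> \oo] --> i / j 
      by apply: (cvgM si); exact: cvgV.
    exact: cvg_trans (near_eq_cvg E) h.
  exists (i / j) => a' b' c' d' QO'; have [s' sj' si'] := box_relation QO'.
  have h : - (C n)^-1 * s' n @[n --> \oo] -->
      i / j * pint (fun x => \1_(bx a' b' c' d') x * conv w psi x) by apply: cvgM.
  exact: (cvg_unique _ si' h).
exists 0 => a b c d QO; rewrite mul0r.
have [s sj si] := box_relation QO.
have j0 : pint (fun x => \1_(bx a b c d) x * conv w psi x) = 0.
  by apply: contrapT => j0; apply: H; exists (a, b, c, d); split=> //; exact/eqP.
rewrite j0 in sj.
(* The factor 1 / C n is bounded, by [m_mass]. *)
suff h0 : - (C n)^-1 * s n @[n --> \oo] --> (0 : R) by exact: (cvg_unique _ si h0).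
apply/cvgrPdist_le => e e0; near=> n.
have Ci0 : `|(C n)^-1| = (C n)^-1 by rewrite gtr0_norm// invr_gt0.
rewrite sub0r normrN normrM normrN Ci0.
have : `|s n| <= e * c0.
  rewrite -[X in `|X|]subr0 distrC; near: n; move/cvgrPdist_le : sj; apply.
  by rewrite mulr_gt0.
move=> h; rewrite mulrC ler_pdivrMr//; apply: (le_trans h).
apply: ler_wpM2l; [exact: ltW|exact: m_mass].
Unshelve. all: by end_near. Qed.

End ApproximateIdentity.

(** * The Weyl lemma near a point *)

Section WeylLocal.
Context {R : realType}.
Local Notation mu2 := (leb2 R).
Implicit Types (w psi : plane R -> R) (D : set (plane R)).

Definition test_real D psi := (forall n, Cn n setT psi) /\
  exists K : set (plane R), [/\ compact K, K `<=` D & forall x, ~ K x -> psi x = 0].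

(** The weak equation against real test functions, for a function extended
by 0 outside [D]. *)
Definition weak_real (k : R) D w := forall psi, test_real D psi ->
  pint (fun y => w y * lapk k psi y) = 0.

Lemma norm_sq (z : plane R) : `|z| ^+ 2 <= sq z.
Proof.
rewrite plane_norm /sq; have [h|h] := leP `|z.1| `|z.2|.
  by rewrite real_normK ?num_real// lerDr sqr_ge0.
by rewrite real_normK ?num_real// lerDl sqr_ge0.
Qed.

Lemma sq_gt0 (z : plane R) : z != 0 -> 0 < sq z.
Proof.
move=> z0; apply: lt_le_trans (norm_sq z); rewrite exprn_gt0//.
by rewrite normr_gt0.
Qed.

Lemma compact_sqd (x : plane R) (b : R) : b <= 1 -> compact [set y : plane R | sqd x y <= b].
Proof.
move=> b1; apply: (@compact_bounded_closed _ _ (`|x| + 1)).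
  apply: (@closed_comp _ _ (sqd x) [set s | s <= b]); last exact: closed_le.
  by move=> y _; exact: Cn_cont (Cn_sqd 0 setT x) y I.
move=> y /= hy; have h1 : `|x - y| <= 1.
  rewrite -(@expr_le1 _ 2)//; apply: le_trans (norm_sq _) _.
  by rewrite -sqdE (le_trans hy).
have := ler_normB x (x - y); rewrite opprB addrC subrK; lra.
Qed.

Lemma is_derive_reflect (f : plane R -> R) (x y v : plane R) (d : R) :
  is_derive (x - y) v f d -> is_derive y v (fun y : plane R => f (x - y)) (- d).
Proof.
move=> /is_derive_along h; apply/is_derive_along.
have -> : (fun t : R => f (x - (t *: v + y))) = (fun t : R => f (- t *: v + (x - y))).
  by apply/funext => t; rewrite scaleNr opprD addrCA.
have dN : is_derive (0 : R) (1 : R) (fun t : R => - t) (-1 : R).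
  exact: is_deriveN (is_derive_id (0 : R) (1 : R)).
have h' : is_derive (- (0 : R)) (1 : R) (fun t : R => f (t *: v + (x - y))) d by rewrite oppr0.
by have := is_derive1_comp h' dN; rewrite mulrN1.
Qed.

Lemma sqr_le_bound (x y : R) : - y < x -> x <= y -> x ^+ 2 <= y ^+ 2.
Proof.
move=> h1 h2; rewrite -subr_ge0 (_ : _ - _ = (y - x) * (y + x)); last by ring.
by rewrite mulr_ge0//; lra.
Qed.

Lemma itg_indic_mul w q : measurable q -> itg w -> itg (fun x => \1_q x * w x).
Proof.
move=> mq hw; rewrite (_ : (fun x => _) = (fun x => w x * \1_q x)); last first.
  by apply/funext => x; rewrite mulrC.
apply: (itg_mul (B := 1) hw) => [|x]; first exact: measurable_indic.
by rewrite indicE; case: (_ \in _); rewrite ?normr1 ?normr0 ?ler01.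
Qed.

Lemma integral_indic_mul w q : measurable q -> itg w ->
  (\int[mu2]_(x in q) (w x)%:E = (pint (fun x => \1_q x * w x))%:E)%E.
Proof.
move=> mq hw; rewrite -pint_fin; last exact: itg_indic_mul.
rewrite integral_mkcond; apply: eq_integral => x _.
by rewrite patchE indicE; case: ifPn => _; rewrite ?mul1r ?mul0r.
Qed.

Lemma bes0_near (k : R) : exists2 b0 : R, 0 < b0 & forall s, 0 <= s -> s <= b0 ->
  2^-1 <= bes0 k s <= 2.
Proof.
have c0 : {for 0, continuous (bes0 k)} by apply: smooth1_cont; have [] := smooth1_bes k.
have h2 : 0 < 2^-1 :> R by rewrite invr_gt0.
move/cvgrPdist_le : c0 => /(_ _ h2) /nbhs_ballP[r /= r0 Hr].
exists (r / 2); first by rewrite divr_gt0.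
move=> s s0 sr; have : ball 0 r s.
  by rewrite -ball_normE /= sub0r normrN ger0_norm//; lra.
by move=> /Hr /=; rewrite bes0_at0 ler_norml => /andP[h3 h4]; apply/andP; split; lra.
Qed.

Lemma Cn_reflect n (ka : plane R -> R) (x : plane R) : Cn n setT ka ->
  Cn n setT (fun y : plane R => ka (x - y)).
Proof.
elim: n ka => [|n IH] ka [ck H]; split => //.
- by move=> y _; apply: shift_continuous => z; exact: ck.
- by move=> y _; apply: shift_continuous => z; exact: ck.
move=> i; have [g dg Cg] := H i; exists (fun y => -1 * g (x - y)).
  by move=> y _; rewrite mulN1r; apply: is_derive_reflect; exact: dg.
by apply: CnM; [exact: Cn_cst|exact: IH].
Qed.

Variables (k : R) (D : set (plane R)) (w : plane R -> R).
Hypotheses (hw : itg w) (weak : weak_real k D w).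

(** The translates of [klog] are test functions, so the convolutions of [w]
with [kmain] and [krest] cancel; [box_proportional] then identifies [w] on boxes
with a multiple of its convolution with the smooth limit kernel. *)
Lemma weyl_kernel (e : R) : 0 < e -> exists b : R, exists2 ka : plane R -> R, [/\ 0 < b, b < e & b <= 1] &
  [/\ forall n, Cn n setT ka, forall z, b < sq z -> ka z = 0 &
   forall a' b' c' d', (forall x, bx a' b' c' d' x -> [set y | sqd x y <= b] `<=` D) ->
     {ae mu2, forall x, bx a' b' c' d' x -> w x = conv w ka x}].
Proof.
move=> e0.
(* The kernel is supported where bes0 stays between 1/2 and 2, so that the main
   part is nonnegative and its mass is bounded below. *)
have [b0 b00 Hb0] := bes0_near k.
have [b [b_gt0 bb0 be b1]] : exists b, [/\ 0 < b, b <= b0, b < e & b <= 1].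
  pose v := Num.min (Num.min b0 e) 1.
  have v0 : 0 < v by rewrite !lt_min b00 e0 ltr01.
  have /andP[/andP[h1 h2] h3] : (v <= b0) && (v <= e) && (v <= 1).
    by rewrite /v -!le_min lexx.
  by exists (v / 2); split; lra.
have [a a0 ab] : exists2 a, 0 < a & a < b by exists (b / 2); lra.
have [chi1 dchi schi1] := smooth1_der (smooth1_sstep ab).
have [chi2 dchi1 schi2] := smooth1_der schi1.
have Ab s : 0 <= s -> s <= b -> 2^-1 <= bes0 k s <= 2.
  by move=> s0 sb; apply: Hb0 => //; lra.
have [d [dp da d0]] : exists d : nat -> R,
    [/\ forall n, 0 < d n, forall n, 2 * d n <= a & d @ \oo --> (0 : R)].
  exists (fun n => a / 2 * n.+1%:R^-1); split.
  - by move=> n; rewrite mulr_gt0 ?divr_gt0 ?invr_gt0 ?ltr0n.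
  - move=> n; rewrite mulrA mulrCA divff ?pnatr_eq0// mulr1 ler_piMr ?(ltW a0)//.
    by rewrite invf_le1 ?ltr0n// ler1n.
  - by rewrite -[X in _ --> X](mulr0 (a / 2)); apply: cvgM; [exact: cvg_cst|exact: cvg_harmonic].
have d1 n : d n <= 1 by have := da n; have := dp n; lra.
pose m n (z : plane R) := kmain k a b (d n) (sq z).
pose r n (z : plane R) := krest k a b chi1 chi2 (d n) (sq z).
pose psi (z : plane R) := klim k a chi1 chi2 (sq z).
have sk n := smooth1_kernels k ab schi1 schi2 (d n).
have sqJ n (z : plane R) : setT z -> [set s | 0 < s + d n] (sq z).
  by move=> _ /=; rewrite ltr_wpDl// sq_ge0.
have Cm j n : Cn j setT (m n).
  have [_ h _] := sk n; exact: (Cn_smooth1 (sqJ n) h (Cn_sq _ _)).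
have Cr j n : Cn j setT (r n).
  have [_ _ h] := sk n; exact: (Cn_smooth1 (sqJ n) h (Cn_sq _ _)).
have Cpsi j : Cn j setT psi.
  apply: (Cn_smooth1 _ (smooth1_klim k a0 schi1 schi2) (Cn_sq _ _)) => z _ /=.
  by rewrite (lt_le_trans _ (sq_ge0 z))// oppr_lt0 divr_gt0.
have sq1 (z : plane R) : 1 < `|z| -> b < sq z.
  move=> z1; apply: (le_lt_trans b1); apply: lt_le_trans (norm_sq z).
  by rewrite exprn_egt1.
have m_supp n z : 1 < `|z| -> m n z = 0 by move=> /sq1 h; exact: kmain_gt.
have r_supp n z : 1 < `|z| -> r n z = 0.
  by move=> /sq1 h; exact: (krest_gt k dchi dchi1 (d n) h).
have psi_gt z : b < sq z -> psi z = 0 by move=> h; exact: (klim_gt k dchi dchi1 h).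
have psi_supp z : 1 < `|z| -> psi z = 0 by move=> /sq1; exact: psi_gt.
have m_ge0 n z : 0 <= m n z by apply: kmain_ge0 => //; exact: sq_ge0.
have m_even n z : m n (- z) = m n z by rewrite /m sq_sym.
have m_mass n : 8 / 9 <= pint (m n).
  pose de := Num.sqrt (d n).
  have de0 : 0 < de by rewrite sqrtr_gt0.
  have de2 : de ^+ 2 = d n by rewrite sqr_sqrtr// ltW.
  have -> : 8 / 9 = pint (fun x => (2 / 9 * (d n)^-1) * \1_(bx (- de) de (- de) de) x).
    rewrite pintZ; last exact: itg_bx.
    rewrite pint_bx; try lra.
    have -> : (de - - de) * (de - - de) = 4 * d n by rewrite -de2; ring.
    by field; rewrite gt_eqF.
  apply: pint_le.
  - by apply: itgZ; exact: itg_bx.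
  - exact: (itg_supp (Cn_continuous (Cm 0%N n)) (m_supp n)).
  - move=> x; rewrite indicE; have [xb|_] := boolP (x \in _); last by rewrite mulr0.
    rewrite mulr1; move: xb; rewrite inE /bx /= !in_itv /= => -[/andP[h1 h2] /andP[h3 h4]].
    have x1 : x.1 ^+ 2 <= d n by rewrite -de2; exact: sqr_le_bound.
    have x2 : x.2 ^+ 2 <= d n by rewrite -de2; exact: sqr_le_bound.
    have sx : sq x <= 2 * d n by rewrite /sq; lra.
    by apply: kmain_lower => //; [exact: sq_ge0|have := da n; lra].
have m_conc rho : 0 < rho -> exists2 e : nat -> R, e @ \oo --> (0 : R) &
     forall n z, rho <= `|z| -> m n z <= e n.
  move=> rho0; exists (fun n => 8 * d n * (rho ^+ 2) ^- 2).
    rewrite -[X in _ --> X](mul0r ((rho ^+ 2) ^- 2)); apply: cvgM; last exact: cvg_cst.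
    by rewrite -[X in _ --> X](mulr0 8); apply: cvgM => //; exact: cvg_cst.
  move=> n z rz; apply: kmain_le => //; first by rewrite exprn_gt0.
  by apply: le_trans (norm_sq z); rewrite lerXn2r ?nnegrE// ltW.
have [B B0 HB] := krest_bounded k a0 ab dchi dchi1 schi1 schi2.
have r_bound n z : `|r n z| <= B by apply: HB => //; exact: sq_ge0.
have r_cvg z : z != 0 -> r n z @[n --> \oo] --> psi z.
  by move=> z0; apply: (krest_cvg a0 ab dchi dchi1) => //; exact: sq_gt0.
pose O : set (plane R) := [set x | [set y | sqd x y <= b] `<=` D].
have eqO n x : O x -> conv w (m n) x + conv w (r n) x = 0.
  move=> Ox.
  have T : test_real D (fun y => klog k a b (d n) (sqd x y)).
    split=> [j|].
      have [h _ _] := sk n; apply: (Cn_smooth1 _ h (Cn_sqd _ _ _)) => y _ /=.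
      by rewrite ltr_wpDl// addr_ge0 ?sqr_ge0.
    exists [set y | sqd x y <= b]; split=> //; first exact: compact_sqd.
    by move=> y /negP; rewrite -ltNge; exact: klog_gt.
  have := weak T; rewrite -pintD; last 2 first.
  - have [Bm _ HBm] := bounded_supp (Cn_continuous (Cm 0%N n)) (m_supp n).
    apply: (itg_mul hw) => [|y]; last exact: HBm.
    by apply: shift_measurable; exact: (Cn_continuous (Cm 0%N n)).
  - apply: (itg_mul hw) => [|y]; last exact: r_bound.
    by apply: shift_measurable; exact: (Cn_continuous (Cr 0%N n)).
  move=> <-; apply: pint_ext => y.
  by rewrite (klog_lapk k dchi dchi1)// -mulrDr.
have c0 : 0 < 8 / 9 :> R by rewrite divr_gt0.
have [la Hla] := box_proportional hw (Cm 1%N) (Cr 1%N) (Cpsi 1%N) m_supp r_supp psi_supp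
  m_ge0 m_even c0 m_mass m_conc r_bound r_cvg eqO.
pose ka (z : plane R) := la * psi z.
have Cka n : Cn n setT ka by apply: CnM => //; exact: Cn_cst.
have ka_supp z : 1 < `|z| -> ka z = 0 by move=> h; rewrite /ka psi_supp// mulr0.
have [Bp _ HBp] := bounded_supp (Cn_continuous (Cpsi 0%N)) psi_supp.
have conv_ka x : conv w ka x = la * conv w psi x.
  rewrite /conv -pintZ; last first.
    apply: (itg_mul hw) => [|y]; last exact: HBp.
    by apply: shift_measurable; exact: (Cn_continuous (Cpsi 0%N)).
  by apply: pint_ext => y; rewrite /ka; ring.
exists b, ka => //; split=> // [z h|a' b' c' d' QD]; first by rewrite /ka psi_gt// mulr0.
have cka : continuous (conv w ka) := conv_continuous hw (Cka 1%N) ka_supp.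
have cpsi : continuous (conv w psi) := conv_continuous hw (Cpsi 1%N) psi_supp.
pose Q := bx a' b' c' d'.
have iwp a2 b2 c2 d2 : itg (fun x => \1_(bx a2 b2 c2 d2) x * conv w psi x).
  apply: (itg_mul (itg_bx _ _ _ _)); first exact: continuous_measurable_plane.
  by move=> x; apply: pint_mul_le => //; apply: shift_measurable; exact: (Cn_continuous (Cpsi 0%N)).
have mb a2 b2 c2 d2 : measurable (bx a2 b2 c2 d2 : set (plane R)) by exact: measurable_bx.
have hf : itg (fun x => \1_Q x * w x - la * (\1_Q x * conv w psi x)).
  exact: (itgB (itg_indic_mul (mb a' b' c' d') hw) (itgZ la (iwp a' b' c' d'))).
have := @box_null_ae R a' b' c' d' _ hf; set P := (X in (X -> _) -> _).
have HP : P.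
  move=> a2 b2' c2 d2 sub.
  have O2 : bx a2 b2' c2 d2 `<=` O by move=> x /sub/QD.
  rewrite (integral_indic_mul (mb a2 b2' c2 d2) hf); congr (_%:E).
  rewrite (@pint_ext _ _ (fun x => \1_(bx a2 b2' c2 d2) x * w x -
      la * (\1_(bx a2 b2' c2 d2) x * conv w psi x))).
    rewrite (pintB (itg_indic_mul (mb a2 b2' c2 d2) hw) (itgZ la (iwp a2 b2' c2 d2))).
    by rewrite (Hla _ _ _ _ O2) (pintZ la (iwp a2 b2' c2 d2)) subrr.
  move=> x; rewrite !indicE; have [xQ|xQ] := boolP (x \in bx a2 b2' c2 d2); last by rewrite !mul0r mulr0 subr0.
  have -> : x \in Q by apply: mem_set; exact: (sub _ (set_mem xQ)).
  by rewrite !mul1r.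
move=> /(_ HP); apply: filterS => x hx Qx; have := hx Qx.
by rewrite indicE mem_set// !mul1r conv_ka => /eqP; rewrite subr_eq0 => /eqP.
Qed.

(** The derivatives fall on the kernel, and the reflected translate of the
kernel is a test function for the weak equation. *)
Lemma conv_solution (b : R) (ka : plane R -> R) (x : plane R) :
  b <= 1 -> (forall n, Cn n setT ka) -> (forall z, b < sq z -> ka z = 0) ->
  [set y | sqd x y <= b] `<=` D -> lapk k (conv w ka) x = 0.
Proof.
move=> b1 Ck k0 xD.
have sq1 (z : plane R) : 1 < `|z| -> b < sq z.
  move=> z1; apply: (le_lt_trans b1); apply: lt_le_trans (norm_sq z).
  by rewrite exprn_egt1.
have supp z : 1 < `|z| -> ka z = 0 by move=> /sq1; exact: k0.
have D2 i : exists g g' : plane R -> R, [/\ forall z, is_derive z (dir i) ka (g z),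
    forall z, is_derive z (dir i) g (g' z), Cn 3 setT g & Cn 2 setT g'].
  have [_ /(_ i)[g dg Cg]] := Ck 4%N; have [_ /(_ i)[g' dg' Cg']] := Cg.
  exists g, g'; split=> // z; [exact: dg|exact: dg'].
have pd i : exists g', [/\ partials [:: i; i] (conv w ka) x = conv w g' x,
   (forall y, partials [:: i; i] (fun y => ka (x - y)) y = g' (x - y)),
   continuous g' & forall z, 1 < `|z| -> g' z = 0].
  have [g [g' [dg dg' Cg Cg']]] := D2 i.
  have gs := derive_supp dg supp; have gs' := derive_supp dg' gs.
  exists g'; split=> //; last exact: Cn_continuous Cg'.
    apply: (partials2 openT) => //.
    - move=> y _; apply: (conv_derive hw (Ck 2%N) supp dg).
      exact: (@Cn_leq _ 1 3 _ _ _ Cg).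
    - apply: (conv_derive hw _ gs dg'); first exact: (@Cn_leq _ 2 3 _ _ _ Cg).
      exact: (@Cn_leq _ 1 2 _ _ _ Cg').
  move=> y; apply: (@partials2 _ _ (fun y => - g (x - y)) _ setT) => //; first exact: openT.
    by move=> z _; apply: is_derive_reflect; exact: dg.
  have := is_deriveN (is_derive_reflect (dg' (x - y))); rewrite opprK; exact.
have [g0 [E0 F0 c0 s0]] := pd 0; have [g1 [E1 F1 c1 s1]] := pd 1.
have T : test_real D (fun y => ka (x - y)).
  split=> [n|].
    exact: Cn_reflect.
  exists [set y | sqd x y <= b]; split=> //; first exact: compact_sqd.
  by move=> y /negP; rewrite -ltNge sqdE; exact: k0.
have := weak T => <-; rewrite /lapk E0 E1.
have it g : continuous g -> (forall z, 1 < `|z| -> g z = 0) -> itg (fun y => w y * g (x - y)).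
  move=> cg sg; have [B _ HB] := bounded_supp cg sg.
  by apply: (itg_mul hw) => [|y]; [exact: shift_measurable|exact: HB].
have ck := Cn_continuous (Ck 0%N).
rewrite /conv -pintZ; last exact: it. 
rewrite -!pintD; try exact: it.
- by apply: pint_ext => y; rewrite F0 F1; ring.
- by apply: itgD; exact: it.
- by apply: itgZ; exact: it.
Qed.

End WeylLocal.

(** * The Weyl lemma on an open set *)

Section Glue.
Context {R : realType}.
Local Notation mu2 := (leb2 R).
Implicit Types (f g w : plane R -> R) (O D : set (plane R)).

(** A nonempty open set is not negligible, as it contains a box. *)
Lemma ae_eq_cont f g O : open O -> continuous f -> continuous g ->
  {ae mu2, forall x, O x -> f x = g x} -> forall x, O x -> f x = g x.
Proof.
move=> oO cf cg [N [mN N0 sN]] x Ox; apply: contrapT => /eqP fg.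
have fg' : [set y | f y - g y != 0] x by rewrite /= subr_eq0.
have oU : open (O `&` [set y | f y - g y != 0]).
  apply: openI => //; apply: (@open_comp _ _ (fun y => f y - g y) [set t | t != 0]).
    by move=> y _; apply: continuousB; [exact: cf|exact: cg].
  exact: open_neq.
have [e e0 He] := (open_planeP _).1 oU x (conj Ox fg').
have eb : bx (x.1 - e / 4) (x.1 + e / 4) (x.2 - e / 4) (x.2 + e / 4) `<=` N.
  move=> y [/=]; rewrite !in_itv /= => /andP[h1 h2] /andP[h3 h4]; apply: sN => /=.
  have [Oy fy] : (O `&` [set y | f y - g y != 0]) y.
    apply: He; rewrite -of_planeB; apply: le_lt_trans (modulus_le _) _ => /=.
    have : `|y.1 - x.1| <= e / 4 by rewrite ler_distl ltW.
    have : `|y.2 - x.2| <= e / 4 by rewrite ler_distl ltW.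
    lra.
  by move=> /(_ Oy) fgy; move: fy; rewrite /= fgy subrr eqxx.
have := le_measure mu2 (mem_set (measurable_bx (x.1 - e / 4) (x.1 + e / 4) (x.2 - e / 4) (x.2 + e / 4)))
   (mem_set mN) eb.
have h := @bx_measure R (x.1 - e / 4) (x.1 + e / 4) (x.2 - e / 4) (x.2 + e / 4) ltac:(lra) ltac:(lra).
rewrite [X in (X <= _)%E]h [X in (_ <= X)%E]N0 lee_fin leNgt => /negP; apply.
by apply: mulr_gt0; lra.
Qed.

(** Countably many rational boxes cover, so an almost everywhere statement
known on small boxes holds on the open set. *)
Lemma ae_rational_cover (P : plane R -> Prop) (G O : set (plane R)) :
  (forall x, O x -> exists2 e : R, 0 < e & forall y, modulus (of_plane y - of_plane x) < e -> G y) ->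
  (forall a b c d, bx a b c d `<=` G -> {ae mu2, forall x, bx a b c d x -> P x}) ->
  {ae mu2, forall x, O x -> P x}.
Proof.
move=> OG H.
have : {ae mu2, forall x, forall n : nat, if unpickle n is Some u then
   (rbx u `<=` G -> rbx u x -> P x) else True}.
  apply: ae_foralln => n; case: (unpickle n) => [u|]; last exact: aeW.
  have [uG|uG] := pselect (rbx u `<=` G); last by apply: aeW.
  by have := H _ _ _ _ uG; apply: filterS => x h _; exact: h.
apply: filterS => x Hx Ox; have [e e0 He] := OG x Ox.
have [u ux uO] := rbx_near x e0.
have := Hx (pickle u); rewrite pickleK; apply => //.
by move=> y /uO/He.
Qed.

Lemma Cn_ext n O f g : open O -> (forall x, O x -> f x = g x) -> Cn n O g -> Cn n O f.
Proof.
move=> oO; elim: n f g => [|n IH] f g fg [cg H].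
  split=> // x Ox; have nfg : \near x, g x = f x.
    by near=> y; apply/esym/fg; near: y; exact: open_nbhs_nbhs.
  have cg' : g @ x --> f x by rewrite fg//; exact: cg.
  exact: cvg_trans (near_eq_cvg nfg) cg'.
split.
  move=> x Ox; have nfg : \near x, g x = f x.
    by near=> y; apply/esym/fg; near: y; exact: open_nbhs_nbhs.
  have cg' : g @ x --> f x by rewrite fg//; exact: cg.
  exact: cvg_trans (near_eq_cvg nfg) cg'.
move=> i; have [g' dg Cg] := H i; exists g' => // x Ox.
apply: near_eq_is_derive (dg x Ox); near=> y; apply/esym/fg; near: y; exact: open_nbhs_nbhs.
Unshelve. all: by end_near. Qed.

(** The derivatives given on the neighbourhoods agree on overlaps, being
derivatives of the same function. *)
Lemma Cn_local n D f : (forall x, D x -> exists O, [/\ open O, O x & Cn n O f]) -> Cn n D f.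
Proof.
elim: n f => [|n IH] f H.
  by split=> // x /H [V [_ Ox CO]]; exact: (Cn_cont CO).
split; first by move=> x /H [V [_ Ox CO]]; exact: (Cn_cont CO).
move=> i; exists (fun x => 'D_(dir i) f x).
  move=> x /H [V [oO Ox [_ /(_ i)[g dg _]]]]; have [d1 _] := dg x Ox; by split.
apply: IH => x /H [V [oO Ox [_ /(_ i)[g dg Cg]]]]; exists V; split=> //.
by apply: (Cn_ext oO _ Cg) => y Oy; have [] := dg y Oy.
Qed.

Lemma lapk_ext k f g O x : open O -> (forall y, O y -> f y = g y) -> O x -> lapk k f x = lapk k g x.
Proof.
move=> oO fg Ox.
have h (f' g' : plane R -> R) i : (forall y, O y -> f' y = g' y) ->
    forall y, O y -> 'D_(dir i) f' y = 'D_(dir i) g' y.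
  move=> fg' y Oy; apply: near_eq_derive; near=> z; apply: fg'; near: z; exact: open_nbhs_nbhs.
have E0 : partials [:: 0; 0] f x = partials [:: 0; 0] g x := h _ _ 0 (h f g 0 fg) x Ox.
have E1 : partials [:: 1; 1] f x = partials [:: 1; 1] g x := h _ _ 1 (h f g 1 fg) x Ox.
by rewrite /lapk E0 E1 (fg x Ox).
Unshelve. all: by end_near. Qed.

(** At each scale 1/n, [weyl_kernel] gives a smooth solution on the points of
[D] that are far enough from the boundary. Two of these solutions agree almost
everywhere, hence everywhere by continuity, and they glue to a solution on
[D]. *)
Lemma weyl k D w : open D -> itg w -> weak_real k D w -> exists u : plane R -> R,
  [/\ forall n, Cn n D u, {ae mu2, forall x, D x -> w x = u x} &
      forall x, D x -> lapk k u x = 0].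
Proof.
move=> oD hw weak.
have ip (n : nat) : 0 < n.+1%:R^-1 :> R by rewrite invr_gt0.
have [b Hb] := choice (fun n : nat => weyl_kernel hw weak (ip n)).
have Hb' n : exists ka : plane R -> R,
    [/\ 0 < b n, b n < n.+1%:R^-1 & b n <= 1] /\
    [/\ forall j, Cn j setT ka, forall z, b n < sq z -> ka z = 0 &
     forall a' b' c' d', (forall x, bx a' b' c' d' x -> [set y | sqd x y <= b n] `<=` D) ->
     {ae mu2, forall x, bx a' b' c' d' x -> w x = conv w ka x}].
  by have [ka h1 h2] := Hb n; exists ka.
have [ka Hka] := choice Hb'.
pose v n := conv w (ka n).
have supp n z : 1 < `|z| -> ka n z = 0.
  have [[_ _ b1] [_ k0 _]] := Hka n => z1; apply: k0; apply: (le_lt_trans b1).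
  by apply: lt_le_trans (norm_sq z); rewrite exprn_egt1.
have Cv n j : Cn j setT (v n).
  have [_ [Ck _ _]] := Hka n; exact: (conv_Cn hw (Ck j.+2) (supp n)).
pose G n : set (plane R) := [set x | [set y | sqd x y <= b n] `<=` D].
pose O n : set (plane R) := (G n)^°.
have oO n : open (O n) by exact: open_interior.
have OG n : O n `<=` G n by exact: interior_subset.
have GO n x : O n x -> exists2 e : R, 0 < e & forall y, modulus (of_plane y - of_plane x) < e -> G n y.
  by move=> Ox; have /nbhs_planeP[e e0 He] : nbhs x (G n) by []; exists e.
have aev n : {ae mu2, forall x, O n x -> w x = v n x}.
  have [_ [_ _ ae]] := Hka n.
  apply: (@ae_rational_cover (fun x => w x = v n x) (G n)); first exact: GO.
  by move=> a c d e sub; apply: ae => x /sub.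
have sol n x : O n x -> lapk k (v n) x = 0.
  move=> /OG Gx; have [[_ _ b1] [Ck k0 _]] := Hka n.
  exact: (conv_solution hw weak b1 Ck k0 Gx).
have cov x : D x -> exists n, O n x.
  move=> Dx; have [e e0 He] := (open_planeP _).1 oD x Dx.
  (* The condition defining G n bounds the square of a distance by 1 / (n + 1). *)
  pose n := Num.trunc (16 / e ^+ 2); exists n.
  have e2 : 0 < e ^+ 2 by rewrite exprn_gt0.
  have ne : n.+1%:R^-1 < e ^+ 2 / 16.
    rewrite -[e ^+ 2 / 16]invrK ltf_pV2 ?posrE ?invr_gt0 ?divr_gt0// invfM invrK mulrC.
    exact: truncnS_gt.
  have [[b0 be _] _] := Hka n.
  apply/nbhs_planeP; exists (e / 2); first by rewrite divr_gt0.
  move=> y yx z /= hz; apply: He.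
  have : modulus (of_plane z - of_plane y) <= e / 4.
    rewrite -(@ler_pXn2r _ 2) ?nnegrE ?modulus_ge0//; last by rewrite divr_ge0// ltW.
    rewrite modulus_sqr -of_planeB /=.
    have -> : (z.1 - y.1) ^+ 2 + (z.2 - y.2) ^+ 2 = sqd y z by rewrite /sqd; ring.
    have -> : (e / 4) ^+ 2 = e ^+ 2 / 16 by field.
    by apply: ltW; apply: (le_lt_trans hz); exact: (lt_trans be ne).
  have := modulus_tri (of_plane z) (of_plane y) (of_plane x); lra.
have vv n m x : O n x -> O m x -> v n x = v m x.
  move=> On Om; apply: (@ae_eq_cont _ _ (O n `&` O m)); last by split.
  - exact: openI.
  - exact: Cn_continuous (Cv n 0%N).
  - exact: Cn_continuous (Cv m 0%N).
  - apply: filterS2 (aev n) (aev m) => y h1 h2 [y1 y2]; rewrite -h1//; exact: h2.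
pose u x := v (xget 0%N [set n | O n x]) x.
have uv n x : O n x -> u x = v n x.
  by move=> On; apply: vv => //; apply: (@xgetPex _ 0%N [set n | O n x]); exists n.
exists u; split.
- move=> n; apply: Cn_local => x Dx; have [m Om] := cov x Dx.
  exists (O m); split=> //; apply: (Cn_ext (oO m) (fun y => @uv m y)).
  exact: Cn_sub (Cv m n).
- have : {ae mu2, forall x, forall n, O n x -> w x = v n x} by apply: ae_foralln.
  apply: filterS => x h Dx; have [n On] := cov x Dx.
  by rewrite (uv n)//; exact: h.
- move=> x Dx; have [n On] := cov x Dx; rewrite -(sol n x On).
  exact: (lapk_ext k (oO n) (fun y => @uv n y) On).
Qed.

End Glue.

(** * Green's formula *)

Section Green.
Context {R : realType}.
Local Notation mu2 := (leb2 R).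
Local Notation leb := (@lebesgue_measure R).
Implicit Types (f g u v : plane R -> R) (D K : set (plane R)).

(** The fundamental theorem of calculus on an interval that contains the
support. *)
Lemma line_integral0 (f g : R -> R) (M : R) : (forall t, is_derive t (1 : R) f (g t)) ->
  continuous g -> (forall t, M < `|t| -> f t = 0) -> (forall t, M < `|t| -> g t = 0) ->
  (\int[leb]_t (g t)%:E = 0)%E.
Proof.
move=> df cg f0 g0; pose L := `|M| + 1.
have LM t : L <= `|t| -> M < `|t|.
  by move=> h; apply: lt_le_trans h; rewrite /L; have := ler_norm M; lra.
have L0 : 0 < L by rewrite /L ltr_wpDl.
have cf : continuous f.
  by move=> t; have [d _] := df t; exact/differentiable_continuous/derivable1_diffP.
have E : (\int[leb]_(t in `[(- L)%R, L]) (g t)%:E = (f L)%:E - (f (- L))%:E)%E.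
  apply: continuous_FTC2.
  - by lra.
  - exact: continuous_subspaceT.
  - have cw : {within `[(- L), L], continuous f} by exact: continuous_subspaceT.
    have LL : - L < L by lra.
    have [_ c0 c1] := (continuous_within_itvP _ LL).1 cw.
    by split=> // x _; have [] := df x.
  - by move=> x _; rewrite derive1E; have [] := df x.
have fL : f L = 0 by apply: f0; apply: LM; rewrite ger0_norm// ltW.
have fNL : f (- L) = 0 by apply: f0; apply: LM; rewrite normrN ger0_norm// ltW.
rewrite fL fNL subee// in E; rewrite -[RHS]E [RHS]integral_mkcond.
apply: eq_integral => t _; rewrite patchE; case: ifPn => // /negP tL.
rewrite g0//; apply: LM; rewrite leNgt; apply/negP => h; apply: tL.
by rewrite inE /= in_itv /= -ler_norml ltW.
Qed.

(** Integrate first along the lines in the direction of the derivative. *)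
Lemma pint_derive0 f g (i : 'I_2) (M : R) : (forall x, is_derive x (dir i) f (g x)) ->
  continuous g -> (forall x, M < `|x| -> f x = 0) -> pint g = 0.
Proof.
move=> df cg f0; have g0 := derive_supp df f0.
have ig := itg_supp cg g0.
rewrite pint_def.
have ct (h : R -> plane R) : (forall s t, modulus (of_plane (h s) - of_plane (h t)) <= `|s - t|) ->
    continuous (fun t => g (h t)).
  move=> lip t; apply: (continuous_comp (f := h) (g := g)); last exact: cg.
  move=> V /nbhs_planeP[e e0 He].
  apply/nbhs_ballP; exists e => // s; rewrite -ball_normE /= distrC => st.
  by apply: He; apply: le_lt_trans (lip _ _) st.
have i01 : i = 0 \/ i = 1.
  by case: i {df} => -[|[|//]] h; [left|right]; apply/val_inj.
case: i01 df => -> df.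
  rewrite -(@integral21_prod_meas1 _ _ _ _ R leb leb _ ig) /fubini_G.
  rewrite (eq_integral (fun=> 0%E)) ?integral0// => y _.
  apply: (@line_integral0 (fun t => f (t, y)) (fun t => g (t, y)) M).
  - move=> t; have := is_derive_shift_line (x := (0, y)) (v := dir 0) (t := t).
    have e (s : R) : s *: dir 0 + (0, y) = (s, y) :> plane R.
      by rewrite dir0E; congr pair; rewrite /= /GRing.scale /= ?mulr1 ?mulr0 ?addr0 ?add0r.
    rewrite e => /(_ f _ (df (t, y))).
    by rewrite (_ : (fun t => f _) = (fun t => f (t, y)))//; apply/funext => s; rewrite e.
  - apply: ct => s t; rewrite -of_planeB; apply: (le_trans (modulus_le _)).
    by rewrite /= subrr normr0 addr0.
  - by move=> t tM; apply: f0; rewrite plane_norm lt_max tM.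
  - by move=> t tM; apply: g0; rewrite plane_norm lt_max tM.
rewrite -(@integral12_prod_meas1 _ _ _ _ R leb leb _ ig) /fubini_F.
rewrite (eq_integral (fun=> 0%E)) ?integral0// => y _.
apply: (@line_integral0 (fun t => f (y, t)) (fun t => g (y, t)) M).
- move=> t; have := is_derive_shift_line (x := (y, 0)) (v := dir 1) (t := t).
  have e (s : R) : s *: dir 1 + (y, 0) = (y, s) :> plane R.
    by rewrite dir1E; congr pair; rewrite /= /GRing.scale /= ?mulr1 ?mulr0 ?addr0 ?add0r.
  rewrite e => /(_ f _ (df (y, t))).
  by rewrite (_ : (fun t => f _) = (fun t => f (y, t)))//; apply/funext => s; rewrite e.
- apply: ct => s t; rewrite -of_planeB; apply: (le_trans (modulus_le _)).
  by rewrite /= subrr normr0 add0r.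
- by move=> t tM; apply: f0; rewrite plane_norm lt_max tM orbT.
- by move=> t tM; apply: g0; rewrite plane_norm lt_max tM orbT.
Qed.

Definition ext0 D v : plane R -> R := fun x => if pselect (D x) then v x else 0.

Lemma ext0E D v x : D x -> ext0 D v x = v x.
Proof. by rewrite /ext0; case: pselect. Qed.
Lemma ext0N D v x : ~ D x -> ext0 D v x = 0.
Proof. by rewrite /ext0; case: pselect. Qed.

(** A product with a function supported in a closed subset of [D] is smooth
across the boundary of [D]. *)
Lemma ext0_mul_derive D K v v' f f' i : open D -> closed K -> K `<=` D ->
  (forall x, D x -> is_derive x (dir i) v (v' x)) -> (forall x, is_derive x (dir i) f (f' x)) ->
  (forall x, ~ K x -> f x = 0) ->
  forall x, is_derive x (dir i) (fun x => ext0 D v x * f x) (ext0 D v x * f' x + f x * ext0 D v' x).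
Proof.
move=> oD cK KD dv df f0 x; have [Dx|Dx] := pselect (D x).
  have h := is_deriveM (dv x Dx) (df x); rewrite !ext0E//.
  apply: near_eq_is_derive h; near=> y; rewrite /= ext0E//; near: y; exact: open_nbhs_nbhs.
rewrite !ext0N// mul0r mulr0 addr0.
apply: (near_eq_is_derive _ (is_derive_cst (0 : R) x (dir i))).
have oK : open (~` K) by exact: closed_openC.
near=> y; rewrite f0 ?mulr0//; near: y; apply: open_nbhs_nbhs; split=> // /KD.
by [].
Unshelve. all: by end_near. Qed.

Lemma ext0_mul_cont D K v f : open D -> closed K -> K `<=` D ->
  (forall x, D x -> {for x, continuous v}) -> continuous f ->
  (forall x, ~ K x -> f x = 0) -> continuous (fun x => ext0 D v x * f x).
Proof.
move=> oD cK KD cv cf f0 x; have [Dx|Dx] := pselect (D x).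
  have E : \near x, v x * f x = ext0 D v x * f x.
    near=> y; rewrite ext0E//; near: y; exact: open_nbhs_nbhs.
  have h : (fun x => v x * f x) @ x --> ext0 D v x * f x.
    by rewrite ext0E//; apply: continuousM; [exact: cv|exact: cf].
  exact: cvg_trans (near_eq_cvg E) h.
have oK : open (~` K) by exact: closed_openC.
have E : \near x, 0 = ext0 D v x * f x.
  near=> y; rewrite f0 ?mulr0//; near: y; apply: open_nbhs_nbhs; split=> // /KD.
  by [].
have h : (fun _ : plane R => 0 : R) @ x --> ext0 D v x * f x.
  by rewrite ext0N// mul0r; exact: cvg_cst.
exact: cvg_trans (near_eq_cvg E) h.
Unshelve. all: by end_near. Qed.

Lemma derive_off K f f' (v : plane R) : closed K -> (forall x, is_derive x v f (f' x)) ->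
  (forall x, ~ K x -> f x = 0) -> forall x, ~ K x -> f' x = 0.
Proof.
move=> cK df f0 x Kx; have [_ <-] := df x.
have oK : open (~` K) by exact: closed_openC.
rewrite (@near_eq_derive _ _ _ f (fun _ => 0) x v) ?derive_cst//.
by near=> y; apply: f0; near: y; exact: open_nbhs_nbhs.
Unshelve. all: by end_near. Qed.

Lemma compact_bound K : compact K -> exists M : R, forall x, K x -> `|x| <= M.
Proof.
move=> cK; have := compact_bounded cK; rewrite /bounded_set => -[M [_ HM]].
by exists (M + 1) => x Kx; apply: (HM (M + 1)) => //; rewrite ltrDl.
Qed.

(** Twice integration by parts in each direction: u d^2 f - d^2 u f is the
derivative of u df - du f, which has compact support in [D]. The factor [f] is
only twice differentiable, in the sense required of cut potentials. *)
Lemma green k D K u f (f1 f2 : 'I_2 -> plane R -> R) : open D -> compact K -> K `<=` D ->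
  Cn 2 D u -> (forall x, D x -> lapk k u x = 0) ->
  (forall i x, is_derive x (dir i) f (f1 i x)) ->
  (forall i x, is_derive x (dir i) (f1 i) (f2 i x)) ->
  continuous f -> (forall i, continuous (f1 i)) -> (forall i, continuous (f2 i)) ->
  (forall x, ~ K x -> f x = 0) ->
  pint (fun x => ext0 D u x * (f2 0 x + f2 1 x + k ^+ 2 * f x)) = 0.
Proof.
move=> oD cK KD Cu Lu df df1 cf cf1 cf2 f0.
have clK : closed K by exact: compact_closed.
have [M HM] := compact_bound cK.
have f10 i := derive_off clK (df i) f0; have f20 i := derive_off clK (df1 i) (f10 i).
have cu := Cn_cont Cu.
have key i : exists g2, [/\ forall x, D x -> partials [:: i; i] u x = g2 x,
    forall x, D x -> {for x, continuous g2} &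
    pint (fun x => ext0 D u x * f2 i x - ext0 D g2 x * f x) = 0].
  have [_ /(_ i)[g dg Cg]] := Cu; have [_ /(_ i)[g2 dg2 Cg2]] := Cg.
  have cg := Cg.1; have cg2 := Cg2.1.
  exists g2; split=> //.
    by move=> x Dx; apply: (partials2 oD dg Dx); exact: dg2.
  apply: (@pint_derive0 (fun x => ext0 D u x * f1 i x - ext0 D g x * f x) _ i M).
  - move=> x; have h1 := ext0_mul_derive oD clK KD dg (df1 i) (f10 i) x.
    have h2 := ext0_mul_derive oD clK KD dg2 (df i) f0 x.
    by apply: is_derive_eq (is_deriveB h1 h2) _; ring.
  - have hA := ext0_mul_cont oD clK KD cu (@cf2 i) (f20 i).
    have hB := ext0_mul_cont oD clK KD cg2 cf f0.
    by move=> x; exact: (continuousB (hA x) (hB x)).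
  - move=> x Mx; have Kx : ~ K x by move=> /HM; rewrite leNgt Mx.
    by rewrite f0// f10// !mulr0 subr0.
have [g0 [E0 c0 I0]] := key 0; have [g1 [E1 c1 I1]] := key 1.
have it v g : (forall x, D x -> {for x, continuous v}) -> continuous g ->
    (forall x, ~ K x -> g x = 0) -> itg (fun x => ext0 D v x * g x).
  move=> cv cg g_0; apply: (@itg_supp _ _ M); first exact: (ext0_mul_cont oD clK KD).
  by move=> x Mx; rewrite g_0 ?mulr0// => /HM; rewrite leNgt Mx.
have := congr2 +%R I0 I1; rewrite addr0 -pintD; last 2 first.
- exact: (itgB (it _ _ cu (@cf2 0) (f20 0)) (it _ _ c0 cf f0)).
- exact: (itgB (it _ _ cu (@cf2 1) (f20 1)) (it _ _ c1 cf f0)).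
move=> <-; apply: pint_ext => x; have [Dx|Dx] := pselect (D x); last first.
  by rewrite !ext0N// !mul0r; ring.
have := Lu x Dx; rewrite /lapk E0// E1// !ext0E// => h.
have hk : k ^+ 2 * u x = - (g0 x + g1 x) by lra.
have -> : u x * (f2 0 x + f2 1 x + k ^+ 2 * f x) = u x * f2 0 x + u x * f2 1 x + (k ^+ 2 * u x) * f x by ring.
by rewrite hk; ring.
Qed.

End Green.

(** * Functions on the disc transported to the plane *)

Section PlanarGlue.
Context {R : realType}.
Local Notation C := R[i].
Implicit Types (O K : set (plane R)) (v f : plane R -> R).

(** Extension by 0 does not change germs inside [O], and gives the germ of 0
outside, when the function vanishes off a closed subset. *)
Lemma ext0_near O K v x : open O -> closed K -> K `<=` O ->
  (forall x, O x -> ~ K x -> v x = 0) ->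
  (O x /\ \forall y \near x, v y = ext0 O v y) \/ (~ O x /\ \forall y \near x, 0 = ext0 O v y).
Proof.
move=> oO cK KO v0; have [Ox|Ox] := pselect (O x); [left|right]; split=> //.
  near=> y; rewrite ext0E//; near: y; exact: open_nbhs_nbhs.
have oK : open (~` K) by exact: closed_openC.
have xK : (~` K) x by move/KO.
near=> y; have [Oy|Oy] := pselect (O y); last by rewrite ext0N.
rewrite ext0E// v0//; near: y; exact: open_nbhs_nbhs.
Unshelve. all: by end_near. Qed.

Lemma ext0_derive O K v v' (w : plane R) : open O -> closed K -> K `<=` O ->
  (forall x, O x -> ~ K x -> v x = 0) -> (forall x, O x -> is_derive x w v (v' x)) ->
  forall x, is_derive x w (ext0 O v) (ext0 O v' x).
Proof.
move=> oO cK KO v0 dv x; case: (ext0_near x oO cK KO v0) => -[Ox E].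
  by rewrite (ext0E v' Ox); apply: (near_eq_is_derive E); exact: dv.
by rewrite (ext0N v' Ox); exact: (near_eq_is_derive E (is_derive_cst (0 : R) x w)).
Qed.

Lemma ext0_cont O K v : open O -> closed K -> K `<=` O ->
  (forall x, O x -> ~ K x -> v x = 0) -> (forall x, O x -> {for x, continuous v}) ->
  continuous (ext0 O v).
Proof.
move=> oO cK KO v0 cv x; case: (ext0_near x oO cK KO v0) => -[Ox E].
  rewrite /continuous_at (ext0E v Ox); apply: cvg_trans (near_eq_cvg E) _; exact: cv.
rewrite /continuous_at (ext0N v Ox); apply: cvg_trans (near_eq_cvg E) _; exact: cvg_cst.
Qed.

Definition cdir (i : 'I_2) : C := of_plane (dir i).

Lemma modulus_cdir i : modulus (cdir i) = 1.
Proof.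
rewrite /modulus normc_def /= /cdir /=; case: i => -[|[|//]] /= h;
  by rewrite /dir /= ?expr1n ?expr0n /= ?addr0 ?add0r sqrtr1.
Qed.

(** A direction e of the plane, seen as a complex number, gives the derivative
a e + b conj e. *)
Lemma jet_is_derive (T : Type) (S : set T) (F : C -> C) (p a b : T -> C) t i :
  jet S (fun _ => F) p a b -> S t ->
  is_derive (to_plane (p t)) (dir i) (fun x => complex.Re (F (of_plane x)))
    (complex.Re (a t * cdir i + b t * conjc (cdir i))).
Proof.
move=> [M [d [M0 d0 _ H]]] /H[_ _ _ {}H].
set x := to_plane (p t); set f := fun x => _; set D := complex.Re _.
suff cv : (fun h : R => h^-1 *: (f (h *: dir i + x) - f x)) @ 0^' --> D.
  by split; [apply/cvg_ex; exists D|exact: cvg_lim].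
apply/cvgrPdist_le => e e0; near=> h.
have hn0 : h != 0 by near: h; exact: nbhs_dnbhs_neq.
have hp : 0 < `|h| by rewrite normr_gt0.
have hd : `|h| < d by near: h; apply: dnbhs0_lt.
have he : `|h| * M <= e.
  have : `|h| <= e / (M + 1) by near: h; apply: dnbhs0_le; rewrite divr_gt0// ltr_wpDl.
  rewrite ler_pdivlMr ?ltr_wpDl// => h1; apply: le_trans h1.
  by rewrite ler_wpM2l// lerDl.
have hE : of_plane (h *: dir i + x) = p t + (h%:C)%C * cdir i.
  rewrite of_planeD /x to_planeK addrC; congr (_ + _).
  by rewrite /cdir /of_plane; apply/eqP; rewrite eq_complex /= !mul0r subr0 addr0 !eqxx.
have mh : modulus ((h%:C)%C * cdir i) = `|h|.
  by rewrite modulusM modulus_real modulus_cdir mulr1.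
have := H ((h%:C)%C * cdir i); rewrite mh => /(_ hd).
set r := F _ - _ - _ - _ => Hr.
have rE : complex.Re r = f (h *: dir i + x) - f x - h * D.
  have reR (s : R) (z : C) : complex.Re ((s%:C)%C * z) = s * complex.Re z.
    by case: z => u v; rewrite /= mul0r subr0.
  rewrite /f hE /x to_planeK /D /r conjcM conjc_real -reR -!raddfB; congr (complex.Re _).
  by ring.
rewrite -(ler_pM2l hp) -normrM mulrBr -[h * (_ *: _)]/(h * (h^-1 * _)) mulVKf// -normrN opprB -rE.
apply: (le_trans (modulus_Re _)); apply: (le_trans Hr).
by rewrite expr2 mulrA [M * _]mulrC [leRHS]mulrC ler_wpM2r.
Unshelve. all: by end_near. Qed.

(** Two levels of expansions, for U and for its derivatives a and b in the
variable phi(z), make the real part of U o g a function of class C^2. The pure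
second derivatives in the two directions are the real parts of
aa + ab + ba + bb and of -(aa - ab - ba + bb); the mixed coefficients alone remain
in their sum. Continuity of the second derivatives is [jet_deriv_lip]. *)
Lemma jet2_test (S : set C) (phi g U a b aa ab ba bb : C -> C) O K :
  open O -> closed K -> K `<=` O ->
  (forall z, S z -> g (phi z) = z) -> (forall x, O x -> exists2 z, S z & phi z = of_plane x) ->
  jet S (fun _ w => U (g w)) phi a b -> jet S (fun _ w => a (g w)) phi aa ab ->
  jet S (fun _ w => b (g w)) phi ba bb ->
  (forall x, O x -> ~ K x -> complex.Re (U (g (of_plane x))) = 0) ->
  let f := ext0 O (fun x => complex.Re (U (g (of_plane x)))) in
  exists f1 f2 : 'I_2 -> plane R -> R,
    [/\ forall i x, is_derive x (dir i) f (f1 i x),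
        forall i x, is_derive x (dir i) (f1 i) (f2 i x),
        continuous f, forall i, continuous (f1 i) & forall i, continuous (f2 i)] /\
    [/\ forall x, ~ K x -> f x = 0 &
    forall x, f2 0 x + f2 1 x =
      ext0 O (fun x => 2 * complex.Re (ab (g (of_plane x)) + ba (g (of_plane x)))) x].
Proof.
move=> oO cK KO gK OS J0 Ja Jb U0 f.
pose a1 i z := a z * cdir i + b z * conjc (cdir i).
pose a2 i z := (aa z * cdir i + ba z * conjc (cdir i)) * cdir i +
               (ab z * cdir i + bb z * conjc (cdir i)) * conjc (cdir i).
have jc (c : C) : jet S (fun _ _ => c) phi (fun _ => 0) (fun _ => 0).
  by apply: (jet_cst _ (c := fun _ => c)); exists (modulus c).
have J1 i : jet S (fun _ w => a1 i (g w)) phi (fun z => aa z * cdir i + ba z * conjc (cdir i))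
    (fun z => ab z * cdir i + bb z * conjc (cdir i)).
  have := jet_add (jet_mul Ja (jc (cdir i))) (jet_mul Jb (jc (conjc (cdir i)))).
  by apply: jet_ext; [exists 1|move=> z _; rewrite !mulr0 !addr0|move=> z _; rewrite !mulr0 !addr0].
pose f1 i := ext0 O (fun x => complex.Re (a1 i (g (of_plane x)))).
pose f2 i := ext0 O (fun x => complex.Re (a2 i (g (of_plane x)))).
have Ox z x : phi z = of_plane x -> x = to_plane (phi z) by move=> ->; rewrite of_planeK.
have d1 i x : is_derive x (dir i) f (f1 i x).
  apply: (ext0_derive oO cK KO U0) => y /OS[z Sz zE]; rewrite -zE gK// (Ox _ _ zE).
  exact: (jet_is_derive i J0 Sz).
have f0 x : ~ K x -> f x = 0.
  move=> Kx; have [Oy|Oy] := pselect (O x); last by rewrite /f ext0N.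
  by rewrite /f ext0E// U0.
have f10 i x : O x -> ~ K x -> complex.Re (a1 i (g (of_plane x))) = 0.
  by move=> Oy Kx; have := derive_off cK (d1 i) f0 Kx; rewrite /f1 ext0E.
have d2 i x : is_derive x (dir i) (f1 i) (f2 i x).
  apply: (ext0_derive oO cK KO (f10 i)) => y /OS[z Sz zE]; rewrite -zE gK// (Ox _ _ zE).
  exact: (jet_is_derive i (J1 i) Sz).
have f1off i x : ~ K x -> f1 i x = 0.
  move=> Kx; have [Oy|Oy] := pselect (O x); last by rewrite /f1 ext0N.
  by rewrite /f1 ext0E// f10.
have f20 i x : O x -> ~ K x -> complex.Re (a2 i (g (of_plane x))) = 0.
  by move=> Oy Kx; have := derive_off cK (d2 i) (f1off i) Kx; rewrite /f2 ext0E.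
have pinj z z' : S z -> S z' -> phi z = phi z' -> z = z'.
  by move=> Sz Sz' /(f_equal g); rewrite !gK.
have ct (L : R) (F : C -> C) : (forall z z', S z -> S z' ->
      modulus (F z' - F z) <= L * modulus (phi z' - phi z)) ->
    forall x, O x -> {for x, continuous (fun x => complex.Re (F (g (of_plane x))))}.
  move=> HL x Oy; apply/cvgrPdist_le => e e0.
  have [z Sz zE] := OS x Oy.
  have [r r0 Hr] := (open_planeP O).1 oO x Oy.
  apply/nbhs_planeP; exists (Num.min r (e / (`|L| + 1))).
    by rewrite lt_min r0 divr_gt0// ltr_wpDl.
  move=> y; rewrite lt_min => /andP[/Hr Oy' ye].
  have [z' Sz' zE'] := OS y Oy'; rewrite -zE -zE' !gK//.
  have := HL z' z Sz' Sz; rewrite zE zE' => h.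
  rewrite -raddfB; apply: (le_trans (modulus_Re _)); apply: (le_trans h).
  move: ye; rewrite modulusC ltr_pdivlMr ?ltr_wpDl// => ye; apply: le_trans (ltW ye).
  rewrite [leRHS]mulrC ler_wpM2r ?modulus_ge0//.
  by have := ler_norm L; lra.
have [L0 _ HL0] := jet_deriv_lip pinj J0.
have HL1 i := jet_deriv_lip pinj (J1 i).
exists f1, f2; split; [split=> //|split=> //].
- by apply: (ext0_cont oO cK KO U0); apply: (ct L0) => z z' Sz Sz'; have [h _ _] := HL0 z z' Sz Sz'; rewrite !gK in h.
- move=> i; have [L _ HL] := HL1 i.
  by apply: (ext0_cont oO cK KO (f10 i)); apply: (ct L) => z z' Sz Sz'; have [h _ _] := HL z z' Sz Sz'; rewrite !gK in h.
- move=> i; have [L L0' HL] := HL1 i.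
  apply: (ext0_cont oO cK KO (f20 i)); apply: (ct (2 * L)) => z z' Sz Sz'.
  have [_ h1 h2] := HL z z' Sz Sz'; rewrite /a2.
  set A := aa z * _ + _ in h1 *; set A' := aa z' * _ + _ in h1 *.
  set B := ab z * _ + _ in h2 *; set B' := ab z' * _ + _ in h2 *.
  rewrite (_ : _ - _ = (A' - A) * cdir i + (B' - B) * conjc (cdir i)); last by ring.
  have := modulusD ((A' - A) * cdir i) ((B' - B) * conjc (cdir i)).
  by rewrite !modulusM modulus_conj modulus_cdir !mulr1; lra.
move=> x; have [Oy|Oy] := pselect (O x); last by rewrite /f2 !ext0N// addr0.
rewrite /f2 !ext0E// -raddfD; set z := g _.
have c0 : cdir 0 = 1 by [].
have c1 : cdir 1 = 'i%C by [].
have ci : conjc ('i%C : C) = - 'i%C by apply/eqP; rewrite eq_complex /= oppr0 !eqxx.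
rewrite (_ : a2 0 z + a2 1 z = (ab z + ba z) + (ab z + ba z)); first by rewrite raddfD /=; ring.
rewrite /a2 c0 c1 ci conjc1 !mulr1 !mulrN; move: ('i%C : C) (sqr_i R) => j.
rewrite expr2 => i2.
move: (aa z) (ba z) (ab z) (bb z) => p q r s.
have -> : (p * j - q * j) * j - (r * j - s * j) * j = (j * j) * (p - q - r + s) by ring.
by rewrite i2; ring.
Qed.

End PlanarGlue.

(** * Radial functions and the inverse of the conformal map *)

Section RealJet.
Context {R : realType}.
Local Notation C := R[i].

Lemma MVT_sym (f f' : R -> R) (s t : R) : (forall t, is_derive t (1 : R) f (f' t)) ->
  exists2 c : R, `|c - t| <= `|s - t| /\ `|c| <= Num.max `|s| `|t| & f s - f t = f' c * (s - t).
Proof.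
move=> df; have cf (a b : R) : {within `[a, b], continuous f}.
  apply: continuous_subspaceT => x; have [d _] := df x.
  exact/differentiable_continuous/derivable1_diffP.
have [st|ts] := leP s t.
  have [c + E] := MVT_segment st (fun x _ => df x) (@cf s t).
  rewrite in_itv /= => /andP[c1 c2]; exists c; last by rewrite -opprB E; ring.
  split; last by rewrite le_max !ler_norml; have := ler_norm t; have := ler_norm (- s);
    have := ler_norm (- t); have := ler_norm s; rewrite !normrN => *; apply/orP;
    have [h|h] := leP 0 c; [right|left]; apply/andP; split; lra.
  by rewrite !ler0_norm; lra.
have [c + E] := MVT_segment (ltW ts) (fun x _ => df x) (@cf t s).
rewrite in_itv /= => /andP[c1 c2]; exists c => //.
split; last by rewrite le_max !ler_norml; have := ler_norm t; have := ler_norm (- s);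
    have := ler_norm (- t); have := ler_norm s; rewrite !normrN => *; apply/orP;
    have [h|h] := leP 0 c; [left|right]; apply/andP; split; lra.
by rewrite !ger0_norm; lra.
Qed.

(** The mean value theorem, twice. *)
Lemma taylor2 (h h1 h2 : R -> R) (B M : R) : (forall t, is_derive t (1 : R) h (h1 t)) ->
  (forall t, is_derive t (1 : R) h1 (h2 t)) -> (forall t, `|t| <= B -> `|h2 t| <= M) ->
  forall s t, `|s| <= B -> `|t| <= B -> `|h s - h t - h1 t * (s - t)| <= M * (s - t) ^+ 2.
Proof.
move=> d1 d2 HM s t sB tB.
have [c [ct cB] ->] := MVT_sym s t d1.
have cB' : `|c| <= B by rewrite (le_trans cB)// ge_max sB.
have [e [et eB] E] := MVT_sym c t d2.
have eB' : `|e| <= B by rewrite (le_trans eB)// ge_max cB'.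
rewrite -mulrBl E !normrM -real_normK ?num_real// expr2 mulrA ler_wpM2r//.
by rewrite ler_pM// HM.
Qed.

Lemma cont_bounded (f : R -> R) (B : R) : continuous f -> exists2 M : R, 0 <= M &
  forall t, `|t| <= B -> `|f t| <= M.
Proof.
move=> cf; have [M M0 HM] := cont_bounded_segment (- B) B cf; exists M => // t.
by rewrite ler_norml => /andP[h1 h2]; exact: HM.
Qed.

Definition sqm (z : C) : R := modulus z ^+ 2.

Lemma sqmE z : ((sqm z)%:C)%C = z * conjc z.
Proof. by rewrite /sqm rmorphXn /= modulusE sqr_normc. Qed.

Lemma Re_mulC z : complex.Re (z * conjc z) = sqm z.
Proof. by rewrite -sqmE. Qed.

(** The derivatives of |z|^2 = z conj z in z and conj z are conj z and z. *)
Lemma jet_sqm (h h1 h2 : R -> R) (S : set C) : (forall t, is_derive t (1 : R) h (h1 t)) ->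
  (forall t, is_derive t (1 : R) h1 (h2 t)) -> continuous h2 -> (forall z, S z -> modulus z <= 1) ->
  jet S (fun _ z => ((h (sqm z))%:C)%C) id (fun z => ((h1 (sqm z))%:C)%C * conjc z)
    (fun z => ((h1 (sqm z))%:C)%C * z).
Proof.
move=> d1 d2 c2 S1.
have cd (f f' : R -> R) : (forall t, is_derive t (1 : R) f (f' t)) -> continuous f.
  by move=> df x; have [d _] := df x; exact/differentiable_continuous/derivable1_diffP.
have [M2 M20 H2] := cont_bounded 2 c2.
have [M1 M10 H1] := cont_bounded 1 (cd _ _ d2).
have [M0 M00 H0] := cont_bounded 1 (cd _ _ d1).
have S2 z : S z -> `|sqm z| <= 1.
  by move/S1 => h'; rewrite /sqm ger0_norm ?exprn_ge0 ?modulus_ge0// exprn_ile1 ?modulus_ge0.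
have jid : jet S (fun _ z => z) id (fun _ => 1 : C) (fun _ => 0) by apply: jet_id; exists 1.
have jre : jet S (fun _ w => ((h (complex.Re w))%:C)%C) (fun z => z * conjc z)
    (fun z => ((h1 (sqm z) / 2)%:C)%C) (fun z => ((h1 (sqm z) / 2)%:C)%C).
  exists (M0 + M1 + M2), 1; split=> //; first by rewrite !addr_ge0.
  move=> z Sz; rewrite Re_mulC !modulus_real; have tz := S2 z Sz.
  have b1 := H1 _ tz; have b0 := H0 _ tz.
  have b2 : `|h1 (sqm z) / 2| <= M1.
    by rewrite normrM [`|2^-1|]ger0_norm; [have := normr_ge0 (h1 (sqm z)); lra|lra].
  split; [lra|lra|lra|] => w w1.
  have -> : complex.Re (z * conjc z + w) = sqm z + complex.Re w by rewrite raddfD /= Re_mulC.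
  rewrite (_ : _ - _ = ((h (sqm z + complex.Re w) - h (sqm z) - h1 (sqm z) * (sqm z + complex.Re w - sqm z))%:C)%C); last first.
    rewrite !rmorphB rmorphM /= -addrA -opprD -mulrDr; congr (_ - _).
    case: w {w1} => a b; apply/eqP; rewrite eq_complex /=.
    by apply/andP; split; apply/eqP; field.
  have wr : `|complex.Re w| <= modulus w := modulus_Re w.
  rewrite modulus_real; have := @taylor2 h h1 h2 2 M2 d1 d2 H2 (sqm z + complex.Re w) (sqm z).
  have sB : `|sqm z + complex.Re w| <= 2 by apply: (le_trans (ler_normD _ _)); lra.
  have tB : `|sqm z| <= 2 by lra.
  move=> /(_ sB tB) h3; apply: (le_trans h3).
  have -> : sqm z + complex.Re w - sqm z = complex.Re w by ring.
  have : complex.Re w ^+ 2 <= modulus w ^+ 2.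
    by rewrite -real_normK ?num_real// lerXn2r ?nnegrE ?normr_ge0 ?modulus_ge0.
  have := sqr_ge0 (modulus w); have := sqr_ge0 (complex.Re w) => e1 e2 e3.
  have : M2 * complex.Re w ^+ 2 <= M2 * modulus w ^+ 2 by rewrite ler_wpM2l.
  have : 0 <= (M0 + M1) * modulus w ^+ 2 by rewrite mulr_ge0// addr_ge0.
  by lra.
have := jet_comp (jet_mul jid (jet_conj jid)) jre.
apply: jet_ext; first by exists 1 => // z w _ _; rewrite Re_mulC.
  move=> z _; rewrite !(conjcD, conjcM, conjcK, conjc0, conjc1).
  rewrite [X in _ = X * _](_ : _ = ((h1 (sqm z) / 2)%:C)%C + ((h1 (sqm z) / 2)%:C)%C); last first.
    by rewrite -rmorphD -splitr.
  by ring.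
move=> z _; rewrite !(conjcD, conjcM, conjcK, conjc0, conjc1).
rewrite [X in _ = X * _](_ : _ = ((h1 (sqm z) / 2)%:C)%C + ((h1 (sqm z) / 2)%:C)%C); last first.
  by rewrite -rmorphD -splitr.
by ring.
Qed.

End RealJet.

Section InverseJet.
Context {R : realType}.
Local Notation C := R[i].
Variable phi : C -> C.
Hypothesis phi_an : forall c, modulus c <= 1 -> exists a (r : R), psat phi c a r.
Hypothesis phi_inj : forall z w, modulus z < 1 -> modulus w < 1 -> phi z = phi w -> z = w.

(** The inverse of [phi] on the unit disc, with value 0 outside its image. *)
Definition pinv (w : C) : C := xget 0 [set z | modulus z < 1 /\ phi z = w].

Lemma pinvK z : modulus z < 1 -> pinv (phi z) = z.
Proof.
move=> z1; rewrite /pinv; case: xgetP => [y _ [y1 E]|/(_ z)]; first exact: phi_inj.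
by case.
Qed.

(** The radius in [phi_open] is uniform on compact discs. *)
Lemma local_surj (b e : R) : b < 1 -> 0 < e -> exists2 d : R, 0 < d &
  forall z h, modulus z <= b -> modulus h < d -> exists2 u, modulus u < e & phi (z + u) = phi z + h.
Proof.
move=> b1 e0.
pose P (n : nat) (z : C) := forall h, modulus h < n.+1%:R^-1 ->
  exists2 u, modulus u < e & phi (z + u) = phi z + h.
have [||N HN] := @compact_cover R [set x : plane R | modulus (of_plane x - 0) <= b] P.
- exact: compact_disc.
- move=> x; rewrite /= subr0 => xb; set c := of_plane x.
  pose s := Num.min (e / 2) ((1 - b) / 2).
  have s0 : 0 < s by rewrite lt_min !divr_gt0// subr_gt0.
  have se : s <= e / 2 by rewrite ge_min lexx.
  have sb : s <= (1 - b) / 2 by rewrite ge_min lexx orbT.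
  have cs : modulus c + s < 1 by rewrite /c; lra.
  have [d d0 Hd] := phi_open phi_an phi_inj s0 cs.
  have c1 : modulus c <= 1 by rewrite /c; lra.
  have [d' d'0 Hd'] := phi_cont phi_an c1 (divr_gt0 d0 (ltr0Sn R 1)).
  exists (Num.min s d'); first by rewrite lt_min s0.
  exists (Num.truncn ((d / 2)^-1)) => n nN z; rewrite lt_min => /andP[zs zd] h hn.
  have nd : n.+1%:R^-1 <= d / 2.
    rewrite -[leRHS]invrK lef_pV2 ?posrE ?invr_gt0 ?divr_gt0//.
    apply: ltW; apply: (lt_le_trans (truncnS_gt _)).
    by rewrite ler_nat.
  have h1 := Hd' z zd.
  have [] := Hd (phi z + h).
    have := modulusD (phi z - phi c) h; rewrite (_ : _ + h = phi z + h - phi c); last by ring.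
    move=> h2; apply: (le_lt_trans h2); rewrite [ltRHS](splitr d); apply: ltrD => //.
    exact: lt_le_trans hn nd.
  move=> z' z'c E; exists (z' - z); last by rewrite addrC subrK.
  by have := modulus_tri z' c z; rewrite (modulusC c z); lra.
exists N.+1%:R^-1; first by rewrite invr_gt0.
move=> z h zb hN; have := HN N (leqnn _) (to_plane z); rewrite /= to_planeK subr0 => /(_ zb h hN).
by [].
Qed.

Variable rho : R.
Hypothesis rho1 : 1 < rho.
Let disc := [set z : C | modulus z <= rho].
Hypothesis phi0 : clin phi disc.
Hypothesis phi1 : clin (der phi) disc.

Lemma der_min (a b : R) : b < 1 ->
  (forall z, a <= modulus z -> modulus z <= b -> der phi z != 0) ->
  exists2 m : R, 0 < m & forall z, a <= modulus z -> modulus z <= b -> m <= modulus (der phi z).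
Proof.
move=> b1 dn0.
pose P (n : nat) (z : C) := a <= modulus z -> n.+1%:R^-1 <= modulus (der phi z).
have [||N HN] := @compact_cover R [set x : plane R | modulus (of_plane x - 0) <= b] P.
- exact: compact_disc.
- move=> x; rewrite /= subr0 => xb; set c := of_plane x.
  have [ca|ac] := ltP (modulus c) a.
    exists (a - modulus c); first by rewrite subr_gt0.
    exists 0%N => n _ z zc az.
    by have := ler_modB z c; lra.
  have q0 : 0 < modulus (der phi c) by rewrite modulus_gt0 dn0.
  have cD : disc c by rewrite /disc /= ltW// (le_lt_trans xb)// (lt_trans b1).
  have [M [d [M0 d0 d1 H]]] := jet_lip (clin_jet phi1 (S := disc) (p := id) (fun z h => h)).
  have [_ _ _ _ Hl] := H c cD.
  have [q qE] : exists q, q = modulus (der phi c) by exists (modulus (der phi c)).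
  rewrite -qE in q0.
  exists (Num.min d (q / 2 / (3 * M + 1))).
    by rewrite lt_min d0 !divr_gt0// ltr_wpDl// mulr_ge0.
  exists (Num.truncn ((q / 2)^-1)) => n nN z; rewrite lt_min => /andP[zd].
  rewrite ltr_pdivlMr ?ltr_wpDl ?mulr_ge0// => zq _.
  have nd : n.+1%:R^-1 <= q / 2.
    rewrite -[leRHS]invrK lef_pV2 ?posrE ?invr_gt0 ?divr_gt0//.
    apply: ltW; apply: (lt_le_trans (truncnS_gt _)).
    by rewrite ler_nat.
  have := Hl (z - c) zd; rewrite /= [c + _]addrC subrK => h1.
  have := ler_modB (der phi c) (der phi z); rewrite -qE.
  have h5 : modulus (der phi z - der phi c) < q / 2.
    apply: le_lt_trans h1 _; apply: le_lt_trans zq.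
    by rewrite [leRHS]mulrC ler_wpM2r ?modulus_ge0// lerDl.
  rewrite modulusC => h6; have := le_lt_trans h6 h5; rewrite ltrBlDr => h7.
  by apply: (le_trans nd); lra.
exists N.+1%:R^-1; first by rewrite invr_gt0.
move=> z az zb; have := HN N (leqnn _) (to_plane z); rewrite /= to_planeK subr0; exact.
Qed.

(** On a compact annulus |phi'| is bounded below by some m, and the preimage
z + u of phi(z) + h is close to z by [local_surj]. Then |u| <= 2 |h| / m and the
remainder u - h / phi' is O(|u|^2) = O(|h|^2). *)
Lemma jet_pinv (a b : R) : b < 1 ->
  (forall z, a <= modulus z -> modulus z <= b -> der phi z != 0) ->
  jet [set z : C | a <= modulus z /\ modulus z <= b] (fun _ => pinv) phi
    (fun z => (der phi z)^-1) (fun _ => 0).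
Proof.
move=> b1 dn0; have [m m0 Hm] := der_min b1 dn0.
have [M [d [M0 d0 d1 H]]] := jet_lip (clin_jet phi0 (S := disc) (p := id) (fun z h => h)).
pose e := Num.min (Num.min d (1 - b)) (m / 2 / (M + 1)).
have e0 : 0 < e by rewrite !lt_min d0 subr_gt0 b1/= !divr_gt0// ltr_wpDl.
have [d' d'0 Hd'] := local_surj b1 e0.
have mi : 0 <= m^-1 by rewrite invr_ge0 ltW.
exists (1 + m^-1 + 4 * M * m^-1 ^+ 3), (Num.min d' 1); split.
- by nonneg.
- by rewrite lt_min d'0 ltr01.
- by rewrite ge_min lexx orbT.
move=> z [az zb]; have mz := Hm z az zb.
have z1 : modulus z < 1 by lra.
have zD : disc z by rewrite /disc /= ltW// (lt_trans z1).
have [_ _ _ H4 _] := H z zD.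
have iv : modulus (der phi z)^-1 <= m^-1.
  by rewrite modulusV lef_pV2 ?posrE// (lt_le_trans m0).
have c0 : 0 <= 4 * M * m^-1 ^+ 3 by nonneg.
split; rewrite ?pinvK ?modulus0//; [lra|lra|nonneg|].
move=> h; rewrite lt_min => /andP[hd _].
have [u ue E] := Hd' z h zb hd.
move: (ue); rewrite !lt_min => /andP[/andP[ud ub] um].
have zu1 : modulus (z + u) < 1 by have := modulusD z u; lra.
rewrite -E pinvK// mul0r subr0.
have h4 := H4 u ud.
have hE : phi (id z + u) - phi (id z) - der phi (id z) * u - 0 * conjc u = h - der phi z * u.
  by rewrite /= E; ring.
rewrite hE in h4.
have dz0 : der phi z != 0 by exact: dn0.
have -> : z + u - z - (der phi z)^-1 * h = - ((der phi z)^-1 * (h - der phi z * u)).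
  by field.
rewrite modulusN modulusM.
have um' : M * modulus u <= m / 2.
  move: um; rewrite ltr_pdivlMr ?ltr_wpDl// => um.
  by have := modulus_ge0 u; nra.
have u0 := modulus_ge0 u.
have hu : m / 2 * modulus u <= modulus h.
  have := ler_modB (der phi z * u) h; rewrite modulusC modulusM.
  have : m * modulus u <= modulus (der phi z) * modulus u by rewrite ler_wpM2r.
  nra.
have hu' : modulus u <= 2 * m^-1 * modulus h.
  have -> : modulus u = 2 * m^-1 * (m / 2 * modulus u) by field; rewrite gt_eqF.
  by rewrite ler_wpM2l//; nonneg.
have step : modulus (der phi z)^-1 * modulus (h - der phi z * u) <= m^-1 * (M * (2 * m^-1 * modulus h) ^+ 2).
  rewrite ler_pM ?modulus_ge0//; apply: (le_trans h4); rewrite ler_wpM2l//.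
  by rewrite lerXn2r ?nnegrE//; nonneg.
apply: (le_trans step).
have -> : m^-1 * (M * (2 * m^-1 * modulus h) ^+ 2) = 4 * M * m^-1 ^+ 3 * modulus h ^+ 2 by ring.
rewrite ler_wpM2r ?exprn_ge0 ?modulus_ge0//; lra.
Qed.

End InverseJet.

(** * The cut potential as a test function *)

Section CutPotential.
Context {R : realType}.
Local Notation C := R[i].
Variables (phi : C -> C) (rho k : R).
Hypothesis phi_an : forall c, modulus c <= 1 -> exists a (r : R), psat phi c a r.
Hypothesis phi_inj : forall z w, modulus z < 1 -> modulus w < 1 -> phi z = phi w -> z = w.
Hypothesis rho1 : 1 < rho.
Let disc := [set z : C | modulus z <= rho].
Hypothesis phi0 : clin phi disc.
Hypothesis phi1 : clin (der phi) disc.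
Hypothesis phi2 : clin (der (der phi)) disc.

Definition img (A : set C) : set (plane R) := [set to_plane (phi z) | z in A].

Lemma img_open (A : set C) : (forall z, A z -> modulus z < 1) ->
  (forall z, A z -> exists2 r : R, 0 < r & forall y, modulus (y - z) < r -> A y) -> open (img A).
Proof.
move=> A1 oA; apply/open_planeP => _ [z Az <-].
have [r r0 Hr] := oA z Az; have z1 := A1 z Az.
pose s := Num.min r ((1 - modulus z) / 2).
have s0 : 0 < s by rewrite lt_min r0 divr_gt0// subr_gt0.
have sr : s <= r by rewrite ge_min lexx.
have sz : s <= (1 - modulus z) / 2 by rewrite ge_min lexx orbT.
have zs : modulus z + s < 1 by lra.
have [d d0 Hd] := phi_open phi_an phi_inj s0 zs; exists d => // y.
rewrite to_planeK => /Hd[u us E]; exists u; last by rewrite E of_planeK.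
by apply: Hr; exact: lt_le_trans us sr.
Qed.

Lemma img_compact (a b : R) : b <= 1 -> compact (img [set z | a <= modulus z /\ modulus z <= b]).
Proof.
move=> b1; set A := [set z | _].
have E : img A = (fun x => to_plane (phi (of_plane x))) @` [set x : plane R | A (of_plane x)].
  apply/seteqP; split=> [_ [z Az <-]|_ [x Ax <-]]; last by exists (of_plane x).
  by exists (to_plane z); rewrite /= to_planeK.
rewrite E; apply: continuous_compact.
  apply: continuous_in_subspaceT => x; rewrite inE /A /= => -[_ xb].
  apply/cvgrPdist_le => e e0.
  have [d d0 Hd] := phi_cont phi_an (le_trans xb b1) e0.
  apply/nbhs_planeP; exists d => // y /Hd h; rewrite (le_trans (plane_norm_modulus _))//.
  by rewrite of_planeB !to_planeK modulusC ltW.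
apply: (@compact_bounded_closed _ _ b); last first.
  by move=> x [_ xb]; rewrite (le_trans (plane_norm_modulus _)).
have cm : continuous (fun x : plane R => modulus (of_plane x)).
  move=> x; have := @modulus_cont R 0 x; rewrite (_ : (fun x => _) = (fun x : plane R => modulus (of_plane x)))//.
  by apply/funext => y; rewrite subr0.
rewrite (_ : [set x | _] = (fun x : plane R => modulus (of_plane x)) @^-1` [set t | a <= t] `&`
   (fun x : plane R => modulus (of_plane x)) @^-1` [set t | t <= b])//.
by apply: closedI; apply: closed_comp; [move=> x _; exact: cm|exact: closed_ge|move=> x _; exact: cm|exact: closed_le].
Qed.

Lemma img_sub (A B : set C) : A `<=` B -> img A `<=` img B.
Proof. by move=> AB _ [z /AB Bz <-]; exists z. Qed.

Lemma img_inj (A : set C) z : (forall z, A z -> modulus z < 1) -> modulus z < 1 ->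
  img A (to_plane (phi z)) -> A z.
Proof.
move=> A1 z1 [y Ay /(can_inj (@to_planeK R)) E].
by rewrite -(phi_inj (A1 y Ay) z1 E).
Qed.

Lemma jet_restrict (T : Type) (S S' : set T) (F : T -> C -> C) (p p' a b : T -> C) : S' `<=` S ->
  (forall t, S' t -> p t = p' t) -> jet S F p a b -> jet S' F p' a b.
Proof.
move=> SS pp [M [d [M0 d0 d1 H]]]; exists M, d; split=> // t St.
by have := H t (SS t St); rewrite pp.
Qed.

Let V := pot phi k.
Let Vz := pot_z phi k.
Let Vq := pot_q phi k.

(** The value of Delta + k^2 on the real part of T(|z|^2) v, read in the
disc: the terms in which T is not differentiated add up to T, since
(Delta + k^2) v = 1. *)
Definition cutlap (T T1 T2 : R -> R) (z : C) : R :=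
  T (sqm z) + 4 * complex.Re (((T2 (sqm z))%:C)%C * ((sqm z)%:C)%C * V z +
     ((T1 (sqm z))%:C)%C * (V z + z * Vz z + conjc z * Vq z)) / sqm (der phi z).

(** The product T(|z|^2) v and its two derivatives have expansions in z;
composed with the inverse of phi they give expansions in phi(z), and [jet2_test]
applies. The cutoff T vanishes outside an annulus a1 <= |z| <= b1, on a
neighbourhood of which phi' has no zero. *)
Lemma test_exists (r a0 a1 b1 b : R) (T T1 T2 T3 : R -> R) : 1 < r -> r < rho ->
  r^-1 <= a0 -> a0 < a1 -> a1 < b1 -> b1 < b -> b < 1 ->
  (forall z, a0 <= modulus z -> modulus z < 1 -> der phi z != 0) ->
  (forall t, is_derive t (1 : R) T (T1 t)) -> (forall t, is_derive t (1 : R) T1 (T2 t)) ->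
  (forall t, is_derive t (1 : R) T2 (T3 t)) -> continuous T3 ->
  (forall t, t <= a1 ^+ 2 \/ b1 ^+ 2 <= t -> [/\ T t = 0, T1 t = 0 & T2 t = 0]) ->
  exists K f (f1 f2 : 'I_2 -> plane R -> R),
    [/\ forall i x, is_derive x (dir i) f (f1 i x),
        forall i x, is_derive x (dir i) (f1 i) (f2 i x),
        continuous f, forall i, continuous (f1 i) & forall i, continuous (f2 i)] /\
    [/\ compact K, K `<=` img [set z | modulus z < 1], forall x, ~ K x -> f x = 0,
        (forall z, modulus z < 1 -> f2 0 (to_plane (phi z)) + f2 1 (to_plane (phi z)) +
           k ^+ 2 * f (to_plane (phi z)) = cutlap T T1 T2 z) &
        forall x, ~ img [set z | modulus z < 1] x -> f2 0 x + f2 1 x + k ^+ 2 * f x = 0].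
Proof.
move=> r1 rr ra0 a01 ab bb b1' dn0 dT dT1 dT2 cT3 T0.
have rp : 0 < r by lra.
have a00 : 0 < a0 by apply: lt_le_trans ra0; rewrite invr_gt0.
pose S := [set z : C | a0 <= modulus z /\ modulus z <= b].
have S1 z : S z -> modulus z < 1 by move=> [_ h]; lra.
have S1' z : S z -> modulus z <= 1 by move/S1/ltW.
have Sr : S `<=` annulus r.
  by move=> z [h1 h2]; split; [exact: le_trans h1|lra].
have jV := jet_restrict Sr (fun t _ => erefl) (pot_jet k rho1 phi0 phi1 phi2 r1 rr).
have [pzz jVz0] := pot_z_jet k rho1 phi0 phi1 phi2 r1 rr.
have jVz := jet_restrict Sr (fun t _ => erefl) jVz0.
have jVq := jet_restrict Sr (fun t _ => erefl) (pot_q_jet k rho1 phi0 phi1 phi2 r1 rr).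
have cT2 : continuous T2.
  by move=> x; have [d _] := dT2 x; exact/differentiable_continuous/derivable1_diffP.
have jT := jet_sqm dT dT1 cT2 S1'.
have jT1 := jet_sqm dT1 dT2 cT3 S1'.
have jid : jet S (fun _ z => z) id (fun _ => 1 : C) (fun _ => 0) by apply: jet_id; exists 1.
have jcj := jet_conj jid.
have dS z : a0 <= modulus z -> modulus z <= b -> der phi z != 0.
  by move=> h1 h2; apply: dn0 => //; lra.
have [m m0 Hm] := der_min rho1 phi1 b1' dS.
have jd := jet_restrict Sr (fun t _ => erefl) (annulus_jet_dphi rho1 phi1 r1 rr).
have jdi := jet_invF m0 jd (fun t St => Hm t St.1 St.2).
have jg := jet_pinv phi_an phi_inj rho1 phi0 phi1 b1' dS.
have gK z : S z -> pinv phi (phi z) = z by move/S1/pinvK; apply.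
pose U z : C := ((T (sqm z))%:C)%C * V z.
pose Uz z : C := ((T1 (sqm z))%:C)%C * conjc z * V z + ((T (sqm z))%:C)%C * Vz z.
pose Uq z : C := ((T1 (sqm z))%:C)%C * z * V z + ((T (sqm z))%:C)%C * Vq z.
pose a z := Uz z * (der phi z)^-1.
pose b' z := Uq z * (conjc (der phi z))^-1.
pose W z : C := ((T2 (sqm z))%:C)%C * ((sqm z)%:C)%C * V z +
     ((T1 (sqm z))%:C)%C * (V z + z * Vz z + conjc z * Vq z).
pose Y z : C := W z + ((T (sqm z))%:C)%C *
  (4^-1 * (conjc (der phi z) * der phi z * (1 - ((k ^+ 2)%:C)%C * V z))).
have jcomp (F A B : C -> C) : jet S (fun _ => F) id A B ->
    jet S (fun _ w => F (pinv phi w)) phi (fun z => A z * (der phi z)^-1)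
      (fun z => B z * (conjc (der phi z))^-1).
  move=> jF; have jF' := jet_restrict (fun t h => h) (fun t St => esym (gK t St)) jF.
  have := jet_comp jg jF'; apply: jet_ext; first by exists 1.
    by move=> z _; rewrite conjc0; ring.
  by move=> z _; rewrite conjcV; ring.
have jU : jet S (fun _ => U) id Uz Uq.
  have := jet_mul jT jV; apply: jet_ext; [by exists 1|by []|by []].
have j0 := jcomp _ _ _ jU.
have [aa ja] : exists aa, jet S (fun _ => a) id aa (fun z => Y z * (der phi z)^-1).
  eexists; have := jet_mul (jet_add (jet_mul (jet_mul jT1 jcj) jV) (jet_mul jT jVz)) jdi.
  apply: jet_ext; [by exists 1|by move=> z _; reflexivity|].
  move=> z _; rewrite /Y /W sqmE conjc1 -/V -/Vz -/Vq /=; ring.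
have [bb' jb] : exists bb, jet S (fun _ => b') id (fun z => Y z * (conjc (der phi z))^-1) bb.
  eexists; have := jet_mul (jet_add (jet_mul (jet_mul jT1 jid) jV) (jet_mul jT jVq)) (jet_conj jdi).
  apply: jet_ext; [by exists 1 => // z h _ _; rewrite /b' conjcV| |by move=> z _; reflexivity].
  move=> z _; rewrite /Y /W sqmE -/V -/Vz -/Vq /= mulr0 conjc0 conjcV; ring.
have Ja := jcomp _ _ _ ja; have Jb := jcomp _ _ _ jb.
pose O := img [set z | a0 < modulus z /\ modulus z < b].
pose K := img [set z | a1 <= modulus z /\ modulus z <= b1].
have O1 z : [set z : C | a0 < modulus z /\ modulus z < b] z -> modulus z < 1.
  by move=> [_ h]; lra.
have oO : open O.
  apply: img_open => // z [h1 h2].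
  exists (Num.min (modulus z - a0) (b - modulus z)); first by rewrite lt_min !subr_gt0 h1.
  move=> y; rewrite lt_min => /andP[h3 h4]; split.
    by have := ler_modB z y; rewrite modulusC; lra.
  by have := ler_modB y z; lra.
have cK : compact K by apply: img_compact; lra.
have KO : K `<=` O by apply: img_sub => z [h1 h2]; split; lra.
have OS x : O x -> exists2 z, S z & phi z = of_plane x.
  by move=> [z [h1 h2] <-]; exists z; [split; exact: ltW|rewrite to_planeK].
have Tz z : ~ (a1 <= modulus z /\ modulus z <= b1) ->
    [/\ T (sqm z) = 0, T1 (sqm z) = 0 & T2 (sqm z) = 0].
  move=> h; apply: T0; rewrite /sqm !ler_sqr ?nnegrE ?modulus_ge0//; [|lra|lra].
  have [h1|h1] := leP (modulus z) a1; [by left|right].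
  by rewrite leNgt; apply/negP => h2; apply: h; split; exact: ltW.
have U0 x : O x -> ~ K x -> complex.Re (U (pinv phi (of_plane x))) = 0.
  move=> /OS[z Sz zE] Kx; rewrite -zE gK// /U.
  have [|-> _ _] := Tz z; last by rewrite mul0r.
  by move=> h; apply: Kx; exists z => //; rewrite zE of_planeK.
have clK : closed K by exact: compact_closed.
have [f1 [f2 [H1 [H2 H3]]]] := jet2_test oO clK KO gK OS j0 Ja Jb U0.
exists K, (ext0 O (fun x => complex.Re (U (pinv phi (of_plane x))))), f1, f2; split=> //.
have KD : K `<=` img [set z | modulus z < 1] by apply: img_sub => z [_ h] /=; lra.
split=> //.
- move=> z z1; rewrite H3; have [Oz|Oz] := pselect (O (to_plane (phi z))).
    have [h1 h2] := img_inj O1 z1 Oz.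
    have Sz : S z by split; exact: ltW.
    rewrite !ext0E// to_planeK gK//.
    have dz0 : der phi z != 0 by apply: dS; exact: ltW.
    have cdz0 : conjc (der phi z) != 0 by rewrite conjc_eq0.
    rewrite (_ : _ + _ = (((2 / sqm (der phi z))%:C)%C * W z + (((T (sqm z)) / 2)%:C)%C * (1 - ((k ^+ 2)%:C)%C * V z))); last first.
      rewrite rmorphM /= fmorphV /= sqmE rmorphM /= fmorphV /= !rmorph_nat /Y.
      by field; rewrite dz0 cdz0.
    have reR (s : R) (y : C) : complex.Re ((s%:C)%C * y) = s * complex.Re y.
      by case: y => u v; rewrite /= mul0r subr0.
    have reD (x y : C) : complex.Re (x + y) = complex.Re x + complex.Re y by exact: raddfD.
    have reB (x y : C) : complex.Re (x - y) = complex.Re x - complex.Re y by exact: raddfB.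
    rewrite reD !reR reB !reR /U ?reR /cutlap -/(W z) (_ : complex.Re 1 = 1)//.
    by move: (sqm (der phi z))^-1 => s; field.
  rewrite !ext0N// mulr0 addr0 /cutlap.
  have [|-> -> ->] := Tz z; last by rewrite !mul0r addr0 mulr0 mul0r addr0.
  by move=> [h1 h2]; apply: Oz; exists z => //; split; lra.
- move=> x Dx; have Ox : ~ O x by move=> Ox; apply: Dx; exact: (img_sub (B := [set z | modulus z < 1]) O1 Ox).
  by rewrite H3 !ext0N// mulr0 addr0.
Qed.

End CutPotential.

(** * Cutoffs that approach the circle *)

Section CutFamily.
Context {R : realType}.

Lemma derive_locally_cst (f f' : R -> R) (J : set R) (c : R) : open J ->
  (forall t, is_derive t (1 : R) f (f' t)) -> (forall t, J t -> f t = c) ->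
  forall t, J t -> f' t = 0.
Proof.
move=> oJ df fc t Jt; apply: (derive_cst_near (df t)).
near=> s; apply: fc; near: s; exact: open_nbhs_nbhs.
Unshelve. all: by end_near. Qed.

Record jet3 := Jet3 { j0 : R -> R; j1 : R -> R; j2 : R -> R; j3 : R -> R }.

Definition is_jet3 (h : jet3) := [/\ forall t, is_derive t (1 : R) (j0 h) (j1 h t),
  forall t, is_derive t (1 : R) (j1 h) (j2 h t),
  forall t, is_derive t (1 : R) (j2 h) (j3 h t) & continuous (j3 h)].

Lemma smooth1_jet3 (h : R -> R) : smooth1 setT h -> exists2 H, is_jet3 H & j0 H = h.
Proof.
move=> /smooth1_der[h1 d1 /smooth1_der[h2 d2 /smooth1_der[h3 d3 /smooth1_cont c3]]].
by exists (Jet3 h h1 h2 h3).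
Qed.

Lemma jet3_off (h : jet3) (J : set R) (c : R) : is_jet3 h -> open J ->
  (forall t, J t -> j0 h t = c) -> forall t, J t -> j1 h t = 0 /\ j2 h t = 0.
Proof.
move=> [d1 d2 _ _] oJ h0; have h1 := derive_locally_cst oJ d1 h0.
by move=> t Jt; split; [exact: h1|exact: (derive_locally_cst oJ d2 h1)].
Qed.

Lemma jet3_cont (h : jet3) : is_jet3 h -> [/\ continuous (j0 h), continuous (j1 h) & continuous (j2 h)].
Proof.
have cd (f f' : R -> R) : (forall t, is_derive t (1 : R) f (f' t)) -> continuous f.
  by move=> df x; have [d _] := df x; exact/differentiable_continuous/derivable1_diffP.
by move=> [d1 d2 d3 _]; split; [exact: cd d1|exact: cd d2|exact: cd d3].
Qed.

(** The product of [h] and of [c] rescaled to the interval [1 - 2e, 1 - e],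
with the derivatives given by Leibniz' rule. *)
Definition cutoff3 (h c : jet3) (e : R) : jet3 :=
  let s t := (t - (1 - 2 * e)) / e in
  Jet3 (fun t => j0 h t * j0 c (s t))
    (fun t => j1 h t * j0 c (s t) + j0 h t * (j1 c (s t) / e))
    (fun t => j2 h t * j0 c (s t) + 2 * (j1 h t * (j1 c (s t) / e)) + j0 h t * (j2 c (s t) / e ^+ 2))
    (fun t => j3 h t * j0 c (s t) + 3 * (j2 h t * (j1 c (s t) / e)) +
       3 * (j1 h t * (j2 c (s t) / e ^+ 2)) + j0 h t * (j3 c (s t) / e ^+ 3)).

Lemma is_jet3_cutoff (h c : jet3) (e : R) : 0 < e -> is_jet3 h -> is_jet3 c -> is_jet3 (cutoff3 h c e).
Proof.
move=> e0 Jh Jc; have [h1 h2 h3 h4] := Jh; have [c1 c2 c3 c4] := Jc.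
pose s (t : R) := (t - (1 - 2 * e)) / e.
have ds t : is_derive t (1 : R) s e^-1.
  rewrite (_ : s = (fun t => e^-1 * (t + - (1 - 2 * e)))); last by apply/funext => u; rewrite /s mulrC.
  have hs := is_deriveD (is_derive_id t (1 : R)) (is_derive_cst (- (1 - 2 * e)) t (1 : R)).
  apply: is_derive_eq (is_deriveM (is_derive_cst (e^-1 : R) t (1 : R)) hs) _.
  by rewrite /GRing.scale /=; ring.
have dc (f f' : R -> R) (n : nat) t : (forall t, is_derive t (1 : R) f (f' t)) ->
    is_derive t (1 : R) (fun t => f (s t) / e ^+ n) (f' (s t) / e ^+ n.+1).
  move=> df; have hs := @is_derive1_comp _ f s t _ _ (df (s t)) (ds t).
  apply: is_derive_eq (is_deriveM hs (is_derive_cst ((e ^+ n)^-1 : R) t (1 : R))) _.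
  by rewrite /GRing.scale /= exprS invfM; ring.
have e00 (f : R -> R) : (fun t => f (s t)) = (fun t => f (s t) / e ^+ 0).
  by apply/funext => t; rewrite expr0 divr1.
have dc0 (f f' : R -> R) t : (forall t, is_derive t (1 : R) f (f' t)) ->
    is_derive t (1 : R) (fun t => f (s t)) (f' (s t) / e).
  by move=> df; rewrite e00 -[e in _ / e]expr1; exact: dc.
have dc1 (f f' : R -> R) t : (forall t, is_derive t (1 : R) f (f' t)) ->
    is_derive t (1 : R) (fun t => f (s t) / e) (f' (s t) / e ^+ 2).
  move=> df; rewrite (_ : (fun t => _) = (fun t => f (s t) / e ^+ 1)); first exact: dc.
  by apply/funext => u; rewrite expr1.
have [_ _ ch2] := jet3_cont Jh; have [ch0 ch1 _] := jet3_cont Jh.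
have [cc0 cc1 cc2] := jet3_cont Jc.
have cs (f : R -> R) (n : nat) : continuous f -> continuous (fun t => f (s t) / e ^+ n).
  move=> cf t; apply: cvgM; last exact: cvg_cst.
  apply: (continuous_comp (f := s) (g := f)); last exact: cf.
  by have [d _] := ds t; exact/differentiable_continuous/derivable1_diffP.
split=> /= [t|t|t|t].
- by apply: is_derive_eq (is_deriveM (h1 t) (dc0 _ _ t c1)) _; rewrite /GRing.scale /= addrC; congr (_ + _); rewrite mulrC.
- have A := is_deriveM (h2 t) (dc0 _ _ t c1); have B := is_deriveM (h1 t) (dc1 _ _ t c2).
  by apply: is_derive_eq (is_deriveD A B) _; rewrite /GRing.scale /=; ring.
- have A := is_deriveM (h3 t) (dc0 _ _ t c1); have B := is_deriveM (h2 t) (dc1 _ _ t c2).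
  have E := is_deriveM (h1 t) (dc _ _ 2%N t c3).
  have B2 := is_deriveM (is_derive_cst (2 : R) t (1 : R)) B.
  by apply: is_derive_eq (is_deriveD (is_deriveD A B2) E) _; rewrite /GRing.scale /=; ring.
- have c0 : continuous (fun t => j0 c (s t)) by rewrite e00; exact: cs.
  have c1' : continuous (fun t => j1 c (s t) / e) by have := @cs _ 1%N cc1; rewrite expr1.
  apply: cvgD; last by apply: cvgM; [exact: ch0|exact: (@cs _ 3%N)].
  apply: cvgD; last by apply: cvgM; [exact: cvg_cst|apply: cvgM; [exact: ch1|exact: (@cs _ 2%N)]].
  apply: cvgD; first by apply: cvgM; [exact: h4|exact: c0].
  by apply: cvgM; [exact: cvg_cst|apply: cvgM; [exact: ch2|exact: c1']].
Qed.

(** The function H is 0 inside and 1 near the circle, and [Th e] is H cut off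
between 1 - 2e and 1 - e. Its derivatives are of orders 1/e and 1/e^2, but the
singular terms live on t >= 1 - 2e, where 1 - t <= 2e: the factors (1 - t) and
(1 - t)^2 make them bounded. *)
Lemma cut_family (b0 b1 : R) : b0 < b1 -> b1 < 1 -> exists (H : jet3) (Th : R -> jet3) (B : R),
  [/\ 0 <= B, (forall t, b1 <= t -> [/\ j0 H t = 1, j1 H t = 0 & j2 H t = 0]) &
  forall e, 0 < e -> 2 * e < 1 - b1 ->
  [/\ is_jet3 (Th e),
      forall t, t <= b0 \/ 1 - e <= t -> [/\ j0 (Th e) t = 0, j1 (Th e) t = 0 & j2 (Th e) t = 0],
      forall t, 0 <= t -> t < 1 -> [/\ `|j0 (Th e) t| <= B, `|j1 (Th e) t| * (1 - t) <= B &
        `|j2 (Th e) t| * (1 - t) ^+ 2 <= B] &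
      forall t, t <= 1 - 2 * e -> [/\ j0 (Th e) t = j0 H t, j1 (Th e) t = j1 H t & j2 (Th e) t = j2 H t]]].
Proof.
move=> b01 b11.
have sh : smooth1 setT (fun t : R => 1 + - sstep b0 b1 t).
  by apply: smooth1D; [exact: smooth1_cst|apply: smooth1N; exact: smooth1_sstep].
have [H JH H0E] := smooth1_jet3 sh.
have [X JX X0E] := smooth1_jet3 (smooth1_sstep (ltr01 : 0 < 1 :> R)).
have cl (f : R -> R) (b c : R) : continuous f -> (forall t, b < t -> f t = c) ->
    forall t, b <= t -> f t = c.
  move=> cf fc t; rewrite le_eqVlt => /orP[/eqP <-|]; last exact: fc.
  apply/eqP; apply: contraT => /negP h.
  have [] : exists2 y, b < y & f y != c.
    have /cvgrPdist_lt := cf b => /(_ `|f b - c|).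
    rewrite normr_gt0 subr_eq0 => /(_ (introN idP h)) /nbhs_ballP[d /= d0 Hd].
    exists (b + d / 2); first by rewrite ltrDl divr_gt0.
    apply/eqP => E; have := Hd (b + d / 2); rewrite -ball_normE /= opprD addNKr normrN.
    rewrite ger0_norm ?divr_ge0// ?ltW// E ltxx => /(_ _)/negP; apply; last by [].
    by rewrite ltr_pdivrMr// ltr_pMr// ltr1n.
  by move=> y yb; rewrite fc// eqxx.
have cr (f : R -> R) (b c : R) : continuous f -> (forall t, t < b -> f t = c) ->
    forall t, t <= b -> f t = c.
  move=> cf fc t tb.
  have := cl (fun t => f (- t)) (- b) c _ _ (- t); rewrite opprK; apply.
  - by move=> x; apply: (continuous_comp (f := -%R) (g := f)); [exact: opp_continuous|exact: cf].
  - by move=> s; rewrite ltrNl => /fc.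
  - by rewrite lerN2.
have [cH0 cH1 cH2] := jet3_cont JH; have [cX0 cX1 cX2] := jet3_cont JX.
have H1 t : b1 <= t -> [/\ j0 H t = 1, j1 H t = 0 & j2 H t = 0].
  have e0 s : b1 <= s -> j0 H s = 1 by move=> bs; rewrite H0E sstep0// oppr0 addr0.
  move=> bt; have h := @jet3_off H [set t | b1 < t] 1 JH (@open_gt _ b1) (fun s bs => e0 s (ltW bs)).
  split; [exact: e0|apply: (@cl _ b1) => //|apply: (@cl _ b1) => //] => s /h[].
    by [].
  by [].
have Hn t : t <= b0 -> [/\ j0 H t = 0, j1 H t = 0 & j2 H t = 0].
  have e0 s : s <= b0 -> j0 H s = 0 by move=> bs; rewrite H0E sstep1// subrr.
  move=> bt; have h := @jet3_off H [set t | t < b0] 0 JH (@open_lt _ b0) (fun s bs => e0 s (ltW bs)).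
  split; [exact: e0|apply: (cr _ b0) => //|apply: (cr _ b0) => //] => s /h[].
    by [].
  by [].
have X1 t : 1 <= t -> [/\ j0 X t = 0, j1 X t = 0 & j2 X t = 0].
  have e0 s : 1 <= s -> j0 X s = 0 by move=> bs; rewrite X0E sstep0.
  move=> bt; have h := @jet3_off X [set t | 1 < t] 0 JX (@open_gt _ 1) (fun s bs => e0 s (ltW bs)).
  split; [exact: e0|apply: (@cl _ 1) => //|apply: (@cl _ 1) => //] => s /h[].
    by [].
  by [].
have X0 t : t <= 0 -> [/\ j0 X t = 1, j1 X t = 0 & j2 X t = 0].
  have e0 s : s <= 0 -> j0 X s = 1 by move=> bs; rewrite X0E sstep1.
  move=> bt; have h := @jet3_off X [set t | t < 0] 1 JX (@open_lt _ 0) (fun s bs => e0 s (ltW bs)).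
  split; [exact: e0|apply: (cr _ 0) => //|apply: (cr _ 0) => //] => s /h[].
    by [].
  by [].
have [A1 A10 HA1] := cont_bounded 1 cH1; have [A2 A20 HA2] := cont_bounded 1 cH2.
have [M1 M10 HM1] := cont_bounded 1 cX1; have [M2 M20 HM2] := cont_bounded 1 cX2.
have bX1 s : `|j1 X s| <= M1.
  have [s0|s0] := leP s 0; first by have [_ -> _] := X0 s s0; rewrite normr0.
  have [s1|s1] := leP 1 s; first by have [_ -> _] := X1 s s1; rewrite normr0.
  by apply: HM1; rewrite ger0_norm; lra.
have bX2 s : `|j2 X s| <= M2.
  have [s0|s0] := leP s 0; first by have [_ _ ->] := X0 s s0; rewrite normr0.
  have [s1|s1] := leP 1 s; first by have [_ _ ->] := X1 s s1; rewrite normr0.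
  by apply: HM2; rewrite ger0_norm; lra.
have bX0 s : `|j0 X s| <= 1.
  by rewrite X0E ger0_norm ?sstep_le1// ?sstep_ge0.
have bH0 s : `|j0 H s| <= 1.
  have h1 := sstep_le1 s b01; have h2 := sstep_ge0 s b01.
  by rewrite H0E ger0_norm; lra.
exists H, (cutoff3 H X), (1 + (A1 + 2 * M1) + (A2 + 4 * (A1 * M1) + 4 * M2)).
split=> //; first by nonneg.
move=> e e0 eb; have ei : 0 <= e^-1 by rewrite invr_ge0 ltW.
have BB1 : 0 <= A1 + 2 * M1 by nonneg.
have BB2 : 0 <= A2 + 4 * (A1 * M1) + 4 * M2 by nonneg.
split; first exact: is_jet3_cutoff.
- move=> t; case=> ht /=.
    by have [-> -> ->] := Hn t ht; split; rewrite !(mul0r, mulr0, addr0).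
  have [|-> -> ->] := X1 ((t - (1 - 2 * e)) / e).
    by rewrite ler_pdivlMr//; lra.
  by split; rewrite !(mul0r, mulr0, addr0).
- move=> t t0 t1 /=; set s := _ / e.
  have d0 : 0 <= 1 - t by lra.
  have d1 : 1 - t <= 1 by lra.
  have At1 : `|j1 H t| <= A1 by apply: HA1; rewrite ger0_norm//; lra.
  have At2 : `|j2 H t| <= A2 by apply: HA2; rewrite ger0_norm//; lra.
  (* Where X s is not constant, t >= 1 - 2 e, that is, 1 - t <= 2 e. *)
  have k1 : `|j1 X s / e| * (1 - t) <= 2 * M1.
    have [s0|s0] := leP s 0; first by have [_ -> _] := X0 s s0; rewrite mul0r normr0 mul0r; nonneg.
    have h : (1 - t) / e <= 2.
      by rewrite ler_pdivrMr//; move: s0; rewrite /s ltr_pdivlMr// mul0r; lra.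
    rewrite normrM (ger0_norm ei) -mulrA [2 * _]mulrC ler_pM// ?mulr_ge0//.
    by rewrite mulrC.
  have k2 : `|j2 X s / e ^+ 2| * (1 - t) ^+ 2 <= 4 * M2.
    have [s0|s0] := leP s 0; first by have [_ _ ->] := X0 s s0; rewrite mul0r normr0 mul0r; nonneg.
    have h : (1 - t) / e <= 2.
      by rewrite ler_pdivrMr//; move: s0; rewrite /s ltr_pdivlMr// mul0r; lra.
    rewrite normrM -exprVn (ger0_norm (exprn_ge0 2 ei)) -mulrA -exprMn [4 * _]mulrC ler_pM// ?exprn_ge0 ?mulr_ge0//.
    rewrite [e^-1 * _]mulrC (_ : 4 = 2 ^+ 2); last by ring.
    by rewrite lerXn2r ?nnegrE ?mulr_ge0.
  have x0 := bX0 s; have y0 := bH0 t.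
  have n1 := normr_ge0 (j1 H t); have n2 := normr_ge0 (j2 H t).
  split.
  + have : `|j0 H t * j0 X s| <= 1 * 1 by rewrite normrM ler_pM.
    by lra.
  + have p1 : `|j1 H t * j0 X s| * (1 - t) <= A1.
      rewrite normrM -[leRHS]mulr1 ler_pM ?mulr_ge0//.
      by rewrite -[leRHS]mulr1 ler_pM.
    have p2 : `|j0 H t * (j1 X s / e)| * (1 - t) <= 2 * M1.
      by rewrite normrM -mulrA -[leRHS]mul1r ler_pM ?mulr_ge0.
    have := ler_wpM2r d0 (ler_normD (j1 H t * j0 X s) (j0 H t * (j1 X s / e))).
    rewrite mulrDl; lra.
  + have d2 : 0 <= (1 - t) ^+ 2 by rewrite exprn_ge0.
    have p1 : `|j2 H t * j0 X s| * (1 - t) ^+ 2 <= A2.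
      rewrite normrM -[leRHS]mulr1 ler_pM ?mulr_ge0 ?exprn_ile1//.
      by rewrite -[leRHS]mulr1 ler_pM.
    have p2 : `|2 * (j1 H t * (j1 X s / e))| * (1 - t) ^+ 2 <= 4 * (A1 * M1).
      have : `|j1 H t| * (`|j1 X s / e| * (1 - t) * (1 - t)) <= A1 * (2 * M1 * 1).
        rewrite ler_pM ?mulr_ge0//; rewrite ler_pM ?mulr_ge0//.
      rewrite (normrM 2) (normrM (j1 H t)) (ger0_norm (ler0n _ 2)) expr2.
      move: (`|j1 X s / e|) (`|j1 H t|) (1 - t) => p q v h.
      rewrite (_ : 2 * (q * p) * (v * v) = 2 * (q * (p * v * v))); last by ring.
      by lra.
    have p3 : `|j0 H t * (j2 X s / e ^+ 2)| * (1 - t) ^+ 2 <= 4 * M2.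
      by rewrite normrM -mulrA -[leRHS]mul1r ler_pM ?mulr_ge0.
    have h1 := ler_normD (j2 H t * j0 X s + 2 * (j1 H t * (j1 X s / e))) (j0 H t * (j2 X s / e ^+ 2)).
    have h2 := ler_normD (j2 H t * j0 X s) (2 * (j1 H t * (j1 X s / e))).
    apply: (le_trans (ler_wpM2r d2 (le_trans h1 (lerD h2 (lexx _))))).
    rewrite mulrDl [X in X + _ <= _]mulrDl; lra.
- move=> t ht /=; have [|-> -> ->] := X0 ((t - (1 - 2 * e)) / e).
    by rewrite ler_pdivrMr// mul0r; lra.
  by split; rewrite !(mul0r, mulr0, mulr1, addr0).
Qed.

End CutFamily.

(** * The density of the quadrature measure *)

Section Density.
Context {R : realType}.
Local Notation C := R[i].
Variables (phi : C -> C) (k : R).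
Hypothesis phi_an : forall c, modulus c <= 1 -> exists a (r : R), psat phi c a r.
Hypothesis phi_inj : forall z w, modulus z < 1 -> modulus w < 1 -> phi z = phi w -> z = w.

Let D := img phi [set z | modulus z < 1].

Lemma sqm_le1 (z : C) : modulus z < 1 -> [/\ 0 <= sqm z, sqm z < 1 & 1 - modulus z <= 1 - sqm z].
Proof.
move=> z1; have z0 := modulus_ge0 z; rewrite /sqm; split; first exact: exprn_ge0.
  by rewrite expr_lt1.
by rewrite lerD2l lerN2 expr2 ler_piMr// ltW.
Qed.

(** The weights d and d^2 in the bounds of the potential compensate the
growth of the derivatives of the cutoff, and the weight |phi'|^2 compensates the
denominator. *)
Lemma cutlap_bound (H : jet3 (R := R)) (z : C) (M B d f : R) (V Vz Vq : C) :
  modulus z <= 1 -> 0 < f -> 0 <= d -> d <= 1 -> 0 <= M -> 0 <= B -> d <= 1 - sqm z ->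
  modulus V <= M * d ^+ 2 * f ^+ 2 -> modulus Vz <= M * d * f ^+ 2 -> modulus Vq <= M * d * f ^+ 2 ->
  `|j0 H (sqm z)| <= B -> `|j1 H (sqm z)| * (1 - sqm z) <= B -> `|j2 H (sqm z)| * (1 - sqm z) ^+ 2 <= B ->
  `|j0 H (sqm z) + 4 * complex.Re (((j2 H (sqm z))%:C)%C * ((sqm z)%:C)%C * V +
     ((j1 H (sqm z))%:C)%C * (V + z * Vz + conjc z * Vq)) / f ^+ 2| <= B + 16 * (B * M).
Proof.
move=> z1 f0 d0 d1 M0 B0 ds hV hz hq h0 h1 h2.
have f2 : 0 < f ^+ 2 by rewrite exprn_gt0.
have t0 : 0 <= sqm z by rewrite /sqm exprn_ge0 ?modulus_ge0.
have t1 : sqm z <= 1 by lra.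
have k1 : `|j1 H (sqm z)| * d <= B by apply: le_trans h1; rewrite ler_wpM2l.
have k2 : `|j2 H (sqm z)| * d ^+ 2 <= B.
  by apply: le_trans h2; rewrite ler_wpM2l// lerXn2r ?nnegrE//; lra.
set W := _ + _ * (V + _ + _).
have hW : modulus W <= 4 * (B * M) * f ^+ 2.
  have e1 : modulus (((j2 H (sqm z))%:C)%C * ((sqm z)%:C)%C * V) <= B * M * f ^+ 2.
    rewrite !modulusM !modulus_real [`|sqm z|]ger0_norm//.
    apply: (@le_trans _ _ (`|j2 H (sqm z)| * 1 * (M * d ^+ 2 * f ^+ 2))).
      by rewrite ler_pM ?mulr_ge0 ?modulus_ge0// ler_wpM2l.
    rewrite (_ : _ * 1 * _ = (`|j2 H (sqm z)| * d ^+ 2) * (M * f ^+ 2)); last by ring.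
    by rewrite -[leRHS]mulrA ler_wpM2r//; nonneg.
  have e2 : modulus (V + z * Vz + conjc z * Vq) <= 3 * (M * d * f ^+ 2).
    have a1 := modulusD (V + z * Vz) (conjc z * Vq); have a2 := modulusD V (z * Vz).
    move: a1 a2; rewrite !modulusM modulus_conj => a1 a2.
    have b1 : modulus z * modulus Vz <= 1 * (M * d * f ^+ 2) by rewrite ler_pM ?modulus_ge0.
    have b2 : modulus z * modulus Vq <= 1 * (M * d * f ^+ 2) by rewrite ler_pM ?modulus_ge0.
    have b3 : M * d ^+ 2 * f ^+ 2 <= M * d * f ^+ 2.
      by rewrite ler_wpM2r ?(ltW f2)// ler_wpM2l// expr2 ler_piMr.
    lra.
  have e3 : modulus (((j1 H (sqm z))%:C)%C * (V + z * Vz + conjc z * Vq)) <= 3 * (B * M * f ^+ 2).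
    rewrite modulusM modulus_real.
    apply: (le_trans (ler_wpM2l (normr_ge0 _) e2)).
    rewrite (_ : _ * _ = 3 * ((`|j1 H (sqm z)| * d) * (M * f ^+ 2))); last by ring.
    rewrite -[B * M * _]mulrA ler_wpM2l// ler_wpM2r//; nonneg.
  have := modulusD (((j2 H (sqm z))%:C)%C * ((sqm z)%:C)%C * V)
    (((j1 H (sqm z))%:C)%C * (V + z * Vz + conjc z * Vq)); rewrite -/W; lra.
have hR : `|4 * complex.Re W / f ^+ 2| <= 16 * (B * M).
  rewrite !normrM normfV (ger0_norm (ltW f2)) ger0_norm// ler_pdivrMr//.
  by have := modulus_Re W; lra.
by have := ler_normD (j0 H (sqm z)) (4 * complex.Re W / f ^+ 2); lra.
Qed.

Lemma cutlap_le (h : jet3 (R := R)) (a0 a1 A M : R) : 0 <= A -> 0 <= M -> 0 <= a0 -> a0 <= a1 ->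
  (forall t, t <= a1 ^+ 2 -> [/\ j0 h t = 0, j1 h t = 0 & j2 h t = 0]) ->
  (forall t, 0 <= t -> t < 1 -> [/\ `|j0 h t| <= A, `|j1 h t| * (1 - t) <= A &
     `|j2 h t| * (1 - t) ^+ 2 <= A]) ->
  (forall z, a0 < modulus z -> modulus z < 1 -> der phi z != 0 /\
     [/\ modulus (pot phi k z) <= M * (1 - modulus z) ^+ 2 * modulus (der phi z) ^+ 2,
         modulus (pot_z phi k z) <= M * (1 - modulus z) * modulus (der phi z) ^+ 2 &
         modulus (pot_q phi k z) <= M * (1 - modulus z) * modulus (der phi z) ^+ 2]) ->
  forall z, modulus z < 1 -> `|cutlap phi k (j0 h) (j1 h) (j2 h) z| <= A + 16 * (A * M).
Proof.
move=> A0 M0 a00 a01 T0 Tb HV z z1; have [t0 t1 td] := sqm_le1 z1.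
have [za|az] := leP (modulus z) a0.
  have tz : sqm z <= a1 ^+ 2.
    by rewrite /sqm lerXn2r ?nnegrE ?modulus_ge0//; [exact: le_trans a01|exact: le_trans a01].
  have [h0 h1 h2] := T0 (sqm z) tz.
  by rewrite /cutlap h0 h1 h2 !mul0r addr0 mulr0 mul0r addr0 normr0; nonneg.
have [dz [v1 v2 v3]] := HV z az z1.
have fz : 0 < modulus (der phi z) by rewrite modulus_gt0.
have [u1 u2 u3] := Tb _ t0 t1.
have m0 := modulus_ge0 z.
by apply: (@cutlap_bound h z M A (1 - modulus z) (modulus (der phi z))) => //; lra.
Qed.

Let cl (h : jet3 (R := R)) z := cutlap phi k (j0 h) (j1 h) (j2 h) z.

(** The cut potentials for a sequence of cutoffs approaching the circle:
their images L n under Delta + k^2 are bounded uniformly, are orthogonal to every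
solution, and at a given point are eventually equal to the value Lam of the
potential cut only on the inner side, which is 1 near the circle. *)
Lemma cut_sequence : exists (a2 e1 B : R) (h : C -> R) (en : nat -> R) (L : nat -> plane R -> R),
  [/\ [/\ 0 <= a2, a2 < 1, 0 < e1, 2 * e1 < 1 - a2 ^+ 2 & 0 <= B],
      [/\ forall n, 0 < en n, en 0%N = e1 & forall d : R, 0 < d -> \forall n \near \oo, 2 * en n <= d],
      [/\ forall n, continuous (L n), forall n x, ~ D x -> L n x = 0 & forall n x, `|L n x| <= B],
      [/\ forall n z, modulus z < 1 -> sqm z <= 1 - 2 * en n -> L n (to_plane (phi z)) = h z &
          forall z, a2 ^+ 2 <= sqm z -> h z = 1] &
      forall n u, Cn 2 D u -> (forall x, D x -> lapk k u x = 0) -> pint (fun x => ext0 D u x * L n x) = 0].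
Proof.
have an1 c : modulus c <= 1 -> exists a (r : R), psat (der phi) c a r.
  by move=> /phi_an[a [r h]]; exists (cdiff a), r; exact: psat_derps.
have an2 c : modulus c <= 1 -> exists a (r : R), psat (der (der phi)) c a r.
  by move=> /an1[a [r h]]; exists (cdiff a), r; exact: psat_derps.
have [rho [rho1 phi0 phi1 phi2]] : exists rho : R, [/\ 1 < rho,
    clin phi [set z | modulus z <= rho], clin (der phi) [set z | modulus z <= rho] &
    clin (der (der phi)) [set z | modulus z <= rho]].
  have [r0 h0 c0] := psat_clin_disc phi_an; have [r1 h1 c1] := psat_clin_disc an1.
  have [r2 h2 c2] := psat_clin_disc an2.
  exists (Num.min r0 (Num.min r1 r2)); split; first by rewrite !lt_min h0 h1.
  - by apply: clin_sub c0 => z /=; rewrite !le_min => /and3P[].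
  - by apply: clin_sub c1 => z /=; rewrite !le_min => /and3P[].
  - by apply: clin_sub c2 => z /=; rewrite !le_min => /and3P[].
have [dd dd0 [B B0 HB]] := der_comparable_annulus phi_an phi_inj.
have [M M0 HM] := pot_bounds k rho1 phi0 phi1 phi2 B0.
have [r [r1 rr]] : exists r, 1 < r /\ r < rho by exists ((1 + rho) / 2); split; lra.
have [a0 [a00 a01 a0r a0d]] : exists a0 : R, [/\ 2^-1 < a0, a0 < 1, r^-1 <= a0 & 1 - dd < a0].
  exists (Num.max (Num.max (3 / 4) (1 - dd / 2)) r^-1); split.
  - by rewrite !lt_max; apply/orP; left; apply/orP; left; lra.
  - rewrite !gt_max invf_lt1 ?r1 ?andbT; last by lra.
    by apply/andP; split; lra.
  - by rewrite le_max lexx orbT.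
  - by rewrite !lt_max; apply/orP; left; apply/orP; right; lra.
have rV : rho^-1 <= r^-1 by rewrite lef_pV2 ?posrE; lra.
have dn0 z : a0 <= modulus z -> modulus z < 1 -> der phi z != 0.
  by move=> h1 h2; have [] := HB z _ h2; first by lra.
have a0p : 0 < a0 by lra.
have HV z : a0 < modulus z -> modulus z < 1 -> der phi z != 0 /\
     [/\ modulus (pot phi k z) <= M * (1 - modulus z) ^+ 2 * modulus (der phi z) ^+ 2,
         modulus (pot_z phi k z) <= M * (1 - modulus z) * modulus (der phi z) ^+ 2 &
         modulus (pot_q phi k z) <= M * (1 - modulus z) * modulus (der phi z) ^+ 2].
  move=> az z1; have zd : 1 - dd < modulus z by lra.
  have [dz HBz] := HB z zd z1; split=> //; apply: HM => //; lra.
have [a1 [a2 [ha1 ha2 ha3]]] : exists a1 a2, [/\ a0 < a1, a1 < a2 & a2 < 1].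
  by exists ((2 * a0 + 1) / 3), ((a0 + 2) / 3); split; lra.
have b01 : a1 ^+ 2 < a2 ^+ 2 by rewrite ltrXn2r ?nnegrE//; lra.
have b11 : a2 ^+ 2 < 1 by rewrite expr_lt1//; lra.
have [H [Th [A [A0 H1 HT]]]] := cut_family b01 b11.
have Hcut e : 0 < e -> 2 * e < 1 - a2 ^+ 2 -> exists L : plane R -> R,
    [/\ continuous L, forall z, modulus z < 1 -> L (to_plane (phi z)) = cl (Th e) z,
        forall x, ~ D x -> L x = 0 &
        forall u, Cn 2 D u -> (forall x, D x -> lapk k u x = 0) -> pint (fun x => ext0 D u x * L x) = 0].
  move=> e0 eb; have [JT T0 _ _] := HT e e0 eb; have [d1 d2 d3 c3] := JT.
  (* The cutoff vanishes for |z|^2 >= 1 - e, in particular for |z| >= 1 - e / 2. *)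
  have h1 : a1 < 1 - e / 2 by nra.
  have h2 : 1 - e / 2 < 1 - e / 4 by lra.
  have h3 : 1 - e / 4 < 1 by lra.
  have T0' t : t <= a1 ^+ 2 \/ (1 - e / 2) ^+ 2 <= t ->
      [/\ j0 (Th e) t = 0, j1 (Th e) t = 0 & j2 (Th e) t = 0].
    by case=> h; apply: T0; [left|right; nra].
  have [K [f [f1 [f2 [[g1 g2 g3 g4 g5] [cK KD f0 fE fD]]]]]] :=
    test_exists k phi_an phi_inj rho1 phi0 phi1 phi2 r1 rr a0r ha1 h1 h2 h3 dn0 d1 d2 d3 c3 T0'.
  exists (fun x => f2 0 x + f2 1 x + k ^+ 2 * f x); split=> //.
    move=> x; apply: cvgD; first by apply: cvgD; [exact: g5|exact: g5].
    by apply: cvgM; [exact: cvg_cst|exact: g3].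
  move=> u Cu Lu; apply: (green _ cK KD Cu Lu g1 g2 g3 g4 g5 f0).
  apply: img_open => // z /= z1; exists (1 - modulus z); first by rewrite subr_gt0.
  by move=> y; have := ler_modB y z; lra.
have [e1 [e10 e1b]] : exists e, 0 < e /\ 2 * e < 1 - a2 ^+ 2.
  by exists ((1 - a2 ^+ 2) / 4); split; lra.
have [en [en0 ene en00 eninf]] : exists en : nat -> R, [/\ forall n, 0 < en n,
    forall n, en n <= e1, en 0%N = e1 & forall d : R, 0 < d -> \forall n \near \oo, 2 * en n <= d].
  exists (fun n => e1 / n.+1%:R); split=> [n|n||d d0].
  - by rewrite divr_gt0.
  - by rewrite ler_pdivrMr// ler_peMr ?ler1n// ltW.
  - by rewrite divr1.
  - near=> n; have h : (2 * e1 / d) <= n%:R by near: n; exact: nbhs_infty_ger.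
    have n1 : n%:R <= n.+1%:R :> R by rewrite ler_nat.
    by move: (le_trans h n1); rewrite ler_pdivrMr// mulrA [_ / n.+1%:R <= _]ler_pdivrMr// [d * _]mulrC.
have enb n : 2 * en n < 1 - a2 ^+ 2 by have := ene n; lra.
have [L HL] := choice (fun n => Hcut _ (en0 n) (enb n)).
have AM : 0 <= A + 16 * (A * M) by nonneg.
exists a2, e1, (A + 16 * (A * M)), (cl H), en, L; split=> //.
- by split=> //; lra.
- split=> [n|n x Dx|n x]; first by have [] := HL n.
    by have [_ _ h _] := HL n; exact: h.
  have [_ LE LD _] := HL n; have [_ T0 Tb _] := HT _ (en0 n) (enb n).
  have [[z /= z1 <-]|Dx] := pselect (D x); last by rewrite LD// normr0.
  have T0' t : t <= a1 ^+ 2 -> [/\ j0 (Th (en n)) t = 0, j1 (Th (en n)) t = 0 & j2 (Th (en n)) t = 0].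
    by move=> ta; apply: T0; left.
  by rewrite LE//; exact: (cutlap_le A0 M0 (ltW a0p) (ltW ha1) T0' Tb HV z1).
- split=> [n z z1 h|z /H1[h0 h1 h2]].
    have [_ LE _ _] := HL n; have [_ _ _ /(_ _ h)[h0 h1 h2]] := HT _ (en0 n) (enb n).
    by rewrite LE// /cl /cutlap h0 h1 h2.
  by rewrite /cl /cutlap h0 h1 h2 !mul0r addr0 mulr0 mul0r addr0.
- by move=> n; have [] := HL n.
Unshelve. all: by end_near. Qed.

(** The density is 1 - L 0 where the outer cutoff of L 0 is inactive, and 0
elsewhere; it is continuous because Lam = 1 near the circle. By dominated
convergence 1 - m, the limit of L n, is orthogonal to every integrable
solution. *)
Lemma density : exists (K : set (plane R)) (m : plane R -> R),
  [/\ compact K, K `<=` D, continuous m, forall x, ~ K x -> m x = 0 &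
  forall u, Cn 2 D u -> (forall x, D x -> lapk k u x = 0) -> itg (ext0 D u) ->
    pint (ext0 D u) = pint (fun x => ext0 D u x * m x)].
Proof.
have [a2 [e1 [B [Lam [en [L [[a20 a21 e10 e1b B0] [en0 en00 eninf] [Lc LD Lb] [LE Lam1] Li]]]]]]] :=
  cut_sequence.
(* On W, L 0 is Lam; K contains the points of D at which Lam may differ from 1. *)
pose W := img phi [set z | sqm z < 1 - 2 * e1].
pose K := img phi [set z | 0 <= modulus z /\ modulus z <= a2].
have W1 z : [set z | sqm z < 1 - 2 * e1] z -> modulus z < 1.
  rewrite /= => h; rewrite ltNge; apply/negP => h'.
  have h1 : 1 <= sqm z by rewrite /sqm exprn_ege1.
  by have := le_lt_trans h1 h; rewrite ltNge gerBl mulr_ge0// ltW.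
have oW : open W.
  apply: img_open => // z /= zt; set q := 1 - _ in zt *.
  have z0 := modulus_ge0 z.
  exists (Num.min 1 ((q - sqm z) / (2 * modulus z + 1))).
    by rewrite lt_min ltr01 divr_gt0 ?subr_gt0// ltr_wpDl// mulr_ge0.
  move=> y; rewrite lt_min ltr_pdivlMr; last by rewrite ltr_wpDl// mulr_ge0.
  move=> /andP[h1 h2]; have := ler_modB y z; have := modulus_ge0 (y - z); have := modulus_ge0 y.
  by rewrite /sqm in h2 *; move: (modulus y) (modulus z) (modulus (y - z)) h1 h2 z0 => *; nra.
have cK : compact K by apply: img_compact => //; lra.
have KW : K `<=` W.
  apply: img_sub => z [_ h] /=.
  have : sqm z <= a2 ^+ 2 by rewrite /sqm lerXn2r ?nnegrE ?modulus_ge0//; lra.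
  lra.
have L0c := Lc 0%N.
have W0 x : W x -> ~ K x -> 1 - L 0%N x = 0.
  move=> [z zt <-] Kx; have z1 := W1 z zt; rewrite LE ?Lam1 ?subrr ?en00//.
  - have : ~ (modulus z <= a2) by move=> h; apply: Kx; exists z => //; split => //; exact: modulus_ge0.
    move=> /negP; rewrite -ltNge => h; rewrite /sqm lerXn2r ?nnegrE ?modulus_ge0//; lra.
  - by move: zt; rewrite /= => /ltW.
pose m := ext0 W (fun x => 1 - L 0%N x).
have cm : continuous m.
  apply: (ext0_cont oW _ KW W0); first exact: compact_closed.
  by move=> x _; apply: cvgB; [exact: cvg_cst|exact: L0c].
have mK x : ~ K x -> m x = 0.
  move=> Kx; have [Wx|Wx] := pselect (W x); last by rewrite /m ext0N.
  by rewrite /m ext0E// W0.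
have KD : K `<=` D by apply: img_sub => z [_ h] /=; lra.
exists K, m; split=> // u Cu Lu iu.
have Lm (x : plane R) : D x -> L ^~ x @ \oo --> 1 - m x.
  move=> [z /= z1 <-]; have [t0 t1 _] := sqm_le1 z1.
  have E n : 2 * (en n) <= 1 - sqm z -> L n (to_plane (phi z)) = Lam z.
    by move=> hn; apply: LE => //; lra.
  have -> : 1 - m (to_plane (phi z)) = Lam z.
    have [Wx|Wx] := pselect (W (to_plane (phi z))).
      rewrite /m ext0E// subKr; apply: E; have := img_inj phi_inj W1 z1 Wx.
      by rewrite /= => h; lra.
    rewrite /m ext0N// subr0 Lam1// leNgt; apply/negP => h; apply: Wx; exists z => //=; lra.
  apply: cvg_near_cst; near=> n; apply: E.
  by near: n; apply: eninf; lra.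
have mu : measurable_fun setT (ext0 D u) by exact: itg_measurable.
have mLn n : measurable_fun setT (L n).
  by exact: continuous_measurable_plane.
have mm : measurable_fun setT m by exact: continuous_measurable_plane.
have := @pint_dominated R (fun n x => ext0 D u x * L n x) (fun x => ext0 D u x * (1 - m x))
  (fun x => B * `|ext0 D u x|).
have -> : (fun n => pint (fun x => ext0 D u x * L n x)) = (fun=> 0).
  by apply/funext => n; exact: Li.
move=> h; have {h} : (fun=> 0 : R) @ \oo --> pint (fun x => ext0 D u x * (1 - m x)).
  apply: h.
  - by move=> n; apply: measurable_funM.
  - by apply: measurable_funM => //; apply: measurable_funB.
  - by apply: itgZ; exact: itg_abs.
  - by move=> n x; rewrite normrM mulrC ler_wpM2r.
  - apply: nearW => x; have [Dx|Dx] := pselect (D x).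
      by apply: cvgM; [exact: cvg_cst|exact: Lm].
    by rewrite ext0N//; under eq_fun do rewrite mul0r; rewrite mul0r; exact: cvg_cst.
move=> /(cvg_unique (@norm_hausdorff _ _) (cvg_cst (0 : R))) => E.
have [Bm Bm0 HBm] : exists2 Bm : R, 0 <= Bm & forall x, `|m x| <= Bm.
  have [MK HMK] := compact_bound cK.
  by apply: (@bounded_supp _ m MK) => // x xM; apply: mK => /HMK; rewrite leNgt xM.
have im : itg (fun x => ext0 D u x * m x) by exact: (itg_mul iu mm HBm).
apply/eqP; rewrite -subr_eq0 -pintB// [eqbRHS]E; apply/eqP.
by apply: pint_ext => x; ring.
Unshelve. all: by end_near. Qed.

End Density.

(** * Smooth cutoffs and restrictions to an open set *)

Section Cutoff.
Context {R : realType}.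
Implicit Types (D K : set (plane R)) (f g psi : plane R -> R).

(** A product of complements of bumps over a finite cover of [K] by discs. *)
Lemma smooth_cutoff D K : open D -> compact K -> K `<=` D ->
  exists2 chi, test_real D chi & exists V : set (plane R), [/\ open V, K `<=` V & forall x, V x -> chi x = 1].
Proof.
move=> oD cK KD.
have ex x : exists r : R, K x -> [/\ 0 < r, r <= 1 & forall y, sqd x y < r -> D y].
  have [Kx|Kx] := pselect (K x); last by exists 0.
  have [r r0 Hr] := (open_planeP D).1 oD x (KD x Kx).
  have m0 : 0 < Num.min r 1 by rewrite lt_min r0 ltr01.
  have m1 : Num.min r 1 <= 1 by rewrite ge_min lexx orbT.
  exists (Num.min r 1 ^+ 2) => _; split; [by rewrite exprn_gt0|by rewrite exprn_ile1// ltW|].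
  move=> y; rewrite /sqd => h; apply: Hr; have mr : Num.min r 1 <= r by rewrite ge_min lexx.
  apply: lt_le_trans mr; rewrite -(@ltr_pXn2r _ 2) ?nnegrE ?modulus_ge0 ?(ltW m0)//.
  by rewrite modulusC modulus_sqr -of_planeB.
have [r Hr] := choice ex.
pose U (x : plane R) := [set y : plane R | sqd x y < r x / 4].
have oU x : open (U x).
  apply: (open_comp (f := sqd x) (D := [set t | t < r x / 4])); last exact: open_lt.
  by move=> y _; exact: (Cn_cont (Cn_sqd 0 setT x) I).
(* finite subcovers, from near-coverings along the filter of finite sequences *)
have [F FK KF] : exists2 F : seq (plane R), forall x, x \in F -> K x &
    forall y, K y -> exists2 x, x \in F & U x y.
  pose Q : set_system (seq (plane R)) := [set A : set (seq (plane R)) |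
    exists s0 : seq (plane R), forall s : seq (plane R), {subset s0 <= s} -> A s].
  have fQ : Filter Q.
    split; first by exists [::].
      move=> A B [s As] [t Bt]; exists (s ++ t) => v sv.
      by split; [apply: As|apply: Bt] => x xs; apply: sv; rewrite mem_cat xs ?orbT.
    by move=> A B AB [s As]; exists s => v /As /AB.
  have /compact_near_coveringP cov := cK.
  have H x : K x -> \forall y \near x & s \near Q, exists2 z, z \in s /\ K z & U z y.
    move=> Kx; exists (U x, [set s : seq (plane R) | x \in s]).
      split => /=; last by exists [:: x] => s; apply; rewrite mem_head.
      apply: open_nbhs_nbhs; split; first exact: oU.
      rewrite /U /= /sqd !subrr expr0n /= addr0.
      by have [h _ _] := Hr x Kx; rewrite divr_gt0.
    by move=> [y s] /= [Uy xs]; exists x.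
  have [s0 Hs0] := cov (seq (plane R)) Q _ fQ H.
  exists [seq x <- s0 | `[< K x >]]; first by move=> x; rewrite mem_filter => /andP[/asboolP].
  move=> y Ky; have [x [xs Kx] Uxy] := Hs0 s0 (fun _ h => h) y Ky.
  by exists x => //; rewrite mem_filter xs andbT; apply/asboolP.
have chiP (s : seq (plane R)) : (forall x, x \in s -> K x) -> exists2 chi, test_real D chi &
    forall x y, x \in s -> U x y -> chi y = 1.
  elim: s => [_|x s IH sK].
    exists (fun _ => 0) => //; split; first by move=> n; exact: Cn_cst.
    by exists set0; split=> //; exact: compact0.
  have [chi [cchi [C [cC CD chi0]]] chi1] := IH (fun y ys => sK y (mem_behead (s := x :: s) ys)).
  have Kx := sK x (mem_head x s); have [r0 r1 rD] := Hr x Kx.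
  have r42 : r x / 4 < r x / 2 by lra.
  pose b y := sstep (r x / 4) (r x / 2) (sqd x y).
  have cb n : Cn n setT b.
    apply: (Cn_smooth1 (J := setT)) => //; [exact: smooth1_sstep|exact: Cn_sqd].
  exists (fun y => chi y + (b y + -1 * (chi y * b y))).
    split=> [n|].
      apply: CnD; first exact: cchi.
      by apply: CnD; [exact: cb|apply: CnM; [exact: Cn_cst|apply: CnM; [exact: cchi|exact: cb]]].
    exists (C `|` [set y | sqd x y <= r x / 2]); split.
    - by apply: compactU => //; apply: compact_sqd; lra.
    - by move=> y [/CD//|/= h]; apply: rD; lra.
    - move=> y h; rewrite chi0; last by move=> Cy; apply: h; left.
      rewrite /b sstep0 ?mul0r ?mulr0 ?addr0//.
      by rewrite leNgt; apply/negP => h'; apply: h; right; exact: ltW.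
  move=> z y; rewrite inE => /orP[/eqP ->|zs] Uy.
    by rewrite /b sstep1 ?(ltW Uy)//; ring.
  by rewrite (chi1 z y)//; ring.
have [chi tchi chi1] := chiP F FK.
exists chi => //; exists (\bigcup_(x in [set` F]) U x); split=> //.
- by apply: bigcup_open => x _; exact: oU.
- by move=> y [x xF Uy]; apply: (chi1 x).
Qed.

(** Real smooth functions of compact support are test functions. *)
Lemma test_real_function D psi : test_real D psi ->
  test_function D (fun x => ((psi x)%:C)%C).
Proof.
move=> [cpsi [K [cK KD psi0]]].
have sub : fsupport (fun x => ((psi x)%:C)%C) `<=` K.
  have clK : closed K by exact: compact_closed.
  rewrite [X in _ `<=` X](closure_id K).1//; apply: closure_subset => x /=; apply: contraNP => Kx.
  by rewrite psi0.
split.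
- split; first by apply: Cn_real_smooth => //; exact: openT.
  by apply: Cn_real_smooth; [exact: openT|move=> n; exact: Cn_cst].
- by apply: (subclosed_compact _ cK sub); exact: closed_closure.
- exact: subset_trans sub KD.
Qed.

Lemma partials_cst0 (s : seq 'I_2) : partials s (fun _ : plane R => 0 : R) = (fun _ => 0).
Proof.
elim: s => [//|i s IH]; rewrite /= IH; apply/funext => x.
by rewrite (derive_cst (0 : R) x (dir i)).
Qed.

Lemma helmholtz_real k psi x :
  helmholtz k (fun x => ((psi x)%:C)%C) x = ((lapk k psi x)%:C)%C.
Proof.
have sum2 (F : 'I_2 -> R[i]) : \sum_(i < 2) F i = F 0 + F 1.
  by rewrite big_ord_recl big_ord1; congr (F _ + F _); exact/val_inj.
rewrite /helmholtz /laplacian sum2 /cpartials.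
have -> : re (fun x => ((psi x)%:C)%C) = psi by [].
have -> : im (fun x => ((psi x)%:C)%C) = (fun _ => 0) by [].
rewrite !partials_cst0.
by apply/eqP; rewrite eq_complex /lapk /= !(mulr0, mul0r, subr0, addr0) !eqxx.
Qed.

End Cutoff.

Section Restriction.
Context {R : realType}.
Local Notation mu2 := (leb2 R).
Implicit Types (D K : set (plane R)) (f g : plane R -> R).

Lemma ext0_patch D f : (EFin \o f) \_ D = EFin \o ext0 D f.
Proof.
apply/funext => x; rewrite patchE /=; case: ifPn => [|/negP]; rewrite inE => Dx.
  by rewrite ext0E.
by rewrite ext0N.
Qed.

Lemma integrable_ext0 D f : open D -> mu2.-integrable D (EFin \o f) -> itg (ext0 D f).
Proof.
move=> oD hf; have mD := open_measurable_plane oD.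
by have := (@integrable_mkcond _ _ R mu2 D (EFin \o f) mD).1 hf; rewrite ext0_patch.
Qed.

Lemma Rintegral_ext0 D f : \int[mu2]_(x in D) f x = pint (ext0 D f).
Proof. by rewrite pint_def /Rintegral integral_mkcond ext0_patch. Qed.

Lemma ext0_mul D f g x : ext0 D (fun x => f x * g x) x = ext0 D f x * g x.
Proof. by have [Dx|Dx] := pselect (D x); [rewrite !ext0E|rewrite !ext0N ?mul0r]. Qed.

Lemma pint_ae_eq f g : measurable_fun setT f -> measurable_fun setT g ->
  {ae mu2, forall x, f x = g x} -> pint f = pint g.
Proof.
move=> mf mg fg; rewrite !pint_def; congr fine; apply: ae_eq_integral => //.
- exact/measurable_EFinP.
- exact/measurable_EFinP.
- by have := fg; apply: filterS => x /= -> _.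
Qed.

Lemma itg_ae_eq f g : itg f -> measurable_fun setT g -> {ae mu2, forall x, f x = g x} -> itg g.
Proof.
move=> itf mg fg; apply/integrableP; split; first exact/measurable_EFinP.
have /integrableP[_] := itf; apply: le_lt_trans.
rewrite (@ae_eq_integral _ _ _ mu2 setT (fun x => `|(f x)%:E|%E) (fun x => `|(g x)%:E|%E))//.
- by apply: measurableT_comp => //; exact/measurable_EFinP.
- by apply: measurableT_comp => //; apply/measurable_EFinP; exact: itg_measurable.
- by have := fg; apply: filterS => x /= -> _.
Qed.

Lemma ext0_measurable D f : open D -> (forall x, D x -> {for x, continuous f}) ->
  measurable_fun setT (ext0 D f).
Proof.
move=> oD cf; have mD := open_measurable_plane oD.
suff mf : measurable_fun D (EFin \o f).
  have := (measurable_restrictT (EFin \o f) mD).1 mf; rewrite ext0_patch.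
  by move/measurable_EFinP.
apply/measurable_EFinP; apply: (measurability _ (RGenOpens.measurableE R)).
move=> _ [_ [a [b ->]] <-]; apply: open_measurable_plane.
have oab : open (`]a, b[%classic : set R) by exact: interval_open.
rewrite openE => x [Dx fx]; apply: filterI; first exact: open_nbhs_nbhs.
by apply: cf => //; exact: open_nbhs_nbhs.
Qed.

End Restriction.

(** * The quadrature identity *)

Section DensityFunctional.
Context {R : realType}.
Local Notation mu2 := (leb2 R).
Implicit Types (D K : set (plane R)) (f g : plane R -> R[i]).

Definition density_functional (m : plane R -> R) : (plane R -> R[i]) -> R[i] :=
  fun f => (pint (fun x => m x * re f x) +i* pint (fun x => m x * im f x))%C.

Lemma smooth_cont (O : set (plane R)) (h : plane R -> R) : real_smooth_on O h ->
  forall x, O x -> {for x, continuous h}.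
Proof. by move=> hs x Ox; have [] := hs [::] x Ox. Qed.

Variables (D K : set (plane R)) (m : plane R -> R).
Hypothesis cK : compact K.
Hypothesis KD : K `<=` D.
Hypothesis cm : continuous m.
Hypothesis m0 : forall x, ~ K x -> m x = 0.

Lemma density_mul_itg (h : plane R -> R) : continuous h -> itg (fun x => m x * h x).
Proof.
move=> ch; have [M HM] := compact_bound cK.
apply: (@itg_supp _ _ M) => [x|x xM].
  by apply: cvgM; [exact: cm|exact: ch].
by rewrite m0 ?mul0r// => /HM; rewrite leNgt xM.
Qed.

Lemma density_distribution : Defs.distribution (density_functional m).
Proof.
have cre (O : set (plane R)) f : test_function O f -> continuous (re f) /\ continuous (im f).
  by move=> [[s1 s2] _ _]; split=> x; [exact: (smooth_cont s1)|exact: (smooth_cont s2)].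
split.
  move=> c f g /cre[cf1 cf2] /cre[cg1 cg2].
  have i1 := density_mul_itg cf1; have i2 := density_mul_itg cf2.
  have i3 := density_mul_itg cg1; have i4 := density_mul_itg cg2.
  case: c => a b.
  have E1 : pint (fun x => m x * re (fun x => (a +i* b)%C * f x + g x) x) =
      a * pint (fun x => m x * re f x) - b * pint (fun x => m x * im f x) +
      pint (fun x => m x * re g x).
    rewrite -!pintZ// -pintB//; [|exact: itgZ|exact: itgZ].
    rewrite -pintD//; last by apply: itgB; exact: itgZ.
    apply: pint_ext => x; rewrite /re /im; move: (f x) (g x) => [f1 f2] [g1 g2] /=.
    by ring.
  have E2 : pint (fun x => m x * im (fun x => (a +i* b)%C * f x + g x) x) =
      a * pint (fun x => m x * im f x) + b * pint (fun x => m x * re f x) +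
      pint (fun x => m x * im g x).
    rewrite -!pintZ// -[X in X + _]pintD//; [|exact: itgZ|exact: itgZ].
    rewrite -pintD//; last by apply: itgD; exact: itgZ.
    apply: pint_ext => x; rewrite /re /im; move: (f x) (g x) => [f1 f2] [g1 g2] /=.
    by ring.
  by rewrite /density_functional E1 E2; apply/eqP; rewrite eq_complex /= !eqxx.
move=> L cL; exists (2 * pint (fun x => `|m x|)), 0%N => f tf.
have [cf1 cf2] := cre _ _ tf; have [_ cf fL] := tf.
have [M HM] := compact_bound cf.
have f0 x : M < `|x| -> f x = 0.
  move=> Mx; apply/eqP; apply: contraT => fx.
  have /HM : fsupport f x by apply: subset_closure.
  by rewrite leNgt Mx.
have [B1 _ HB1] : exists2 B : R, 0 <= B & forall x, `|re f x| <= B.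
  by apply: (bounded_supp cf1) => x /f0; rewrite /re => ->.
have [B2 _ HB2] : exists2 B : R, 0 <= B & forall x, `|im f x| <= B.
  by apply: (bounded_supp cf2) => x /f0; rewrite /im => ->.
have NE : CN_norm 0 f = sup (range (fun x => modulus (f x))).
  have E : cpartials [::] f = f.
    by apply/funext => x; rewrite /cpartials /re /im /=; case: (f x).
  by rewrite /CN_norm big_ord1 big_mkcond big_ord1 -[X in _ = sup (range (fun x => modulus (X x)))]E.
have fle x : modulus (f x) <= CN_norm 0 f.
  rewrite NE; apply: sup_upper_bound; last by exists x.
  split; first by exists (modulus (f 0)); exists 0.
  exists (B1 + B2) => _ [y _ <-]; apply: (le_trans (modulus_le _)).
  by apply: lerD; [exact: HB1|exact: HB2].
have im' : itg (fun x => `|m x|).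
  have := density_mul_itg (h := fun _ => 1); rewrite (_ : (fun x => m x * 1) = m); last first.
    by apply/funext => x; rewrite mulr1.
  by move=> h; apply: itg_abs; apply: h => x; exact: cvg_cst.
have key (h : plane R -> R) : continuous h -> (forall x, `|h x| <= CN_norm 0 f) ->
    `|pint (fun x => m x * h x)| <= pint (fun x => `|m x|) * CN_norm 0 f.
  move=> ch hB; apply: (le_trans (pint_abs_le (density_mul_itg ch))).
  rewrite mulrC -pintZ//; apply: pint_le.
  - by apply: itg_abs; exact: density_mul_itg.
  - exact: itgZ.
  - by move=> x; rewrite normrM mulrC ler_wpM2r.
apply: (le_trans (modulus_le _)); rewrite /density_functional /=.
have k1 := key _ cf1 (fun x => le_trans (modulus_Re (f x)) (fle x)).
have k2 := key _ cf2 (fun x => le_trans (modulus_Im (f x)) (fle x)).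
by lra.
Qed.

Lemma density_support : dist_support (density_functional m) `<=` K.
Proof.
move=> x; apply: contraPP => Kx /(_ (~` K)).
have clK : closed K by exact: compact_closed.
have oK : open (~` K) by exact: closed_openC.
move=> /(_ oK Kx)[f [_ _ fK] /eqP]; apply.
have f0 y : K y -> f y = 0.
  move=> Ky; apply/eqP; apply: contraT => fy.
  by have /fK : fsupport f y by apply: subset_closure.
rewrite /density_functional; apply/eqP; rewrite eq_complex /=.
have z (h : plane R -> R) : (forall y, K y -> h y = 0) -> pint (fun x => m x * h x) = 0.
  move=> h0; rewrite (@pint_ext _ _ (fun=> 0)); last first.
    by move=> y; have [/h0 ->|/m0 ->] := pselect (K y); rewrite ?mulr0 ?mul0r.
  by rewrite pint_def integral0.
by rewrite !z ?eqxx// => y Ky; rewrite /re /im f0.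
Qed.

Lemma density_compactly_supported : compactly_supported_in D (density_functional m).
Proof.
split; first exact: density_distribution.
  apply: (subclosed_compact _ cK density_support).
  rewrite -[X in closed X]setCK; apply: open_closedC.
  rewrite openE => x /= /existsNP[V /not_implyP[oV /not_implyP[Vx h]]].
  apply: (@filterS _ (nbhs x) _ V); last exact: open_nbhs_nbhs.
  by move=> y Vy /(_ V oV Vy).
exact: subset_trans density_support KD.
Qed.

End DensityFunctional.

Section Quadrature.
Context {R : realType}.
Local Notation mu2 := (leb2 R).

(** The real and imaginary parts of the smooth representative of [w] are
solutions, to which the identity for [m] applies; the cutoff in the pairing is 1
on the support of [m]. *)
Lemma density_quadrature (k : R) (D K : set (plane R)) (m : plane R -> R) :
  open D -> bounded_set D -> compact K -> K `<=` D -> continuous m ->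
  (forall x, ~ K x -> m x = 0) ->
  (forall u, Cn 2 D u -> (forall x, D x -> lapk k u x = 0) -> itg (ext0 D u) ->
    pint (ext0 D u) = pint (fun x => ext0 D u x * m x)) ->
  quadrature_domain k D (density_functional m).
Proof.
move=> oD bD cK KD cm m0 Hm.
split=> //; first exact: (density_compactly_supported cK KD cm m0).
move=> w [iw1 iw2] weak.
have jw1 := integrable_ext0 oD iw1; have jw2 := integrable_ext0 oD iw2.
have wk psi : test_real D psi ->
    pint (fun y => ext0 D (re w) y * lapk k psi y) = 0 /\
    pint (fun y => ext0 D (im w) y * lapk k psi y) = 0.
  move=> tpsi; have := weak _ (test_real_function tpsi).
  rewrite /cintegral !Rintegral_ext0 => /eqP; rewrite eq_complex /= => /andP[/eqP h1 /eqP h2].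
  split.
    rewrite -[RHS]h1; apply: pint_ext => x; rewrite -ext0_mul; congr (ext0 D _ x).
    apply/funext => y; rewrite /re helmholtz_real; case: (w y) => a b /=.
    by rewrite mulr0 subr0.
  rewrite -[RHS]h2; apply: pint_ext => x; rewrite -ext0_mul; congr (ext0 D _ x).
  apply/funext => y; rewrite /im helmholtz_real; case: (w y) => a b /=.
  by rewrite mulr0 add0r.
have [u1 [c1 e1 l1]] := weyl oD jw1 (fun psi t => (wk psi t).1).
have [u2 [c2 e2 l2]] := weyl oD jw2 (fun psi t => (wk psi t).2).
pose u x : R[i] := (u1 x +i* u2 x)%C.
have [chi tchi [V [oV KV chi1]]] := smooth_cutoff oD cK KD.
exists u; split.
- by split; exact: Cn_real_smooth.
- have := ae_and e1 e2; apply: filterS => x [h1 h2] Dx.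
  rewrite /u -h1// -h2// !ext0E// /re /im; by case: (w x).
exists (fun x => ((chi x)%:C)%C).
  split; first exact: test_real_function.
  exists V; split=> //; last by move=> x Vx; rewrite chi1.
  exact: subset_trans (density_support cK m0) KV.
(* Integrals do not distinguish w from its smooth representative, and chi = 1
   wherever m does not vanish. *)
have key (h v : plane R -> R) : (forall n, Cn n D v) -> (forall x, D x -> lapk k v x = 0) ->
    itg (ext0 D h) -> {ae mu2, forall x, D x -> ext0 D h x = v x} ->
    pint (fun x => m x * (chi x * v x)) = pint (ext0 D h).
  move=> cv lv ih ev.
  have mv : measurable_fun setT (ext0 D v).
    by apply: ext0_measurable => //; exact: Cn_cont (cv 0%N).
  have ev' : {ae mu2, forall x, ext0 D h x = ext0 D v x}.
    have := ev; apply: filterS => x hx; have [Dx|Dx] := pselect (D x).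
      by rewrite (ext0E v Dx) hx.
    by rewrite !ext0N.
  have iv : itg (ext0 D v) by exact: (itg_ae_eq ih mv ev').
  rewrite (pint_ae_eq (itg_measurable ih) mv ev') (Hm v (cv 2%N) lv iv).
  apply: pint_ext => x; have [Kx|Kx] := pselect (K x).
    by rewrite ext0E ?chi1 ?mul1r; [rewrite mulrC|exact: KV|exact: KD].
  by rewrite m0// mul0r mulr0.
rewrite /density_functional /cintegral !Rintegral_ext0 -(key _ _ c1 l1 jw1 e1) -(key _ _ c2 l2 jw2 e2).
apply/eqP; rewrite eq_complex /=; apply/andP; split; apply/eqP; apply: pint_ext => x.
  by rewrite /re /u /= mul0r subr0.
by rewrite /im /u /= mul0r addr0.
Qed.

Lemma analytic_psat (phi : R[i]^o -> R[i]^o) (c : R[i]^o) : complex_analytic_at phi c ->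
  exists a (r : R), psat phi c a r.
Proof.
move=> [a [r [r0 H]]].
have rE : r = ((complex.Re r)%:C)%C.
  by move: r0; case: (r) => x y; rewrite ltcE /= => /andP[/eqP -> _].
have r0' : 0 < complex.Re r by move: r0; rewrite rE ltcR.
exists a, (complex.Re r); split=> // z zr.
have /H h : `|z - c| < r by rewrite rE -modulusE ltcR.
move=> e e0; have e0' : 0 < (e%:C)%C :> R[i]^o by rewrite ltcR.
have /cvgrPdist_lt/(_ _ e0')[N _ HN] := h.
exists N => n nN; have := HN n nN; rewrite -modulusE ltcR.
by rewrite /series /= big_mkord.
Qed.

(** The points (1 - s) c approach [c] from inside. *)
Lemma closure_unit_disc (c : R[i]^o) : modulus c <= 1 -> closure (@unit_disc R) c.
Proof.
move=> c1 B /nbhs_complexP[r r0 Hr].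
pose s : R := Num.min (r / 2) 1.
have s0 : 0 < s by rewrite lt_min divr_gt0 ?ltr01.
have s1 : s <= 1 by rewrite ge_min lexx orbT.
have sr : s <= r / 2 by rewrite ge_min lexx.
exists (((1 - s)%:C)%C * c); split.
  rewrite /unit_disc /= -modulusE modulusM modulus_real ger0_norm; last by lra.
  have := modulus_ge0 c; rewrite -(rmorph1 (real_complex R)) ltcR => h; nra.
apply: Hr; rewrite (_ : _ - _ = ((- s)%:C)%C * c); last by rewrite rmorphB rmorph1 rmorphN; ring.
rewrite modulusM modulus_real normrN ger0_norm ?(ltW s0)//.
by have := modulus_ge0 c; nra.
Qed.

End Quadrature.

Unset Implicit Arguments.

Theorem theorem1p5 (R : realType) (k : R) (phi : R[i]^o -> R[i]^o)
    (U : set R[i]^o) (D : set (plane R)) :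
  0 < k ->
  open U -> closure unit_disc `<=` U -> complex_analytic_on U phi ->
  D = (fun z => to_plane (phi z)) @` unit_disc ->
  set_bij unit_disc D (fun z => to_plane (phi z)) ->
  exists2 mu : (plane R -> R[i]) -> R[i],
    compactly_supported_in D mu & quadrature_domain k D mu.
Proof.
move=> k0 oU dU phiU DE [_ inj _].
have disc1 (z : R[i]^o) : unit_disc z <-> modulus z < 1.
  by rewrite /unit_disc /= -modulusE -[1]/((1%:C)%C) ltcR.
have phi_an (c : R[i]) : modulus c <= 1 -> exists a (r : R), psat phi c a r.
  by move=> c1; apply: analytic_psat; apply: phiU; apply: dU; exact: closure_unit_disc.
have phi_inj (z w : R[i]) : modulus z < 1 -> modulus w < 1 -> phi z = phi w -> z = w.
  move=> z1 w1 E; apply: inj; rewrite ?inE; [exact/disc1|exact/disc1|by rewrite E].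
have DE' : D = img phi [set z | modulus z < 1].
  by rewrite DE; apply/seteqP; split=> _ [z z1 <-]; exists z => //; exact/disc1.
have oD : open D.
  rewrite DE'; apply: (img_open phi_an phi_inj) => // z /= z1.
  exists (1 - modulus z); first by rewrite subr_gt0.
  by move=> y; have := ler_modB y z; lra.
have bD : bounded_set D.
  have [M HM] := compact_bound (@img_compact R phi phi_an 0 1 (lexx 1)).
  exists M; split; first exact: num_real.
  move=> N MN x; rewrite DE' => -[z /= z1 <-]; apply: (le_trans (HM _ _) (ltW MN)).
  by exists z => //; split; [exact: modulus_ge0|exact: ltW].
have [K [m [cK KD cm m0 Hm]]] := density k phi_an phi_inj.
rewrite -DE' in KD Hm.
have q := density_quadrature oD bD cK KD cm m0 Hm.
by exists (density_functional m) => //; have [] := q.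
Qed.
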